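(* For every $V\in\mathcal{K}$ (the family of Kodaira-type solutions) and for every $\lambda>0$ the limits $$V^+_\lambda=\lim_{\varepsilon\to0+}V_{\lambda+i\varepsilon}\quad\text{and}\quad V^-_\lambda=\lim_{\varepsilon\to0+}V_{\lambda-i\varepsilon}$$ exist in the standard topology on $C^\infty(\mathbb{R}^3_0)$ of uniform convergence on compact sets of functions and all their derivatives. The limits are $\lambda$-eigenfunctions of $T$, and moreover $V^+_\lambda-V^-_\lambda\in\mathrm{RegSol}(\lambda)$. In fact there is a unique $F\in\mathcal{R}$ such that $$V^+_\lambda-V^-_\lambda=w(\lambda)\cdot F_\lambda$$ for every $\lambda>0$.
   Context: Fix a real constant $\gamma>0$. Put $\mathbb{R}^3_0=\mathbb{R}^3\setminus\{0\}$, $r=\|x\|$, $T=-\Delta-2\gamma/r$. $T$ is also regarded as the self-adjoint operator on $L^2(\mathbb{R}^3)$ with domain $\mathrm{dom}(T)=\mathcal{H}^2(\mathbb{R}^3)$ (Sobolev space), whose spectrum is $\mathrm{Spec}(T)=\{-\gamma^2/n^2:n=1,2,\dots\}\cup[0,\infty)$. $K=O(3)$ acts on $\mathbb{R}^3_0$ by $A\colon v\mapsto\det(A)^{-1}Av$ and hence on functions. For $\lambda\in\mathbb{C}$, $\mathrm{Sol}(\lambda)=\{\psi\in C^\infty(\mathbb{R}^3_0):\psi\ K\text{-finite},\ T\psi=\lambda\psi\}$. $F_{\ell,\lambda}$ is the unique solution of $r^2\psi''+2r\psi'-\ell(\ell+1)\psi+2\gamma r\psi+\lambda r^2\psi=0$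 extending to an entire function of $r$ with $F_{\ell,\lambda}(r)=r^\ell+\text{higher-order terms}$. $\mathrm{RegSol}(\lambda)\subseteq\mathrm{Sol}(\lambda)$ is the span of the functions $F_{\ell,\lambda}(r)Y_\ell$, $Y_\ell$ a spherical harmonic of degree $\ell$, $\ell\ge0$. $\mathcal{R}$ is the complex vector space of sections $\lambda\mapsto F_\lambda\in\mathrm{RegSol}(\lambda)$ ($\lambda\in\mathbb{C}$) spanned by $\lambda\mapsto p(\lambda)F_{\ell,\lambda}Y_\ell$ with $p$ polynomial. The Wronskian form on $\mathrm{Sol}(\lambda)$ is $\mathrm{Wr}(\varphi,\psi)=\frac1{4\pi}\int_{S^2}r^2\bigl(\frac{\partial\varphi}{\partial r}\psi-\varphi\frac{\partial\psi}{\partial r}\bigr)d\mathrm{Area}$ (independent of $r$). $\mathrm{Sol}_\infty(\lambda)$ is the space of those $\psi\in\mathrm{Sol}(\lambda)$ for which $\sigma\psi\in\mathrm{dom}(T)$ for some cutoff $\sigma$ at $\infty$, meaning a smooth function on $\mathbb{R}^3$ (vanishing near $0$ where needed so that $\sigma\psi$ makes sense) that is identically $1$ outside a compact set. $\mathcal{K}$ (Kodaira-type solutions) is the complex vector space spanned by functions $(\lambda,x)\mapsto V_\lambda(x)$ on $[\mathbb{C}\setminus\mathrm{Spec}(T)]\times\mathbb{R}^3_0$ such that $V_\lambda\in\mathrm{Sol}_\infty(\lambda)$ for all $\lambda\notin\mathrm{Spec}(T)$, and such that for every $F\in\mathcal{R}$ the function $\lambda\mapsto\mathrm{Wr}(F_\lambda,V_\lambda)$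 is a polynomial function on $\mathbb{C}\setminus\mathrm{Spec}(T)$. Let $V_0\in\mathcal{K}$ be the family of $K$-invariant functions with $\mathrm{Wr}(V_{0,\lambda},F_{0,\lambda})=1$ for every $\lambda\notin\mathrm{Spec}(T)$. The limits $V^\pm_{0,\lambda}=\lim_{\varepsilon\to0+}V_{0,\lambda\pm i\varepsilon}$ exist in $C^\infty(\mathbb{R}^3_0)$ for $\lambda>0$, and $w(\lambda):=\mathrm{Wr}(V^+_{0,\lambda},V^-_{0,\lambda})$ for $\lambda>0$; it is nowhere zero. *)

(* Defs.v *)
From mathcomp Require Import all_boot all_order all_algebra.
From mathcomp Require Import all_classical all_reals all_analysis.
From mathcomp Require Import complex.
(* The notations of [mpoly] clash with those of MathComp-Analysis. *)
From mathcomp Require mpoly.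
Import (canonicals, coercions) mpoly.

Set Implicit Arguments.
Unset Strict Implicit.
Unset Printing Implicit Defensive.
Import Order.TTheory GRing.Theory Num.Theory.
Import numFieldNormedType.Exports.

Local Open Scope classical_set_scope.
Local Open Scope ring_scope.
Local Open Scope complex_scope.

Section ComplexCalculus.
Context {R : realType}.

Definition normc : R[i] -> R := @ComplexField.Normc.normc R.

Definition cvgc (u : nat -> R[i]) (l : R[i]) : Prop :=
  (fun n => normc (u n - l)) @ \oo --> (0 : R).

(* [V] is a real space: these are real directional derivatives of a
   complex-valued function. *)
Definition cderivable (V : normedModType R) (f : V -> R[i]) (x v : V) : Prop :=
  derivable (fun y => complex.Re (f y)) x v /\ derivable (fun y => complex.Im (f y)) x v.

Definition cderive (V : normedModType R) (v : V) (f : V -> R[i]) (x : V) : R[i] :=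
  'D_v (fun y => complex.Re (f y)) x +i* 'D_v (fun y => complex.Im (f y)) x.

Definition cintegral d (T : measurableType d) (mu : {measure set T -> \bar R})
    (D : set T) (f : T -> R[i]) : R[i] :=
  Rintegral mu D (fun t => complex.Re (f t)) +i* Rintegral mu D (fun t => complex.Im (f t)).

(* [f] agrees on [D] with a finite C-linear combination of members of [G];
   values outside [D] are irrelevant. *)
Definition span_on (X : Type) (D : set X) (G : set (X -> R[i])) : set (X -> R[i]) :=
  [set f | exists (n : nat) (c : 'I_n -> R[i]) (g : 'I_n -> X -> R[i]),
     (forall i, G (g i)) /\ forall x, D x -> f x = \sum_(i < n) c i * g i x].

End ComplexCalculus.

Section Space.
Context {R : realType}.
Notation E := 'cV[R]_3.

(* Euclidean norm; [`|x|] is the sup norm on matrices. *)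
Definition enorm (x : E) : R := Num.sqrt (\sum_i x i 0 ^+ 2).

Definition R30 : set E := [set x | x != 0].

Definition pderiv (i : 'I_3) (f : E -> R[i]) : E -> R[i] :=
  fun x => cderive (delta_mx i 0 : E) f x.

Fixpoint pderivs (s : seq 'I_3) (f : E -> R[i]) : E -> R[i] :=
  if s is i :: s' then pderiv i (pderivs s' f) else f.

(* To be used for open [U]: all iterated partial derivatives exist and are
   continuous at the points of [U]. *)
Definition smooth_on (U : set E) (f : E -> R[i]) : Prop :=
  forall (s : seq 'I_3) (x : E), U x ->
    [/\ {for x, continuous (fun y => complex.Re (pderivs s f y))},
        {for x, continuous (fun y => complex.Im (pderivs s f y))} &
        forall i : 'I_3, cderivable (pderivs s f) x (delta_mx i 0)].

Definition laplacian (f : E -> R[i]) (x : E) : R[i] :=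
  \sum_(i < 3) pderivs [:: i; i] f x.

(* f eps --> g as eps --> 0+, in C^oo(R^3 \ 0) with uniform convergence of all
   derivatives on compact sets *)
Definition cvg_smooth (f : R -> E -> R[i]) (g : E -> R[i]) : Prop :=
  smooth_on R30 g /\
  forall (s : seq 'I_3) (K : set E), compact K -> K `<=` R30 ->
  forall e : R, 0 < e ->
    \forall eps \near (0 : R)^'+,
      forall x, K x -> normc (pderivs s (f eps) x - pderivs s g x) < e.

Definition O3 : set 'M[R]_3 := [set A | A *m A^T = 1%:M].

Definition Kact (A : 'M[R]_3) (x : E) : E := (\det A)^-1 *: (A *m x).

(* The span of the K-orbit of [f] is finite dimensional: the orbit lies in the
   span of finitely many functions. *)
Definition Kfinite (f : E -> R[i]) : Prop :=
  exists (n : nat) (g : 'I_n -> E -> R[i]),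
  forall A, O3 A -> exists c : 'I_n -> R[i],
  forall x, R30 x -> f (Kact (invmx A) x) = \sum_(i < n) c i * g i x.

Definition Kinvariant (f : E -> R[i]) : Prop :=
  forall A x, O3 A -> R30 x -> f (Kact A x) = f x.

Definition vec3 (p : R * R * R) : E :=
  \col_(i < 3) [:: p.1.1; p.1.2; p.2]`_i.

Notation T3 := (measurableTypeR R * measurableTypeR R * measurableTypeR R)%type.

Definition lebesgue3 : {measure set T3 -> \bar R} :=
  ((@lebesgue_measure R \x @lebesgue_measure R) \x @lebesgue_measure R)%E.

Definition integral3 (f : E -> R[i]) : R[i] :=
  cintegral lebesgue3 setT (fun p => f (vec3 p)).

Definition L2 (u : E -> R[i]) : Prop :=
  ((fun p => complex.Re (u (vec3 p))) : T3 -> R) \in Lfun lebesgue3 2%:E /\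
  ((fun p => complex.Im (u (vec3 p))) : T3 -> R) \in Lfun lebesgue3 2%:E.

Definition test_function (phi : E -> R[i]) : Prop :=
  smooth_on setT phi /\
  exists K : set E, compact K /\ forall x, ~ K x -> phi x = 0.

(* u, together with its weak derivatives of order at most 2, is in L^2 *)
Definition H2 (u : E -> R[i]) : Prop :=
  L2 u /\
  forall s : seq 'I_3, (size s <= 2)%N -> exists g : E -> R[i], L2 g /\
    forall phi, test_function phi ->
      integral3 (fun x => u x * pderivs s phi x) =
      (-1) ^+ size s * integral3 (fun x => g x * phi x).

(* polar angle in [0, pi], azimuth in [0, 2 pi] *)
Definition sphere_point (t : R * R) : E :=
  vec3 (sin t.1 * cos t.2, sin t.1 * sin t.2, cos t.1).

Definition sphere_integral (f : E -> R[i]) : R[i] :=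
  cintegral (@lebesgue_measure R \x @lebesgue_measure R)%E
    (`[0, pi]%classic `*` `[0, 2 * pi]%classic)
    (fun t => f (sphere_point t) * (sin t.1)%:C).

Definition wronskian_at (r : R) (phi psi : E -> R[i]) : R[i] :=
  ((4 * pi)^-1)%:C * sphere_integral (fun om =>
    (r ^+ 2)%:C * (cderive om phi (r *: om) * psi (r *: om)
                   - phi (r *: om) * cderive om psi (r *: om))).

(* The value does not depend on the radius when [phi], [psi] lie in a common
   [Sol gamma lam]. *)
Definition wronskian (phi psi : E -> R[i]) : R[i] := wronskian_at 1 phi psi.

(* restrictions to the unit sphere of harmonic homogeneous polynomials *)
Definition spherical_harmonic (l : nat) (Y : E -> R[i]) : Prop :=
  exists P : mpoly.mpoly 3 R[i],
    [/\ P \is mpoly.ishomog1 l mpoly.mdeg,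
        \sum_(i < 3) mpoly.mderiv i (mpoly.mderiv i P) = 0 &
        forall x : E, enorm x = 1 ->
          Y x = mpoly.meval (fun i => (x i 0)%:C) P].

End Space.

Section Hydrogen.
Context {R : realType}.
Notation E := 'cV[R]_3.
Variable gamma : R.

Definition Top (psi : E -> R[i]) (x : E) : R[i] :=
  - laplacian psi x - (2 * gamma / enorm x)%:C * psi x.

(* the zero function is allowed *)
Definition eigenfunction (lam : R[i]) (psi : E -> R[i]) : Prop :=
  smooth_on R30 psi /\ forall x, R30 x -> Top psi x = lam * psi x.

(* The spectrum of [T], self-adjoint in L^2(R^3) with domain [H2], given by its
   known explicit value. *)
Definition SpecT : set R[i] :=
  [set z | (exists n : nat, (0 < n)%N /\ z = (- (gamma ^+ 2 / n%:R ^+ 2))%:C) \/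
           (exists t : R, 0 <= t /\ z = t%:C)].

Definition Sol (lam : R[i]) : set (E -> R[i]) :=
  [set psi | Kfinite psi /\ eigenfunction lam psi].

Definition radial_ode (l : nat) (lam : R[i]) (f : R -> R[i]) : Prop :=
  let f' := cderive (1 : R^o) (f : R^o -> R[i]) in
  let f'' := cderive (1 : R^o) f' in
  forall r : R, 0 < r ->
    [/\ cderivable (f : R^o -> R[i]) r 1, cderivable f' r 1 &
        (r ^+ 2)%:C * f'' r + (2 * r)%:C * f' r - (l * l.+1)%:R * f r
        + (2 * gamma * r)%:C * f r + lam * (r ^+ 2)%:C * f r = 0].

Definition is_regular_radial (l : nat) (lam : R[i]) (f : R[i] -> R[i]) : Prop :=
  (exists a : nat -> R[i],
     [/\ forall k, (k < l)%N -> a k = 0, a l = 1 &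
         forall z, cvgc (fun n => \sum_(k < n) a k * z ^+ k) (f z)]) /\
  radial_ode l lam (fun r => f r%:C).

(* F_{l,lam}, as an entire function *)
Definition Freg (l : nat) (lam : R[i]) : R[i] -> R[i] :=
  xget (fun=> 0) [set f | is_regular_radial l lam f].

Definition Fsol (l : nat) (lam : R[i]) (Y : E -> R[i]) (x : E) : R[i] :=
  Freg l lam (enorm x)%:C * Y ((enorm x)^-1 *: x).

Definition RegSol (lam : R[i]) : set (E -> R[i]) :=
  span_on R30 [set psi | exists l Y, spherical_harmonic l Y /\ psi = Fsol l lam Y].

(* Families lam |-> F_lam are functions of (lam, x). *)
Definition fiber (F : R[i] * E -> R[i]) (lam : R[i]) : E -> R[i] :=
  fun x => F (lam, x).

Definition RegFam : set (R[i] * E -> R[i]) :=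
  span_on (setT `*` R30)
    [set F | exists (l : nat) (Y : E -> R[i]) (p : {poly R[i]}),
       spherical_harmonic l Y /\ F = fun q => p.[q.1] * Fsol l q.1 Y q.2].

Definition cutoff_at_infinity (sigma : E -> R[i]) : Prop :=
  [/\ smooth_on setT sigma, (\forall x \near (0 : E), sigma x = 0) &
      exists K : set E, compact K /\ forall x, ~ K x -> sigma x = 1].

Definition Sol_infty (lam : R[i]) : set (E -> R[i]) :=
  [set psi | Sol lam psi /\
     exists sigma, cutoff_at_infinity sigma /\ H2 (fun x => sigma x * psi x)].

Definition Kodaira : set (R[i] * E -> R[i]) :=
  span_on ((~` SpecT) `*` R30)
    [set V | (forall lam, ~ SpecT lam -> Sol_infty lam (fiber V lam)) /\
       forall F, RegFam F -> exists p : {poly R[i]},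
       forall lam, ~ SpecT lam ->
         wronskian (fiber F lam) (fiber V lam) = p.[lam]].

(* V^+_lam and V^-_lam: the limits, when they exist *)
Definition upper_limit (V : R[i] * E -> R[i]) (lam : R) : E -> R[i] :=
  xget (fun=> 0) [set g | cvg_smooth (fun eps => fiber V (lam +i* eps)) g].

Definition lower_limit (V : R[i] * E -> R[i]) (lam : R) : E -> R[i] :=
  xget (fun=> 0) [set g | cvg_smooth (fun eps => fiber V (lam -i* eps)) g].

Definition is_V0 (V : R[i] * E -> R[i]) : Prop :=
  [/\ Kodaira V, (forall lam, ~ SpecT lam -> Kinvariant (fiber V lam)) &
      forall lam, ~ SpecT lam ->
        wronskian (fiber V lam) (Fsol 0 lam (fun=> 1)) = 1].

(* the function w, for V = V_0 *)
Definition wfun (V : R[i] * E -> R[i]) (lam : R) : R[i] :=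
  wronskian (upper_limit V lam) (lower_limit V lam).

End Hydrogen.

(* Main.v *)
(* For lambda = - kappa^2 with Re kappa > 0, the radial equation with l = 0 has a decaying
   solution D_0 given by a Laplace integral; first-order ladder operators carry it to a
   solution D_l for every l and multiply Wronskians by a polynomial in lambda.
   K-finiteness leaves finitely many spherical harmonics in an eigenfunction, and square
   integrability at infinity excludes the growing radial solution, so that V_lambda is a
   sum of P_lk(lambda) D_l(r) / r H_lk.  The coefficient P_lk is a Wronskian with
   F_l H_(l, 2l-k), hence polynomial; at a generic lambda no nonzero P_lk vanishes, so
   only finitely many P_lk are nonzero.
   When lambda approaches the positive half-line, kappa tends to an imaginary number and
   D_0, D_0' converge locally uniformly; all partial derivatives of V_lambda are
   polynomials in lambda, the coordinates, 1/r, D_0 and D_0', which gives limits in C^oo.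
   Finally D_l^+ - D_l^- = Wr(D_l^+, D_l^-) F_l, where Wr(D_l^+, D_l^-) is a polynomial in
   lambda times Wr(D_0^+, D_0^-), and the latter is w because V_0 = - D_0 / r. *)
Require Import Defs.
From mathcomp Require Import all_boot all_order all_algebra.
From mathcomp Require Import all_classical all_reals all_analysis.
From mathcomp Require Import complex.
From mathcomp Require Import measurable_realfun ring lra.
From mathcomp Require mpoly.
Import (canonicals, coercions) mpoly.
Import Order.TTheory GRing.Theory Num.Theory.
Import numFieldNormedType.Exports.
Set Implicit Arguments.
Unset Strict Implicit.
Unset Printing Implicit Defensive.
Local Open Scope classical_set_scope.
Local Open Scope ring_scope.
Local Open Scope complex_scope.

(** * Calculus for complex-valued functions *)

(** The analysis takes place at non-real lambda close to the positive half-line. There [2 * k] and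
    [- 2 * k] lie off the half-line of integration, so a single Laplace formula yields the decaying
    solution at [k] and the growing one at [- k], without analytic continuation. The price is the
    restriction [good], namely that the exponent [gamma / k] has real part of modulus at most 1/2;
    it is harmless because that real part tends to 0 at the boundary. Independence of the two
    solutions is proved first for imaginary [k], where an energy bound contradicts opposite
    radiation conditions, and is carried to nearby [k] by continuity. The solutions are normalized
    at 0, not at infinity: their Wronskian with the regular solution is then exactly 1, and no Gamma
    factor spoils the polynomial coefficients. Spherical harmonics are coefficients of powers of
    isotropic linear forms, so that their integrals follow from the moments of linear forms. The
    sphere integral is given in polar coordinates; its rotation invariance and the completeness of
    the harmonics both come from the polynomial kernel (1 + x.y)^n. *)

Section ComplexBasics.
Context {R : realType}.
Implicit Types z w : R[i].

Lemma cReD z w : complex.Re (z + w) = complex.Re z + complex.Re w.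
Proof. by case: z; case: w. Qed.
Lemma cImD z w : complex.Im (z + w) = complex.Im z + complex.Im w.
Proof. by case: z; case: w. Qed.
Lemma cReN z : complex.Re (- z) = - complex.Re z.
Proof. by case: z. Qed.
Lemma cImN z : complex.Im (- z) = - complex.Im z.
Proof. by case: z. Qed.
Lemma cReM z w :
  complex.Re (z * w) = complex.Re z * complex.Re w - complex.Im z * complex.Im w.
Proof. by case: z; case: w. Qed.
Lemma cImM z w :
  complex.Im (z * w) = complex.Re z * complex.Im w + complex.Im z * complex.Re w.
Proof. by case: z; case: w. Qed.

Lemma Cext z w : complex.Re z = complex.Re w -> complex.Im z = complex.Im w -> z = w.
Proof. by case: z => a b; case: w => c d /= -> ->. Qed.

Lemma Re_sum (I : Type) (s : seq I) (P : pred I) (F : I -> R[i]) :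
  complex.Re (\sum_(i <- s | P i) F i) = \sum_(i <- s | P i) complex.Re (F i).
Proof. exact: (big_morph _ cReD). Qed.
Lemma Im_sum (I : Type) (s : seq I) (P : pred I) (F : I -> R[i]) :
  complex.Im (\sum_(i <- s | P i) F i) = \sum_(i <- s | P i) complex.Im (F i).
Proof. exact: (big_morph _ cImD). Qed.

Lemma normcE z : normc z = Num.sqrt (complex.Re z ^+ 2 + complex.Im z ^+ 2).
Proof. by case: z. Qed.
Lemma normc_ge0 z : 0 <= normc z.
Proof. by rewrite normcE sqrtr_ge0. Qed.
Lemma normc_sqr z : normc z ^+ 2 = complex.Re z ^+ 2 + complex.Im z ^+ 2.
Proof. by rewrite normcE sqr_sqrtr// addr_ge0// sqr_ge0. Qed.
Lemma Re_le_normc z : `|complex.Re z| <= normc z.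
Proof.
by rewrite -sqrtr_sqr normcE ler_wsqrtr// lerDl sqr_ge0.
Qed.
Lemma Im_le_normc z : `|complex.Im z| <= normc z.
Proof.
by rewrite -sqrtr_sqr normcE ler_wsqrtr// lerDr sqr_ge0.
Qed.
Lemma normc_le z : normc z <= `|complex.Re z| + `|complex.Im z|.
Proof.
rewrite -(@ler_pXn2r _ 2)// ?nnegrE ?normc_ge0 ?addr_ge0//.
by rewrite normc_sqr sqrrD !real_normK ?num_real// lerD2r lerDl mulrn_wge0// mulr_ge0.
Qed.
Lemma normc_mul z w : normc (z * w) = normc z * normc w.
Proof. exact: ComplexField.Normc.normcM. Qed.
Lemma normc_add z w : normc (z + w) <= normc z + normc w.
Proof. exact: le_normcD. Qed.
Lemma normc_opp z : normc (- z) = normc z.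
Proof. exact: normcN. Qed.
Lemma normc_sub z w : normc (z - w) <= normc z + normc w.
Proof. by rewrite (le_trans (normc_add _ _))// normc_opp. Qed.
Lemma normc_inv z : normc z^-1 = (normc z)^-1.
Proof. exact: ComplexField.Normc.normcV. Qed.
Lemma normc_eq0 z : (normc z == 0) = (z == 0).
Proof.
by apply/eqP/eqP => [/ComplexField.Normc.eq0_normc//|->]; rewrite normcE/= expr0n/= addr0 sqrtr0.
Qed.
Lemma normc_gt0 z : (0 < normc z) = (z != 0).
Proof. by rewrite lt0r normc_eq0 normc_ge0 andbT. Qed.
Lemma normc_0 : normc (0 : R[i]) = 0.
Proof. by apply/eqP; rewrite normc_eq0. Qed.
Lemma normc_real (x : R) : normc x%:C = `|x|.
Proof. by rewrite normcE/= expr0n/= addr0 sqrtr_sqr. Qed.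
Lemma normc_nat (n : nat) : normc (n%:R : R[i]) = n%:R.
Proof. by rewrite -(rmorph_nat (real_complex R)) normc_real ger0_norm. Qed.
Lemma normc_X z n : normc (z ^+ n) = normc z ^+ n.
Proof.
elim: n => [|n IH]; first by rewrite !expr0 normcE/= expr0n/= addr0 expr1n sqrtr1.
by rewrite !exprS normc_mul IH.
Qed.
Lemma normc_dist z w : `|normc z - normc w| <= normc (z - w).
Proof.
have h (a b : R[i]) : normc a - normc b <= normc (a - b).
  rewrite lerBlDr; have := normc_add (a - b) b; by rewrite subrK.
by rewrite ler_norml h andbT lerNl opprB -[normc (z - w)]normc_opp opprB h.
Qed.

Definition cexp (z : R[i]) : R[i] :=
  (expR (complex.Re z))%:C * (cos (complex.Im z) +i* sin (complex.Im z)).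

Lemma cexpD z w : cexp (z + w) = cexp z * cexp w.
Proof.
rewrite /cexp cReD cImD expRD cosD sinD.
by apply: Cext; rewrite !(cReM, cImM) /=; ring.
Qed.
Lemma cexp0 : cexp 0 = 1.
Proof. by rewrite /cexp /= expR0 cos0 sin0 mul1r. Qed.
Lemma cexpNM z : cexp (- z) * cexp z = 1.
Proof. by rewrite -cexpD addNr cexp0. Qed.
Lemma normc_cexp z : normc (cexp z) = expR (complex.Re z).
Proof.
rewrite normc_mul normc_real ger0_norm ?expR_ge0// normcE/= cos2Dsin2 sqrtr1 mulr1//.
Qed.
Lemma cexp_neq0 z : cexp z != 0.
Proof. by rewrite -normc_gt0 normc_cexp expR_gt0. Qed.
Lemma cexpMn z n : cexp (n%:R * z) = cexp z ^+ n.
Proof.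
elim: n => [|n IH]; first by rewrite mul0r cexp0.
by rewrite -[n.+1%:R]nat1r mulrDl mul1r cexpD IH exprS.
Qed.
End ComplexBasics.

Section ComplexDerivative.
Context {R : realType}.

(** A relation rather than a function: existence and value of the derivative travel together, so
    derivative formulas compose and are put in the desired shape at the end by [cd_eq]. *)
Definition cd (V : normedModType R) (f : V -> R[i]) (x v : V) (d : R[i]) : Prop :=
  is_derive x v (fun y => complex.Re (f y)) (complex.Re d) /\
  is_derive x v (fun y => complex.Im (f y)) (complex.Im d).

Section General.
Context (V : normedModType R).
Implicit Types (f g : V -> R[i]) (x v : V).

Lemma is_derive_cong (f g : V -> R) (x v : V) (a b : R) :
  is_derive x v f a -> f = g -> a = b -> is_derive x v g b.
Proof. by move=> h <- <-. Qed.

Lemma cd_cderive f x v d : cd f x v d -> cderive v f x = d.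
Proof. by case=> [[_ h1] [_ h2]]; rewrite /cderive h1 h2; case: d {h1 h2}. Qed.

Lemma cd_cderivable f x v d : cd f x v d -> cderivable f x v.
Proof. by case=> [[h1 _] [h2 _]]. Qed.

Lemma cderivable_cd f x v : cderivable f x v -> cd f x v (cderive v f x).
Proof. by case=> h1 h2; split; apply: DeriveDef. Qed.

Lemma cd_eq f x v d d' : cd f x v d -> d = d' -> cd f x v d'.
Proof. by move=> ? <-. Qed.

Lemma cd_near f g x v d : (\near x, f x = g x) -> cd f x v d -> cd g x v d.
Proof.
move=> fg [h1 h2]; split.
- by apply: near_eq_is_derive h1; apply: filterS fg => y ->.
- by apply: near_eq_is_derive h2; apply: filterS fg => y ->.
Qed.

Lemma cd_cst (a : R[i]) x v : cd (fun=> a) x v 0.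
Proof. by split; exact: is_derive_cst. Qed.

Lemma cd_add f g x v a b : cd f x v a -> cd g x v b ->
  cd (fun y => f y + g y) x v (a + b).
Proof.
move=> [f1 f2] [g1 g2]; split; rewrite ?cReD ?cImD.
- under eq_fun do rewrite cReD; exact: is_deriveD.
- under eq_fun do rewrite cImD; exact: is_deriveD.
Qed.

Lemma cd_opp f x v a : cd f x v a -> cd (fun y => - f y) x v (- a).
Proof.
move=> [f1 f2]; split; rewrite ?cReN ?cImN.
- under eq_fun do rewrite cReN; exact: is_deriveN.
- under eq_fun do rewrite cImN; exact: is_deriveN.
Qed.

Lemma cd_sub f g x v a b : cd f x v a -> cd g x v b ->
  cd (fun y => f y - g y) x v (a - b).
Proof. by move=> hf /cd_opp; exact: cd_add. Qed.

Lemma cd_mul f g x v a b : cd f x v a -> cd g x v b ->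
  cd (fun y => f y * g y) x v (a * g x + f x * b).
Proof.
move=> [f1 f2] [g1 g2]; split.
- under eq_fun do rewrite cReM.
  apply: (@is_derive_eq _ _ _ _ _ _ _ _ (is_deriveB (is_deriveM f1 g1) (is_deriveM f2 g2))).
  by rewrite !(cReD, cReM) /GRing.scale /=; ring.
- under eq_fun do rewrite cImM.
  apply: (@is_derive_eq _ _ _ _ _ _ _ _ (is_deriveD (is_deriveM f1 g2) (is_deriveM f2 g1))).
  by rewrite !(cImD, cImM) /GRing.scale /=; ring.
Qed.

Lemma cd_mull (c : R[i]) f x v a : cd f x v a -> cd (fun y => c * f y) x v (c * a).
Proof. by move=> h; apply: cd_eq (cd_mul (cd_cst c x v) h) _; rewrite mul0r add0r. Qed.

Lemma cd_exp f x v a n : cd f x v a ->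
  cd (fun y => f y ^+ n) x v (n%:R * f x ^+ n.-1 * a).
Proof.
move=> h; elim: n => [|n IH].
  by rewrite !mul0r; exact: cd_cst.
under eq_fun do rewrite exprS.
apply: cd_eq (cd_mul h IH) _; case: n {IH} => [|n].
  by rewrite /= !expr0; ring.
by rewrite /= !exprS -!nat1r; ring.
Qed.

Lemma cd_sum (I : Type) (s : seq I) (P : pred I) (F : I -> V -> R[i]) (D : I -> R[i]) x v :
  (forall i, P i -> cd (F i) x v (D i)) ->
  cd (fun y => \sum_(i <- s | P i) F i y) x v (\sum_(i <- s | P i) D i).
Proof.
move=> h; elim: s => [|i s IH].
  under eq_fun do rewrite big_nil.
  by rewrite big_nil; exact: cd_cst.
rewrite big_cons; under eq_fun do rewrite big_cons.
case: ifP => // Pi; exact: cd_add (h _ Pi) IH.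
Qed.

Lemma cd_unique f x v a b : cd f x v a -> cd f x v b -> a = b.
Proof. by move=> /cd_cderive <- /cd_cderive <-. Qed.

Lemma cd_real (f : V -> R) x v (a : R) : is_derive x v f a ->
  cd (fun y => (f y)%:C) x v a%:C.
Proof. by move=> h; split => //=; exact: is_derive_cst. Qed.

(** Restriction to the line through [x] in direction [v]; it reduces chain rules on [V] to those for
    one real variable. *)
Lemma cd_line f x v d :
  cd f x v d <-> cd (fun h : R^o => f (h *: v + x)) (0 : R^o) (1 : R^o) d.
Proof.
have key (F : V -> R) (e : R) :
    is_derive x v F e <-> is_derive (0 : R^o) (1 : R^o) (fun h : R^o => F (h *: v + x)) e.
  have E : 'D_v F x = 'D_(1 : R^o) (fun h : R^o => F (h *: v + x)) (0 : R^o).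
    rewrite /derive; set g1 := fun h => h^-1 *: _; set g2 := fun h => h^-1 *: _.
    suff -> : g1 = g2 by [].
    by rewrite funeqE /g1 /g2 => h /=; rewrite addr0 scale0r add0r [_%:A]mulr1.
  have D := @derivable1P R V R^o F x v.
  split => -[h1 h2]; apply: DeriveDef.
  - exact: D.1 h1.
  - by rewrite -E.
  - exact: D.2 h1.
  - by rewrite E.
by split => -[h1 h2]; split; apply/key.
Qed.

End General.

Lemma cd_real_comp (V : normedModType R) (f : R^o -> R[i]) (g : V -> R) (x v : V) a (b : R) :
  cd f (g x) 1 a -> is_derive x v g b -> cd (fun y => f (g y)) x v (a * b%:C).
Proof.
move=> hf hg; apply/cd_line.
have hg' : is_derive (0 : R^o) (1 : R^o) (fun h : R^o => g (h *: v + x)) b.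
  have /cd_line[] : cd (fun y => (g y)%:C) x v b%:C by exact: cd_real.
  by [].
case: hf; have {1 2}-> : g x = g (0 *: v + x) by rewrite scale0r add0r.
move=> f1 f2; split.
- rewrite cReM /= mulr0 subr0.
  exact: (@is_derive1_comp _ (fun y => complex.Re (f y))).
- rewrite cImM /= mulr0 add0r.
  exact: (@is_derive1_comp _ (fun y => complex.Im (f y))).
Qed.

Lemma cd_id (x : R^o) : cd (fun r : R^o => r%:C) x 1 1.
Proof. exact: (@cd_real _ id x 1 1 (is_derive_id _ _)). Qed.

Lemma cd_cexp (V : normedModType R) (f : V -> R[i]) (x v : V) a :
  cd f x v a -> cd (fun y => cexp (f y)) x v (a * cexp (f x)).
Proof.
move=> hf; apply/cd_line; move/cd_line: hf.
set g := fun h : R^o => _.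
have -> : f x = g 0 by rewrite /g scale0r add0r.
rewrite -[fun h : R^o => cexp _]/(fun h => cexp (g h)).
move: g => {x v f V} g -[g1 g2].
have e1 := @is_derive1_comp _ _ _ _ _ _ (is_derive_expR _) g1.
have c1 := @is_derive1_comp _ _ _ _ _ _ (is_derive_cos _) g2.
have s1 := @is_derive1_comp _ _ _ _ _ _ (is_derive_sin _) g2.
have cs : cd (fun y => cos (complex.Im (g y)) +i* sin (complex.Im (g y))) (0 : R^o) 1
   ((- sin (complex.Im (g 0)) * complex.Im a) +i* (cos (complex.Im (g 0)) * complex.Im a)).
  by split.
apply: cd_eq (cd_mul (cd_real e1) cs) _.
rewrite /cexp /=; move: (expR _) (sin _) (cos _) => E S K.
by apply: Cext; rewrite !(cReD, cImD, cReM, cImM) /=; ring.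
Qed.

Lemma cd_const_itv (f : R^o -> R[i]) :
  (forall r : R, 0 < r -> cd f r 1 0) -> forall r s : R, 0 < r -> 0 < s -> f r = f s.
Proof.
move=> h.
have key (F : R -> R) : (forall r : R, 0 < r -> is_derive r 1 F 0) ->
    forall r s : R, 0 < r -> 0 < s -> F r = F s.
  move=> dF r s r0 s0; wlog rs : r s r0 s0 / r <= s.
    by move=> H; case: (leP r s) => [/H|/ltW/H ->//]; exact.
  have [||c _] := @MVT_segment R F (fun=> 0) r s rs.
  - by move=> x /[!in_itv]/= /andP[rx _]; apply: dF; exact: lt_trans rx.
  - apply: derivable_within_continuous => x /[!in_itv]/= /andP[rx _].
    by case: (dF x (lt_le_trans r0 rx)).
  - by rewrite mul0r => /eqP; rewrite subr_eq0 => /eqP ->.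
move=> r s r0 s0; apply: Cext.
- by apply: (key (fun r => complex.Re (f r))) => // t t0; case: (h t t0).
- by apply: (key (fun r => complex.Im (f r))) => // t t0; case: (h t t0).
Qed.

Lemma cd_continuous (f : R^o -> R[i]) (x : R) d : cd f x 1 d ->
  {for x, continuous (fun y : R => complex.Re (f y))} /\
  {for x, continuous (fun y : R => complex.Im (f y))}.
Proof.
move=> [[h1 _] [h2 _]].
by split; apply: differentiable_continuous; exact: (derivable1_diffP _ _).1.
Qed.

Lemma cd_Rpos (f : R^o -> R[i]) (g : R^o -> R[i]) (x : R) d : 0 < x ->
  (forall y : R, 0 < y -> f y = g y) -> cd f x 1 d -> cd g x 1 d.
Proof.
move=> x0 fg; apply: cd_near.
by near=> y; apply: fg; near: y; exact: lt_nbhsr.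
Unshelve. all: end_near. Qed.

Lemma cd_inv (x : R) : x != 0 -> cd (fun r : R^o => (r^-1)%:C) x 1 (- (x^-1 ^+ 2))%:C.
Proof.
move=> x0; apply: cd_real.
apply: is_derive_eq (@is_deriveV _ id x 1 1 x0 (is_derive_id _ _)) _.
by rewrite /GRing.scale /= mulr1 exprVn.
Qed.

End ComplexDerivative.

Section ComplexIntegral.
Context {R : realType} d (T : measurableType d) (mu : {measure set T -> \bar R}).
Variables (D : set T) (mD : measurable D).
Implicit Types (f g : T -> R[i]).

Definition cintegrable f : Prop :=
  mu.-integrable D (EFin \o (fun t => complex.Re (f t))) /\
  mu.-integrable D (EFin \o (fun t => complex.Im (f t))).

Definition cmeasurable f : Prop :=
  measurable_fun D (fun t => complex.Re (f t)) /\
  measurable_fun D (fun t => complex.Im (f t)).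

Lemma cintegrable_measurable f : cintegrable f -> cmeasurable f.
Proof.
by case=> h1 h2; split; apply/measurable_EFinP; apply: measurable_int; [exact: h1|exact: h2].
Qed.

Lemma cintegrable_add f g : cintegrable f -> cintegrable g ->
  cintegrable (fun t => f t + g t).
Proof.
move=> [f1 f2] [g1 g2]; split.
- by under eq_fun do rewrite cReD; exact: (integrableD mD f1 g1).
- by under eq_fun do rewrite cImD; exact: (integrableD mD f2 g2).
Qed.

Lemma cintegrable_mull c f : cintegrable f -> cintegrable (fun t => c * f t).
Proof.
move=> [f1 f2]; split.
- under eq_fun do rewrite cReM.
  exact: (integrableB mD (integrableZl mD (complex.Re c) f1) (integrableZl mD (complex.Im c) f2)).
- under eq_fun do rewrite cImM.
  exact: (integrableD mD (integrableZl mD (complex.Re c) f2) (integrableZl mD (complex.Im c) f1)).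
Qed.

Lemma cintegrable0 : cintegrable (fun=> 0).
Proof. by split; exact: integrable0. Qed.

Lemma cintegrable_sum (I : Type) (s : seq I) (F : I -> T -> R[i]) :
  (forall i, cintegrable (F i)) -> cintegrable (fun t => \sum_(i <- s) F i t).
Proof.
move=> h; elim: s => [|i s IH].
  by under eq_fun do rewrite big_nil; exact: cintegrable0.
by under eq_fun do rewrite big_cons; exact: cintegrable_add.
Qed.

Lemma eq_cintegrable f g : (forall t, D t -> f t = g t) -> cintegrable f -> cintegrable g.
Proof.
move=> fg [h1 h2]; split.
- by apply: eq_integrable h1 => // t /set_mem Dt /=; rewrite fg.
- by apply: eq_integrable h2 => // t /set_mem Dt /=; rewrite fg.
Qed.

Lemma eq_cintegral f g : (forall t, D t -> f t = g t) ->
  cintegral mu D f = cintegral mu D g.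
Proof.
move=> fg; rewrite /cintegral; congr (_ +i* _); apply: eq_Rintegral => t /set_mem Dt.
- by rewrite fg.
- by rewrite fg.
Qed.

Lemma cintegral_add f g : cintegrable f -> cintegrable g ->
  cintegral mu D (fun t => f t + g t) = cintegral mu D f + cintegral mu D g.
Proof.
move=> [f1 f2] [g1 g2]; rewrite /cintegral; apply: Cext => /=.
- by rewrite -RintegralD//; apply: eq_Rintegral => t _; rewrite cReD.
- by rewrite -RintegralD//; apply: eq_Rintegral => t _; rewrite cImD.
Qed.

Lemma cintegral_mull c f : cintegrable f ->
  cintegral mu D (fun t => c * f t) = c * cintegral mu D f.
Proof.
move=> [f1 f2]; rewrite /cintegral; apply: Cext; rewrite ?cReM ?cImM /=.
- rewrite -!RintegralZl// -RintegralB//; last 2 first.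
  + exact: (integrableZl mD _ f1).
  + exact: (integrableZl mD _ f2).
  by apply: eq_Rintegral => t _; rewrite cReM.
- rewrite -!RintegralZl// -RintegralD//; last 2 first.
  + exact: (integrableZl mD _ f2).
  + exact: (integrableZl mD _ f1).
  by apply: eq_Rintegral => t _; rewrite cImM.
Qed.

Lemma cintegral0 : cintegral mu D (fun=> 0) = 0.
Proof.
apply: Cext; rewrite /cintegral /= /Rintegral.
- by rewrite integral0.
- by rewrite integral0.
Qed.

Lemma cintegral_sum (I : Type) (s : seq I) (F : I -> T -> R[i]) :
  (forall i, cintegrable (F i)) ->
  cintegral mu D (fun t => \sum_(i <- s) F i t) = \sum_(i <- s) cintegral mu D (F i).
Proof.
move=> h; elim: s => [|i s IH].
  by under eq_cintegral do rewrite big_nil; rewrite big_nil cintegral0.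
under eq_cintegral do rewrite big_cons.
by rewrite big_cons cintegral_add// ?IH//; exact: cintegrable_sum.
Qed.

Lemma dominated_integrable (h g : T -> R) : measurable_fun D h ->
  (forall t, D t -> `|h t| <= g t) -> mu.-integrable D (EFin \o g) ->
  mu.-integrable D (EFin \o h).
Proof.
move=> mh hg ig; apply: le_integrable ig => //; first exact/measurable_EFinP.
move=> t Dt /=; rewrite lee_fin (ger0_norm (le_trans (normr_ge0 _) (hg t Dt))).
exact: hg.
Qed.

Lemma cintegrable_dominated f (g : T -> R) : cmeasurable f ->
  (forall t, D t -> normc (f t) <= g t) -> mu.-integrable D (EFin \o g) ->
  cintegrable f.
Proof.
move=> [m1 m2] fg ig; split; apply: dominated_integrable ig => // t Dt.
- exact: le_trans (Re_le_normc _) (fg _ Dt).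
- exact: le_trans (Im_le_normc _) (fg _ Dt).
Qed.

(** The factor 2 comes from estimating real and imaginary parts separately. It recurs in the later
    constants, of which only the order of magnitude matters. *)
Lemma normc_cintegral_le f (g : T -> R) : cintegrable f ->
  mu.-integrable D (EFin \o g) ->
  (forall t, D t -> normc (f t) <= g t) ->
  normc (cintegral mu D f) <= 2 * \int[mu]_(t in D) g t.
Proof.
move=> [f1 f2] ig fg.
have key (h : T -> R) : mu.-integrable D (EFin \o h) ->
    (forall t, D t -> `|h t| <= g t) ->
    `|\int[mu]_(t in D) h t| <= \int[mu]_(t in D) g t.
  move=> ih hg; apply: le_trans (le_normr_Rintegral mD ih) _.
  by apply: le_Rintegral => //; exact: integrable_norm.
rewrite (le_trans (normc_le _))// mulr_natl mulr2n /cintegral /= lerD// key// => t Dt.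
- exact: le_trans (Re_le_normc _) (fg _ Dt).
- exact: le_trans (Im_le_normc _) (fg _ Dt).
Qed.

Lemma cvgc_ReIm (u : nat -> R[i]) l :
  cvgc u l <-> (fun n => complex.Re (u n)) @ \oo --> complex.Re l /\
               (fun n => complex.Im (u n)) @ \oo --> complex.Im l.
Proof.
split=> [h|[h1 h2]].
- split; apply/cvgrPdist_lt => e e0; move/cvgrPdist_lt: h => /(_ e e0); apply: filterS => n;
    rewrite sub0r normrN ger0_norm ?normc_ge0// => /(le_lt_trans _); apply.
  + by rewrite distrC -cReN -cReD Re_le_normc.
  + by rewrite distrC -cImN -cImD Im_le_normc.
- apply/cvgrPdist_lt => e e0.
  have e2 : 0 < e / 2 by rewrite divr_gt0.
  move/cvgrPdist_lt: h1 => /(_ _ e2); move/cvgrPdist_lt: h2 => /(_ _ e2).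
  apply: filterS2 => n a b; rewrite sub0r normrN ger0_norm ?normc_ge0//.
  rewrite (le_lt_trans (normc_le _))// cReD cImD cReN cImN (splitr e).
  by rewrite ltrD// distrC.
Qed.

Lemma cintegral_cvg (F : nat -> T -> R[i]) f (g : T -> R) :
  (forall n, cmeasurable (F n)) -> cmeasurable f ->
  (forall t, D t -> cvgc (F ^~ t) (f t)) ->
  (forall n t, D t -> normc (F n t) <= g t) -> mu.-integrable D (EFin \o g) ->
  cvgc (fun n => cintegral mu D (F n)) (cintegral mu D f).
Proof.
move=> mF [mf1 mf2] Ff Fg ig.
have key (H : nat -> T -> R) (h : T -> R) : (forall n, measurable_fun D (H n)) ->
    measurable_fun D h -> (forall t, D t -> H ^~ t @ \oo --> h t) ->
    (forall n t, D t -> `|H n t| <= g t) ->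
    (fun n => \int[mu]_(t in D) H n t) @ \oo --> \int[mu]_(t in D) h t.
  move=> mH mh Hh Hg.
  have [|||||ih _ cv] := @dominated_convergence _ _ _ mu D mD (fun n => EFin \o H n) (EFin \o h) (EFin \o g).
  - by move=> n; exact/measurable_EFinP.
  - exact/measurable_EFinP.
  - by apply/aeW => t Dt; apply: cvg_EFin; [exact: nearW|exact: Hh].
  - exact: ig.
  - by apply/aeW => t n Dt /=; rewrite lee_fin Hg.
  apply: fine_cvg; rewrite fineK//; exact: integrable_fin_num.
apply/cvgc_ReIm; split; apply: key => //.
- by move=> n; case: (mF n).
- by move=> t /Ff /cvgc_ReIm[].
- by move=> n t Dt; exact: le_trans (Re_le_normc _) (Fg _ _ Dt).
- by move=> n; case: (mF n).
- by move=> t /Ff /cvgc_ReIm[].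
- by move=> n t Dt; exact: le_trans (Im_le_normc _) (Fg _ _ Dt).
Qed.

Lemma cintegral_cd (F dF : R -> T -> R[i]) (g : T -> R) (u v a : R) :
  u < a < v ->
  (forall r, u < r < v -> cintegrable (F r)) ->
  (forall r t, u < r < v -> D t -> cd (fun r : R^o => F r t) r 1 (dF r t)) ->
  (forall t, 0 <= g t) -> mu.-integrable D (EFin \o g) ->
  (forall r t, u < r < v -> D t -> normc (dF r t) <= g t) ->
  cd (fun r : R^o => cintegral mu D (F r)) a 1 (cintegral mu D (dF a)).
Proof.
move=> uav iF dFE g0 ig dFg.
have key (H dH : R -> T -> R) :
    (forall r, u < r < v -> mu.-integrable D (EFin \o H r)) ->
    (forall r t, u < r < v -> D t -> is_derive (r : R^o) 1 (fun r : R^o => H r t) (dH r t)) ->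
    (forall r t, u < r < v -> D t -> `|dH r t| <= g t) ->
    is_derive (a : R^o) 1 (fun r : R^o => \int[mu]_(t in D) H r t : R) (\int[mu]_(t in D) dH a t).
  move=> iH dHE dHg.
  have Ia : `]u, v[%classic a by rewrite /= in_itv.
  have h1 x : `]u, v[%classic x -> mu.-integrable D (EFin \o H x).
    by rewrite /= in_itv; exact: iH.
  have h2 x y : `]u, v[%classic x -> D y -> derivable (H ^~ y) x 1.
    by rewrite /= in_itv => ux Dy; case: (dHE x y ux Dy).
  have E x y : u < x < v -> D y -> partial1of2 H x y = dH x y.
    by move=> ux Dy; rewrite partial1of2E; case: (dHE x y ux Dy).
  have h3 x y : `]u, v[%classic x -> D y -> `|partial1of2 H x y| <= g y.
    by rewrite /= in_itv => ux Dy; rewrite E// dHg.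
  apply: DeriveDef.
    exact: (@derivable_under_integral _ _ _ mu H D mD a u v Ia h1 h2 g g0 ig h3).
  have := @differentiation_under_integral _ _ _ mu H D mD a u v Ia h1 h2 g g0 ig h3.
  rewrite derive1E => ->; apply: eq_Rintegral => t /set_mem Dt.
  exact: E.
split.
- apply: (key (fun r t => complex.Re (F r t)) (fun r t => complex.Re (dF r t))).
  + by move=> r /iF[].
  + by move=> r t ur Dt; case: (dFE r t ur Dt).
  + by move=> r t ur Dt; exact: le_trans (Re_le_normc _) (dFg _ _ ur Dt).
- apply: (key (fun r t => complex.Im (F r t)) (fun r t => complex.Im (dF r t))).
  + by move=> r /iF[].
  + by move=> r t ur Dt; case: (dFE r t ur Dt).
  + by move=> r t ur Dt; exact: le_trans (Im_le_normc _) (dFg _ _ ur Dt).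
Qed.

End ComplexIntegral.

Section ComplexLimits.
Context {R : realType} {T : Type} (F : set_system T) {FF : Filter F}.
Implicit Types (f g : T -> R[i]) (l m : R[i]).

Definition clim f l : Prop := (fun t => normc (f t - l)) @ F --> (0 : R).

Lemma climP f l : clim f l <-> forall e : R, 0 < e -> \forall t \near F, normc (f t - l) < e.
Proof.
split=> [/cvgrPdist_lt h e e0|h].
  by apply: filterS (h e e0) => t; rewrite sub0r normrN ger0_norm ?normc_ge0.
apply/cvgrPdist_lt => e e0; apply: filterS (h e e0) => t.
by rewrite sub0r normrN ger0_norm ?normc_ge0.
Qed.

Lemma clim_ReIm f l : clim f l <->
  ((fun t => complex.Re (f t)) @ F --> complex.Re l /\
   (fun t => complex.Im (f t)) @ F --> complex.Im l).
Proof.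
split=> [/climP h|[h1 h2]].
- split; apply/cvgrPdist_lt => e e0; apply: filterS (h e e0) => t; apply: le_lt_trans.
  + by rewrite distrC -cReN -cReD Re_le_normc.
  + by rewrite distrC -cImN -cImD Im_le_normc.
- apply/climP => e e0; have e2 : 0 < e / 2 by rewrite divr_gt0.
  move/cvgrPdist_lt: h1 => /(_ _ e2); move/cvgrPdist_lt: h2 => /(_ _ e2).
  apply: filterS2 => n a b.
  rewrite (le_lt_trans (normc_le _))// cReD cImD cReN cImN (splitr e).
  by rewrite ltrD// distrC.
Qed.

Lemma clim_cst l : clim (fun=> l) l.
Proof. by apply/climP => e e0; apply: nearW => t; rewrite subrr normc_0. Qed.

Lemma clim_near f g l : (\forall t \near F, f t = g t) -> clim f l -> clim g l.
Proof.
by move=> fg /climP h; apply/climP => e /h; apply: filterS2 fg => t ->.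
Qed.

Lemma clim_add f g l m : clim f l -> clim g m -> clim (fun t => f t + g t) (l + m).
Proof.
move=> /clim_ReIm[f1 f2] /clim_ReIm[g1 g2]; apply/clim_ReIm; rewrite cReD cImD; split.
- by under eq_fun do rewrite cReD; exact: cvgD.
- by under eq_fun do rewrite cImD; exact: cvgD.
Qed.

Lemma clim_mul f g l m : clim f l -> clim g m -> clim (fun t => f t * g t) (l * m).
Proof.
move=> /clim_ReIm[f1 f2] /clim_ReIm[g1 g2]; apply/clim_ReIm; rewrite cReM cImM; split.
- by under eq_fun do rewrite cReM; apply: cvgB; apply: cvgM.
- by under eq_fun do rewrite cImM; apply: cvgD; apply: cvgM.
Qed.

Lemma clim_mull c f l : clim f l -> clim (fun t => c * f t) (c * l).
Proof. exact: clim_mul (clim_cst c). Qed.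

Lemma clim_opp f l : clim f l -> clim (fun t => - f t) (- l).
Proof.
move=> h; have := clim_mull (-1) h; rewrite mulN1r.
by under eq_fun do rewrite mulN1r.
Qed.

Lemma clim_sub f g l m : clim f l -> clim g m -> clim (fun t => f t - g t) (l - m).
Proof. by move=> hf /clim_opp; exact: clim_add. Qed.

Lemma clim_sum (I : Type) (s : seq I) (G : I -> T -> R[i]) (L : I -> R[i]) :
  (forall i, clim (G i) (L i)) ->
  clim (fun t => \sum_(i <- s) G i t) (\sum_(i <- s) L i).
Proof.
move=> h; elim: s => [|i s IH].
  by under eq_fun do rewrite big_nil; rewrite big_nil; exact: clim_cst.
by under eq_fun do rewrite big_cons; rewrite big_cons; exact: clim_add.
Qed.

Lemma clim_real (f : T -> R) (l : R) : f @ F --> l -> clim (fun t => (f t)%:C) l%:C.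
Proof. by move=> h; apply/clim_ReIm; split => //=; exact: cvg_cst. Qed.

Lemma clim_cexp f l : clim f l -> clim (fun t => cexp (f t)) (cexp l).
Proof.
move=> /clim_ReIm[f1 f2]; rewrite /cexp; apply: clim_mul.
  by apply: clim_real; apply: continuous_cvg => //; exact: continuous_expR.
apply/clim_ReIm; split => /=.
- by apply: continuous_cvg => //; exact: continuous_cos.
- by apply: continuous_cvg => //; exact: continuous_sin.
Qed.

Lemma clim_squeeze f l (b : T -> R) : (\forall t \near F, normc (f t - l) <= b t) ->
  b @ F --> (0 : R) -> clim f l.
Proof.
move=> fb b0; apply: (@squeeze_cvgr _ _ _ _ (fun=> 0) b) => //; last exact: cvg_cst.
by apply: filterS fb => t ->; rewrite normc_ge0.
Qed.

End ComplexLimits.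

Lemma clim_unique {R : realType} {T : Type} (F : set_system T) {FF : ProperFilter F}
  (f : T -> R[i]) l m : clim F f l -> clim F f m -> l = m.
Proof.
move=> /climP h1 /climP h2; apply/eqP; rewrite -subr_eq0 -normc_eq0.
apply/eqP/le_anti; rewrite normc_ge0 andbT; apply/ler_addgt0Pr => e e0.
have e2 : 0 < e / 2 by rewrite divr_gt0.
have [t [a b]] := filter_ex (filterI (h1 _ e2) (h2 _ e2)).
rewrite add0r (splitr e) -[l - m](subrKA (f t)).
rewrite (le_trans (normc_add _ _))// lerD// ltW//.
by rewrite -normc_opp opprB.
Qed.

(** * Laplace integrals after [s = t ^ 2]: Gaussian weights on the half-line *)

Section HalfLine.
Context {R : realType}.
Implicit Types (r t a : R) (h : R -> R[i]).
Notation mu := (@lebesgue_measure R).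
Definition hline : set (measurableTypeR R) := `]0, +oo[%classic.
Notation P := hline.

Lemma hlineE t : P t = (0 < t) :> Prop.
Proof. by rewrite /hline /= in_itv /= andbT. Qed.

Lemma measurable_hline : measurable P.
Proof. exact: measurable_itv. Qed.
Hint Resolve measurable_hline : core.

Lemma cts_measurable_hline (f : R -> R) : (forall t, 0 < t -> {for t, continuous f}) ->
  measurable_fun P f.
Proof.
move=> h; apply: open_continuous_measurable_fun; first exact: interval_open.
by move=> t /set_mem; rewrite hlineE => /h.
Qed.

Lemma cd_cmeasurable h dh : (forall t, 0 < t -> cd (h : R^o -> R[i]) t 1 (dh t)) -> cmeasurable P h.
Proof.
move=> H; split; apply: cts_measurable_hline => t t0; by case: (cd_continuous (H t t0)).
Qed.

Lemma cmeasurable_mul h g : cmeasurable P h -> cmeasurable P g ->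
  cmeasurable P (fun t => h t * g t).
Proof.
move=> [h1 h2] [g1 g2]; split.
- under eq_fun do rewrite cReM.
  by apply: measurable_funB; apply: measurable_funM.
- under eq_fun do rewrite cImM.
  by apply: measurable_funD; apply: measurable_funM.
Qed.

Lemma cmeasurable_real (f : R -> R) : measurable_fun P f -> cmeasurable P (fun t => (f t)%:C).
Proof. by move=> mf; split => //=; exact: measurable_cst. Qed.

(** The Laplace kernel exp(- r s) after [s = t ^ 2]. Differentiation in [r] brings down even powers
    of [t], which is why only these occur in [moment]. *)
Definition gk r t : R := expR (- (r * t ^+ 2)).

Lemma gk_ge0 r t : 0 <= gk r t. Proof. exact: expR_ge0. Qed.

Lemma continuous_gk r : continuous (gk r).
Proof.
move=> t; apply: continuous_comp; last exact: continuous_expR.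
apply: cvgN; apply: cvgM; first exact: cvg_cst.
exact: exprn_continuous.
Qed.

Lemma measurable_gkX r n : measurable_fun P (fun t => gk r t * t ^+ n).
Proof.
apply: cts_measurable_hline => t _; apply: cvgM; first exact: continuous_gk.
exact: exprn_continuous.
Qed.

(** Completing the square, [0 <= r * (t - r^-1) ^+ 2] bounds exp(- r t^2) exp(t) by exp(1/r) exp(-
    t); the extra factor exp(t) absorbs [t ^+ n]. *)
Lemma gkX_le r n t : 0 < r -> 0 <= t ->
  gk r t * t ^+ n <= (n.+1)`!%:R * expR r^-1 * expR (- t).
Proof.
move=> r0 t0; have h1 : t ^+ n <= (n.+1)`!%:R * expR t.
  case: n => [|n].
    by rewrite expr0 mul1r -expR0 ler_expR.
  have := expR_ge1Dxn n t0; set A := n.+1`!%:R => hA.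
  have A0 : 0 < A by rewrite ltr0n fact_gt0.
  have hB : t ^+ n.+1 <= A * expR t.
    rewrite -ler_pdivrMl// mulrC (le_trans _ hA)// lerDr//.
  apply: (le_trans hB); rewrite ler_wpM2r ?expR_ge0// ler_nat.
  by rewrite [leqRHS]factS leq_pmull.
have h2 : gk r t * expR t <= expR r^-1 * expR (- t).
  rewrite /gk -!expRD ler_expR.
  have : 0 <= r * (t - r^-1) ^+ 2 by rewrite mulr_ge0 ?sqr_ge0// ltW.
  have -> : r * (t - r^-1) ^+ 2 = r * t ^+ 2 - 2 * t + r^-1 by field; rewrite gt_eqF.
  lra.
apply: (le_trans (ler_wpM2l (gk_ge0 _ _) h1)).
by rewrite mulrCA -mulrA ler_wpM2l.
Qed.

Lemma integrable_expN : mu.-integrable P (EFin \o (fun t => expR (- t))).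
Proof.
have h : mu.-integrable P (EFin \o @exponential_pdf R 1).
  by apply: (@integrableS _ _ _ mu setT) => //; exact: integrable_exponential_pdf.
apply: eq_integrable h => // t /set_mem; rewrite hlineE => t0 /=.
by rewrite exponential_pdfE ?ltW// mul1r mulN1r.
Qed.

Lemma integrable_gkX r n : 0 < r -> mu.-integrable P (EFin \o (fun t => gk r t * t ^+ n)).
Proof.
move=> r0; set c := (n.+1)`!%:R * expR r^-1 : R.
apply: (le_integrable measurable_hline _ _ (integrableZl measurable_hline c integrable_expN)).
  by apply/measurable_EFinP; exact: measurable_gkX.
move=> t; rewrite hlineE => t0 /=; rewrite lee_fin !ger0_norm.
- exact/gkX_le/ltW.
- by rewrite mulr_ge0 ?expR_ge0// mulr_ge0// expR_ge0.
- by rewrite mulr_ge0 ?gk_ge0// exprn_ge0// ltW.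
Qed.

Lemma integrable_gkX2 r (A B : R) m n : 0 < r ->
  mu.-integrable P (EFin \o (fun t => A * (gk r t * t ^+ m) + B * (gk r t * t ^+ n))).
Proof.
move=> r0; have h1 := integrableZl measurable_hline A (integrable_gkX m r0).
have h2 := integrableZl measurable_hline B (integrable_gkX n r0).
exact: (integrableD measurable_hline h1 h2).
Qed.

(** Replaces integration by parts: identities between Laplace moments are obtained by exhibiting a
    [K] that vanishes at both ends of the half-line. The fundamental theorem is applied on compact
    intervals exhausting it, followed by dominated convergence. *)
Lemma cintegral_derivative_eq0 (K dK : R -> R[i]) :
  (forall t, 0 < t -> cd (K : R^o -> R[i]) t 1 (dK t)) ->
  (forall t, 0 < t -> {for t, continuous (fun y => complex.Re (dK y))} /\
     {for t, continuous (fun y => complex.Im (dK y))}) ->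
  cintegrable mu P dK ->
  clim 0^'+ K 0 -> clim +oo K 0 -> cintegral mu P dK = 0.
Proof.
move=> hK cK [i1 i2] K0 Ky.
have key (F f : R -> R) : (forall t, 0 < t -> is_derive (t : R^o) 1 (F : R^o -> R) (f t)) ->
    (forall t, 0 < t -> {for t, continuous f}) -> mu.-integrable P (EFin \o f) ->
    F @ 0^'+ --> (0 : R) -> F @ +oo --> (0 : R) -> \int[mu]_(t in P) f t = 0.
  move=> dF cf jf F0 Fy.
  (* With these offsets the interval is nondegenerate already for [n = 0]. *)
  pose I n : set (measurableTypeR R) := `[n.+2%:R^-1, n.+1%:R]%classic.
  have ab n : n.+2%:R^-1 < n.+1%:R :> R.
    rewrite (@lt_le_trans _ _ 1)// ?ler1n// invf_lt1// ?ltr1n// ltr0n//.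
  have IP n : I n `<=` P.
    by move=> t; rewrite hlineE /I /= in_itv /= => /andP[+ _]; apply: lt_le_trans; rewrite invr_gt0 ltr0n.
  have E n : \int[mu]_(t in P) (f \_ (I n)) t = F n.+1%:R - F n.+2%:R^-1.
    rewrite -Rintegral_mkcondr setIC (setIidl (IP n)) /Rintegral.
    rewrite (@continuous_FTC2 _ f F _ _ (ab n)) ?EFinB//.
    - apply: continuous_in_subspaceT => t /set_mem /(IP n); rewrite hlineE; exact: cf.
    - split.
      + move=> t; rewrite in_itv/= => /andP[h _]; suff /dF[] : 0 < t by [].
        by rewrite (lt_trans _ h)// invr_gt0 ltr0n.
      + apply: cvg_at_right_filter; apply: differentiable_continuous; apply/derivable1_diffP.
        by suff /dF[] : 0 < (n.+2%:R : R)^-1 by []; rewrite invr_gt0 ltr0n.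
      + apply: cvg_at_left_filter; apply: differentiable_continuous; apply/derivable1_diffP.
        by suff /dF[] : 0 < (n.+1%:R : R) by []; rewrite ltr0n.
    - move=> t; rewrite in_itv/= => /andP[h _]; rewrite derive1E.
      suff /dF[] : 0 < t by []. by rewrite (lt_trans _ h)// invr_gt0 ltr0n.
  have mf : measurable_fun P f by exact: cts_measurable_hline.
  have c1 : (fun n => \int[mu]_(t in P) (f \_ (I n)) t) @ \oo --> \int[mu]_(t in P) f t.
    have [|||||ih _ cv] := @dominated_convergence _ _ R mu P measurable_hline
        (fun n => EFin \o (f \_ (I n))) (EFin \o f) (EFin \o (Num.norm \o f)).
    - move=> n; apply/measurable_EFinP; apply/(measurable_restrict _ _ _).1 => //.
        exact: measurable_itv.
      by apply: measurable_funS mf => //; exact: subIsetl.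
    - exact/measurable_EFinP.
    - apply/aeW => t; rewrite hlineE => t0; apply: cvg_near_cst.
      have tI : \forall n \near \oo, I n t.
        exists (Num.bound (t + t^-1)) => // n /= hn.
        have tb : t + t^-1 < n%:R.
          apply: (lt_le_trans (archi_boundP _)); last by rewrite ler_nat.
          by rewrite addr_ge0 ?invr_ge0 ?ltW.
        have ti : 0 < t^-1 by rewrite invr_gt0.
        rewrite /I /= in_itv /=; apply/andP; split.
          rewrite -[t]invrK lef_pV2 ?posrE ?ltr0n//.
          rewrite -addn2 natrD; lra.
        rewrite -natr1; lra.
      by apply: filterS tI => n h; rewrite /= patchT// inE.
    - exact: integrable_norm.
    - apply/aeW => t n _ /=; rewrite lee_fin /patch; case: ifP => // _.
      by rewrite normr0.
    by apply: fine_cvg; rewrite fineK//; exact: integrable_fin_num.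
  have c2 : (fun n => \int[mu]_(t in P) (f \_ (I n)) t) @ \oo --> (0 : R).
    under eq_fun do rewrite E.
    rewrite -[0 : R](subr0 0); apply: cvgB.
    - move/cvg_pinftyP: Fy => /(_ (fun n => n.+1%:R)); apply.
      by apply/cvgryPge => A; near=> n; rewrite (@le_trans _ _ n%:R)// ?ler_nat//; near: n; exact: nbhs_infty_ger.
    - move/cvg_at_rightP: F0 => /(_ (fun n => n.+2%:R^-1)); apply; split.
        by move=> n; rewrite invr_gt0 ltr0n.
      have := @cvg_harmonic R; rewrite -(cvg_shiftS _) => h; exact: h.
  by have := cvg_unique _ c1 c2; apply; exact: norm_hausdorff.
move/clim_ReIm: K0 => [K01 K02]; move/clim_ReIm: Ky => [Ky1 Ky2].
rewrite /cintegral; apply: Cext => /=.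
- apply: (key (fun t => complex.Re (K t))) => // t t0; first by case: (hK t t0).
  by case: (cK t t0).
- apply: (key (fun t => complex.Im (K t))) => // t t0; first by case: (hK t t0).
  by case: (cK t t0).
Unshelve. all: end_near. Qed.

End HalfLine.
#[export] Hint Extern 0 (measurable _) => (exact: measurable_hline) : core.

Section GaussMoments.
Context {R : realType}.
Notation mu := (@lebesgue_measure R).
Notation P := (@hline R).
Implicit Types r t : R.

Lemma gk_derive r t : is_derive (t : R^o) 1 (gk r : R^o -> R) (- (2 * r * t) * gk r t).
Proof.
have h : is_derive (t : R^o) 1 (fun y : R^o => - (r * y ^+ 2)) (- (2 * r * t)).
  apply: is_derive_eq; rewrite /GRing.scale /=; ring.
have := @is_derive1_comp _ _ _ _ _ _ (is_derive_expR _) h.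
by move=> H; apply: is_derive_eq H _; rewrite /gk mulrC.
Qed.

Lemma gk_derive_r r t : is_derive (r : R^o) 1 (fun y : R^o => gk y t) (- t ^+ 2 * gk r t).
Proof.
have h : is_derive (r : R^o) 1 (fun y : R^o => - (y * t ^+ 2)) (- t ^+ 2).
  apply: is_derive_eq; rewrite /GRing.scale /=; ring.
have := @is_derive1_comp _ _ _ _ _ _ (is_derive_expR _) h.
by move=> H; apply: is_derive_eq H _; rewrite /gk mulrC.
Qed.

Lemma gk_le_inv r t : 0 < r -> 0 < t -> gk r t <= (r * t ^+ 2)^-1.
Proof.
move=> r0 t0; have x0 : 0 < r * t ^+ 2 by rewrite mulr_gt0// exprn_gt0.
rewrite /gk expRN lef_pV2 ?posrE ?expR_gt0//.
by rewrite (le_trans _ (expR_ge1Dx _))// lerDr.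
Qed.

Lemma cvg_inv_y : (fun t => t^-1) @ +oo --> (0 : R).
Proof.
apply/cvgrPdist_lt => e e0; near=> t.
have t0 : 0 < t by [].
rewrite sub0r normrN ger0_norm ?invr_ge0 ?ltW// invf_plt ?posrE//.
by near: t; apply: nbhs_pinfty_gt; rewrite num_real.
Unshelve. all: end_near. Qed.

Lemma cvg_gk_y r : 0 < r -> gk r @ +oo --> (0 : R).
Proof.
move=> r0.
have h : (fun t => r^-1 * (t^-1 * t^-1)) @ +oo --> (0 : R).
  rewrite -[0 : R](mulr0 r^-1); apply: cvgM; first exact: cvg_cst.
  rewrite -[0 : R](mulr0 0); apply: cvgM; exact: cvg_inv_y.
apply: (@squeeze_cvgr _ _ _ _ (fun=> 0) _ _ _ _ _ h); last exact: cvg_cst.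
near=> t; rewrite gk_ge0/= (le_trans (gk_le_inv r0 _))//.
by rewrite invfM expr2 invfM.
Unshelve. all: end_near. Qed.

Lemma gauss_moment1 r : 0 < r -> \int[mu]_(t in P) (gk r t * t) = (2 * r)^-1.
Proof.
move=> r0; have r2 : 2 * r != 0 by rewrite mulf_neq0// gt_eqF.
rewrite /hline Rintegral_itv_obnd_cbnd; last first.
  by have := integrable_gkX 1 r0; under eq_fun do rewrite expr1.
rewrite (@Rintegral_ge0_continuous_FTC2y _ _ (fun t => - (2 * r)^-1 * gk r t) 0 0).
- by rewrite /gk expr0n/= mulr0 oppr0 expR0 mulr1 sub0r opprK.
- by move=> t t0; rewrite mulr_ge0// gk_ge0.
- apply: continuous_subspaceT => t; apply: cvgM; [exact: continuous_gk|exact: cvg_id].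
- rewrite -[0 : R](mulr0 (- (2 * r)^-1)); apply: cvgM; [exact: cvg_cst|exact: cvg_gk_y].
- move=> t _; have [h _] := gk_derive r t; exact: (derivableM (derivable_cst _ _ _) h).
- apply: cvg_at_right_filter; apply: cvgM; [exact: cvg_cst|exact: continuous_gk].
- move=> t _; rewrite derive1E.
  have [_ ->] := is_deriveZ (- (2 * r)^-1) (gk_derive r t).
  by rewrite /GRing.scale /=; field; rewrite gt_eqF.
Qed.

Lemma gauss_moment3 r : 0 < r -> \int[mu]_(t in P) (gk r t * (2 * t ^+ 3)) = (r ^+ 2)^-1.
Proof.
move=> r0.
pose K t : R[i] := (t ^+ 2 * gk r t)%:C.
pose dK t : R[i] := (2 * (gk r t * t ^+ 1) + (- (2 * r)) * (gk r t * t ^+ 3))%:C.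
have hK t : 0 < t -> cd (K : R^o -> R[i]) t 1 (dK t).
  move=> _; apply: cd_real.
  have h2 : is_derive (t : R^o) 1 (fun y : R^o => y ^+ 2) (2 * t).
    by apply: is_derive_eq; rewrite /GRing.scale /=; ring.
  have := is_deriveM h2 (gk_derive r t).
  by move=> H; apply: is_derive_eq H _; rewrite /GRing.scale /=; ring.
have i1 := integrable_gkX2 2 (- (2 * r)) 1 3 r0.
have : cintegral mu P dK = 0.
  apply: (cintegral_derivative_eq0 hK).
  - move=> t _; split => /=; last exact: cvg_cst.
    by apply: cvgD; apply: cvgM; do ?exact: cvg_cst; apply: cvgM;
      [exact: continuous_gk|exact: exprn_continuous|exact: continuous_gk|exact: exprn_continuous].
  - by split; [exact: i1 | exact: integrable0].
  - rewrite -[0 : R[i]]/(0%:C); apply: clim_real.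
    rewrite [X in _ --> X](_ : 0 = 0 ^+ 2 * gk r 0); last by rewrite expr0n/= mul0r.
    apply: cvg_at_right_filter; apply: cvgM; [exact: exprn_continuous|exact: continuous_gk].
  - rewrite -[0 : R[i]]/(0%:C); apply: clim_real.
    have h : (fun t => (r ^+ 2)^-1 * (2 * (t^-1 * t^-1))) @ +oo --> (0 : R).
      rewrite -[0 : R](mulr0 (r ^+ 2)^-1); apply: cvgM; first exact: cvg_cst.
      rewrite -[0 : R](mulr0 2); apply: cvgM; first exact: cvg_cst.
      rewrite -[0 : R](mulr0 0); apply: cvgM; exact: cvg_inv_y.
    apply: (@squeeze_cvgr _ _ _ _ (fun=> 0) _ _ _ _ _ h); last exact: cvg_cst.
    near=> t; have t0 : 0 < t by [].
    rewrite mulr_ge0 ?gk_ge0 ?sqr_ge0//=.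
    have x0 : 0 < r * t ^+ 2 by rewrite mulr_gt0// exprn_gt0.
    have : gk r t <= ((r * t ^+ 2) ^+ 2 / 2)^-1.
      rewrite /gk expRN lef_pV2 ?posrE ?expR_gt0 ?divr_gt0 ?exprn_gt0//.
      by have := expR_ge1Dxn 1 (ltW x0); rewrite !factS fact0 muln1/=; lra.
    move=> /(ler_wpM2l (sqr_ge0 t)) /le_trans; apply.
    rewrite le_eqVlt; apply/orP; left; apply/eqP; field.
    by rewrite !gt_eqF.
move=> /(congr1 (@complex.Re R)) /=.
have j1 := integrable_gkX 1 r0; have j3 := integrable_gkX 3 r0.
rewrite RintegralD//; last 2 first.
- exact: (integrableZl measurable_hline 2 j1).
- exact: (integrableZl measurable_hline (- (2 * r)) j3).
rewrite !RintegralZl//.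
under eq_Rintegral do rewrite expr1.
rewrite gauss_moment1// => h.
have -> : \int[mu]_(t in P) (gk r t * (2 * t ^+ 3)) = 2 * \int[mu]_(t in P) (gk r t * t ^+ 3).
  by rewrite -RintegralZl//; apply: eq_Rintegral => t _; ring.
have r1 : r != 0 by rewrite gt_eqF.
apply: (mulfI r1); have -> : r * (r ^+ 2)^-1 = 2 * (2 * r)^-1 by field.
lra.
Unshelve. all: end_near. Qed.

Lemma integrable_indic_hline (s : R) : mu.-integrable P (EFin \o (\1_(`]0, s]%classic : set (measurableTypeR R)) : R -> R)).
Proof.
by apply: (@integrableS _ _ _ mu setT) => //; exact: integrable_indic_itv.
Qed.

Lemma Rintegral_indic_hline (s : R) : 0 < s ->
  \int[mu]_(t in P) (\1_(`]0, s]%classic : set (measurableTypeR R)) t) = s.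
Proof.
move=> s0; rewrite /Rintegral.
rewrite (@integral_indic _ _ _ mu _ measurable_hline _ (measurable_itv _)).
rewrite setIidl; last first.
  by move=> t; rewrite hlineE /= in_itv/= => /andP[].
have E := @lebesgue_measure_itv R `]0, s]; rewrite /= lte_fin s0 in E.
transitivity (fine (s%:E - 0%:E)%E); first by congr fine; exact: E.
by rewrite /= subr0.
Qed.

(** Split at [t = 1 / sqrt r]: below, the kernel is at most 1; above, [t * sqrt r >= 1] and the
    first moment takes over. The two parts add up to 3/2 times [1 / sqrt r]. *)
Lemma gauss_moment0_le r : 0 < r -> \int[mu]_(t in P) gk r t <= 2 / Num.sqrt r.
Proof.
move=> r0; set s := (Num.sqrt r)^-1.
have sr : 0 < Num.sqrt r by rewrite sqrtr_gt0.
have s0 : 0 < s by rewrite invr_gt0.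
have j1 := integrable_gkX 1 r0.
have i1 := integrableZl measurable_hline s^-1 j1.
have ii := integrable_indic_hline s.
have i0 : mu.-integrable P (EFin \o gk r).
  by have := integrable_gkX 0 r0; under eq_fun do rewrite expr0 mulr1.
apply: (@le_trans _ _ (\int[mu]_(t in P) (\1_(`]0, s]%classic : set (measurableTypeR R)) t + s^-1 * (gk r t * t ^+ 1)))).
  apply: le_Rintegral => //; first exact: (integrableD measurable_hline ii i1).
  move=> t; rewrite hlineE => t0; rewrite indicE expr1.
  have [ts|ts] := leP t s.
    rewrite mem_set ?/= ?in_itv/= ?t0//.
    have : gk r t <= 1 by rewrite /gk -expR0 ler_expR oppr_le0 mulr_ge0 ?sqr_ge0 ?ltW.
    have : 0 <= s^-1 * (gk r t * t) by rewrite mulr_ge0 ?invr_ge0 ?mulr_ge0 ?gk_ge0 ?ltW.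
    lra.
  rewrite memNset ?add0r ?/=; last by rewrite in_itv/= t0/= leNgt ts.
  rewrite mulrCA ler_peMr ?gk_ge0// ler_pdivlMl// mulr1; exact: ltW.
rewrite RintegralD// RintegralZl// Rintegral_indic_hline//.
under [X in _ + _ * X]eq_Rintegral do rewrite expr1.
rewrite gauss_moment1// /s invrK -[X in 2 * X](sqr_sqrtr (ltW r0)).
have -> : Num.sqrt r * (2 * Num.sqrt r ^+ 2)^-1 = 2^-1 * (Num.sqrt r)^-1.
  by field; rewrite gt_eqF.
have : 0 < (Num.sqrt r)^-1 by [].
lra.
Qed.

Section Profile.
Variables (h : R -> R[i]) (C0 : R).
Hypothesis hm : cmeasurable P h.
Hypothesis C0_ge0 : 0 <= C0.
Hypothesis hb : forall t, 0 < t -> normc (h t) <= C0 * (1 + t).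

Definition moment (j : nat) r : R[i] :=
  cintegral mu P (fun t => (gk r t * t ^+ (2 * j))%:C * h t).

Lemma moment_dom j r t : 0 < t ->
  normc ((gk r t * t ^+ (2 * j))%:C * h t) <=
  C0 * (gk r t * t ^+ (2 * j)) + C0 * (gk r t * t ^+ (2 * j).+1).
Proof.
move=> t0; rewrite normc_mul normc_real ger0_norm; last first.
  by rewrite mulr_ge0 ?gk_ge0// exprn_ge0// ltW.
rewrite (le_trans (ler_wpM2l _ (hb t0)))//.
  by rewrite mulr_ge0 ?gk_ge0// exprn_ge0// ltW.
by rewrite exprS le_eqVlt; apply/orP; left; apply/eqP; ring.
Qed.

Lemma moment_integrable j r : 0 < r ->
  cintegrable mu P (fun t => (gk r t * t ^+ (2 * j))%:C * h t).
Proof.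
move=> r0; apply: (cintegrable_dominated measurable_hline (g := fun t => C0 * (gk r t * t ^+ (2 * j)) + C0 * (gk r t * t ^+ (2 * j).+1))) => //.
- by apply: cmeasurable_mul => //; apply: cmeasurable_real; exact: measurable_gkX.
- by move=> t; rewrite hlineE; exact: moment_dom.
- exact: integrable_gkX2.
Qed.

Lemma moment_cd j r : 0 < r -> cd (moment j : R^o -> R[i]) r 1 (- moment j.+1 r).
Proof.
move=> r0.
have E : - moment j.+1 r = cintegral mu P (fun t => (- t ^+ 2 * gk r t * t ^+ (2 * j))%:C * h t).
  rewrite -mulN1r /moment -cintegral_mull//; last exact: moment_integrable.
  apply: eq_cintegral => t _.
  have -> : gk r t * t ^+ (2 * j.+1) = t ^+ 2 * gk r t * t ^+ (2 * j).
    by rewrite mulnS exprD; ring.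
  by rewrite !rmorphM rmorphN /=; ring.
rewrite E.
have r2 : 0 < r / 2 by rewrite divr_gt0.
(* On [r / 2 < x < 2 * r] the kernel [gk x t] is largest at the left end, so the bound for the
   integrand at [r / 2] dominates the derivative for all these [x]. *)
apply: (@cintegral_cd _ _ _ mu _ measurable_hline (fun r t => (gk r t * t ^+ (2 * j))%:C * h t)
   (fun r t => (- t ^+ 2 * gk r t * t ^+ (2 * j))%:C * h t)
   (fun t => `|C0 * (gk (r/2) t * t ^+ (2 * j.+1)) + C0 * (gk (r/2) t * t ^+ (2 * j.+1).+1)|)
   (r / 2) (2 * r)).
- by apply/andP; split; lra.
- by move=> x /andP[rx _]; apply: moment_integrable; exact: lt_trans rx.
- move=> x t _ _.
  have := cd_mul (cd_real (is_deriveM (gk_derive_r x t) (is_derive_cst (t ^+ (2 * j)) (x : R^o) (1 : R^o)))) (cd_cst (h t) x 1).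
  move=> H; apply: cd_eq H _; rewrite mulr0 addr0 /GRing.scale /cst /= mulr0 add0r.
  by rewrite [t ^+ (2 * j) * _]mulrC.
- by move=> t; exact: normr_ge0.
- exact: (integrable_norm (integrable_gkX2 C0 C0 (2 * j.+1) (2 * j.+1).+1 r2)).
- move=> x t /andP[rx _]; rewrite hlineE => t0; apply: le_trans (ler_norm _).
  apply: le_trans (moment_dom j.+1 (r / 2) t0).
  rewrite !normc_mul ler_wpM2r ?normc_ge0// !normc_real.
  have -> : - t ^+ 2 * gk x t * t ^+ (2 * j) = - (gk x t * t ^+ (2 * j.+1)).
    by rewrite mulnS exprD; ring.
  have tj : 0 <= t ^+ (2 * j.+1) by rewrite exprn_ge0// ltW.
  rewrite normrN !ger0_norm ?mulr_ge0 ?gk_ge0// ler_wpM2r//.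
  by rewrite /gk ler_expR lerN2 ler_wpM2r ?sqr_ge0// ltW.
Qed.

(* h resembles 2 t for large t, for which both limits would be exact equalities *)
Lemma moment_cvg0 (hy : forall e : R, 0 < e -> exists2 A, 0 < A &
     forall t, A <= t -> normc (h t - (2 * t)%:C) <= e * (2 * t)) :
  clim 0^'+ (fun r => r%:C * moment 0 r) 1 /\
  clim 0^'+ (fun r => (r ^+ 2)%:C * moment 1 r) 1.
Proof.
have key (j : nat) : (j <= 1)%N -> clim 0^'+ (fun r => (r ^+ j.+1)%:C * moment j r) 1.
  move=> j1; apply/climP => e e0.
  have e8 : 0 < e / 8 by rewrite divr_gt0.
  have [A A0 hA] := hy _ e8.
  (* [K] bounds the difference of [h] and [2 * t] on []0, A]]; this interval contributes a bounded
     amount, killed by the factor [r ^+ j.+1]. Beyond [A] the error is at most [e / 8] times the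
     exact moment. *)
  pose K := C0 * (1 + A) + 2 * A.
  have A0' := ltW A0.
  have K0 : 0 <= K by apply: addr_ge0; [apply: mulr_ge0 => //; exact: addr_ge0 | exact: mulr_ge0].
  have Ij r : 0 < r -> \int[mu]_(t in P) (gk r t * (2 * t ^+ (2 * j).+1)) = (r ^+ j.+1)^-1.
    move=> r0; case: j j1 => [|[|//]] _; rewrite ?muln0 ?muln1 ?expr1.
      under eq_Rintegral do rewrite expr1 mulrCA.
      rewrite RintegralZl//; last by have := integrable_gkX 1 r0; under eq_fun do rewrite expr1.
      by rewrite gauss_moment1//; field; rewrite gt_eqF.
    by rewrite gauss_moment3.
  have bound r : 0 < r -> normc ((r ^+ j.+1)%:C * moment j r - 1) <=
      2 * (e / 8 + r ^+ j.+1 * (K * A ^+ (2 * j) * A)).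
    move=> r0.
    have i1 := integrable_gkX (2 * j).+1 r0.
    have i1' : mu.-integrable P (EFin \o (fun t => gk r t * (2 * t ^+ (2 * j).+1))).
      by have := integrableZl measurable_hline 2 i1; apply: eq_integrable => // t _ /=; rewrite -EFinM; congr EFin; ring.
    have ii := integrable_indic_hline A.
    pose f1 t : R[i] := (gk r t * (2 * t ^+ (2 * j).+1))%:C.
    have if1 : cintegrable mu P f1 by split; [exact: i1'|exact: integrable0].
    have mi := moment_integrable j r0.
    have E : (r ^+ j.+1)%:C * moment j r - 1 =
       (r ^+ j.+1)%:C * cintegral mu P (fun t => (gk r t * t ^+ (2 * j))%:C * (h t - (2 * t)%:C)).
      have -> : cintegral mu P (fun t => (gk r t * t ^+ (2 * j))%:C * (h t - (2 * t)%:C))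
         = moment j r + (-1) * cintegral mu P f1.
        rewrite -cintegral_mull// -cintegral_add//; last exact: cintegrable_mull.
        apply: eq_cintegral => t _; rewrite /f1 exprS !rmorphM /=; ring.
      have -> : cintegral mu P f1 = ((r ^+ j.+1)^-1)%:C.
        rewrite /cintegral /f1 /= Ij//; congr (_ +i* _).
        by rewrite /Rintegral integral0.
      rewrite mulrDr mulN1r mulrN -rmorphM /= divff// expf_neq0// gt_eqF//.
    rewrite E normc_mul normc_real ger0_norm; last by rewrite exprn_ge0// ltW.
    have W0 : 0 < r ^+ j.+1 by rewrite exprn_gt0.
    pose c := K * A ^+ (2 * j).
    have ig : mu.-integrable P (EFin \o (fun t => e / 8 * (gk r t * (2 * t ^+ (2 * j).+1)) + c * (\1_(`]0, A]%classic : set (measurableTypeR R)) t))).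
      exact: (integrableD measurable_hline (integrableZl measurable_hline (e / 8) i1') (integrableZl measurable_hline c ii)).
    have := @normc_cintegral_le _ _ _ mu _ measurable_hline (fun t => (gk r t * t ^+ (2 * j))%:C * (h t - (2 * t)%:C)) _ _ ig.
    move=> /(_ _ _)/(ler_wpM2l (ltW W0)) /le_trans -> //.
    - apply: (eq_cintegrable measurable_hline _ (cintegrable_add measurable_hline mi (cintegrable_mull measurable_hline (-1) if1))).
      by move=> t _; rewrite /f1 exprS !rmorphM /=; ring.
    - move=> t; rewrite hlineE => t0.
      have gt0 : 0 <= gk r t * t ^+ (2 * j) by rewrite mulr_ge0 ?gk_ge0// exprn_ge0// ltW.
      rewrite normc_mul normc_real (ger0_norm gt0) indicE.
      have [tA|At] := leP t A.
        rewrite mem_set ?/= ?in_itv/= ?t0// mulr1.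
        have a1 : normc (h t - (2 * t)%:C) <= K.
          rewrite (le_trans (normc_sub _ _))// lerD//.
            by rewrite (le_trans (hb t0))// ler_wpM2l// lerD2l.
          by rewrite normc_real ger0_norm ?mulr_ge0 ?(ltW t0)// ler_wpM2l.
        have a2 : gk r t * t ^+ (2 * j) <= A ^+ (2 * j).
          rewrite -[leRHS]mul1r ler_pM ?gk_ge0 ?exprn_ge0 ?(ltW t0)//.
            by rewrite /gk -expR0 ler_expR oppr_le0 mulr_ge0 ?sqr_ge0 ?(ltW r0).
          by apply: lerXn2r; rewrite ?nnegrE ?(ltW t0).
        rewrite -[leLHS]add0r lerD//.
          by rewrite mulr_ge0 ?(ltW e8)// mulr_ge0 ?gk_ge0 ?mulr_ge0 ?exprn_ge0 ?(ltW t0).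
        by rewrite /c mulrC ler_pM ?normc_ge0.
      rewrite memNset ?/= ?mulr0 ?addr0; last by rewrite in_itv/= t0/= leNgt At.
      rewrite (le_trans (ler_wpM2l gt0 (hA t (ltW At))))//.
      by rewrite exprS le_eqVlt; apply/orP; left; apply/eqP; ring.
    - rewrite RintegralD//; last 2 first.
        exact: (integrableZl measurable_hline (e / 8) i1').
        exact: (integrableZl measurable_hline c ii).
      rewrite !RintegralZl// Ij// Rintegral_indic_hline//.
      rewrite mulrCA ler_wpM2l// mulrDr mulrCA divff ?gt_eqF// mulr1.
      by rewrite /c.
  have c0 : (fun r => r ^+ j.+1 * (K * A ^+ (2 * j) * A)) @ 0^'+ --> (0 : R).
    rewrite -[X in _ --> X](mul0r (K * A ^+ (2 * j) * A)); apply: cvgM; last exact: cvg_cst.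
    rewrite -[X in _ --> X](expr0n _ j.+1); apply: cvg_at_right_filter; exact: exprn_continuous.
  move/cvgrPdist_lt: c0 => /(_ _ e8) c0.
  near=> r.
  have r0 : 0 < r by [].
  rewrite (le_lt_trans (bound r r0))//.
  have : `|0 - r ^+ j.+1 * (K * A ^+ (2 * j) * A)| < e / 8 by near: r.
  rewrite sub0r normrN => /(le_lt_trans (ler_norm _)) h2.
  apply: (@lt_trans _ _ (2 * (e / 8 + e / 8))); last by lra.
  by rewrite ltr_pM2l// ltrD2l.
split.
- by apply: clim_near (key 0 isT); near=> r; rewrite expr1.
- exact: key.
Unshelve. all: end_near. Qed.

End Profile.

End GaussMoments.

(** * The solution for [l = 0] as a Laplace integral *)

Section LaplaceProfile.
Context {R : realType}.
Variable gamma : R.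
Implicit Types (k : R[i]) (s t B : R).

(** [lmod k s +i* larg k s] is the branch of log(1 + 2 k / s) that tends to 0 as [s] grows. For
    [Im k != 0] the point [s + 2 k] never meets the real axis, so no cut interferes. *)
Definition lmod k s : R :=
  ln ((s + 2 * complex.Re k) ^+ 2 + (2 * complex.Im k) ^+ 2) / 2 - ln s.
(* the argument of s + 2 k, continuous in s and tending to 0 as s grows *)
Definition larg k s : R :=
  Num.sg (complex.Im k) * (pi / 2) - atan ((s + 2 * complex.Re k) / (2 * complex.Im k)).
(* [(1 + 2 k / s) ^ (gamma / k)], the density of the Laplace integral of a Whittaker function *)
Definition gfun k s : R[i] := cexp (gamma%:C / k * (lmod k s +i* larg k s)).
(* includes the Jacobian of [s = t ^ 2], which removes the singularity of [gfun] at 0 *)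
Definition hfun k t : R[i] := (2 * t)%:C * gfun k (t ^+ 2).

Lemma Im_neq0 k : complex.Im k != 0 -> k != 0.
Proof. by apply: contra => /eqP ->. Qed.

Lemma sq_gt0 k s : complex.Im k != 0 ->
  0 < (s + 2 * complex.Re k) ^+ 2 + (2 * complex.Im k) ^+ 2.
Proof.
move=> k0; rewrite ltr_wpDl ?sqr_ge0// exprn_even_gt0//= mulf_neq0//.
Qed.

Lemma Im_shift k s : complex.Im (s%:C + 2 * k) = 2 * complex.Im k.
Proof. by case: k => a b /=; ring. Qed.

Lemma shift_neq0 k s : complex.Im k != 0 -> s%:C + 2 * k != 0.
Proof.
by move=> k0; apply: Im_neq0; rewrite Im_shift mulf_neq0.
Qed.

Lemma normc_shift k s :
  normc (s%:C + 2 * k) ^+ 2 = (s + 2 * complex.Re k) ^+ 2 + (2 * complex.Im k) ^+ 2.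
Proof. by rewrite normc_sqr; case: k => a b /=; ring. Qed.

(** The logarithmic derivative is [gamma / k] times 1/(s + 2 k) - 1/s, in which [k] cancels. This
    first-order equation is what makes the Laplace integral satisfy a second-order one. *)
Lemma gfun_cd k s : complex.Im k != 0 -> 0 < s ->
  cd (gfun k : R^o -> R[i]) s 1 (- (2 * gamma)%:C / (s%:C * (s%:C + 2 * k)) * gfun k s).
Proof.
move=> k0 s0; set a := complex.Re k; set b := complex.Im k.
have D0 := sq_gt0 s k0; rewrite -/a -/b in D0.
have h1 : is_derive (s : R^o) 1 (fun y : R^o => (y + 2 * a) ^+ 2 + (2 * b) ^+ 2) (2 * (s + 2 * a)).
  by apply: is_derive_eq; rewrite /GRing.scale /=; ring.
have h2 : is_derive (s : R^o) 1 (fun y : R^o => (y + 2 * a) / (2 * b)) (2 * b)^-1.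
  by apply: is_derive_eq; rewrite /GRing.scale /=; ring.
have l1 := @is_derive1_comp R (@ln R) (fun y => (y + 2 * a) ^+ 2 + (2 * b) ^+ 2) _ _ _ (is_derive1_ln D0) h1.
have l0 := is_derive1_ln s0.
have a1 := @is_derive1_comp R (@atan R) (fun y => (y + 2 * a) / (2 * b)) _ _ _ (is_derive1_atan _) h2.
pose d1 := (s + 2 * a) / ((s + 2 * a) ^+ 2 + (2 * b) ^+ 2) - s^-1.
pose d2 := - ((1 + ((s + 2 * a) / (2 * b)) ^+ 2)^-1 / (2 * b)).
have dm : is_derive (s : R^o) 1 (lmod k : R^o -> R) d1.
  have H := is_deriveB (is_deriveM l1 (is_derive_cst (2^-1 : R^o) (s : R^o) (1 : R^o))) l0.
  apply: (is_derive_cong H) => //.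
  by rewrite /d1 /GRing.scale /=; field; rewrite !gt_eqF.
have da : is_derive (s : R^o) 1 (larg k : R^o -> R) d2.
  have H := is_deriveB (is_derive_cst (Num.sg b * (pi / 2) : R^o) (s : R^o) (1 : R^o)) a1.
  apply: (is_derive_cong H) => //.
  by rewrite /d2 sub0r.
have dl : cd (fun s : R^o => lmod k s +i* larg k s) (s : R^o) 1 (d1 +i* d2) by split.
apply: cd_eq (cd_cexp (cd_mull (gamma%:C / k) dl)) _.
congr (_ * _).
have kn := Im_neq0 k0; have sn := shift_neq0 s k0.
have s1 : s%:C != 0 :> R[i] by rewrite -(rmorph0 (real_complex R)) (inj_eq (@complexI R)) gt_eqF.
have E : d1 +i* d2 = - (2 * k) / (s%:C * (s%:C + 2 * k)).
  apply: (mulIf (mulf_neq0 s1 sn)); rewrite divfK ?mulf_neq0//.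
  have -> : k = a +i* b by rewrite /a /b; case: (k).
  pose D := (s + 2 * a) ^+ 2 + (2 * b) ^+ 2.
  have Dn : D != 0 by rewrite gt_eqF.
  have sn0 : s != 0 by rewrite gt_eqF.
  have d2E : d2 = - (2 * b) / D.
    rewrite /d2 (_ : 1 + _ = D / (2 * b) ^+ 2); last by rewrite /D; field.
    by rewrite invf_div; field; rewrite Dn k0.
  have d1E : d1 = (s + 2 * a) / D - s^-1 by [].
  apply: Cext.
  - transitivity (d1 * (s * (s + 2 * a)) - d2 * (s * (2 * b))); first by rewrite /=; ring.
    rewrite d2E d1E; transitivity (s * ((s + 2 * a) ^+ 2 + (2 * b) ^+ 2) / D - (s + 2 * a)).
      by field; rewrite Dn sn0.
    by rewrite -/D mulfK//=; ring.
  - transitivity (d1 * (s * (2 * b)) + d2 * (s * (s + 2 * a))); first by rewrite /=; ring.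
    transitivity (- (2 * b)); last by rewrite /=; ring.
    by rewrite d2E d1E; field; rewrite Dn sn0.
by rewrite E rmorphM /=; field; rewrite kn s1 sn.
Qed.

Lemma normc_gfun k s : normc (gfun k s) =
  expR (complex.Re (gamma%:C / k) * lmod k s - complex.Im (gamma%:C / k) * larg k s).
Proof. by rewrite /gfun; set p := gamma%:C / k; rewrite normc_cexp cReM. Qed.

Lemma larg_le k s : `|larg k s| <= pi.
Proof.
rewrite /larg (le_trans (ler_normB _ _))// normrM.
have h1 : `|Num.sg (complex.Im k)| <= 1 by rewrite normr_sg; case: (_ != 0).
have p0 : 0 < pi / 2 :> R by rewrite divr_gt0 ?pi_gt0.
have h2 : `|atan ((s + 2 * complex.Re k) / (2 * complex.Im k))| <= pi / 2.
  by rewrite ler_norml !ltW ?atan_gtNpi2 ?atan_ltpi2.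
have : `|Num.sg (complex.Im k)| * `|pi / 2| <= 1 * (pi / 2).
  by rewrite (gtr0_norm p0) ler_wpM2r// ltW.
lra.
Qed.

Lemma expR_lmod k s : complex.Im k != 0 -> 0 < s ->
  expR (lmod k s) = normc (s%:C + 2 * k) / s.
Proof.
move=> k0 s0; rewrite /lmod expRB lnK ?posrE// -normc_shift.
have n0 : 0 < normc (s%:C + 2 * k) by rewrite normc_gt0 shift_neq0.
have -> : ln (normc (s%:C + 2 * k) ^+ 2) / 2 = ln (normc (s%:C + 2 * k)).
  by rewrite lnXn//; field.
by rewrite lnK.
Qed.

Lemma gfun_le k s B : normc (gamma%:C / k) <= B ->
  normc (gfun k s) <= expR (pi * B) * expR (complex.Re (gamma%:C / k) * lmod k s).
Proof.
move=> hB; rewrite normc_gfun -expRD ler_expR [leRHS]addrC lerD2l.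
rewrite (le_trans (ler_norm _))// normrN normrM mulrC ler_pM ?larg_le//.
exact: le_trans (Im_le_normc _) hB.
Qed.

(** Near 0, [gfun] grows at most like [s] to the power -1/2, which the Jacobian [2 * t] cancels
    exactly: the bound 1/2 on the real part of the exponent originates here. In the proof, the
    square of [t * X] is the modulus of [t ^ 2 + 2 k]. *)
Lemma hfun_le k t B : complex.Im k != 0 -> 0 < t ->
  0 <= complex.Re (gamma%:C / k) <= 2^-1 ->
  normc (gamma%:C / k) <= B -> normc (2 * k) <= B ->
  normc (hfun k t) <= 2 * expR (pi * B) * (B + 1) * (1 + t).
Proof.
move=> k0 t0 /andP[p0 p1] hB kB; have B0 : 0 <= B by rewrite (le_trans _ hB)// normc_ge0.
have s0 : 0 < t ^+ 2 by rewrite exprn_gt0.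
rewrite /hfun normc_mul normc_real ger0_norm ?mulr_ge0 ?(ltW t0)//.
have e0 : 0 <= 2 * expR (pi * B) by rewrite mulr_ge0 ?expR_ge0.
have key : t * expR (complex.Re (gamma%:C / k) * lmod k (t ^+ 2)) <= (B + 1) * (1 + t).
  have [l0|l0] := leP (lmod k (t ^+ 2)) 0.
    have : expR (complex.Re (gamma%:C / k) * lmod k (t ^+ 2)) <= 1.
      by rewrite -expR0 ler_expR mulr_ge0_le0.
    move=> /(ler_wpM2l (ltW t0)) /le_trans; apply; rewrite mulr1; nra.
  have : expR (complex.Re (gamma%:C / k) * lmod k (t ^+ 2)) <= expR (2^-1 * lmod k (t ^+ 2)).
    by rewrite ler_expR ler_wpM2r// ltW.
  move=> /(ler_wpM2l (ltW t0)) /le_trans; apply.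
  set X := expR _.
  have X2 : X ^+ 2 = normc ((t ^+ 2)%:C + 2 * k) / t ^+ 2.
    by rewrite -expR_lmod// /X -expRM_natl mulrA divff ?mul1r// pnatr_eq0.
  rewrite -(@ler_pXn2r _ 2)// ?nnegrE ?mulr_ge0 ?expR_ge0 ?addr_ge0 ?(ltW t0)//.
  rewrite exprMn X2 mulrCA divff ?gt_eqF// mulr1.
  rewrite (le_trans (normc_add _ _))// normc_real ger0_norm ?(ltW s0)//.
  apply: (@le_trans _ _ (t ^+ 2 + B)); first by rewrite lerD2l.
  rewrite exprMn; nra.
have t2 : 0 <= 2 * t by rewrite mulr_ge0 ?(ltW t0).
have := ler_wpM2l t2 (gfun_le (t ^+ 2) hB).
have := ler_wpM2l e0 key.
move=> h1 h2; apply: le_trans h2 _; rewrite -[leRHS]mulrA; apply: le_trans h1.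
by rewrite le_eqVlt; apply/orP; left; apply/eqP; ring.
Qed.

(** When the exponent has nonpositive real part, the danger is the zero [s = - 2 k] of the base,
    kept at distance [b0] by the imaginary part. The bound is a multiple of [t] without constant
    term, which later makes the corresponding moment of order [1 / r]. *)
Lemma hfun_leN k t B (b0 : R) : 0 < b0 -> b0 <= `|2 * complex.Im k| -> 0 < t ->
  - 2^-1 <= complex.Re (gamma%:C / k) <= 0 ->
  normc (gamma%:C / k) <= B -> normc (2 * k) <= B ->
  normc (hfun k t) <= 2 * expR (pi * B) * (2 + B / b0) * t.
Proof.
move=> b00 bk t0 /andP[p0 p1] hB kB; have B0 : 0 <= B by rewrite (le_trans _ hB)// normc_ge0.
have k0 : complex.Im k != 0.
  by apply/eqP => k0; move: bk; rewrite k0 mulr0 normr0 leNgt b00.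
have s0 : 0 < t ^+ 2 by rewrite exprn_gt0.
rewrite /hfun normc_mul normc_real ger0_norm ?mulr_ge0 ?(ltW t0)//.
have e0 : 0 <= 2 * expR (pi * B) by rewrite mulr_ge0 ?expR_ge0.
have key : expR (complex.Re (gamma%:C / k) * lmod k (t ^+ 2)) <= 2 + B / b0.
  have b1 : 0 <= B / b0 by rewrite divr_ge0// ltW.
  have [l0|l0] := leP 0 (lmod k (t ^+ 2)).
    apply: (@le_trans _ _ 1); first by rewrite -expR0 ler_expR mulr_le0_ge0.
    lra.
  apply: (@le_trans _ _ (expR (- lmod k (t ^+ 2)))).
    rewrite ler_expR; nra.
  rewrite expRN expR_lmod// invf_div.
  have n0 : b0 <= normc ((t ^+ 2)%:C + 2 * k).
    apply: le_trans bk _; apply: le_trans (Im_le_normc _).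
    by rewrite Im_shift.
  rewrite ler_pdivrMr ?(lt_le_trans b00)//.
  have h1 : t ^+ 2 <= normc ((t ^+ 2)%:C + 2 * k) + B.
    have := normc_sub ((t ^+ 2)%:C + 2 * k) (2 * k); rewrite addrK normc_real ger0_norm ?(ltW s0)//.
    by move=> /le_trans; apply; rewrite lerD2l.
  apply: (le_trans h1).
  have : B <= B / b0 * normc ((t ^+ 2)%:C + 2 * k).
    have bn : b0 != 0 by rewrite gt_eqF.
    by rewrite -{1}[B](divfK bn) ler_wpM2l.
  have := normc_ge0 ((t ^+ 2)%:C + 2 * k).
  nra.
have t2 : 0 <= 2 * t by rewrite mulr_ge0 ?(ltW t0).
have := ler_wpM2l t2 (gfun_le (t ^+ 2) hB).
have := ler_wpM2r (ltW t0) (ler_wpM2l e0 key).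
move=> h1 h2; apply: le_trans h2 _; apply: le_trans h1.
by rewrite le_eqVlt; apply/orP; left; apply/eqP; ring.
Qed.

Lemma clim_inv (T : Type) (F : set_system T) {FF : Filter F} (f : T -> R[i]) (l : R[i]) :
  l != 0 -> clim F f l -> clim F (fun u => (f u)^-1) l^-1.
Proof.
move=> l0 /clim_ReIm[h1 h2].
have E (z : R[i]) : z^-1 = (complex.Re z / (complex.Re z ^+ 2 + complex.Im z ^+ 2)) +i*
    (- complex.Im z / (complex.Re z ^+ 2 + complex.Im z ^+ 2)) by case: z => a b; rewrite mulNr.
have d0 : complex.Re l ^+ 2 + complex.Im l ^+ 2 != 0.
  by rewrite -normc_sqr expf_neq0// normc_eq0.
have hd : (fun u => (complex.Re (f u) ^+ 2 + complex.Im (f u) ^+ 2)^-1) @ F -->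
    (complex.Re l ^+ 2 + complex.Im l ^+ 2)^-1.
  by apply: cvgV => //; under eq_fun do rewrite !expr2; rewrite !expr2; apply: cvgD; apply: cvgM.
rewrite (E l); under eq_fun do rewrite E.
apply/clim_ReIm; split => /=; apply: cvgM => //; exact: cvgN.
Qed.

Lemma gfun_clim (T : Type) (F : set_system T) {FF : Filter F} (kn : T -> R[i]) k s :
  complex.Im k != 0 -> 0 < s -> clim F kn k -> clim F (fun n => gfun (kn n) s) (gfun k s).
Proof.
move=> k0 s0 hk; have [h1 h2] := (clim_ReIm _ _).1 hk.
apply: clim_cexp; apply: clim_mul.
  by apply: clim_mull; apply: clim_inv => //; exact: Im_neq0.
have hb : (fun n => 2 * complex.Im (kn n)) @ F --> 2 * complex.Im k by apply: cvgM => //; exact: cvg_cst.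
have ha : (fun n => s + 2 * complex.Re (kn n)) @ F --> s + 2 * complex.Re k.
  by apply: cvgD; [exact: cvg_cst|apply: cvgM => //; exact: cvg_cst].
apply/clim_ReIm; split => /=.
- apply: cvgB; last exact: cvg_cst.
  apply: cvgM; last exact: cvg_cst.
  apply: continuous_cvg; first by apply: continuous_ln; exact: sq_gt0.
  by under eq_fun do rewrite !expr2; rewrite !expr2; apply: cvgD; apply: cvgM.
- apply: cvgB.
    apply: cvgM; last exact: cvg_cst.
    apply: cvg_near_cst; case: (ltgtP (complex.Im k) 0) k0 => // ki _.
    + by near=> n; rewrite !ltr0_sg//; near: n; exact: (cvgr_lt _ h2).
    + by near=> n; rewrite !gtr0_sg//; near: n; exact: (cvgr_gt _ h2).
  apply: continuous_cvg; first exact: continuous_atan.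
  by apply: cvgM => //; apply: cvgV => //; rewrite mulf_neq0.
Unshelve. all: end_near. Qed.

Lemma gfun_cvgy k : complex.Im k != 0 -> clim +oo (gfun k) 1.
Proof.
move=> k0.
rewrite -cexp0 -(mulr0 (gamma%:C / k)); apply: clim_cexp; apply: clim_mull.
apply/clim_ReIm; split => /=.
- have h1 : (fun s => normc (s%:C + 2 * k) / s) @ +oo --> (1 : R).
    apply/cvgrPdist_le => e e0; near=> s.
    have s0 : 0 < s by [].
    have s1 : s != 0 by rewrite gt_eqF.
    rewrite -[X in `|X - _|](divff s1) -mulrBl normrM [`|s^-1|]ger0_norm ?invr_ge0 ?(ltW s0)//.
    rewrite ler_pdivrMr//.
    have := normc_dist s%:C (s%:C + 2 * k).
    rewrite normc_real (ger0_norm (ltW s0)) opprD addNKr normc_opp => /le_trans; apply.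
    rewrite -ler_pdivrMl//; near: s; apply: nbhs_pinfty_ge; rewrite num_real//.
  have h2 : (fun s => ln (normc (s%:C + 2 * k) / s)) @ +oo --> (0 : R).
    by rewrite -[X in _ --> X](@ln1 R); apply: continuous_cvg => //; exact: continuous_ln.
  apply: cvg_trans h2; apply: near_eq_cvg; near=> s.
  have s0 : 0 < s by [].
  by rewrite -expR_lmod// expRK.
- have key (b : R) (a : R) : 0 < b -> (fun s => atan ((s + a) / b)) @ +oo --> (pi / 2 : R).
    move=> b0; apply: (cvg_comp (fun s => (s + a) / b) (@atan R)); last exact: cvgy_atan.
    apply/cvgryPge => A; near=> s; rewrite ler_pdivlMr// -lerBlDr.
    by near: s; apply: nbhs_pinfty_ge; rewrite num_real.
  rewrite /larg; case: (ltgtP (complex.Im k) 0) k0 => // ki _.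
  + rewrite -[X in _ --> X](subrr (-1 * (pi / 2))) ltr0_sg//; apply: cvgB; first exact: cvg_cst.
    have b0 : 0 < - (2 * complex.Im k) by rewrite oppr_gt0 pmulr_rlt0.
    have H := cvgN (key (- (2 * complex.Im k)) (2 * complex.Re k) b0).
    rewrite mulN1r; apply: cvg_trans (H _); apply: near_eq_cvg.
    by near=> s; rewrite opprfctE/= -atanN invrN mulrN opprK.
  + rewrite -[X in _ --> X](subrr (1 * (pi / 2))) gtr0_sg//; apply: cvgB; first exact: cvg_cst.
    by rewrite mul1r; apply: key; rewrite mulr_gt0.
Unshelve. all: end_near. Qed.

Lemma hfun_asympt k : complex.Im k != 0 -> forall e : R, 0 < e -> exists2 A : R, 0 < A &
  forall t, A <= t -> normc (hfun k t - (2 * t)%:C) <= e * (2 * t).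
Proof.
move=> k0 e e0; have /climP /(_ e e0) [A [_ hA]] := gfun_cvgy k0.
exists (`|A| + 1) => [|t ht]; first by rewrite ltr_wpDl.
have t1 : 1 <= t by rewrite (le_trans _ ht)// lerDr.
have t0 : 0 < t by rewrite (lt_le_trans _ t1).
rewrite /hfun -[X in _ - X]mulr1 -mulrBr normc_mul normc_real ger0_norm ?mulr_ge0 ?(ltW t0)//.
rewrite mulrC ler_wpM2r ?mulr_ge0 ?(ltW t0)// ltW//; apply: hA.
rewrite (lt_le_trans (_ : A < `|A| + 1))//; first by rewrite (le_lt_trans (ler_norm _))// ltrDl.
by rewrite (le_trans ht)// expr2 ler_peMr// ltW.
Qed.

Lemma sqr_derive t : is_derive (t : R^o) 1 (fun y : R^o => y ^+ 2) (2 * t).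
Proof. by apply: is_derive_eq; rewrite /GRing.scale /=; ring. Qed.

Lemma gfun_sq_cd k t : complex.Im k != 0 -> 0 < t ->
  cd (fun t : R^o => gfun k (t ^+ 2)) t 1
    (- (2 * gamma)%:C / ((t ^+ 2)%:C * ((t ^+ 2)%:C + 2 * k)) * gfun k (t ^+ 2) * (2 * t)%:C).
Proof.
move=> k0 t0; have s0 : 0 < t ^+ 2 by rewrite exprn_gt0.
have H := cd_real_comp (g := fun y : R^o => y ^+ 2) (gfun_cd k0 s0) (sqr_derive t).
exact: H.
Qed.

Lemma hfun_cd k t : complex.Im k != 0 -> 0 < t ->
  cd (hfun k : R^o -> R[i]) t 1 (cderive (1 : R^o) (hfun k : R^o -> R[i]) t).
Proof.
move=> k0 t0; have d2 : is_derive (t : R^o) 1 (fun y : R^o => 2 * y) 2.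
  by apply: is_derive_eq; rewrite /GRing.scale /=; ring.
have H := cd_mul (cd_real d2) (gfun_sq_cd k0 t0).
by have := H; rewrite -(cd_cderive H).
Qed.

Lemma hfun_cmeasurable k : complex.Im k != 0 -> cmeasurable (@hline R) (hfun k).
Proof. by move=> k0; apply: cd_cmeasurable => t t0; exact: hfun_cd. Qed.

End LaplaceProfile.

Section RadialSolution.
Context {R : realType}.
Variables (gamma : R) (k : R[i]) (C0 : R).
Hypothesis k0 : complex.Im k != 0.
Hypothesis C0_ge0 : 0 <= C0.
Hypothesis hb : forall t, 0 < t -> normc (hfun gamma k t) <= C0 * (1 + t).
Notation mu := (@lebesgue_measure R).
Notation P := (@hline R).
Notation h := (hfun gamma k).
Notation M := (moment h).

Let hm : cmeasurable P h. Proof. exact: hfun_cmeasurable. Qed.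

(** With [s = t ^ 2] this is exp(- r s) s (s + 2 k) gfun(s): the weight s (s + 2 k) clears the
    denominator in the logarithmic derivative of [gfun], so that the derivative [dKf] is a
    combination of moment integrands. *)
Let Kf r t : R[i] := (gk r t)%:C * (((t ^+ 2)%:C * ((t ^+ 2)%:C + 2 * k)) * gfun gamma k (t ^+ 2)).
Let dKf r t : R[i] := - r%:C * ((gk r t * t ^+ (2 * 2))%:C * h t)
  + ((2 - 2 * k * r%:C) * ((gk r t * t ^+ (2 * 1))%:C * h t)
  + (2 * (k - gamma%:C)) * ((gk r t * t ^+ (2 * 0))%:C * h t)).

Let Kf_cd r t : 0 < t -> cd (Kf r : R^o -> R[i]) t 1 (dKf r t).
Proof.
move=> t0.
have t1 : t%:C != 0 :> R[i].
  by rewrite -(rmorph0 (real_complex R)) (inj_eq (@complexI R)) gt_eqF.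
have sn := shift_neq0 (t ^+ 2) k0.
have d1 := cd_real (sqr_derive t).
have d2 := cd_add d1 (cd_cst (2 * k) (t : R^o) (1 : R^o)).
have := cd_mul (cd_real (gk_derive r t)) (cd_mul (cd_mul d1 d2) (gfun_sq_cd gamma k0 t0)).
move=> H; apply: cd_eq H _; rewrite /dKf /hfun.
rewrite (_ : (2 * 2 = 4)%N)// (_ : (2 * 1 = 2)%N)// (_ : (2 * 0 = 0)%N)//.
rewrite !(rmorphM, rmorphXn, rmorphN, rmorph_nat) /=.
rewrite rmorphXn /= in sn.
by field; rewrite sn t1.
Qed.

Let Kf_bound r t : 0 < t ->
  normc (Kf r t) <= (C0 * 2^-1) * (gk r t * t ^+ 1 * (t ^+ 2 + normc (2 * k)) * (1 + t)).
Proof.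
move=> t0.
have -> : Kf r t = (gk r t * t * 2^-1)%:C * ((t ^+ 2)%:C + 2 * k) * h t.
  rewrite /Kf /hfun !(rmorphM, rmorphXn, fmorphV, rmorph_nat) /=; by field.
rewrite normc_mul [X in X * _]normc_mul normc_real ger0_norm ?mulr_ge0 ?gk_ge0 ?(ltW t0)//.
have h1 : normc ((t ^+ 2)%:C + 2 * k) <= t ^+ 2 + normc (2 * k).
  by rewrite (le_trans (normc_add _ _))// normc_real ger0_norm ?sqr_ge0.
have := ler_pM (normc_ge0 _) (normc_ge0 _) h1 (hb t0).
have g0 : 0 <= gk r t * t * 2^-1 by rewrite !mulr_ge0 ?gk_ge0 ?(ltW t0).
move=> /(ler_wpM2l g0); rewrite [X in X <= _]mulrA => /le_trans; apply.
by rewrite le_eqVlt; apply/orP; left; apply/eqP; rewrite expr1; ring.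
Qed.

(** Kummer's equation for [M 0]: by [moment_cd], [M 1] is minus its first derivative and [M 2] its
    second. The left-hand side is the integral of the derivative of [Kf], which vanishes at both
    ends. *)
Lemma kummer r : 0 < r ->
  - r%:C * M 2 r + ((2 - 2 * k * r%:C) * M 1 r + 2 * (k - gamma%:C) * M 0 r) = 0.
Proof.
move=> r0.
have mi j := moment_integrable hm hb j r0.
have z1 := cintegrable_mull measurable_hline (- r%:C) (mi 2).
have z2 := cintegrable_mull measurable_hline (2 - 2 * k * r%:C) (mi 1).
have z3 := cintegrable_mull measurable_hline (2 * (k - gamma%:C)) (mi 0).
have z23 := cintegrable_add measurable_hline z2 z3.
rewrite /moment -!cintegral_mull// -!cintegral_add//.
apply: (cintegral_derivative_eq0 (K := Kf r) (dK := dKf r)).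
- by move=> t; exact: Kf_cd.
- move=> t t0.
  have ch : clim (nbhs t) h (h t) by apply/clim_ReIm; exact: (cd_continuous (hfun_cd gamma k0 t0)).
  have cg n : clim (nbhs t) (fun t => (gk r t * t ^+ n)%:C * h t) ((gk r t * t ^+ n)%:C * h t).
    apply: clim_mul ch; apply: clim_real; apply: cvgM; [exact: continuous_gk|exact: exprn_continuous].
  apply: (clim_ReIm _ (dKf r t)).1.
  apply: clim_add; first exact: (clim_mull _ (cg _)).
  by apply: clim_add; exact: (clim_mull _ (cg _)).
- exact: (cintegrable_add measurable_hline z1 z23).
- apply: (clim_squeeze (b := fun t => (C0 * 2^-1) * (gk r t * t ^+ 1 * (t ^+ 2 + normc (2 * k)) * (1 + t)))).
    by near=> t; rewrite subr0 Kf_bound.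
  rewrite [X in _ --> X](_ : 0 = (C0 * 2^-1) * (gk r 0 * 0 ^+ 1 * (0 ^+ 2 + normc (2 * k)) * (1 + 0))); last first.
    by rewrite expr1 mulr0 !mul0r mulr0.
  apply: cvg_at_right_filter; apply: cvgM; first exact: cvg_cst.
  apply: cvgM; last by apply: cvgD; [exact: cvg_cst|exact: cvg_id].
  apply: cvgM; last by apply: cvgD; [exact: exprn_continuous|exact: cvg_cst].
  by apply: cvgM; [exact: continuous_gk|exact: exprn_continuous].
- pose c n : R := (n.+1)`!%:R * expR r^-1.
  pose B := normc (2 * k).
  apply: (clim_squeeze (b := fun t => (C0 * 2^-1) * ((c 3 + c 4 + B * c 1 + B * c 2) * expR (- t)))).
    near=> t; have t0 : 0 < t by [].
    rewrite subr0 (le_trans (Kf_bound r t0))// ler_wpM2l ?mulr_ge0//.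
    have hn n : gk r t * t ^+ n <= c n * expR (- t) by exact/gkX_le/ltW.
    have B0 : 0 <= B by exact: normc_ge0.
    have -> : gk r t * t ^+ 1 * (t ^+ 2 + normc (2 * k)) * (1 + t) =
      gk r t * t ^+ 3 + gk r t * t ^+ 4 + B * (gk r t * t ^+ 1) + B * (gk r t * t ^+ 2).
      by rewrite -/B; ring.
    have -> : (c 3 + c 4 + B * c 1 + B * c 2) * expR (- t) =
      c 3 * expR (- t) + c 4 * expR (- t) + B * (c 1 * expR (- t)) + B * (c 2 * expR (- t)) by ring.
    have b1 := ler_wpM2l B0 (hn 1); have b2 := ler_wpM2l B0 (hn 2).
    have b3 := hn 3; have b4 := hn 4.
    by rewrite !lerD.
  rewrite [X in _ --> X](_ : 0 = (C0 * 2^-1) * ((c 3 + c 4 + B * c 1 + B * c 2) * 0)); last by rewrite !mulr0.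
  apply: cvgM; first exact: cvg_cst.
  apply: cvgM; [exact: cvg_cst|exact: cvgr_expR].
Unshelve. all: end_near. Qed.

(** For [Re k > 0] this is Gamma(1 - gamma / k) times the Whittaker function W with parameters
    [gamma / k] and 1/2 at [2 k r]; the Gamma factor is what normalizes the value at 0 to 1. *)
Definition phi0 r : R[i] := cexp (- (k * r%:C)) * (r%:C * M 0 r).
Definition dphi0 r : R[i] :=
  cexp (- (k * r%:C)) * (- k * (r%:C * M 0 r) + (M 0 r - r%:C * M 1 r)).

Lemma cd_expN r : cd (fun r : R^o => cexp (- (k * r%:C))) (r : R^o) 1 (- k * cexp (- (k * r%:C))).
Proof.
have := cd_cexp (cd_opp (cd_mull k (cd_id (r : R^o)))).
by move=> H; apply: cd_eq H _; rewrite mulr1.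
Qed.

Lemma phi0_cd r : 0 < r -> cd (phi0 : R^o -> R[i]) r 1 (dphi0 r).
Proof.
move=> r0; have m0 := moment_cd hm hb 0 r0.
have := cd_mul (cd_expN r) (cd_mul (cd_id (r : R^o)) m0).
by move=> H; apply: cd_eq H _; rewrite /dphi0; ring.
Qed.

Lemma dphi0_cd r : 0 < r ->
  cd (dphi0 : R^o -> R[i]) r 1 ((k ^+ 2 - (2 * gamma / r)%:C) * phi0 r).
Proof.
move=> r0; have m0 := moment_cd hm hb 0 r0; have m1 := moment_cd hm hb 1 r0.
have rm0 := cd_mul (cd_id (r : R^o)) m0.
have := cd_mul (cd_expN r) (cd_add (cd_mull (- k) rm0) (cd_sub m0 (cd_mul (cd_id (r : R^o)) m1))).
move=> H; apply: cd_eq H _; rewrite /phi0.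
have r1 : r%:C != 0 :> R[i].
  by rewrite -(rmorph0 (real_complex R)) (inj_eq (@complexI R)) gt_eqF.
have E := kummer r0; set E0 := cexp _.
have {}E : r%:C * M 2 r = (2 - 2 * k * r%:C) * M 1 r + 2 * (k - gamma%:C) * M 0 r.
  by apply/eqP; rewrite -subr_eq0 -oppr_eq0 -E; apply/eqP; ring.
transitivity (E0 * (k ^+ 2 * (r%:C * M 0 r) - 2 * k * M 0 r + 2 * k * (r%:C * M 1 r) - 2 * M 1 r + r%:C * M 2 r)).
  by rewrite /E0; ring.
rewrite E !rmorphM fmorphV rmorph_nat /=; field; exact: r1.
Qed.

Lemma clim_id0 : clim 0^'+ (fun r : R => r%:C) 0.
Proof. by apply: clim_real; apply: cvg_at_right_filter; exact: cvg_id. Qed.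

Lemma clim_expN0 : clim 0^'+ (fun r : R => cexp (- (k * r%:C))) 1.
Proof.
pose proof (clim_cexp (clim_opp (clim_mull k clim_id0))) as H.
by rewrite mulr0 oppr0 cexp0 in H.
Qed.

Lemma phi0_cvg0 : clim 0^'+ phi0 1.
Proof.
have [h0 h1] := moment_cvg0 hm C0_ge0 hb (hfun_asympt gamma k0).
by pose proof (clim_mul clim_expN0 h0) as H; rewrite mulr1 in H.
Qed.

Lemma r_dphi0_cvg0 : clim 0^'+ (fun r => r%:C * dphi0 r) 0.
Proof.
have [h0 h1] := moment_cvg0 hm C0_ge0 hb (hfun_asympt gamma k0).
pose proof (clim_mul clim_expN0 (clim_add (clim_mul (clim_mull (- k) clim_id0) h0) (clim_sub h0 h1))) as H.
move: H; rewrite mulr0 mul0r subrr addr0 mulr0; apply: clim_near; apply: nearW => r.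
by rewrite /dphi0 rmorphXn /=; ring.
Qed.

End RadialSolution.

(** * The radial equations and their ladder operators *)

Section RadialEquation.
Context {R : realType}.
Variable gamma : R.
Implicit Types (lam : R[i]) (r : R) (f g : R -> R[i]).

Definition potential (l : nat) lam r : R[i] :=
  (l * l.+1)%:R * (r^-1)%:C ^+ 2 - 2 * gamma%:C * (r^-1)%:C - lam.

(* [f], with derivative [df], solves the equation satisfied by [r * v(r)] when
   [v(r) Y_l] is a [lam]-eigenfunction *)
Definition rsol (l : nat) lam f df : Prop := forall r, 0 < r ->
  cd (f : R^o -> R[i]) r 1 (df r) /\
  cd (df : R^o -> R[i]) r 1 (potential l lam r * f r).

Definition wr f df g dg r : R[i] := df r * g r - f r * dg r.

Lemma wr_const l lam f df g dg : rsol l lam f df -> rsol l lam g dg ->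
  forall r s, 0 < r -> 0 < s -> wr f df g dg r = wr f df g dg s.
Proof.
move=> hf hg; apply: cd_const_itv => r r0.
have [f1 f2] := hf r r0; have [g1 g2] := hg r r0.
by apply: cd_eq (cd_sub (cd_mul f2 g1) (cd_mul f1 g2)) _; ring.
Qed.

Lemma rsol_mull l lam c f df : rsol l lam f df ->
  rsol l lam (fun r => c * f r) (fun r => c * df r).
Proof.
move=> hf r r0; have [f1 f2] := hf r r0.
by split; [exact: cd_mull|apply: cd_eq (cd_mull c f2) _; ring].
Qed.

(* a solution expanded in a basis, the coefficients being Wronskians *)
Lemma wr_expand f df g dg h dh r :
  f r * wr g dg h dh r = wr f df h dh r * g r - wr f df g dg r * h r.
Proof. by rewrite /wr; ring. Qed.

Lemma rsol_basis l lam f df g dg h dh :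
  rsol l lam f df -> rsol l lam g dg -> rsol l lam h dh -> wr g dg h dh 1 != 0 ->
  forall r, 0 < r -> f r = (wr f df h dh 1 / wr g dg h dh 1) * g r
                         - (wr f df g dg 1 / wr g dg h dh 1) * h r.
Proof.
move=> hf hg hh w0 r r0; apply: (mulIf w0).
rewrite -(wr_const hg hh r0 ltr01) (wr_expand f df) (wr_const hg hh r0 ltr01).
rewrite (wr_const hf hh r0 ltr01) (wr_const hf hg r0 ltr01).
move: (wr g dg h dh 1) (wr f df h dh 1) (wr f df g dg 1) w0 => a b c a0.
by field.
Qed.

Lemma wr_eq0_proportional l lam f df g dg :
  rsol l lam f df -> rsol l lam g dg -> wr f df g dg 1 = 0 ->
  (forall r, 0 < r -> wr f df g dg r = 0).
Proof. by move=> hf hg w r r0; rewrite (wr_const hf hg r0 ltr01). Qed.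

(** A solution of the Riccati equation w^2 + w' = [potential l lam] at the bound-state energy
    [lam = - gamma ^ 2 / l.+1 ^ 2]. *)
Definition up_weight (l : nat) r : R[i] := l.+1%:R * (r^-1)%:C - gamma%:C / l.+1%:R.
(* First-order factorization of the radial operators: [up] maps solutions for [l] to
   solutions for [l.+1], normalized to preserve [sing_at0]. *)
Definition up (l : nat) f df r : R[i] := (2 * l + 3)%:R^-1 * (up_weight l r * f r - df r).
Definition dup (l : nat) lam f df r : R[i] := (2 * l + 3)%:R^-1 *
  (up_weight l r * df r - (l.+1%:R * (r^-1)%:C ^+ 2 + potential l lam r) * f r).

Lemma natC_neq0 (n : nat) : n.+1%:R != 0 :> R[i].
Proof. by rewrite pnatr_eq0. Qed.

Lemma inv_cd r : 0 < r -> cd (fun r : R^o => (r^-1)%:C) r 1 (- (r^-1)%:C ^+ 2).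
Proof.
move=> r0; have r1 : r != 0 by rewrite gt_eqF.
by apply: cd_eq (cd_inv r1) _; rewrite rmorphN rmorphXn.
Qed.

Lemma up_rsol l lam f df : rsol l lam f df -> rsol l.+1 lam (up l f df) (dup l lam f df).
Proof.
move=> hf r r0; have [f1 f2] := hf r r0.
have i1 := inv_cd r0.
have w1 : cd (up_weight l : R^o -> R[i]) r 1 (- (l.+1%:R * (r^-1)%:C ^+ 2)).
  by apply: cd_eq (cd_sub (cd_mull _ i1) (cd_cst _ _ _)) _; ring.
have i2 : cd (fun r : R^o => (r^-1)%:C ^+ 2) r 1 (- 2 * (r^-1)%:C ^+ 3).
  by apply: cd_eq (cd_exp 2 i1) _; rewrite /=; ring.
have q1 : cd (potential l lam : R^o -> R[i]) r 1
   (- 2 * (l * l.+1)%:R * (r^-1)%:C ^+ 3 + 2 * gamma%:C * (r^-1)%:C ^+ 2).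
  by apply: cd_eq (cd_sub (cd_sub (cd_mull _ i2) (cd_mull _ i1)) (cd_cst _ _ _)) _; ring.
split.
- apply: cd_eq (cd_mull _ (cd_sub (cd_mul w1 f1) f2)) _.
  by rewrite /dup; ring.
- apply: cd_eq (cd_mull _ (cd_sub (cd_mul w1 f2) (cd_mul (cd_add (cd_mull _ i2) q1) f1))) _.
  rewrite /up /up_weight /potential !natrM -[l.+2%:R]natr1 -[l.+1%:R]natr1.
  have l1 : l%:R + 1 != 0 :> R[i] by rewrite natr1 natC_neq0.
  by move: ((2 * l + 3)%:R^-1) ((r^-1)%:C) => c x; field.
Qed.

(** The factor linear in [lam] is the scalar to which the product of the first-order operator and
    its adjoint reduces on solutions. It vanishes only at [lam = - gamma ^ 2 / l.+1 ^ 2], where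
    [up l] annihilates a solution. *)
Lemma wr_up l lam f df g dg r : 0 < r ->
  wr (up l f df) (dup l lam f df) (up l g dg) (dup l lam g dg) r =
  (lam + gamma%:C ^+ 2 / l.+1%:R ^+ 2) / (2 * l + 3)%:R ^+ 2 * wr f df g dg r.
Proof.
move=> r0; rewrite /wr /up /dup /up_weight /potential natrM -[l.+1%:R]natr1.
have l1 : l%:R + 1 != 0 :> R[i] by rewrite natr1 natC_neq0.
rewrite -[(2 * l + 3)%:R ^- 2]exprVn.
by move: ((2 * l + 3)%:R^-1) ((r^-1)%:C) => c x; field.
Qed.

Fixpoint ladder (l : nat) lam f df : (R -> R[i]) * (R -> R[i]) :=
  if l is l'.+1 then
    let p := ladder l' lam f df in (up l' p.1 p.2, dup l' lam p.1 p.2)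
  else (f, df).

Lemma ladder_rsol l lam f df : rsol 0 lam f df ->
  rsol l lam (ladder l lam f df).1 (ladder l lam f df).2.
Proof. by move=> h; elim: l => //= l IH; exact: up_rsol. Qed.

Definition ladder_factor (l : nat) lam : R[i] :=
  \prod_(j < l) ((lam + gamma%:C ^+ 2 / j.+1%:R ^+ 2) / (2 * j + 3)%:R ^+ 2).

Lemma wr_ladder l lam f df g dg r : 0 < r ->
  wr (ladder l lam f df).1 (ladder l lam f df).2 (ladder l lam g dg).1 (ladder l lam g dg).2 r
  = ladder_factor l lam * wr f df g dg r.
Proof.
move=> r0; elim: l => [|l IH]; first by rewrite /ladder_factor big_ord0 mul1r.
by rewrite /= wr_up// IH /ladder_factor big_ord_recr /=; ring.
Qed.

(** The leading term r^(-l) / (2 l + 1) is normalized to have Wronskian 1 with a regular solution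
    starting with r^(l+1). The limit of the derivative is recorded separately because asymptotics
    cannot be differentiated. *)
Definition sing_at0 (l : nat) f df : Prop :=
  clim 0^'+ (fun r => r%:C ^+ l * f r) (2 * l + 1)%:R^-1 /\
  clim 0^'+ (fun r => r%:C ^+ l.+1 * df r) (- (l%:R / (2 * l + 1)%:R)).

Lemma clim_r0 : clim 0^'+ (fun r : R => r%:C) 0.
Proof. by apply: clim_real; apply: cvg_at_right_filter; exact: cvg_id. Qed.

Lemma ladder_sing l lam f df : sing_at0 0 f df ->
  sing_at0 l (ladder l lam f df).1 (ladder l lam f df).2.
Proof.
move=> h; elim: l => //= l; move: (ladder l lam f df) => [{h}f {}df] /= [h1 h2].
have l1 : l%:R + 1 != 0 :> R[i] by rewrite natr1 natC_neq0.
have l3 : (2 * l + 3)%:R != 0 :> R[i] by rewrite addnS natC_neq0.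
have l2 : (2 * l + 1)%:R != 0 :> R[i] by rewrite addnS natC_neq0.
have E3 : (2 * l.+1 + 1)%N = (2 * l + 3)%N by rewrite mulnS; ring.
have hr := clim_r0.
have hw : clim 0^'+ (fun r : R => l.+1%:R - gamma%:C / l.+1%:R * r%:C) l.+1%:R.
  have H : clim 0^'+ (fun r : R => l.+1%:R - gamma%:C / l.+1%:R * r%:C) (l.+1%:R - gamma%:C / l.+1%:R * 0).
    by apply: clim_sub; [exact: clim_cst|exact: clim_mull].
  by rewrite mulr0 subr0 in H.
have hq : clim 0^'+ (fun r : R => l.+1%:R + ((l * l.+1)%:R - 2 * gamma%:C * r%:C - lam * (r%:C * r%:C))) (l.+1%:R + ((l * l.+1)%:R - 2 * gamma%:C * 0 - lam * (0 * 0))).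
  apply: clim_add; first exact: clim_cst.
  apply: clim_sub; first by apply: clim_sub; [exact: clim_cst|exact: clim_mull].
  by apply: clim_mull; exact: clim_mul.
rewrite /sing_at0 E3; split.
- have H : clim 0^'+ (fun r => (2 * l + 3)%:R^-1 * ((l.+1%:R - gamma%:C / l.+1%:R * r%:C) * (r%:C ^+ l * f r) - r%:C ^+ l.+1 * df r))
     ((2 * l + 3)%:R^-1 * (l.+1%:R * (2 * l + 1)%:R^-1 - - (l%:R / (2 * l + 1)%:R))).
    by apply: clim_mull; apply: clim_sub h2; exact: clim_mul.
  have E : (2 * l + 3)%:R^-1 * (l.+1%:R * (2 * l + 1)%:R^-1 - - (l%:R / (2 * l + 1)%:R)) = (2 * l + 3)%:R^-1 :> R[i].
    rewrite -[RHS]mulr1; congr (_ * _); apply: (mulIf l2); rewrite mulrDl opprK !divfK// mul1r.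
    by rewrite -natrD; congr (_%:R); ring.
  rewrite E in H; apply: clim_near H; near=> r.
  have r0 : 0 < r by [].
  have r1 : r%:C != 0 :> R[i] by rewrite -(rmorph0 (real_complex R)) (inj_eq (@complexI R)) gt_eqF.
  rewrite /up /up_weight exprS fmorphV -[l.+1%:R]natr1 /=.
  by move: ((2 * l + 3)%:R^-1) => b; field; rewrite r1 l1.
- have H : clim 0^'+ (fun r => (2 * l + 3)%:R^-1 * ((l.+1%:R - gamma%:C / l.+1%:R * r%:C) * (r%:C ^+ l.+1 * df r) - (l.+1%:R + ((l * l.+1)%:R - 2 * gamma%:C * r%:C - lam * (r%:C * r%:C))) * (r%:C ^+ l * f r)))
     ((2 * l + 3)%:R^-1 * (l.+1%:R * (- (l%:R / (2 * l + 1)%:R)) - (l.+1%:R + ((l * l.+1)%:R - 2 * gamma%:C * 0 - lam * (0 * 0))) * (2 * l + 1)%:R^-1)).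
    apply: clim_mull; apply: clim_sub; first exact: clim_mul.
    exact: clim_mul.
  have E : (2 * l + 3)%:R^-1 * (l.+1%:R * (- (l%:R / (2 * l + 1)%:R)) - (l.+1%:R + ((l * l.+1)%:R - 2 * gamma%:C * 0 - lam * (0 * 0))) * (2 * l + 1)%:R^-1) = - (l.+1%:R / (2 * l + 3)%:R) :> R[i].
    move: ((2 * l + 3)%:R^-1) l2 => b; rewrite natrD !natrM -[l.+1%:R]natr1 => l2.
    by field.
  rewrite E in H; apply: clim_near H; near=> r.
  have r0 : 0 < r by [].
  have r1 : r%:C != 0 :> R[i] by rewrite -(rmorph0 (real_complex R)) (inj_eq (@complexI R)) gt_eqF.
  rewrite /dup /up_weight /potential [r%:C ^+ l.+2]exprS [r%:C ^+ l.+1]exprS fmorphV natrM -[l.+1%:R]natr1 /=.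
  by move: ((2 * l + 3)%:R^-1) => b; field; rewrite r1 l1.
Unshelve. all: end_near. Qed.

Lemma clim_invy : clim +oo (fun r : R => (r^-1)%:C) 0.
Proof.
apply: clim_real; apply/cvgrPdist_lt => e e0; near=> t.
have t0 : 0 < t by [].
rewrite sub0r normrN ger0_norm ?invr_ge0 ?(ltW t0)// invf_plt ?posrE//.
by near: t; apply: nbhs_pinfty_gt; rewrite num_real.
Unshelve. all: end_near. Qed.

(** At infinity [up_weight] tends to a constant and [potential] to [- lam], so a ladder step acts on
    the limits [(c, d)] by a constant matrix, with [(c, k * c)] as eigenvector for the eigenvalue
    [- (k + gamma / l.+1) / (2 * l + 3)]. Dividing by a common [psi] lets one statement serve the
    decaying solution ([c = d = 0]) and the growing one. *)
Lemma ladder_growth lam f df (psi : R -> R[i]) (c d : R[i]) :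
  clim +oo (fun r => f r / psi r) c -> clim +oo (fun r => df r / psi r) d ->
  forall l, exists c' d', [/\ clim +oo (fun r => (ladder l lam f df).1 r / psi r) c',
    clim +oo (fun r => (ladder l lam f df).2 r / psi r) d',
    (c = 0 -> d = 0 -> c' = 0 /\ d' = 0) &
    (forall k : R[i], k ^+ 2 = - lam -> (forall n, k + gamma%:C / n.+1%:R != 0) ->
       c != 0 -> d = k * c -> c' != 0 /\ d' = k * c')].
Proof.
move=> hc hd; elim=> [|l [c' [d' [h1 h2 h0 hk]]]].
  by exists c, d; split.
rewrite /=; move: (ladder l lam f df) h1 h2 => [{hc hd}f {}df] /= h1 h2.
have hi := clim_invy.
have l1 : l%:R + 1 != 0 :> R[i] by rewrite natr1 natC_neq0.
have l3 : (2 * l + 3)%:R != 0 :> R[i] by rewrite addnS natC_neq0.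
have hw : clim +oo (up_weight l) (l.+1%:R * 0 - gamma%:C / l.+1%:R).
  by apply: clim_sub; [exact: clim_mull|exact: clim_cst].
have hq : clim +oo (fun r => l.+1%:R * (r^-1)%:C ^+ 2 + potential l lam r)
    (l.+1%:R * (0 * 0) + ((l * l.+1)%:R * (0 * 0) - 2 * gamma%:C * 0 - lam)).
  apply: clim_add; first by apply: clim_mull; exact: clim_mul.
  apply: clim_sub; last exact: clim_cst.
  apply: clim_sub; last exact: clim_mull.
  by apply: clim_mull; exact: clim_mul.
rewrite !mulr0 sub0r in hw; rewrite !mulr0 subr0 sub0r !add0r in hq.
pose c2 := (2 * l + 3)%:R^-1 * (- (gamma%:C / l.+1%:R) * c' - d').
pose d2 := (2 * l + 3)%:R^-1 * (- (gamma%:C / l.+1%:R) * d' - (- lam) * c').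
exists c2, d2; split.
- have H : clim +oo (fun r => (2 * l + 3)%:R^-1 * (up_weight l r * (f r / psi r) - df r / psi r)) c2.
    by apply: clim_mull; apply: clim_sub h2; exact: clim_mul.
  by apply: clim_near H; apply: nearW => r; rewrite /up; ring.
- have H : clim +oo (fun r => (2 * l + 3)%:R^-1 * (up_weight l r * (df r / psi r) - (l.+1%:R * (r^-1)%:C ^+ 2 + potential l lam r) * (f r / psi r))) d2.
    by apply: clim_mull; apply: clim_sub; exact: clim_mul.
  by apply: clim_near H; apply: nearW => r; rewrite /dup; ring.
- move=> c0 d0; have [e1 e2] := h0 c0 d0.
  by rewrite /c2 /d2 e1 e2 !mulr0 subrr mulr0.
- move=> k kl kn cn dk; have [e1 e2] := hk k kl kn cn dk; split.
    have -> : c2 = - ((2 * l + 3)%:R^-1 * (k + gamma%:C / l.+1%:R) * c').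
      by rewrite /c2 e2; ring.
    by rewrite oppr_eq0 !mulf_neq0// invr_eq0.
  by rewrite /d2 /c2 e2 -kl; ring.
Qed.

End RadialEquation.

Ltac pos_tac := repeat first [ done | exact: expR_ge0 | exact: normc_ge0 | exact: pi_ge0 | exact: ltW | apply: mulr_ge0 | apply: addr_ge0 | apply: divr_ge0 ].

(** * Asymptotics at infinity of the two solutions for [l = 0] *)

Section MomentBounds.
Context {R : realType}.
Notation mu := (@lebesgue_measure R).
Notation P := (@hline R).
Variables (h : R -> R[i]) (C0 a : R).
Hypothesis hm : cmeasurable P h.
Hypothesis C0_ge0 : 0 <= C0.
Hypothesis a_ge0 : 0 <= a.
Hypothesis hb : forall t, 0 < t -> normc (h t) <= C0 * (a + t).

Let hb1 t : 0 < t -> normc (h t) <= (C0 * (1 + a)) * (1 + t).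
Proof.
move=> t0; apply: (le_trans (hb t0)); rewrite -mulrA ler_wpM2l//.
have := mulr_ge0 a_ge0 (ltW t0); lra.
Qed.

Lemma gauss_weight_integral r : 0 < r ->
  mu.-integrable P (EFin \o (fun t => a * gk r t + gk r t * t)) /\
  \int[mu]_(t in P) (a * gk r t + gk r t * t) <= a * (2 / Num.sqrt r) + (2 * r)^-1.
Proof.
move=> r0.
have i0 : mu.-integrable P (EFin \o gk r).
  by have := integrable_gkX 0 r0; under eq_fun do rewrite expr0 mulr1.
have i1 : mu.-integrable P (EFin \o (fun t => gk r t * t)).
  by have := integrable_gkX 1 r0; under eq_fun do rewrite expr1.
have ia := integrableZl measurable_hline a i0.
split; first exact: (integrableD measurable_hline ia i1).
by rewrite RintegralD// RintegralZl// gauss_moment1// lerD2r ler_wpM2l// gauss_moment0_le.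
Qed.

(** With [a = 0], the case of [hfun_leN], the term of order [1 / sqrt r] disappears and
    [r * moment h 0 r] is bounded; with [a = 1] it may grow like [sqrt r]. *)
Lemma moment0_le r : 0 < r ->
  normc (moment h 0 r) <= 2 * C0 * (a * (2 / Num.sqrt r) + (2 * r)^-1).
Proof.
move=> r0; have [ii hi] := gauss_weight_integral r0.
have mi := moment_integrable hm hb1 0 r0.
have ig := integrableZl measurable_hline C0 ii.
apply: le_trans (normc_cintegral_le measurable_hline mi ig _) _.
  move=> t; rewrite hlineE => t0.
  rewrite muln0 expr0 mulr1 normc_mul normc_real ger0_norm ?gk_ge0//.
  rewrite (le_trans (ler_wpM2l (gk_ge0 r t) (hb t0)))//.
  by rewrite le_eqVlt; apply/orP; left; apply/eqP; ring.
by rewrite RintegralZl// -[leRHS]mulrA ler_wpM2l// ler_wpM2l.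
Qed.

(** The left-hand side is the modulus of the derivative of [r * moment h 0 r]. The factor
    [1 - r * t ^+ 2] costs half of the Gaussian, because (1 + x) exp(- x / 2) is at most 2 for
    nonnegative x. *)
Lemma moment01_le r : 0 < r ->
  normc (moment h 0 r - r%:C * moment h 1 r) <=
  4 * C0 * (a * (2 / Num.sqrt (r / 2)) + (2 * (r / 2))^-1).
Proof.
move=> r0; have r2 : 0 < r / 2 by rewrite divr_gt0.
have [ii hi] := gauss_weight_integral r2.
have mi0 := moment_integrable hm hb1 0 r0.
have mi1 := moment_integrable hm hb1 1 r0.
have mi1' := cintegrable_mull measurable_hline (- r%:C) mi1.
have E : moment h 0 r - r%:C * moment h 1 r = cintegral mu P (fun t =>
  (gk r t * t ^+ (2 * 0))%:C * h t + - r%:C * ((gk r t * t ^+ (2 * 1))%:C * h t)).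
  by rewrite cintegral_add// cintegral_mull// mulNr.
have ig := integrableZl measurable_hline (2 * C0) ii.
rewrite E; apply: le_trans (normc_cintegral_le measurable_hline (cintegrable_add measurable_hline mi0 mi1') ig _) _.
  move=> t; rewrite hlineE => t0.
  have -> : (gk r t * t ^+ (2 * 0))%:C * h t + - r%:C * ((gk r t * t ^+ (2 * 1))%:C * h t)
     = ((1 - r * t ^+ 2) * gk r t)%:C * h t.
    by rewrite muln0 muln1 expr0 mulr1 !rmorphM rmorphB rmorphM /=; ring.
  rewrite normc_mul normc_real.
  have x0 : 0 <= r * t ^+ 2 by rewrite mulr_ge0 ?sqr_ge0 ?(ltW r0).
  have h1 : `|(1 - r * t ^+ 2) * gk r t| <= 2 * gk (r / 2) t.
    rewrite normrM (ger0_norm (gk_ge0 r t)).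
    have e1 : gk r t = gk (r / 2) t * gk (r / 2) t.
      by rewrite /gk -expRD; congr expR; field.
    have e2 : (1 + r * t ^+ 2) * gk (r / 2) t <= 2.
      have : 1 + r / 2 * t ^+ 2 <= expR (r / 2 * t ^+ 2) by exact: expR_ge1Dx.
      have g0 := expR_gt0 (r / 2 * t ^+ 2).
      rewrite /gk expRN ler_pdivrMr//; lra.
    rewrite e1 mulrA ler_wpM2r ?gk_ge0// (le_trans _ e2)// ler_wpM2r ?gk_ge0//.
    by rewrite (le_trans (ler_normB _ _))// normr1 ger0_norm.
  apply: (le_trans (ler_pM (normr_ge0 _) (normc_ge0 _) h1 (hb t0))).
  by rewrite le_eqVlt; apply/orP; left; apply/eqP; ring.
rewrite RintegralZl//.
have -> : 4 * C0 = 2 * (2 * C0) by ring.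
by rewrite -[leRHS]mulrA ler_wpM2l// ler_wpM2l// mulr_ge0.
Qed.

End MomentBounds.

Section Growth.
Context {R : realType}.
Variable gamma : R.
Hypothesis gamma_gt0 : 0 < gamma.
Implicit Types (k : R[i]) (r t : R).

(** Invariant under [k] to [- k], so that the decaying and the growing solution are both instances
    of [phi0]. *)
Definition good k : Prop := complex.Im k != 0 /\ `|complex.Re (gamma%:C / k)| <= 2^-1.

Lemma good_opp k : good k -> good (- k).
Proof.
move=> [k0 kr]; split; first by rewrite cImN oppr_eq0.
by rewrite invrN mulrN cReN normrN.
Qed.

Lemma good_bound k : good k -> exists2 C0 : R, 0 <= C0 &
  forall t, 0 < t -> normc (hfun gamma k t) <= C0 * (1 + t).
Proof.
move=> [k0 kr]; pose B := normc (gamma%:C / k) + normc (2 * k).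
have hB : normc (gamma%:C / k) <= B by rewrite lerDl normc_ge0.
have kB : normc (2 * k) <= B by rewrite lerDr normc_ge0.
have B0 : 0 <= B by rewrite addr_ge0 ?normc_ge0.
have [h|h] := leP 0 (complex.Re (gamma%:C / k)).
  exists (2 * expR (pi * B) * (B + 1)) => [|t t0].
    by pos_tac.
  by apply: hfun_le => //; rewrite h (le_trans (ler_norm _)).
have b0 : 0 < `|2 * complex.Im k| by rewrite normr_gt0 mulf_neq0.
exists (2 * expR (pi * B) * (2 + B / `|2 * complex.Im k|)) => [|t t0].
  by pos_tac.
apply: le_trans (hfun_leN b0 (lexx _) t0 _ hB kB) _.
  by move: kr; rewrite ler_norml => /andP[-> _]; rewrite ltW.
by rewrite ler_wpM2l ?lerDr//; pos_tac.
Qed.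

Lemma phi0_rsol k : good k -> rsol gamma 0 (- k ^+ 2) (phi0 gamma k) (dphi0 gamma k).
Proof.
move=> gk; have [C0 c0 hb] := good_bound gk; have [k0 _] := gk.
move=> r r0; split; first exact: (phi0_cd k0 hb).
apply: cd_eq (dphi0_cd k0 c0 hb r0) _; congr (_ * _).
by rewrite /potential mul0n mul0r sub0r opprK !rmorphM rmorph_nat /= fmorphV addrC.
Qed.

Lemma phi0_sing k : good k -> sing_at0 0 (phi0 gamma k) (dphi0 gamma k).
Proof.
move=> gk; have [C0 c0 hb] := good_bound gk; have [k0 _] := gk.
split; rewrite ?mul0r ?oppr0 ?muln0 ?add0n ?invr1.
- by apply: clim_near (phi0_cvg0 k0 c0 hb); apply: nearW => r; rewrite expr0 mul1r.
- by apply: clim_near (r_dphi0_cvg0 k0 c0 hb); apply: nearW => r; rewrite expr1.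
Qed.

Section FixedK.
Variable k : R[i].
Hypothesis kg : good k.
Hypothesis kR : 0 < complex.Re k.
Hypothesis wk : wr (phi0 gamma k) (dphi0 gamma k) (phi0 gamma (- k)) (dphi0 gamma (- k)) 1 != 0.
Let k0 : complex.Im k != 0. Proof. by case: kg. Qed.

(** Amplitudes of the two solutions after splitting off exp(- k r) and exp(k r); [A'] and [B'] are
    their derivatives. *)
Let A r := r%:C * moment (hfun gamma k) 0 r.
Let A' r := moment (hfun gamma k) 0 r - r%:C * moment (hfun gamma k) 1 r.
Let B r := r%:C * moment (hfun gamma (- k)) 0 r.
Let B' r := moment (hfun gamma (- k)) 0 r - r%:C * moment (hfun gamma (- k)) 1 r.

Lemma Re_gamma_div : 0 <= complex.Re (gamma%:C / k).
Proof.
case: k kR => x y /= x0; rewrite mul0r subr0 mulr_ge0 ?(ltW gamma_gt0)//.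
by rewrite divr_ge0 ?(ltW x0)// addr_ge0 ?sqr_ge0.
Qed.

Let bounds : exists2 C : R, 0 < C & forall r, 1 <= r ->
  [/\ normc (A r) <= C * Num.sqrt r, normc (A' r) <= C / Num.sqrt r,
      normc (B r) <= C & normc (B' r) <= C / r].
Proof.
have [C0 c0 hb] := good_bound kg.
have p0 := Re_gamma_div.
pose Bd := normc (gamma%:C / - k) + normc (2 * - k).
have hB : normc (gamma%:C / - k) <= Bd by rewrite lerDl normc_ge0.
have kB : normc (2 * - k) <= Bd by rewrite lerDr normc_ge0.
have B0 : 0 <= Bd by rewrite addr_ge0 ?normc_ge0.
have b0 : 0 < `|2 * complex.Im (- k)| by rewrite normr_gt0 cImN mulf_neq0// oppr_eq0.
pose C1 := 2 * expR (pi * Bd) * (2 + Bd / `|2 * complex.Im (- k)|).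
have c1 : 0 <= C1 by rewrite /C1; pos_tac.
have hb' t : 0 < t -> normc (hfun gamma (- k) t) <= C1 * (0 + t).
  move=> t0; rewrite add0r; apply: hfun_leN => //.
  have [_] := kg; rewrite invrN mulrN cReN ler_norml => /andP[h1 h2].
  by apply/andP; split; lra.
have m1 := hfun_cmeasurable gamma k0.
have k0' : complex.Im (- k) != 0 by rewrite cImN oppr_eq0.
have m2 := hfun_cmeasurable gamma k0'.
exists (20 * C0 + 4 * C1 + 1) => [|r r1]; first by rewrite ltr_wpDl// addr_ge0// mulr_ge0.
have r0 : 0 < r by rewrite (lt_le_trans _ r1).
have s0 : 0 < Num.sqrt r by rewrite sqrtr_gt0.
have sr : Num.sqrt r * Num.sqrt r = r by rewrite -expr2 sqr_sqrtr// ltW.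
have s1 : 1 <= Num.sqrt r by rewrite -(sqrtr1 R) ler_wsqrtr.
have si : 0 < (Num.sqrt r)^-1 by rewrite invr_gt0.
have ri : r^-1 = (Num.sqrt r)^-1 * (Num.sqrt r)^-1 by rewrite -invfM sr.
have si1 : (Num.sqrt r)^-1 <= 1 by rewrite invf_le1.
have rr : (2 * r)^-1 = 2^-1 * r^-1 by rewrite invfM.
have rr2 : (2 * (r / 2))^-1 = r^-1 by rewrite mulrCA divff ?mulr1// pnatr_eq0.
have n1 x : normc (r%:C * x) = r * normc x by rewrite normc_mul normc_real gtr0_norm.
have sh : (Num.sqrt (r / 2))^-1 <= 2 * (Num.sqrt r)^-1.
  rewrite -[2 in leRHS]invrK -invfM lef_pV2 ?posrE ?mulr_gt0 ?invr_gt0 ?sqrtr_gt0 ?divr_gt0//.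
  rewrite -(@ler_pXn2r _ 2)// ?nnegrE ?mulr_ge0 ?invr_ge0 ?sqrtr_ge0//.
  rewrite exprMn !sqr_sqrtr ?divr_ge0 ?(ltW r0)//; lra.
have z0 : 0 <= 0 :> R by [].
have z1 : 0 <= 1 :> R by [].
split.
- rewrite /A n1 (le_trans (ler_wpM2l (ltW r0) (moment0_le m1 c0 z1 hb r0)))//.
  have -> : r * (2 * C0 * (1 * (2 / Num.sqrt r) + (2 * r)^-1)) = C0 * (4 * Num.sqrt r + 1).
    rewrite -[X in X * _]sr rr ri; field; exact: lt0r_neq0.
  nra.
- rewrite /A' (le_trans (moment01_le m1 c0 z1 hb r0))// rr2 ri.
  have p1 := ler_wpM2l c0 sh.
  have p2 := ler_wpM2l c0 (ler_wpM2l (ltW si) si1).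
  have p3 := mulr_ge0 c1 (ltW si).
  lra.
- rewrite /B n1 (le_trans (ler_wpM2l (ltW r0) (moment0_le m2 c1 z0 hb' r0)))//.
  have -> : r * (2 * C1 * (0 * (2 / Num.sqrt r) + (2 * r)^-1)) = C1.
    by field; rewrite !lt0r_neq0.
  lra.
- rewrite /B' (le_trans (moment01_le m2 c1 z0 hb' r0))// rr2 mul0r add0r.
  have : 0 < r^-1 by rewrite invr_gt0.
  nra.
Qed.

Let growthE (r : R) : phi0 gamma (- k) r = cexp (k * r%:C) * B r /\
  dphi0 gamma (- k) r = cexp (k * r%:C) * (k * B r + B' r) /\
  phi0 gamma k r = cexp (- (k * r%:C)) * A r /\
  dphi0 gamma k r = cexp (- (k * r%:C)) * (- k * A r + A' r).
Proof. by rewrite /phi0 /dphi0 mulNr !opprK. Qed.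

Let wronskianE (r : R) : 0 < r ->
  wr (phi0 gamma k) (dphi0 gamma k) (phi0 gamma (- k)) (dphi0 gamma (- k)) 1 =
  - (2 * k) * (A r * B r) + (A' r * B r - A r * B' r).
Proof.
move=> r0; have s1 := phi0_rsol kg; have s2 := phi0_rsol (good_opp kg).
rewrite sqrrN in s2.
rewrite -(wr_const s1 s2 r0 ltr01) /wr.
have [-> [-> [-> ->]]] := growthE r.
transitivity (cexp (- (k * r%:C)) * cexp (k * r%:C) * (- (2 * k) * (A r * B r) + (A' r * B r - A r * B' r))).
  by ring.
by rewrite cexpNM mul1r.
Qed.

(** The Wronskian is a nonzero constant, equal to [- 2 * k * A * B] up to terms of order
    [1 / sqrt r]. Since [A] is at most of order [sqrt r], [B] is at least of order [1 / sqrt r]. *)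
Let lower : exists C c r1 : R, [/\ 0 < C, 0 < c, 1 <= r1 & forall r, r1 <= r ->
  [/\ normc (A r) <= C * Num.sqrt r, normc (A' r) <= C, normc (B' r) <= C / r &
      c / Num.sqrt r <= normc (B r)]].
Proof.
have [C C0 hC] := bounds.
pose w := wr (phi0 gamma k) (dphi0 gamma k) (phi0 gamma (- k)) (dphi0 gamma (- k)) 1.
have w0 : 0 < normc w by rewrite normc_gt0; exact: wk.
have kn : 0 < normc k by rewrite normc_gt0; apply: Im_neq0.
pose c := normc w / (4 * normc k * C).
have c0 : 0 < c by rewrite divr_gt0// !mulr_gt0.
(* From this radius on, the error terms in the Wronskian stay below half of its modulus. *)
pose r1 := 1 + (4 * C ^+ 2 / normc w) ^+ 2.
exists C, c, r1; split => // [|r hr]; first by rewrite lerDl sqr_ge0.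
have r1' : 1 <= r by apply: le_trans hr; rewrite lerDl sqr_ge0.
have r0 : 0 < r by rewrite (lt_le_trans _ r1').
have s0 : 0 < Num.sqrt r by rewrite sqrtr_gt0.
have s1 : 1 <= Num.sqrt r by rewrite -(sqrtr1 R) ler_wsqrtr.
have sr : Num.sqrt r ^+ 2 = r by rewrite sqr_sqrtr// ltW.
have [hA hA' hB hB'] := hC r r1'.
split => //.
  by apply: (le_trans hA'); rewrite ler_pdivrMr// ler_peMr// ltW.
have hs : 4 * C ^+ 2 / normc w <= Num.sqrt r.
  rewrite -(@ler_pXn2r _ 2)// ?nnegrE ?(ltW s0) ?divr_ge0 ?mulr_ge0 ?sqr_ge0 ?(ltW C0) ?(ltW w0)//.
  by rewrite sr (le_trans _ hr)// lerDr.
have hs' : 2 * C ^+ 2 / Num.sqrt r <= normc w / 2.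
  move: hs; rewrite ler_pdivrMr// => hs; rewrite ler_pdivrMr//; lra.
have e1 : normc (A' r * B r) <= C ^+ 2 / Num.sqrt r.
  rewrite normc_mul (le_trans (ler_pM (normc_ge0 _) (normc_ge0 _) hA' hB))//.
  by rewrite le_eqVlt; apply/orP; left; apply/eqP; ring.
have e2 : normc (A r * B' r) <= C ^+ 2 / Num.sqrt r.
  rewrite normc_mul (le_trans (ler_pM (normc_ge0 _) (normc_ge0 _) hA hB'))//.
  rewrite le_eqVlt; apply/orP; left; apply/eqP.
  by rewrite -{2}sr; field; exact: lt0r_neq0.
have e3 : normc w <= 2 * normc k * (normc (A r) * normc (B r)) + 2 * C ^+ 2 / Num.sqrt r.
  rewrite /w (wronskianE r0) (le_trans (normc_add _ _))// lerD//.
    by rewrite normc_mul normc_opp [normc (2 * k)]normc_mul normc_nat [normc (A r * _)]normc_mul.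
  rewrite (le_trans (normc_sub _ _))//.
  move: e1 e2; lra.
have e4 : normc w / 2 <= 2 * normc k * (C * Num.sqrt r * normc (B r)).
  have : 2 * normc k * (normc (A r) * normc (B r)) <= 2 * normc k * (C * Num.sqrt r * normc (B r)).
    by rewrite ler_wpM2l ?mulr_ge0 ?normc_ge0// ler_wpM2r ?normc_ge0.
  lra.
rewrite ler_pdivrMr// /c ler_pdivrMr ?mulr_gt0//.
apply: (@le_trans _ _ (2 * (2 * normc k * (C * Num.sqrt r * normc (B r))))); first by lra.
by rewrite le_eqVlt; apply/orP; left; apply/eqP; ring.
Qed.

Lemma clim_of_sqrt_bound (f : R -> R[i]) (D r1 : R) :
  (forall r, r1 <= r -> normc (f r) <= D / Num.sqrt r) -> clim +oo f 0.
Proof.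
move=> h; apply: (clim_squeeze (b := fun r => `|D| * (Num.sqrt r)^-1)).
  near=> r; have r1r : r1 <= r by near: r; apply: nbhs_pinfty_ge; rewrite num_real.
  rewrite subr0 (le_trans (h r r1r))//.
  by rewrite ler_wpM2r ?invr_ge0 ?sqrtr_ge0// ler_norm.
rewrite -[X in _ --> X](mulr0 `|D|); apply: cvgM; first exact: cvg_cst.
apply/cvgrPdist_lt => e e0; near=> r.
have r0 : 0 < r by [].
have s0 : 0 < Num.sqrt r by rewrite sqrtr_gt0.
rewrite sub0r normrN ger0_norm ?invr_ge0 ?sqrtr_ge0// invf_plt ?posrE//.
have <- : Num.sqrt (e^-1 ^+ 2) = e^-1 by rewrite sqrtr_sqr ger0_norm// invr_ge0 ltW.
rewrite ltr_sqrt//.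
by near: r; apply: nbhs_pinfty_gt; rewrite num_real.
Unshelve. all: end_near. Qed.

Let B_neq0 : \forall r \near +oo, B r != 0.
Proof.
have [C [c [r1 [C0 c0 r11 h]]]] := lower.
near=> r; have r1r : r1 <= r by near: r; apply: nbhs_pinfty_ge; rewrite num_real.
have [_ _ _ hB] := h r r1r.
rewrite -normc_gt0 (lt_le_trans _ hB)// divr_gt0// sqrtr_gt0.
by rewrite (lt_le_trans _ (le_trans r11 r1r)).
Unshelve. all: end_near. Qed.

Lemma dphi0_growing_ratio : clim +oo (fun r => dphi0 gamma (- k) r / phi0 gamma (- k) r) k.
Proof.
have [C [c [r1 [C0 c0 r11 h]]]] := lower.
have H : clim +oo (fun r => k + B' r / B r) (k + 0).
  apply: clim_add; first exact: clim_cst.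
  apply: (@clim_of_sqrt_bound _ (C / c) r1) => r r1r.
  have [_ _ hB' hB] := h r r1r.
  have r0 : 0 < r by rewrite (lt_le_trans _ (le_trans r11 r1r)).
  have s0 : 0 < Num.sqrt r by rewrite sqrtr_gt0.
  have sr : Num.sqrt r ^+ 2 = r by rewrite sqr_sqrtr// ltW.
  have b0 : 0 < normc (B r) by apply: lt_le_trans hB; rewrite divr_gt0.
  rewrite normc_mul normc_inv ler_pdivrMr// (le_trans hB')//.
  have := ler_wpM2l (_ : 0 <= C / c / Num.sqrt r) hB; rewrite !divr_ge0 ?(ltW C0) ?(ltW c0) ?(ltW s0)//.
  move=> /(_ isT); apply: le_trans; rewrite le_eqVlt; apply/orP; left; apply/eqP.
  by rewrite -[in LHS]sr; field; rewrite !lt0r_neq0.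
rewrite addr0 in H; apply: clim_near H; near=> r.
have b0 : B r != 0 by near: r; exact: B_neq0.
have [-> [-> _]] := growthE r.
by field; rewrite b0 cexp_neq0.
Unshelve. all: end_near. Qed.

Let exp_le (x : R) : 0 < x -> expR (- x) <= 6 / x ^+ 3.
Proof.
move=> x0; rewrite expRN -[6 / _]invf_div lef_pV2 ?posrE ?expR_gt0 ?divr_gt0 ?exprn_gt0//.
have := expR_ge1Dxn 2 (ltW x0); rewrite !factS fact0 muln1/=.
have : 0 <= 1 :> R by []. lra.
Qed.

(** Here exp(- 2 Re k r) competes with at most a multiple of [r]; the cubic bound on the exponential
    leaves a factor [r ^ -2]. *)
Let decay_ratio (E : R -> R[i]) (D : R) : (forall r, 1 <= r -> normc (E r) <= D * Num.sqrt r) ->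
  clim +oo (fun r => cexp (- (k * r%:C)) * E r / phi0 gamma (- k) r) 0.
Proof.
move=> hE; have [C [c [r1 [C0 c0 r11 h]]]] := lower.
pose x := complex.Re k; have xR : 0 < x := kR.
apply: (@clim_of_sqrt_bound _ (6 / (2 * x) ^+ 3 * (`|D| / c)) r1) => r r1r.
have [_ _ _ hB] := h r r1r.
have r1' := le_trans r11 r1r.
have r0 : 0 < r by rewrite (lt_le_trans _ r1').
have s0 : 0 < Num.sqrt r by rewrite sqrtr_gt0.
have s1 : 1 <= Num.sqrt r by rewrite -(sqrtr1 R) ler_wsqrtr.
have sr : Num.sqrt r ^+ 2 = r by rewrite sqr_sqrtr// ltW.
have b0 : 0 < normc (B r) by apply: lt_le_trans hB; rewrite divr_gt0.
have [-> _] := growthE r.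
have xr : 0 < 2 * x * r by rewrite !mulr_gt0.
have -> : normc (cexp (- (k * r%:C)) * E r / (cexp (k * r%:C) * B r)) =
   expR (- (2 * x * r)) * (normc (E r) / normc (B r)).
  rewrite normc_mul [normc (cexp _ * E r)]normc_mul normc_inv [normc (cexp _ * B r)]normc_mul !normc_cexp invfM -expRN.
  have -> : complex.Re (- (k * r%:C)) = - (x * r) by rewrite cReN cReM /= mulr0 subr0.
  have -> : complex.Re (k * r%:C) = x * r by rewrite cReM /= mulr0 subr0.
  have -> : - (2 * x * r) = - (x * r) + - (x * r) by ring.
  by rewrite expRD; ring.
have hEB : normc (E r) / normc (B r) <= `|D| / c * r.
  rewrite ler_pdivrMr// (le_trans (hE r r1'))//.
  have d0 : 0 <= `|D| / c * r by rewrite mulr_ge0 ?divr_ge0 ?(ltW c0) ?(ltW r0).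
  apply: le_trans (ler_wpM2l d0 hB).
  have -> : `|D| / c * r * (c / Num.sqrt r) = `|D| * Num.sqrt r.
    by rewrite -[X in _ * X * _]sr; field; rewrite !lt0r_neq0.
  by rewrite ler_wpM2r ?sqrtr_ge0// ler_norm.
apply: (le_trans (ler_pM (expR_ge0 _) _ (exp_le xr) hEB)).
  by rewrite divr_ge0 ?normc_ge0.
have -> : 6 / (2 * x * r) ^+ 3 * (`|D| / c * r) = 6 / (2 * x) ^+ 3 * (`|D| / c) * (r ^+ 2)^-1.
  by field; rewrite !lt0r_neq0// mulr_gt0.
rewrite ler_wpM2l//.
  by rewrite mulr_ge0 ?divr_ge0 ?exprn_ge0 ?mulr_ge0 ?(ltW kR) ?(ltW c0).
rewrite lef_pV2 ?posrE ?exprn_gt0// (@le_trans _ _ r)//; last by rewrite expr2 ler_peMr// ltW.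
by rewrite -[leRHS]sr expr2 ler_peMr// ltW.
Qed.

Lemma phi0_decay_ratio : clim +oo (fun r => phi0 gamma k r / phi0 gamma (- k) r) 0.
Proof.
have [C C0 h] := bounds.
have H : clim +oo (fun r => cexp (- (k * r%:C)) * A r / phi0 gamma (- k) r) 0.
  by apply: (@decay_ratio A C) => r r1; case: (h r r1).
by apply: clim_near H; apply: nearW => r; have [_ [_ [-> _]]] := growthE r.
Qed.

Lemma dphi0_decay_ratio : clim +oo (fun r => dphi0 gamma k r / phi0 gamma (- k) r) 0.
Proof.
have [C C0 h] := bounds.
have H := @decay_ratio (fun r => - k * A r + A' r) ((normc k + 1) * C) _.
apply: clim_near (H _); first by apply: nearW => r; have [_ [_ [_ ->]]] := growthE r.
move=> r r1; have [hA hA' _ _] := h r r1.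
have s1 : 1 <= Num.sqrt r by rewrite -(sqrtr1 R) ler_wsqrtr.
have s0 : 0 < Num.sqrt r by rewrite (lt_le_trans _ s1).
rewrite (le_trans (normc_add _ _))// -mulrA mulrDl mul1r lerD//.
  by rewrite normc_mul normc_opp ler_wpM2l ?normc_ge0.
apply: (le_trans hA'); rewrite ler_pdivrMr// -mulrA ler_peMr ?(ltW C0)//.
by rewrite -[1]mulr1 ler_pM.
Qed.

Lemma phi0_growing (A0 : R) : exists2 r1 : R, 0 < r1 & forall r, r1 <= r -> A0 * r <= normc (phi0 gamma (- k) r).
Proof.
have [C [c [r1 [C0 c0 r11 h]]]] := lower.
pose x := complex.Re k; have xR : 0 < x := kR.
pose D := 6 * `|A0| / (x ^+ 3 * c).
exists (r1 + D) => [|r hr].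
  rewrite ltr_wpDr ?(lt_le_trans _ r11)// divr_ge0 ?mulr_ge0 ?exprn_ge0 ?(ltW c0) ?(ltW kR)//.
have D0 : 0 <= D by rewrite divr_ge0 ?mulr_ge0 ?exprn_ge0 ?(ltW c0) ?(ltW kR).
have r1r : r1 <= r by apply: le_trans hr; rewrite lerDl.
have Dr : D <= r by apply: le_trans hr; rewrite lerDr (le_trans _ r11).
have [_ _ _ hB] := h r r1r.
have r1' := le_trans r11 r1r.
have r0 : 0 < r by rewrite (lt_le_trans _ r1').
have s0 : 0 < Num.sqrt r by rewrite sqrtr_gt0.
have s1 : 1 <= Num.sqrt r by rewrite -(sqrtr1 R) ler_wsqrtr.
have sr : Num.sqrt r ^+ 2 = r by rewrite sqr_sqrtr// ltW.
have [-> _] := growthE r.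
rewrite normc_mul normc_cexp cReM /= mulr0 subr0 -/x.
have xr : 0 < x * r by rewrite mulr_gt0.
have e3 : (x * r) ^+ 3 / 6 <= expR (x * r).
  have := expR_ge1Dxn 2 (ltW xr); rewrite !factS fact0 muln1/=.
  have : 0 <= 1 :> R by []. lra.
have sle : Num.sqrt r <= r by rewrite -[leRHS]sr expr2 ler_peMr// ltW.
have hB' : c / r <= normc (B r).
  by apply: le_trans hB; rewrite ler_wpM2l ?(ltW c0)// lef_pV2 ?posrE.
have x3 : 0 <= (x * r) ^+ 3 / 6 by rewrite divr_ge0 ?exprn_ge0 ?(ltW xr).
have cr : 0 <= c / r by rewrite divr_ge0 ?(ltW c0) ?(ltW r0).
apply: le_trans (ler_pM x3 cr e3 hB').
have -> : (x * r) ^+ 3 / 6 * (c / r) = (x ^+ 3 * c / 6 * r) * r.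
  by field; rewrite lt0r_neq0.
rewrite ler_wpM2r ?(ltW r0)//; apply: le_trans (ler_norm _) _.
have xc : 0 < x ^+ 3 * c by rewrite mulr_gt0// exprn_gt0.
move: Dr; rewrite /D ler_pdivrMr//; lra.
Qed.

End FixedK.
End Growth.

(** * Limiting absorption: convergence of the solutions as [kappa] tends to the imaginary axis *)

Lemma clim_normc {R : realType} {T : Type} (F : set_system T) {FF : Filter F}
    (f : T -> R[i]) (l : R[i]) : clim F f l -> (fun t => normc (f t)) @ F --> normc l.
Proof.
move=> /climP h; apply/cvgrPdist_lt => e e0; apply: filterS (h e e0) => t ht.
by rewrite distrC (le_lt_trans (normc_dist _ _)).
Qed.

Lemma cd_normc_continuous {R : realType} (f : R -> R[i]) (x : R) (d : R[i]) :
  cd f x 1 d -> {for x, continuous (fun t => normc (f t))}.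
Proof. by move=> /cd_continuous[h1 h2]; apply: clim_normc; apply/clim_ReIm; split. Qed.

Section UniformLimits.
Context {R : realType} {T X : Type} (F : set_system T) {FF : Filter F} (S : set X).
Implicit Types (f g : T -> X -> R[i]) (l m : X -> R[i]).

Definition uclim f l : Prop :=
  forall e : R, 0 < e -> \forall t \near F, forall x, S x -> normc (f t x - l x) < e.

Definition cbounded l : Prop := exists B : R, forall x, S x -> normc (l x) <= B.

Lemma uclim_const l : uclim (fun=> l) l.
Proof. by move=> e e0; apply: nearW => t x _; rewrite subrr normc_0. Qed.

Lemma uclim_scalar (c : T -> R[i]) (d : R[i]) : clim F c d -> uclim (fun t _ => c t) (fun=> d).
Proof. by move=> /climP h e e0; apply: filterS (h e e0) => t ? x _. Qed.

Lemma uclim_add f g l m : uclim f l -> uclim g m ->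
  uclim (fun t x => f t x + g t x) (fun x => l x + m x).
Proof.
move=> hf hg e e0; have e2 : 0 < e / 2 by rewrite divr_gt0.
apply: filterS2 (hf _ e2) (hg _ e2) => t h1 h2 x Sx.
have -> : f t x + g t x - (l x + m x) = (f t x - l x) + (g t x - m x) by ring.
by rewrite (le_lt_trans (normc_add _ _))// (splitr e) ltrD ?h1 ?h2.
Qed.

Lemma uclim_mul f g l m : cbounded l -> cbounded m -> uclim f l -> uclim g m ->
  uclim (fun t x => f t x * g t x) (fun x => l x * m x).
Proof.
move=> [B hB] [B' hB'] hf hg e e0.
pose D := `|B| + `|B'| + 1.
have D1 : 1 <= D by rewrite lerDr addr_ge0.
have D0 : 0 < D by rewrite (lt_le_trans _ D1).
pose d := Num.min 1 (e / (3 * D)).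
have d0 : 0 < d by rewrite lt_min ltr01 divr_gt0// mulr_gt0.
have d1 : d <= 1 by rewrite ge_min lexx.
have d2 : d * (3 * D) <= e by rewrite -ler_pdivlMr ?mulr_gt0// ge_min lexx orbT.
apply: filterS2 (hf _ d0) (hg _ d0) => t h1 h2 x Sx.
have -> : f t x * g t x - l x * m x =
  (f t x - l x) * (g t x - m x) + ((f t x - l x) * m x + l x * (g t x - m x)) by ring.
have hl : normc (l x) <= D.
  by rewrite (le_trans (hB x Sx))// (le_trans (ler_norm _))// /D -addrA lerDl addr_ge0.
have hm : normc (m x) <= D.
  by rewrite (le_trans (hB' x Sx))// (le_trans (ler_norm _))// /D; have := normr_ge0 B; lra.
have a1 := h1 x Sx; have a2 := h2 x Sx.
have n1 := normc_ge0 (f t x - l x); have n2 := normc_ge0 (g t x - m x).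
have n3 := normc_ge0 (l x); have n4 := normc_ge0 (m x).
rewrite (le_lt_trans (normc_add _ _))// normc_mul.
have h3 := normc_add ((f t x - l x) * m x) (l x * (g t x - m x)).
rewrite !(normc_mul) in h3.
have b1 : normc (f t x - l x) * normc (g t x - m x) < d * D.
  by apply: ltr_pM => //; rewrite (lt_le_trans a2)// (le_trans d1).
have b2 : normc (f t x - l x) * normc (m x) <= d * D by rewrite ler_pM// ltW.
have b3 : normc (l x) * normc (g t x - m x) <= D * d by rewrite ler_pM// ltW.
lra.
Qed.

Lemma cbounded_cst (c : R[i]) : cbounded (fun=> c).
Proof. by exists (normc c). Qed.

Lemma cbounded_add l m : cbounded l -> cbounded m -> cbounded (fun x => l x + m x).
Proof.
move=> [B hB] [B' hB']; exists (B + B') => x Sx.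
by rewrite (le_trans (normc_add _ _))// lerD ?hB ?hB'.
Qed.

Lemma cbounded_mul l m : cbounded l -> cbounded m -> cbounded (fun x => l x * m x).
Proof.
move=> [B hB] [B' hB']; exists (B * B') => x Sx.
by rewrite normc_mul ler_pM ?normc_ge0 ?hB ?hB'.
Qed.

Lemma uclim_near f g l : (\forall t \near F, forall x, S x -> f t x = g t x) ->
  uclim f l -> uclim g l.
Proof.
move=> fg h e e0; apply: filterS2 fg (h e e0) => t h1 h2 x Sx.
by rewrite -h1// h2.
Qed.

Lemma uclim_pt f l x : S x -> uclim f l -> clim F (f ^~ x) (l x).
Proof. by move=> Sx h; apply/climP => e e0; apply: filterS (h e e0) => t; apply. Qed.

(** By cexp(a) - cexp(b) = cexp(b) (cexp(a - b) - 1), uniform convergence follows from continuity at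
    0 and boundedness of the limit. The filter [G] of neighbourhoods of 0 extracts that continuity
    from [clim_cexp]. *)
Lemma uclim_cexp f l : cbounded l -> uclim f l ->
  uclim (fun t x => cexp (f t x)) (fun x => cexp (l x)).
Proof.
move=> [B hB] hf e e0.
pose G := filter_from [set d : R | 0 < d] (fun d => [set z : R[i] | normc z < d]).
have FG : Filter G.
  apply: filter_from_filter; first by exists 1; exact: ltr01.
  move=> d d' d0 d0'; exists (Num.min d d'); first by rewrite /= lt_min d0.
  by move=> z /=; rewrite lt_min => /andP[].
have H : clim G id (0 : R[i]).
  by apply/climP => d d0; exists d => // z; rewrite /= subr0.
have H1 : clim G (fun z => cexp z) (cexp 0) by exact: clim_cexp.
rewrite cexp0 in H1; move/climP: H1 => H1.
have eB : 0 < e / expR B by rewrite divr_gt0// expR_gt0.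
have [d d0 hd] := H1 _ eB.
apply: filterS (hf d d0) => t ht x Sx.
have -> : cexp (f t x) - cexp (l x) = cexp (l x) * (cexp (f t x - l x) - 1).
  by rewrite mulrBr mulr1 -cexpD [l x + _]addrC subrK.
rewrite normc_mul normc_cexp.
have h1 : normc (cexp (f t x - l x) - 1) < e / expR B by apply: hd; exact: ht.
apply: (@le_lt_trans _ _ (expR B * normc (cexp (f t x - l x) - 1))).
  by rewrite ler_wpM2r ?normc_ge0// ler_expR (le_trans _ (hB x Sx))// (le_trans (ler_norm _))// Re_le_normc.
by rewrite mulrC -ltr_pdivlMr ?expR_gt0.
Qed.

End UniformLimits.

Section LimitingAbsorption.
Context {R : realType}.
Variable gamma : R.
Notation mu := (@lebesgue_measure R).
Notation P := (@hline R).

Variables (kap : R -> R[i]) (k0 : R[i]) (C0 : R).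
Hypothesis kap_cvg : clim 0^'+ kap k0.
Hypothesis k0_Im : complex.Im k0 != 0.
Hypothesis kap_Im : forall e : R, 0 < e -> complex.Im (kap e) != 0.

Hypothesis C0_ge0 : 0 <= C0.
Hypothesis h0_le : forall t, 0 < t -> normc (hfun gamma k0 t) <= C0 * (1 + t).
Hypothesis he_le : forall e t : R, 0 < e -> 0 < t -> normc (hfun gamma (kap e) t) <= C0 * (1 + t).

(** Controls the variation of the moments for all [r >= a] at once, since [gk r t <= gk a t]; being
    independent of [r], it can be sent to 0 by dominated convergence. *)
Let gap (j : nat) (a e : R) : R :=
  \int[mu]_(t in P) (gk a t * t ^+ (2 * j) * normc (hfun gamma (kap e) t - hfun gamma k0 t)).

Let dom j a t : R := 2 * C0 * (gk a t * t ^+ (2 * j)) + 2 * C0 * (gk a t * t ^+ (2 * j).+1).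

Let diff_le e t : 0 < e -> 0 < t ->
  normc (hfun gamma (kap e) t - hfun gamma k0 t) <= 2 * C0 * (1 + t).
Proof.
move=> e0 t0; rewrite (le_trans (normc_sub _ _))// -[2]natr1 mulrDl mul1r mulrDl lerD//.
- exact: he_le.
- exact: h0_le.
Qed.

Let gap_integrand_le j a e t : 0 < e -> 0 < t ->
  `|gk a t * t ^+ (2 * j) * normc (hfun gamma (kap e) t - hfun gamma k0 t)| <= dom j a t.
Proof.
move=> e0 t0; have g0 : 0 <= gk a t * t ^+ (2 * j) by rewrite mulr_ge0 ?gk_ge0 ?exprn_ge0 ?(ltW t0).
rewrite ger0_norm; last by apply: mulr_ge0 => //; exact: normc_ge0.
rewrite (le_trans (ler_wpM2l g0 (diff_le e0 t0)))//.
by rewrite /dom exprS le_eqVlt; apply/orP; left; apply/eqP; ring.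
Qed.

Let gap_measurable j a e : 0 < e ->
  measurable_fun P (fun t => gk a t * t ^+ (2 * j) * normc (hfun gamma (kap e) t - hfun gamma k0 t)).
Proof.
move=> e0; have ei := kap_Im e0.
apply: measurable_funM; first exact: measurable_gkX.
apply: cts_measurable_hline => t t0.
exact: (cd_normc_continuous (cd_sub (hfun_cd gamma ei t0) (hfun_cd gamma k0_Im t0))).
Qed.

Let gap_cvg j a : 0 < a -> gap j a @ 0^'+ --> (0 : R).
Proof.
move=> a0; apply/cvg_at_rightP => u [u0 uc].
have idom : mu.-integrable P (EFin \o dom j a) by exact: integrable_gkX2.
pose f n t := gk a t * t ^+ (2 * j) * normc (hfun gamma (kap (u n)) t - hfun gamma k0 t).
have := @dominated_convergence _ _ _ mu P measurable_hline (fun n => EFin \o f n) (EFin \o (fun=> 0)) (EFin \o dom j a).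
case.
- by move=> n; apply/measurable_EFinP; exact: gap_measurable.
- by apply/measurable_EFinP; exact: measurable_cst.
- apply/aeW => t; rewrite hlineE => t0; apply: cvg_EFin; first exact: nearW.
  have ku : clim \oo (fun n => kap (u n)) k0.
    apply/clim_ReIm; have [h1 h2] := (clim_ReIm _ _).1 kap_cvg.
    move/cvg_at_rightP: h1 => /(_ u (conj u0 uc)) h1.
    by move/cvg_at_rightP: h2 => /(_ u (conj u0 uc)) h2.
  have s0 : 0 < t ^+ 2 by rewrite exprn_gt0.
  have hh : clim \oo (fun n => hfun gamma (kap (u n)) t) (hfun gamma k0 t).
    by apply: clim_mull; exact: gfun_clim.
  rewrite /f /= -[X in _ --> X](mulr0 (gk a t * t ^+ (2 * j))); apply: cvgM; first exact: cvg_cst.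
  exact: hh.
- exact: idom.
- by apply/aeW => t n; rewrite hlineE => t0; rewrite /= lee_fin gap_integrand_le.
move=> ih _ cv; have E : (\int[mu]_(x in P) ((EFin \o (fun=> 0%R : R)) x) = 0%:E)%E by apply: integral0_eq.
by rewrite E in cv; exact: (fine_cvg cv).
Qed.

Lemma moment_uclim j (a b : R) : 0 < a ->
  uclim 0^'+ [set r | a <= r <= b] (fun e => moment (hfun gamma (kap e)) j) (moment (hfun gamma k0) j).
Proof.
move=> a0 e e0.
have e2 : 0 < e / 2 by rewrite divr_gt0.
move/cvgrPdist_lt: (gap_cvg j a0) => /(_ _ e2) hg.
near=> x; have x0 : 0 < x by [].
have xi := kap_Im x0.
move=> r /andP[ar rb]; have r0 : 0 < r := lt_le_trans a0 ar.
have m1 := hfun_cmeasurable gamma xi; have m0 := hfun_cmeasurable gamma k0_Im.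
have hx t : 0 < t -> normc (hfun gamma (kap x) t) <= C0 * (1 + t) by move=> t0; exact: he_le.
have i1 := moment_integrable m1 hx j r0.
have i0 := moment_integrable m0 h0_le j r0.
have i0' := cintegrable_mull measurable_hline (-1) i0.
have E : moment (hfun gamma (kap x)) j r - moment (hfun gamma k0) j r = cintegral mu P (fun t =>
   (gk r t * t ^+ (2 * j))%:C * hfun gamma (kap x) t + -1 * ((gk r t * t ^+ (2 * j))%:C * hfun gamma k0 t)).
  by rewrite cintegral_add// cintegral_mull// mulN1r.
have ig : mu.-integrable P (EFin \o (fun t => gk a t * t ^+ (2 * j) * normc (hfun gamma (kap x) t - hfun gamma k0 t))).
  have id : mu.-integrable P (EFin \o dom j a) by exact: integrable_gkX2.
  apply: (dominated_integrable measurable_hline (gap_measurable j a x0) _ id).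
  by move=> t; rewrite hlineE; exact: gap_integrand_le.
have := normc_cintegral_le measurable_hline (cintegrable_add measurable_hline i1 i0') ig.
rewrite E => H; apply: (le_lt_trans (H _)).
  move=> t; rewrite hlineE => t0.
  have -> : (gk r t * t ^+ (2 * j))%:C * hfun gamma (kap x) t + -1 * ((gk r t * t ^+ (2 * j))%:C * hfun gamma k0 t)
    = (gk r t * t ^+ (2 * j))%:C * (hfun gamma (kap x) t - hfun gamma k0 t) by ring.
  rewrite normc_mul normc_real ger0_norm ?mulr_ge0 ?gk_ge0 ?exprn_ge0 ?(ltW t0)//.
  rewrite ler_wpM2r ?normc_ge0// ler_wpM2r ?exprn_ge0 ?(ltW t0)//.
  by rewrite /gk ler_expR lerN2 ler_wpM2r ?sqr_ge0.
have : `|0 - gap j a x| < e / 2 by near: x.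
rewrite sub0r normrN => /(le_lt_trans (ler_norm _)).
by rewrite /gap; lra.
Unshelve. all: end_near. Qed.

Lemma phi0_uclim (a b : R) : 0 < a ->
  uclim 0^'+ [set r | a <= r <= b] (fun e => phi0 gamma (kap e)) (phi0 gamma k0) /\
  uclim 0^'+ [set r | a <= r <= b] (fun e => dphi0 gamma (kap e)) (dphi0 gamma k0).
Proof.
move=> a0; set S := [set r | a <= r <= b].
have um j := @moment_uclim j a b a0.
have ur : uclim 0^'+ S (fun (e : R) r => r%:C) (fun r => r%:C) by exact: uclim_const.
have br : cbounded S (fun r => r%:C : R[i]).
  by exists `|b| => r /andP[ar rb]; rewrite normc_real ger0_norm ?(le_trans (ltW a0))// (le_trans rb)// ler_norm.
have bm j : cbounded S (moment (hfun gamma k0) j).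
  have cc : {within `[a, b], continuous (fun r => normc (moment (hfun gamma k0) j r))}.
    apply: continuous_in_subspaceT => r /set_mem; rewrite /= in_itv/= => /andP[ar rb].
    have r0 : 0 < r := lt_le_trans a0 ar.
    exact: (cd_normc_continuous (moment_cd (hfun_cmeasurable gamma k0_Im) h0_le j r0)).
  have [ab|ba] := leP a b; last first.
    by exists 0 => r /andP[ar rb]; have := lt_le_trans ba (le_trans ar rb); rewrite ltxx.
  have [c _ hc] := EVT_max ab cc; exists (normc (moment (hfun gamma k0) j c)) => r Sr.
  by apply: hc; rewrite in_itv.
have uk : uclim 0^'+ S (fun (e : R) (r : R) => - kap e) (fun=> - k0).
  by apply: uclim_scalar; exact: clim_opp.
have bk : cbounded S (fun r : R => - k0) by exact: cbounded_cst.
have ue : uclim 0^'+ S (fun e r => cexp (- (kap e * r%:C))) (fun r => cexp (- (k0 * r%:C))).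
  have be : cbounded S (fun r => cexp (- (k0 * r%:C))).
    exists (expR (normc k0 * `|b|)) => r /andP[ar rb]; rewrite normc_cexp ler_expR.
    rewrite (le_trans (ler_norm _))// (le_trans (Re_le_normc _))// normc_opp normc_mul normc_real.
    rewrite ler_wpM2l ?normc_ge0// ger0_norm ?(le_trans (ltW a0))//.
    by rewrite (le_trans rb)// ler_norm.
  apply: uclim_cexp => //.
    exists (normc k0 * `|b|) => r /andP[ar rb]; rewrite normc_opp normc_mul normc_real.
    by rewrite ler_wpM2l ?normc_ge0// ger0_norm ?(le_trans (ltW a0))// (le_trans rb)// ler_norm.
  have H : uclim 0^'+ S (fun e r => - kap e * r%:C) (fun r => - k0 * r%:C) by exact: uclim_mul.
  by move=> e e0; apply: filterS (H e e0) => x h r Sr; have := h r Sr; rewrite !mulNr.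
have be : cbounded S (fun r => cexp (- (k0 * r%:C))).
  exists (expR (normc k0 * `|b|)) => r /andP[ar rb]; rewrite normc_cexp ler_expR.
  rewrite (le_trans (ler_norm _))// (le_trans (Re_le_normc _))// normc_opp normc_mul normc_real.
  by rewrite ler_wpM2l ?normc_ge0// ger0_norm ?(le_trans (ltW a0))// (le_trans rb)// ler_norm.
have ugm j : uclim 0^'+ S (fun t x => x%:C * moment (hfun gamma (kap t)) j x)
  (fun x => x%:C * moment (hfun gamma k0) j x) by exact: uclim_mul.
have bgm := cbounded_mul br (bm 0).
split; first exact: uclim_mul.
have bN1 : cbounded S (fun r => (-1 : R[i])) by exact: cbounded_cst.
have uN1 : uclim 0^'+ S (fun (_ : R) r => (-1 : R[i])) (fun=> -1) by exact: uclim_const.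
have ug1 : uclim 0^'+ S (fun t x => -1 * (x%:C * moment (hfun gamma (kap t)) 1 x))
  (fun x => -1 * (x%:C * moment (hfun gamma k0) 1 x)).
  by apply: uclim_mul => //; exact: cbounded_mul.
have bg1 := cbounded_mul bN1 (cbounded_mul br (bm 1)).
have H : uclim 0^'+ S (fun t x => cexp (- (kap t * x%:C)) *
    (- kap t * (x%:C * moment (hfun gamma (kap t)) 0 x)
     + (moment (hfun gamma (kap t)) 0 x + -1 * (x%:C * moment (hfun gamma (kap t)) 1 x))))
   (fun x => cexp (- (k0 * x%:C)) * (- k0 * (x%:C * moment (hfun gamma k0) 0 x)
     + (moment (hfun gamma k0) 0 x + -1 * (x%:C * moment (hfun gamma k0) 1 x)))).
  apply: uclim_mul => //.
    by apply: cbounded_add; [exact: cbounded_mul|exact: cbounded_add].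
  by apply: uclim_add; [exact: uclim_mul|exact: uclim_add].
move=> e e0; apply: filterS (H e e0) => x hx r Sr; have := hx r Sr.
by rewrite /dphi0 !mulN1r.
Qed.
End LimitingAbsorption.

(** * Independence of the two solutions at positive energy *)

Section RealEnergy.
Context {R : realType}.
Variable gamma : R.
Hypothesis gamma_gt0 : 0 < gamma.

(* The energy [|f'|^2 + (q + 2 gamma / r) |f|^2] loses at most the factor
   [exp (2 gamma / (q s))] after [s]. *)
Lemma rsol_energy_lower (q : R) f df (s : R) : 0 < q -> rsol gamma 0 (q%:C) f df ->
  0 < s -> f s != 0 -> exists2 c : R, 0 < c &
  forall r, s <= r -> c <= normc (df r) ^+ 2 + (q + 2 * gamma / s) * normc (f r) ^+ 2.
Proof.
move=> q0 hf s0 fs.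
pose V (r : R) := q + 2 * gamma * r^-1.
pose N2 (g : R -> R[i]) r := complex.Re (g r) ^+ 2 + complex.Im (g r) ^+ 2.
pose E r := N2 df r + V r * N2 f r.
pose c := 2 * gamma / q.
(* [dE] is at least [- c / r ^ 2] times [E], so the integrating factor exp(- c / r) makes [G]
   nondecreasing. *)
pose G r := E r * expR (- (c * r^-1)).
pose dE r := - (2 * gamma * r^-1 ^+ 2) * N2 f r.
have iV r : 0 < r -> is_derive (r : R^o) 1 (fun y : R^o => y^-1) (- r^-1 ^+ 2).
  by move=> r0; apply: is_derive_eq; [apply: is_deriveV; rewrite gt_eqF|rewrite /GRing.scale/= mulr1 exprVn].
have N2_d (g dg : R -> R[i]) (r : R) : cd (g : R^o -> R[i]) r 1 (dg r) ->
    is_derive (r : R^o) 1 (N2 g : R^o -> R^o) (2 * (complex.Re (g r) * complex.Re (dg r) + complex.Im (g r) * complex.Im (dg r))).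
  by move=> [h1 h2]; apply: is_derive_eq; rewrite /GRing.scale/=; ring.
have E_d r : 0 < r -> is_derive (r : R^o) 1 (E : R^o -> R^o) (dE r).
  move=> r0; have [f1 f2] := hf r r0.
  have i0 := iV r r0.
  have n1 := N2_d _ _ _ f1.
  have n2 := N2_d df (fun r => potential gamma 0 q%:C r * f r) _ f2.
  apply: is_derive_eq; rewrite /GRing.scale/= /dE /N2 /V /potential mul0n mul0r sub0r.
  have -> : - (2 * gamma%:C * (r^-1)%:C) - q%:C = (- (V r))%:C :> R[i].
    rewrite /V -[2 : R[i]](rmorph_nat (real_complex R) 2) -!rmorphM -rmorphN -rmorphB.
    by congr (_%:C); ring.
  by rewrite cReM cImM /V /=; ring.
have G_d r : 0 < r -> is_derive (r : R^o) 1 (G : R^o -> R^o) ((dE r + c * r^-1 ^+ 2 * E r) * expR (- (c * r^-1))).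
  move=> r0; have e1 := E_d r r0; have i0 := iV r r0.
  by apply: is_derive_eq; rewrite /GRing.scale/=; ring.
have N2_ge0 g r : 0 <= N2 g r by rewrite addr_ge0 ?sqr_ge0.
have V_gt r : 0 < r -> q <= V r.
  by move=> r0; rewrite /V lerDl !mulr_ge0 ?invr_ge0 ?(ltW r0) ?(ltW gamma_gt0).
have dG_ge0 r : 0 < r -> 0 <= (dE r + c * r^-1 ^+ 2 * E r) * expR (- (c * r^-1)).
  move=> r0; rewrite mulr_ge0 ?expR_ge0//.
  have h : q * N2 f r <= E r.
    by rewrite /E (le_trans (ler_wpM2r (N2_ge0 f r) (V_gt r r0)))// lerDr.
  have c0 : 0 <= c * r^-1 ^+ 2 by rewrite mulr_ge0 ?sqr_ge0// divr_ge0 ?mulr_ge0 ?(ltW q0) ?(ltW gamma_gt0).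
  have := ler_wpM2l c0 h.
  have -> : c * r^-1 ^+ 2 * (q * N2 f r) = - dE r.
    by rewrite /dE /c; field; rewrite ?gt_eqF.
  by rewrite lerNl -subr_ge0 opprK addrC.
have G_mono r : s <= r -> G s <= G r.
  rewrite le_eqVlt => /predU1P[->//|sr].
  have [||x xI] := @MVT R G (fun r => (dE r + c * r^-1 ^+ 2 * E r) * expR (- (c * r^-1))) s r sr.
  - by move=> x /[!in_itv]/= /andP[rx _]; apply: G_d; exact: lt_trans rx.
  - apply: derivable_within_continuous => x /[!in_itv]/= /andP[rx _].
    by case: (G_d x (lt_le_trans s0 rx)).
  move=> h; rewrite -subr_ge0 h mulr_ge0 ?subr_ge0 ?(ltW sr)// dG_ge0//.
  by move: xI; rewrite in_itv/= => /andP[sx _]; exact: lt_trans sx.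
have Nn g r : N2 g r = normc (g r) ^+ 2 by rewrite normc_sqr.
exists (G s).
  rewrite /G mulr_gt0 ?expR_gt0// /E ltr_wpDl ?N2_ge0// mulr_gt0//.
    by rewrite (lt_le_trans q0)// V_gt.
  by rewrite Nn exprn_gt0// normc_gt0.
move=> r sr; apply: (le_trans (G_mono r sr)).
have r0 : 0 < r := lt_le_trans s0 sr.
have E0 : 0 <= E r by rewrite /E addr_ge0 ?mulr_ge0// (le_trans (ltW q0))// V_gt.
rewrite /G (@le_trans _ _ (E r))//.
  by rewrite ler_piMr// expR_le1 oppr_le0 mulr_ge0 ?invr_ge0 ?(ltW r0)// divr_ge0 ?mulr_ge0 ?(ltW q0) ?(ltW gamma_gt0).
rewrite /E !Nn lerD2l ler_wpM2r ?sqr_ge0// /V lerD2l ler_wpM2l ?mulr_ge0 ?(ltW gamma_gt0)//.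
by rewrite lef_pV2.
Qed.

(** For imaginary [k] the exponent [gamma / k] is imaginary and exp(- k r) has modulus 1, so the
    amplitude is bounded and its derivative is of order [1 / r]. The second estimate is Sommerfeld's
    radiation condition, with the sign of [k]. *)
Lemma phi0_imaginary_bounds (k : R[i]) : complex.Re k = 0 -> complex.Im k != 0 ->
  exists2 C : R, 0 < C & forall r : R, 1 <= r ->
    normc (phi0 gamma k r) <= C /\ normc (dphi0 gamma k r + k * phi0 gamma k r) <= C / r.
Proof.
move=> kR k0.
pose Bd := normc (gamma%:C / k) + normc (2 * k).
have hB : normc (gamma%:C / k) <= Bd by rewrite lerDl normc_ge0.
have kB : normc (2 * k) <= Bd by rewrite lerDr normc_ge0.
have B0 : 0 <= Bd by rewrite addr_ge0 ?normc_ge0.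
have b0 : 0 < `|2 * complex.Im k| by rewrite normr_gt0 mulf_neq0.
pose C1 := 2 * expR (pi * Bd) * (2 + Bd / `|2 * complex.Im k|).
have c1 : 0 <= C1 by rewrite /C1; pos_tac.
have gk0 : complex.Re (gamma%:C / k) = 0.
  by case: k kR {k0 hB kB Bd B0 b0 C1 c1} => x y /= ->; rewrite !mul0r mulr0 subr0.
have hb' t : 0 < t -> normc (hfun gamma k t) <= C1 * (0 + t).
  move=> t0; rewrite add0r; apply: hfun_leN => //.
  by rewrite gk0 lexx andbT oppr_le0.
have m2 := hfun_cmeasurable gamma k0.
exists (4 * C1 + 1) => [|r r1]; first by rewrite ltr_wpDl// mulr_ge0.
have r0 : 0 < r by rewrite (lt_le_trans _ r1).
have e1 : normc (cexp (- (k * r%:C))) = 1.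
  by rewrite normc_cexp cReN cReM /= kR mul0r mulr0 subrr oppr0 expR0.
have z0 : 0 <= 0 :> R by [].
have rr : (2 * r)^-1 = 2^-1 * r^-1 by rewrite invfM.
have rr2 : (2 * (r / 2))^-1 = r^-1 by rewrite mulrCA divff ?mulr1// pnatr_eq0.
split.
- rewrite /phi0 normc_mul e1 mul1r normc_mul normc_real gtr0_norm//.
  rewrite (le_trans (ler_wpM2l (ltW r0) (moment0_le m2 c1 z0 hb' r0)))//.
  have -> : r * (2 * C1 * (0 * (2 / Num.sqrt r) + (2 * r)^-1)) = C1.
    by rewrite mul0r add0r; field; rewrite lt0r_neq0.
  lra.
- have -> : dphi0 gamma k r + k * phi0 gamma k r =
     cexp (- (k * r%:C)) * (moment (hfun gamma k) 0 r - r%:C * moment (hfun gamma k) 1 r).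
    by rewrite /phi0 /dphi0; ring.
  rewrite normc_mul e1 mul1r (le_trans (moment01_le m2 c1 z0 hb' r0))// rr2 mul0r add0r.
  have : 0 < r^-1 by rewrite invr_gt0.
  nra.
Qed.

Lemma phi0_neq0_near0 (k : R[i]) : good gamma k -> exists2 s : R, 0 < s & phi0 gamma k s != 0.
Proof.
move=> gk; have [h _] := phi0_sing gk.
move/climP: h => /(_ 1 ltr01) h.
have [s [s0 hs]] : exists s : R, 0 < s /\ normc (s%:C ^+ 0 * phi0 gamma k s - (2 * 0 + 1)%:R^-1) < 1.
  have h2 : \forall s \near (0:R)^'+, 0 < s by exact: nbhs_right_gt.
  by have [s hs] := @filter_ex _ (0:R)^'+ _ _ (filterI h2 h); exists s.
exists s => //; apply/eqP => e; move: hs.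
by rewrite e mulr0 sub0r normc_opp muln0 add0n invr1 [normc 1](normc_nat 1) ltxx.
Qed.

(** The energy stays bounded below by [rsol_energy_lower], and the radiation condition makes [dphi0]
    equal to [- k * phi0] up to order [1 / r]; hence the lower bound passes to [phi0] itself. *)
Lemma phi0_imaginary_lower (k : R[i]) : complex.Re k = 0 -> complex.Im k != 0 ->
  exists2 c : R, 0 < c & \forall r \near +oo, c <= normc (phi0 gamma k r) ^+ 2.
Proof.
move=> kR k0.
have gk : good gamma k.
  split=> //; case: k kR {k0} => x y /= ->; rewrite !mul0r mulr0 subr0 normr0 invr_ge0//.
have [C C0 hC] := phi0_imaginary_bounds kR k0.
have [s s0 fs] := phi0_neq0_near0 gk.
pose q := complex.Im k ^+ 2.
have q0 : 0 < q by rewrite exprn_even_gt0.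
have hr : rsol gamma 0 q%:C (phi0 gamma k) (dphi0 gamma k).
  have -> : q%:C = - k ^+ 2; last exact: phi0_rsol.
  by case: k kR @q {k0 gk hC fs q0} => x y /= ->; apply: Cext; rewrite /= ; ring.
have [c c0 hc] := rsol_energy_lower q0 hr s0 fs.
pose K := 2 * normc k ^+ 2 + (q + 2 * gamma / s).
have K0 : 0 < K.
  have : 0 <= 2 * gamma / s by rewrite divr_ge0 ?mulr_ge0 ?(ltW s0) ?(ltW gamma_gt0).
  have : 0 <= 2 * normc k ^+ 2 by rewrite mulr_ge0 ?sqr_ge0.
  by rewrite /K; lra.
exists (c / (2 * K)); first by rewrite divr_gt0// mulr_gt0.
near=> r.
have sr : s <= r by near: r; apply: nbhs_pinfty_ge; rewrite num_real.
have r1 : 1 <= r by near: r; apply: nbhs_pinfty_ge; rewrite num_real.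
have rb : 4 * C ^+ 2 / c <= r by near: r; apply: nbhs_pinfty_ge; rewrite num_real.
have r0 : 0 < r by rewrite (lt_le_trans _ r1).
have [_ h2] := hC r r1.
have h3 := hc r sr.
rewrite ler_pdivrMr ?mulr_gt0//.
set P := normc (phi0 gamma k r) in h3 *.
set D := normc (dphi0 gamma k r) in h3.
set a := normc (dphi0 gamma k r + k * phi0 gamma k r) in h2.
have hD : D <= a + normc k * P.
  rewrite /D /a /P -normc_mul -[normc (k * _)]normc_opp.
  have -> : dphi0 gamma k r = (dphi0 gamma k r + k * phi0 gamma k r) + - (k * phi0 gamma k r) by ring.
  by rewrite (le_trans (normc_add _ _))// addrNK.
have D0 : 0 <= D := normc_ge0 _; have P0 : 0 <= P := normc_ge0 _; have a0 : 0 <= a := normc_ge0 _.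
have n0 : 0 <= normc k * P by rewrite mulr_ge0// normc_ge0.
have hD2 : D ^+ 2 <= 2 * a ^+ 2 + 2 * (normc k * P) ^+ 2.
  have h4 : D ^+ 2 <= (a + normc k * P) ^+ 2 by rewrite ler_pXn2r// nnegrE addr_ge0.
  have := sqr_ge0 (a - normc k * P); move: h4; rewrite sqrrB sqrrD; lra.
have ha : 2 * a ^+ 2 <= c / 2.
  have h5 : a ^+ 2 <= (C / r) ^+ 2.
    by rewrite ler_pXn2r// nnegrE divr_ge0 ?(ltW C0) ?(ltW r0).
  have h6 : (C / r) ^+ 2 <= C ^+ 2 / r.
    rewrite exprMn ler_wpM2l ?sqr_ge0// exprVn lef_pV2 ?posrE ?exprn_gt0//.
    by rewrite expr2 ler_peMl// ltW.
  have h7 : C ^+ 2 / r <= c / 4.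
    rewrite ler_pdivrMr// mulrAC ler_pdivlMr//.
    by move: rb; rewrite ler_pdivrMr// mulrC [c * r]mulrC [_ * 4]mulrC.
  lra.
move: hD2 h3; rewrite exprMn /K; lra.
Unshelve. all: end_near. Qed.

(** Proportional solutions would satisfy the radiation conditions of both signs: with zero
    Wronskian, [2 * k] times the product of the two solutions is a combination of the two radiation
    terms, hence of order [1 / r], against the lower bounds. *)
Lemma wr_phi0_imaginary_neq0 (k : R[i]) : complex.Re k = 0 -> complex.Im k != 0 ->
  wr (phi0 gamma k) (dphi0 gamma k) (phi0 gamma (- k)) (dphi0 gamma (- k)) 1 != 0.
Proof.
move=> kR k0; apply/eqP => w0.
have kR' : complex.Re (- k) = 0 by rewrite cReN kR oppr0.
have k0' : complex.Im (- k) != 0 by rewrite cImN oppr_eq0.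
have gk : good gamma k.
  split=> //; case: k kR {k0 w0 kR' k0'} => x y /= ->; rewrite !mul0r mulr0 subr0 normr0 invr_ge0//.
have s1 := phi0_rsol gk; have s2 := phi0_rsol (good_opp gk); rewrite sqrrN in s2.
have wr0 := wr_eq0_proportional s1 s2 w0.
have [C C0 hC] := phi0_imaginary_bounds kR k0.
have [C' C0' hC'] := phi0_imaginary_bounds kR' k0'.
have [c c0 hc] := phi0_imaginary_lower kR k0.
have [c' c0' hc'] := phi0_imaginary_lower kR' k0'.
have nk : 0 < normc k by rewrite normc_gt0 Im_neq0.
pose d := c * c' * normc k ^+ 2.
have d0 : 0 < d by rewrite !mulr_gt0// exprn_gt0.
suff : \forall r \near (+oo : set_system R), False.
  by move=> /filter_ex[].
near=> r.
have r1 : 1 <= r by near: r; apply: nbhs_pinfty_ge; rewrite num_real.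
have rb : (C * C') ^+ 2 / d + 1 <= r by near: r; apply: nbhs_pinfty_ge; rewrite num_real.
have r0 : 0 < r by rewrite (lt_le_trans _ r1).
have p1 : c <= normc (phi0 gamma k r) ^+ 2 by near: r; exact: hc.
have p2 : c' <= normc (phi0 gamma (- k) r) ^+ 2 by near: r; exact: hc'.
have [b1 b2] := hC r r1; have [b3 b4] := hC' r r1.
have := wr0 r r0; rewrite /wr => e.
have e2 : 2 * k * (phi0 gamma k r * phi0 gamma (- k) r) =
  (dphi0 gamma k r + k * phi0 gamma k r) * phi0 gamma (- k) r
  - phi0 gamma k r * (dphi0 gamma (- k) r + - k * phi0 gamma (- k) r).
  by apply/eqP; rewrite -subr_eq0 -oppr_eq0; apply/eqP; rewrite -e; ring.
move: e2; move: b1 b2 b3 b4 p1 p2.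
move: (phi0 gamma k r) (phi0 gamma (- k) r) (dphi0 gamma k r + _) (dphi0 gamma (- k) r + _).
move=> P M a b b1 b2 b3 b4 p1 p2 e2.
have h1 : normc (2 * k * (P * M)) <= 2 * (C * C') / r.
  rewrite e2 (le_trans (normc_sub _ _))// !normc_mul.
  have h : normc a * normc M <= C / r * C' by rewrite ler_pM// normc_ge0.
  have h' : normc P * normc b <= C * (C' / r) by rewrite ler_pM// normc_ge0.
  lra.
have h2 : normc k * (normc P * normc M) <= C * C' / r.
  move: h1; rewrite normc_mul [normc (P * M)]normc_mul [normc (2 * k)]normc_mul.
  have -> : normc (2 : R[i]) = 2 by rewrite normc_nat.
  lra.
have h3 : d <= (C * C' / r) ^+ 2.
  have h4 : (normc k * (normc P * normc M)) ^+ 2 <= (C * C' / r) ^+ 2.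
    have z : 0 <= normc k * (normc P * normc M) by rewrite !mulr_ge0 ?normc_ge0.
    by rewrite ler_pXn2r// nnegrE// (le_trans z).
  apply: le_trans h4; rewrite !exprMn /d mulrC ler_wpM2l ?sqr_ge0// ler_pM// ltW//.
have : (C * C' / r) ^+ 2 < d.
  rewrite exprMn exprVn ltr_pdivrMr ?exprn_gt0//.
  have h5 : (C * C') ^+ 2 < d * r.
    by rewrite [d * r]mulrC -ltr_pdivrMr//; apply: lt_le_trans rb; rewrite ltrDl.
  apply: (lt_le_trans h5); rewrite ler_wpM2l ?(ltW d0)// expr2 ler_peMl// ltW//.
by rewrite ltNge h3.
Unshelve. all: end_near. Qed.

End RealEnergy.

(** * Paths of [kappa] that reach the imaginary axis from the right half-plane *)

Section LimitingAbsorptionPath.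
Context {R : realType}.
Variable gamma : R.
Hypothesis gamma_gt0 : 0 < gamma.

Lemma clim_normc_le (T : Type) (F : set_system T) {FF : Filter F} (f : T -> R[i]) (l : R[i]) (B : R) :
  clim F f l -> normc l < B -> \forall t \near F, normc (f t) <= B.
Proof.
move=> /clim_normc/cvgrPdist_lt h lB; have d0 : 0 < B - normc l by rewrite subr_gt0.
apply: filterS (h _ d0) => t; rewrite ltr_distlC addrCA subrr addr0 => /andP[_ /ltW]; exact.
Qed.

Variables (kap : R -> R[i]) (k0 : R[i]).
Hypothesis kap_cvg : clim 0^'+ kap k0.
Hypothesis k0_Re : complex.Re k0 = 0.
Hypothesis k0_Im : complex.Im k0 != 0.
Hypothesis kap_Re : forall e, 0 < e -> 0 < complex.Re (kap e).

Let B : R := normc (gamma%:C / k0) + normc (2 * k0) + 1.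
Let b0 : R := `|complex.Im k0|.
(** The quantities on which the constants of [hfun_le] and [hfun_leN] depend, with enough slack to
    hold in a neighbourhood of [k0]; they give one bound [C0] valid along the whole path. *)
Let cond (z : R[i]) : Prop := [/\ b0 <= `|2 * complex.Im z|, `|complex.Re (gamma%:C / z)| <= 2^-1,
  0 <= complex.Re z, normc (gamma%:C / z) <= B & normc (2 * z) <= B].

Let b0_gt0 : 0 < b0. Proof. by rewrite normr_gt0. Qed.
Let B_ge0 : 0 <= B. Proof. by rewrite /B !addr_ge0 ?normc_ge0. Qed.

Let Bb0_ge0 : 0 <= B / b0. Proof. by rewrite divr_ge0 ?(ltW b0_gt0). Qed.

Let gk0 : complex.Re (gamma%:C / k0) = 0.
Proof. by case: k0 k0_Re => x y /= ->; rewrite !mul0r mulr0 subr0. Qed.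

Let cond0 : cond k0.
Proof.
have h1 := normc_ge0 (gamma%:C / k0); have h2 := normc_ge0 (2 * k0).
split; rewrite ?gk0 ?k0_Re ?normr0 ?invr_ge0//.
- by rewrite normrM ger0_norm//; have := b0_gt0; rewrite /b0; lra.
- by rewrite /B; lra.
- by rewrite /B; lra.
Qed.

Let gkap_cvg : clim 0^'+ (fun e => gamma%:C / kap e) (gamma%:C / k0).
Proof. by apply: clim_mull; apply: clim_inv => //; exact: Im_neq0. Qed.

Let cond_near : \forall e \near 0^'+, cond (kap e).
Proof.
have h1 := normc_ge0 (gamma%:C / k0); have h2 := normc_ge0 (2 * k0).
have c2 : clim 0^'+ (fun e => 2 * kap e) (2 * k0) by exact: clim_mull.
have g1 : \forall e \near 0^'+, normc (gamma%:C / kap e) <= B.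
  by apply: clim_normc_le gkap_cvg _; rewrite /B; lra.
have g2 : \forall e \near 0^'+, normc (2 * kap e) <= B.
  by apply: clim_normc_le c2 _; rewrite /B; lra.
have g3 : \forall e \near 0^'+, normc (gamma%:C / kap e - gamma%:C / k0) < 2^-1.
  by move/climP: gkap_cvg; apply; rewrite invr_gt0.
have g4 : \forall e \near 0^'+, normc (2 * kap e - 2 * k0) < b0.
  by move/climP: c2; apply.
near=> e; have e0 : 0 < e by [].
split; [|..].
- have : normc (2 * kap e - 2 * k0) < b0 by near: e; exact: g4.
  move/(le_lt_trans (Im_le_normc _)); rewrite cImD cImN.
  have E z : complex.Im (2 * z) = 2 * complex.Im z :> R.
    by rewrite -(rmorph_nat (real_complex R)) cImM /= mul0r addr0.
  rewrite !E.
  rewrite distrC => /(le_lt_trans (ler_dist_dist _ _)).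
  have -> : `|2 * complex.Im k0| = 2 * b0 by rewrite normrM ger0_norm.
  by move/(le_lt_trans (ler_norm _)); lra.
- have : normc (gamma%:C / kap e - gamma%:C / k0) < 2^-1 by near: e; exact: g3.
  by move/(le_lt_trans (Re_le_normc _)); rewrite cReD cReN gk0 subr0 => /ltW.
- exact/ltW/kap_Re.
- by near: e; exact: g1.
- by near: e; exact: g2.
Unshelve. all: end_near. Qed.

(** Where [cond] fails the path is replaced by its endpoint, so that the uniform bounds hold for
    every [e]; limits at 0 are not affected. *)
Let kap' e : R[i] := if pselect (cond (kap e)) then kap e else k0.

Let cond' e : cond (kap' e).
Proof. by rewrite /kap'; case: pselect. Qed.

Let kap'E : \forall e \near 0^'+, kap' e = kap e.
Proof. by apply: filterS cond_near => e h; rewrite /kap'; case: pselect. Qed.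

Let kap'_cvg : clim 0^'+ kap' k0.
Proof. by apply: clim_near kap_cvg; apply: filterS kap'E => e ->. Qed.

Let cond_Im z : cond z -> complex.Im z != 0.
Proof.
by case=> h _ _ _ _; apply/eqP => z0; move: h; rewrite z0 mulr0 normr0 leNgt b0_gt0.
Qed.

Let cond_pos z : cond z -> 0 <= complex.Re (gamma%:C / z).
Proof.
case=> _ _ + _ _; case: z => x y /= x0; rewrite mul0r subr0 mulr_ge0 ?(ltW gamma_gt0)//.
by rewrite divr_ge0 ?x0// addr_ge0 ?sqr_ge0.
Qed.

Let C0 : R := 2 * expR (pi * B) * (B + 1) + 2 * expR (pi * B) * (2 + B / b0).
Let C0_ge0 : 0 <= C0.
Proof. by rewrite /C0; pos_tac. Qed.

Let cond_le z t : cond z -> 0 < t -> normc (hfun gamma z t) <= C0 * (1 + t).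
Proof.
move=> cz t0; have [h1 h2 h3 h4 h5] := cz.
apply: le_trans (hfun_le (cond_Im cz) t0 _ h4 h5) _.
  by rewrite cond_pos//= (le_trans (ler_norm _)).
by rewrite ler_wpM2r ?addr_ge0 ?(ltW t0)// /C0 lerDl; pos_tac.
Qed.

Let cond_leN z t : cond z -> 0 < t -> normc (hfun gamma (- z) t) <= C0 * (1 + t).
Proof.
move=> cz t0; have [h1 h2 h3 h4 h5] := cz.
have E1 : gamma%:C / - z = - (gamma%:C / z) by rewrite invrN mulrN.
have h6 : normc (gamma%:C / - z) <= B by rewrite E1 normc_opp.
have h7 : normc (2 * - z) <= B by rewrite mulrN normc_opp.
have h8 : b0 <= `|2 * complex.Im (- z)| by rewrite cImN mulrN normrN.
apply: le_trans (hfun_leN b0_gt0 h8 t0 _ h6 h7) _.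
  rewrite E1 cReN oppr_le0 cond_pos// andbT lerN2.
  by rewrite (le_trans (ler_norm _)).
have c0 : 0 <= 2 * expR (pi * B) * (2 + B / b0) by pos_tac.
rewrite (@le_trans _ _ (C0 * t))//.
  by rewrite ler_wpM2r ?(ltW t0)// /C0 lerDr; pos_tac.
by rewrite ler_wpM2l// lerDr.
Qed.

Let cvg_pair (a b : R) : 0 < a ->
  uclim 0^'+ [set r | a <= r <= b] (fun e => phi0 gamma (kap' e)) (phi0 gamma k0) /\
  uclim 0^'+ [set r | a <= r <= b] (fun e => dphi0 gamma (kap' e)) (dphi0 gamma k0).
Proof.
apply: (@phi0_uclim R gamma kap' k0 C0) => //.
- by move=> e _; exact: cond_Im.
- by move=> t t0; exact: cond_le.
- by move=> e t _ t0; exact: cond_le.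
Qed.

Let cvg_pairN (a b : R) : 0 < a ->
  uclim 0^'+ [set r | a <= r <= b] (fun e => phi0 gamma (- kap' e)) (phi0 gamma (- k0)) /\
  uclim 0^'+ [set r | a <= r <= b] (fun e => dphi0 gamma (- kap' e)) (dphi0 gamma (- k0)).
Proof.
apply: (@phi0_uclim R gamma (fun e => - kap' e) (- k0) C0) => //.
- exact: clim_opp.
- by rewrite cImN oppr_eq0.
- by move=> e _; rewrite cImN oppr_eq0; exact: cond_Im.
- by move=> t t0; exact: cond_leN.
- by move=> e t _ t0; exact: cond_leN.
Qed.

Lemma good_near : \forall e \near 0^'+, good gamma (kap e).
Proof. by apply: filterS cond_near => e h; split; [exact: cond_Im|case: h]. Qed.

Lemma phi0_limit (a b : R) : 0 < a ->
  uclim 0^'+ [set r | a <= r <= b] (fun e => phi0 gamma (kap e)) (phi0 gamma k0) /\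
  uclim 0^'+ [set r | a <= r <= b] (fun e => dphi0 gamma (kap e)) (dphi0 gamma k0).
Proof.
move=> a0; have [h1 h2] := cvg_pair b a0.
by split; [apply: uclim_near h1|apply: uclim_near h2]; apply: filterS kap'E => e ->.
Qed.

(** Independence at non-real energy is inherited from the boundary: the Wronskian at [r = 1] is
    continuous up to [k0], where [wr_phi0_imaginary_neq0] applies. *)
Lemma wr_phi0_neq0_near : \forall e \near 0^'+,
  wr (phi0 gamma (kap e)) (dphi0 gamma (kap e)) (phi0 gamma (- kap e)) (dphi0 gamma (- kap e)) 1 != 0.
Proof.
have [h1 h2] := cvg_pair 1 ltr01; have [h3 h4] := cvg_pairN 1 ltr01.
have S1 : [set r : R | 1 <= r <= 1] 1 by rewrite /= lexx.
have H : clim 0^'+ (fun e => wr (phi0 gamma (kap' e)) (dphi0 gamma (kap' e)) (phi0 gamma (- kap' e)) (dphi0 gamma (- kap' e)) 1)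
   (wr (phi0 gamma k0) (dphi0 gamma k0) (phi0 gamma (- k0)) (dphi0 gamma (- k0)) 1).
  apply: clim_sub; apply: clim_mul; [exact: (uclim_pt S1 h2)|exact: (uclim_pt S1 h3)|exact: (uclim_pt S1 h1)|exact: (uclim_pt S1 h4)].
have w0 := wr_phi0_imaginary_neq0 gamma_gt0 k0_Re k0_Im.
have n0 := w0; rewrite -normc_gt0 in n0.
move/climP: H => /(_ _ n0) H.
apply: filterS2 H kap'E => e h E; rewrite E in h; apply/eqP => e0.
by move: h; rewrite e0 sub0r normc_opp ltxx.
Qed.
End LimitingAbsorptionPath.

Section Path.
Context {R : realType}.
Variables (gamma q s : R).
Hypothesis gamma_gt0 : 0 < gamma.
Hypothesis q_gt0 : 0 < q.
Hypothesis s_sqr : s ^+ 2 = 1.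

(* [kpath e] is the square root of [- (q + i s e)] with positive real part *)
Definition kpath (e : R) : R[i] :=
  let m := Num.sqrt (q ^+ 2 + e ^+ 2) in
  Num.sqrt ((m - q) / 2) +i* (- s * Num.sqrt ((m + q) / 2)).

Let m_gt e : e != 0 -> q < Num.sqrt (q ^+ 2 + e ^+ 2).
Proof.
move=> e0; rewrite -[X in X < _]gtr0_norm// -sqrtr_sqr ltr_sqrt ?ltrDl ?exprn_even_gt0//.
by rewrite ltr_pwDl ?sqr_ge0// exprn_gt0.
Qed.

Lemma kpath_Re e : 0 < e -> 0 < complex.Re (kpath e).
Proof. by move=> e0; rewrite /= sqrtr_gt0 divr_gt0// subr_gt0 m_gt// gt_eqF. Qed.

Lemma kpath_sqr e : 0 < e -> kpath e ^+ 2 = - (q +i* (s * e)).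
Proof.
move=> e0; have mq : q < Num.sqrt (q ^+ 2 + e ^+ 2) by rewrite m_gt// gt_eqF.
rewrite /kpath; have : Num.sqrt (q ^+ 2 + e ^+ 2) ^+ 2 = q ^+ 2 + e ^+ 2.
  by rewrite sqr_sqrtr// addr_ge0 ?sqr_ge0.
move: (Num.sqrt (q ^+ 2 + e ^+ 2)) mq => m mq m2.
have x2 : Num.sqrt ((m - q) / 2) ^+ 2 = (m - q) / 2 by rewrite sqr_sqrtr// divr_ge0// subr_ge0 ltW.
have y2 : Num.sqrt ((m + q) / 2) ^+ 2 = (m + q) / 2.
  by rewrite sqr_sqrtr// divr_ge0// addr_ge0 ?(ltW q_gt0)// (le_trans (ltW q_gt0) (ltW mq)).
have xy : 2 * (Num.sqrt ((m - q) / 2) * Num.sqrt ((m + q) / 2)) = e.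
  have p0 : 0 <= 2 * (Num.sqrt ((m - q) / 2) * Num.sqrt ((m + q) / 2)).
    by apply: mulr_ge0 => //; apply: mulr_ge0; exact: sqrtr_ge0.
  apply/eqP; rewrite -(eqrXn2 (ltn0Sn 1) p0 (ltW e0)).
  apply/eqP; rewrite exprMn [(Num.sqrt _ * _) ^+ 2]exprMn x2 y2.
  have -> : e ^+ 2 = m ^+ 2 - q ^+ 2 by rewrite m2; ring.
  by field.
move: (Num.sqrt ((m - q) / 2)) (Num.sqrt ((m + q) / 2)) x2 y2 xy => x y x2 y2 xy.
apply: Cext; rewrite /= -?expr2.
- by rewrite exprMn sqrrN s_sqr mul1r x2 y2; field.
- by rewrite -xy; ring.
Qed.

Lemma kpath_cvg : clim 0^'+ kpath (0 +i* (- s * Num.sqrt q)).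
Proof.
have sc (f : R -> R) l : f @ 0^'+ --> l -> (fun e => Num.sqrt (f e)) @ 0^'+ --> Num.sqrt l.
  by move=> h; apply: continuous_cvg => //; exact: sqrt_continuous.
have hm : (fun e => Num.sqrt (q ^+ 2 + e ^+ 2)) @ 0^'+ --> q.
  rewrite -[X in _ --> X]gtr0_norm// -sqrtr_sqr; apply: sc.
  rewrite -[X in _ --> X]addr0; apply: cvgD; first exact: cvg_cst.
  rewrite -[X in _ --> X](expr0n R 2); apply: cvg_at_right_filter; exact: exprn_continuous.
apply/clim_ReIm; split => /=.
- rewrite [X in _ --> X](_ : 0 = Num.sqrt ((q - q) / 2)); last by rewrite subrr mul0r sqrtr0.
  by apply: sc; apply: cvgM; [apply: cvgB => //; exact: cvg_cst|exact: cvg_cst].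
- apply: cvgM; first exact: cvg_cst.
  have -> : Num.sqrt q = Num.sqrt ((q + q) / 2) by congr Num.sqrt; field.
  by apply: sc; apply: cvgM; [apply: cvgD => //; exact: cvg_cst|exact: cvg_cst].
Qed.

Lemma kpath0_Im : complex.Im (0 +i* (- s * Num.sqrt q)) != 0 :> R.
Proof.
rewrite /= mulf_neq0//; last by rewrite gt_eqF// sqrtr_gt0.
rewrite oppr_eq0.
by apply/eqP => s0; move: s_sqr; rewrite s0 expr0n /= => /eqP; rewrite eq_sym oner_eq0.
Qed.

End Path.

Section RealEmbedding.
Context {R : realType}.
Lemma rC_inv (r : R) : (r^-1)%:C = (r%:C)^-1 :> R[i]. Proof. exact: fmorphV. Qed.
Lemma rC_mul (r s : R) : (r * s)%:C = r%:C * s%:C :> R[i]. Proof. exact: rmorphM. Qed.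
Lemma rC_add (r s : R) : (r + s)%:C = r%:C + s%:C :> R[i]. Proof. exact: rmorphD. Qed.
Lemma rC_X (r : R) n : (r ^+ n)%:C = r%:C ^+ n :> R[i]. Proof. exact: rmorphXn. Qed.
Lemma rC_nat (n : nat) : (n%:R : R)%:C = n%:R :> R[i]. Proof. exact: rmorph_nat. Qed.
Lemma rC_neq0 (r : R) : 0 < r -> r%:C != 0 :> R[i].
Proof. by move=> r0; rewrite -(rmorph0 (real_complex R)) (inj_eq (@complexI R)) gt_eqF. Qed.
End RealEmbedding.

(** * The regular radial solution *)

Section PowerSeries.
Context {R : realType}.
Implicit Types (a b : nat -> R[i]) (z s : R[i]) (r : R).

Definition cser a z s : Prop := clim \oo (fun n => \sum_(k < n) a k * z ^+ k) s.
Definition cdiffs a k : R[i] := k.+1%:R * a k.+1.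
Definition cshift (l : nat) a k : R[i] := if (k < l)%N then 0 else a (k - l)%N.
Definition ecv a : Prop := forall r, exists s, cser a r%:C s.
Definition csum a z : R[i] := xget 0 [set s | cser a z s].

Lemma cser_add a b z s t : cser a z s -> cser b z t -> cser (fun k => a k + b k) z (s + t).
Proof.
move=> h1 h2; have H : clim \oo (fun n => \sum_(k < n) a k * z ^+ k + \sum_(k < n) b k * z ^+ k) (s + t).
  exact: clim_add.
apply: clim_near H; apply: nearW => n; rewrite -big_split /=; apply: eq_bigr => k _.
by rewrite mulrDl.
Qed.

Lemma cser_mull c a z s : cser a z s -> cser (fun k => c * a k) z (c * s).
Proof.
move=> h; have H : clim \oo (fun n => c * \sum_(k < n) a k * z ^+ k) (c * s) by exact: clim_mull.
apply: clim_near H; apply: nearW => n; rewrite mulr_sumr; apply: eq_bigr => k _.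
by rewrite mulrA.
Qed.

Lemma clim_shift (l : nat) (u : nat -> R[i]) s : clim \oo u s <-> clim \oo (fun n => u (n + l)%N) s.
Proof.
rewrite !clim_ReIm; split=> -[h1 h2]; split.
- by rewrite (cvg_shiftn l (fun n => complex.Re (u n))).
- by rewrite (cvg_shiftn l (fun n => complex.Im (u n))).
- by rewrite -(cvg_shiftn l (fun n => complex.Re (u n))).
- by rewrite -(cvg_shiftn l (fun n => complex.Im (u n))).
Qed.

Lemma cshift_sum l a z n :
  \sum_(k < n + l) cshift l a k * z ^+ k = z ^+ l * \sum_(k < n) a k * z ^+ k.
Proof.
rewrite addnC big_split_ord /= [X in X + _]big1 ?add0r; last first.
  by move=> i _; rewrite /cshift ltn_ord mul0r.
rewrite mulr_sumr; apply: eq_bigr => i _.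
by rewrite /cshift ltnNge leq_addr /= addKn exprD mulrCA.
Qed.

Lemma cser_shift l a z s : cser a z s -> cser (cshift l a) z (z ^+ l * s).
Proof.
move=> h; apply/(clim_shift l); under eq_fun do rewrite cshift_sum.
exact: clim_mull.
Qed.

Lemma cser_unshift l a z s : z != 0 -> cser (cshift l a) z s -> cser a z (s / z ^+ l).
Proof.
move=> z0 /(clim_shift l); under eq_fun do rewrite cshift_sum.
move=> h; have H : clim \oo (fun n => (z ^+ l)^-1 * (z ^+ l * \sum_(k < n) a k * z ^+ k)) ((z ^+ l)^-1 * s).
  exact: clim_mull.
rewrite mulrC; apply: clim_near H; apply: nearW => n.
by rewrite mulKf// expf_neq0.
Qed.

Lemma cser_eq a b z s t : (forall k, a k = b k) -> s = t -> cser a z s -> cser b z t.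
Proof.
by move=> e <-; apply: clim_near; apply: nearW => n; apply: eq_bigr => k _; rewrite e.
Qed.

Lemma cser_unique a z s t : cser a z s -> cser a z t -> s = t.
Proof. exact: clim_unique. Qed.

Lemma csumP a z s : cser a z s -> csum a z = s.
Proof.
move=> h; apply: (cser_unique _ h).
by rewrite /csum; case: xgetP => [y _ //|/(_ s)/(_ h)].
Qed.

Lemma cser_csum a r : ecv a -> cser a r%:C (csum a r%:C).
Proof. by move=> /(_ r)[s hs]; rewrite (csumP hs). Qed.

Lemma Re_realX (z : R[i]) r k : complex.Re (z * r%:C ^+ k) = complex.Re z * r ^+ k.
Proof. by rewrite -rmorphXn cReM /= mulr0 subr0. Qed.
Lemma Im_realX (z : R[i]) r k : complex.Im (z * r%:C ^+ k) = complex.Im z * r ^+ k.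
Proof. by rewrite -rmorphXn cImM /= mulr0 add0r. Qed.

Lemma cser_pseries a r s : cser a r%:C s <->
  (pseries (fun k => complex.Re (a k)) r @ \oo --> complex.Re s /\
   pseries (fun k => complex.Im (a k)) r @ \oo --> complex.Im s).
Proof.
rewrite /cser clim_ReIm /pseries /series /=.
under [X in (X @ _ --> _ /\ _) <-> _]eq_fun do rewrite Re_sum.
under [X in (_ /\ X @ _ --> _) <-> _]eq_fun do rewrite Im_sum.
have -> : (fun n : nat => \sum_(i < n) complex.Re (a i * r%:C ^+ i)) =
  (fun n : nat => \sum_(0 <= k < n) complex.Re (a k) * r ^+ k).
  by apply/funext => n; rewrite big_mkord; apply: eq_bigr => i _; rewrite Re_realX.
have -> : (fun n : nat => \sum_(i < n) complex.Im (a i * r%:C ^+ i)) =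
  (fun n : nat => \sum_(0 <= k < n) complex.Im (a k) * r ^+ k).
  by apply/funext => n; rewrite big_mkord; apply: eq_bigr => i _; rewrite Im_realX.
by [].
Qed.

Lemma ecv_pseries a : ecv a <-> forall r,
  cvgn (pseries (fun k => complex.Re (a k)) r) /\ cvgn (pseries (fun k => complex.Im (a k)) r).
Proof.
split=> [h r|h r].
  by have [s /cser_pseries[h1 h2]] := h r; split; apply/cvg_ex; eexists; eassumption.
have [h1 h2] := h r; exists (lim (pseries (fun k => complex.Re (a k)) r @ \oo) +i* lim (pseries (fun k => complex.Im (a k)) r @ \oo)).
by apply/cser_pseries.
Qed.

Lemma pseries_diffs_everywhere (c : R^nat) : (forall r : R, cvgn (pseries c r)) ->
  forall r : R, cvgn (pseries (pseries_diffs c) r).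
Proof.
(* The factor 2 pays for the differentiation, since [k.+1 <= 2 ^ k.+1]; the summand 1 provides a
   base that is at least 1. *)
move=> h r; pose y := 2 * (`|r| + 1).
have y1 : 1 <= `|r| + 1 by rewrite lerDr.
have y0 : 0 < y by rewrite mulr_gt0// (lt_le_trans _ y1).
have H : cvgn (pseries (fun i => `|c i|) y).
  apply: (@is_cvg_pseries_inside_norm _ _ (y + 1)) => //.
  by rewrite !gtr0_norm ?ltrDl ?addr_gt0.
apply: normed_cvg.
apply: (@series_le_cvg _ _ (fun k => `|c k.+1| * y ^+ k.+1)) => [k|k|k|].
- exact: normr_ge0.
- by rewrite mulr_ge0 ?exprn_ge0 ?(ltW y0).
- rewrite /= /pseries_diffs normrM normrM normrX ger0_norm// mulrAC mulrC.
  rewrite ler_wpM2l// /y exprMn ler_pM ?exprn_ge0//.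
    by rewrite -natrX ler_nat ltnW// ltn_expl.
  rewrite (@le_trans _ _ ((`|r| + 1) ^+ k))//.
    by rewrite lerXn2r ?nnegrE ?addr_ge0// lerDl.
  by rewrite ler_weXn2l.
- have -> : series (fun k => `|c k.+1| * y ^+ k.+1) =
     (fun n => pseries (fun i => `|c i|) y n.+1 - `|c 0%N|).
    apply/funext => n; rewrite /pseries /series /= big_nat_recl//= expr0 mulr1 addrC addKr.
    by [].
  apply: is_cvgB; last exact: is_cvg_cst.
  by move/cvg_ex : H => [l hl]; apply/cvg_ex; exists l; rewrite (@cvg_shiftS _ (pseries (fun i => `|c i|) y)).
Qed.

Lemma Re_nat (n : nat) z : complex.Re (n%:R * z) = n%:R * complex.Re z.
Proof. by rewrite -(rmorph_nat (real_complex R)) cReM /= mul0r subr0. Qed.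
Lemma Im_nat (n : nat) z : complex.Im (n%:R * z) = n%:R * complex.Im z.
Proof. by rewrite -(rmorph_nat (real_complex R)) cImM /= mul0r addr0. Qed.

Lemma Re_cdiffs a : (fun k => complex.Re (cdiffs a k)) = pseries_diffs (fun k => complex.Re (a k)).
Proof. by apply/funext => k; rewrite /cdiffs Re_nat. Qed.
Lemma Im_cdiffs a : (fun k => complex.Im (cdiffs a k)) = pseries_diffs (fun k => complex.Im (a k)).
Proof. by apply/funext => k; rewrite /cdiffs Im_nat. Qed.

Lemma ecv_cdiffs a : ecv a -> ecv (cdiffs a).
Proof.
move=> /ecv_pseries h; apply/ecv_pseries => r; rewrite Re_cdiffs Im_cdiffs; split.
- by apply: pseries_diffs_everywhere => x; case: (h x).
- by apply: pseries_diffs_everywhere => x; case: (h x).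
Qed.

Lemma csum_cd a r : ecv a ->
  cd (fun r : R^o => csum a r%:C) r 1 (csum (cdiffs a) r%:C).
Proof.
move=> ha; have ha1 := ecv_cdiffs ha; have ha2 := ecv_cdiffs ha1.
have [Kr K0] : `|r| < `|(`|r| + 1)| /\ 0 < `|r| + 1.
  by split; rewrite ?ltr_wpDl// [ltRHS]gtr0_norm ?ltrDl// ltr_wpDl.
have E (b : nat -> R[i]) : ecv b ->
    (fun r : R => complex.Re (csum b r%:C)) = (fun r => limn (pseries (fun k => complex.Re (b k)) r)) /\
    (fun r : R => complex.Im (csum b r%:C)) = (fun r => limn (pseries (fun k => complex.Im (b k)) r)).
  move=> hb; split; apply/funext => x; have /cser_pseries[h1 h2] := cser_csum x hb.
  - by apply/esym/cvg_lim.
  - by apply/esym/cvg_lim.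
have [e1 e2] := E a ha; have [e3 e4] := E _ ha1.
have e3' := congr1 (fun f => f r) e3; have e4' := congr1 (fun f => f r) e4.
rewrite Re_cdiffs in e3'; rewrite Im_cdiffs in e4'.
have /ecv_pseries p0 := ha; have /ecv_pseries p1 := ha1; have /ecv_pseries p2 := ha2.
move: p1 p2; rewrite !Re_cdiffs !Im_cdiffs => p1 p2.
split; rewrite ?e1 ?e2 ?e3' ?e4'.
- by apply: (@pseries_snd_diffs _ _ (`|r| + 1)) => //; [case: (p0 (`|r| + 1))|case: (p1 (`|r| + 1))|case: (p2 (`|r| + 1))].
- by apply: (@pseries_snd_diffs _ _ (`|r| + 1)) => //; [case: (p0 (`|r| + 1))|case: (p1 (`|r| + 1))|case: (p2 (`|r| + 1))].
Qed.

Lemma csum0 a : csum a 0 = a 0%N.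
Proof.
apply: csumP; apply/(clim_shift 1).
have H : clim \oo (fun=> a 0%N) (a 0%N) by exact: clim_cst.
apply: clim_near H.
apply: nearW => n; rewrite addn1 big_ord_recl /= expr0 mulr1 big1 ?addr0// => i _.
by rewrite exprS mul0r mulr0.
Qed.

Lemma cser_fact_bound a (M : R) : (forall k, normc (a k) <= M ^+ k / k`!%:R) ->
  forall z, exists s, cser a z s.
Proof.
move=> h z; pose x := M * normc z.
have M0 : 0 <= M.
  by have := le_trans (normc_ge0 _) (h 1%N); rewrite expr1 factS fact0 muln1 divr1.
have x0 : 0 <= x by rewrite mulr_ge0 ?normc_ge0.
have hb k : normc (a k * z ^+ k) <= exp_coeff x k.
  rewrite normc_mul normc_X /exp_coeff /= /x exprMn mulrAC ler_wpM2r ?exprn_ge0 ?normc_ge0//.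
have hR : cvgn (series (fun k => complex.Re (a k * z ^+ k))).
  apply: normed_cvg; apply: (series_le_cvg _ _ _ (is_cvg_series_exp_coeff x)) => k.
  - exact: normr_ge0.
  - by rewrite /exp_coeff /= divr_ge0 ?exprn_ge0.
  - exact: le_trans (Re_le_normc _) (hb k).
have hI : cvgn (series (fun k => complex.Im (a k * z ^+ k))).
  apply: normed_cvg; apply: (series_le_cvg _ _ _ (is_cvg_series_exp_coeff x)) => k.
  - exact: normr_ge0.
  - by rewrite /exp_coeff /= divr_ge0 ?exprn_ge0.
  - exact: le_trans (Im_le_normc _) (hb k).
exists (limn (series (fun k => complex.Re (a k * z ^+ k))) +i* limn (series (fun k => complex.Im (a k * z ^+ k)))).
apply/clim_ReIm; split.
- under eq_fun do rewrite Re_sum.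
  have -> // : (fun n : nat => \sum_(i < n) complex.Re (a i * z ^+ i)) = series (fun k => complex.Re (a k * z ^+ k)).
  by apply/funext => n; rewrite /series /= big_mkord.
- under eq_fun do rewrite Im_sum.
  have -> // : (fun n : nat => \sum_(i < n) complex.Im (a i * z ^+ i)) = series (fun k => complex.Im (a k * z ^+ k)).
  by apply/funext => n; rewrite /series /= big_mkord.
Qed.
End PowerSeries.

Section Frobenius.
Context {R : realType}.
Variables (gamma : R) (l : nat) (lam : R[i]).

(* consecutive Frobenius coefficients: [(b_(k-1), b_k)] *)
Fixpoint frob_pair (k : nat) : R[i] * R[i] :=
  if k is k'.+1 then
    let p := frob_pair k' in
    (p.2, - (2 * gamma%:C * p.2 + lam * p.1) / (k'.+1%:R * (k' + 2 * l + 2)%:R))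
  else (0, 1).
Definition frob k := (frob_pair k).2.

Lemma frob_rec k : k.+1%:R * (k + 2 * l + 2)%:R * frob k.+1 =
  - (2 * gamma%:C * frob k + lam * cshift 1 frob k).
Proof.
have -> : cshift 1 frob k = (frob_pair k).1.
  by rewrite /cshift; case: k => //= k; rewrite subn1.
by rewrite /frob /= mulrC divfK// mulf_neq0 ?pnatr_eq0// addn2.
Qed.

Let M : R := 2 * `|gamma| + normc lam + 1.

(** In the recursion one denominator builds the factorial; the other, [k + 2 * l + 2], pays for the
    older coefficient, whose bound lacks a factor of order [k]. A factorial bound makes the series
    entire. *)
Lemma frob_bound k : normc (frob_pair k.+1).1 <= M ^+ k / k`!%:R /\
  normc (frob k.+1) <= M ^+ k.+1 / k.+1`!%:R.
Proof.
have M1 : 1 <= M by rewrite /M lerDr addr_ge0 ?normc_ge0// mulr_ge0.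
have M0 : 0 <= M by rewrite (le_trans _ M1).
have key (j : nat) : normc (frob_pair j).2 <= M ^+ j / j`!%:R ->
    normc (frob_pair j).1 <= (M ^+ j / j`!%:R) * j.+1%:R ->
    normc (frob j.+1) <= M ^+ j.+1 / j.+1`!%:R.
  move=> h2 h1; rewrite /frob /= normc_mul normc_opp normc_inv normc_mul !normc_nat.
  rewrite ler_pdivrMr ?mulr_gt0 ?ltr0n ?addn2//.
  set B := M ^+ j / j`!%:R in h1 h2.
  have B0 : 0 <= B by rewrite divr_ge0 ?exprn_ge0.
  have -> : M ^+ j.+1 / j.+1`!%:R * (j.+1%:R * (j + 2 * l).+2%:R) = M * B * (j + 2 * l).+2%:R.
    rewrite /B factS natrM exprS invfM; field.
    by rewrite nat1r !pnatr_eq0 /= -lt0n fact_gt0.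
  have hn : (j.+1%:R : R) <= (j + 2 * l).+2%:R by rewrite ler_nat ltnS ltnW// ltnS leq_addr.
  have hn1 : (1 : R) <= (j + 2 * l).+2%:R by rewrite (ler_nat R 1).
  rewrite (le_trans (normc_add _ _))// !normc_mul normc_real (normc_nat 2).
  have p1 : 2 * `|gamma| * normc (frob_pair j).2 <= 2 * `|gamma| * (B * (j + 2 * l).+2%:R).
    by rewrite ler_wpM2l ?mulr_ge0// (le_trans h2)// ler_peMr.
  have p2 : normc lam * normc (frob_pair j).1 <= normc lam * (B * (j + 2 * l).+2%:R).
    by rewrite ler_wpM2l ?normc_ge0// (le_trans h1)// ler_wpM2l.
  have p3 : 0 <= B * (j + 2 * l).+2%:R by rewrite mulr_ge0.
  rewrite (le_trans (lerD p1 p2))// -mulrDl -mulrA ler_wpM2r// /M; lra.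
elim: k => [|k [IH1 IH2]].
  have e : normc (frob_pair 0).2 <= M ^+ 0 / 0`!%:R.
    by rewrite expr0 fact0 invr1 mulr1 (_ : (frob_pair 0).2 = 1%:R)// normc_nat.
  split=> //; apply: key => //.
  by rewrite -[(frob_pair 0).1]/(0%:R) normc_nat expr0 fact0 divr1 mulr1.
split=> //; apply: key => //; apply: (le_trans IH1).
rewrite factS natrM exprS invfM.
have f0 : (0 : R) < k`!%:R by rewrite ltr0n fact_gt0.
have -> : M * M ^+ k * (k.+1%:R^-1 * k`!%:R^-1) * k.+2%:R = M ^+ k / k`!%:R * (M * (k.+2%:R / k.+1%:R)).
  by ring.
have B0 : 0 <= M ^+ k / k`!%:R by rewrite divr_ge0 ?exprn_ge0 ?(ltW f0).
rewrite ler_peMr//.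
rewrite -[leLHS]mulr1 ler_pM// ler_pdivlMr// mul1r ler_nat//.
Qed.

Lemma frob_cser z : exists s, cser frob z s.
Proof.
apply: (@cser_fact_bound _ _ M) => -[|k]; last by case: (frob_bound k).
by rewrite expr0 fact0 invr1 mulr1 (_ : frob 0 = 1%:R)// normc_nat.
Qed.

Lemma frob_ecv : ecv frob. Proof. by move=> r; exact: frob_cser. Qed.

Lemma frob_ode r : r%:C * csum (cdiffs (cdiffs frob)) r%:C + (2 * l + 2)%:R * csum (cdiffs frob) r%:C
  + (2 * gamma%:C + lam * r%:C) * csum frob r%:C = 0.
Proof.
have h0 := cser_csum r frob_ecv; have h1 := cser_csum r (ecv_cdiffs frob_ecv).
have h2 := cser_csum r (ecv_cdiffs (ecv_cdiffs frob_ecv)).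
have H := cser_add (cser_add (cser_shift 1 h2) (cser_mull (2 * l + 2)%:R h1))
  (cser_add (cser_mull (2 * gamma%:C) h0) (cser_mull lam (cser_shift 1 h0))).
apply: (@cser_unique _ (fun=> 0) r%:C); last first.
  have H0 : clim \oo (fun=> 0 : R[i]) 0 by exact: clim_cst.
  apply: clim_near H0; apply: nearW => n.
  by rewrite big1// => i _; rewrite mul0r.
apply: cser_eq H => [k|]; last by rewrite !expr1; ring.
have -> : cshift 1 (cdiffs (cdiffs frob)) k = k%:R * k.+1%:R * frob k.+1.
  rewrite /cshift /cdiffs; case: k => [|k] /=; first by rewrite !mul0r.
  by rewrite subn1 /= mulrA.
rewrite /cdiffs; have := frob_rec k; rewrite -addnA [(k + _)%:R]natrD => e.
transitivity (k.+1%:R * (k%:R + (2 * l + 2)%:R) * frob k.+1 + (2 * gamma%:C * frob k + lam * cshift 1 frob k)).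
  by move: (k.+1%:R) ((2 * l + 2)%:R) => a c; ring.
by rewrite e addNr.
Qed.

End Frobenius.

Section RegularSolution.
Context {R : realType}.
Variables (gamma : R) (l : nat) (lam : R[i]).

Lemma cd_realX (x : R) n : 0 < x -> cd (fun r : R^o => r%:C ^+ n : R[i]) x 1 (n%:R * x^-1%:C * x%:C ^+ n).
Proof.
move=> x0; have x1 := rC_neq0 x0.
apply: cd_eq (cd_exp n (cd_id (x : R^o))) _; rewrite mulr1.
case: n => [|n]; first by rewrite !mul0r.
rewrite /= [in RHS]exprS rC_inv; move: (x%:C) x1 (n.+1%:R : R[i]) => y y1 a.
by move: (y ^+ n) => b; field.
Qed.

Lemma regular_radial_exists : exists f, is_regular_radial gamma l lam f.
Proof.
pose b := frob gamma l lam.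
pose f z := z ^+ l * csum b z.
have hb z : cser b z (csum b z) by have [s hs] := frob_cser gamma l lam z; rewrite (csumP hs).
have be : ecv b by exact: frob_ecv.
exists f; split.
  exists (cshift l b); split.
  - by move=> k kl; rewrite /cshift kl.
  - by rewrite /cshift ltnn subnn.
  - by move=> z; exact: cser_shift.
pose g r := csum b r%:C; pose g1 r := csum (cdiffs b) r%:C; pose g2 r := csum (cdiffs (cdiffs b)) r%:C.
pose f1 (r : R) := r%:C ^+ l * (l%:R * r^-1%:C * g r + g1 r).
pose f2 (r : R) := r%:C ^+ l * (l%:R * r^-1%:C * (l%:R * r^-1%:C * g r + g1 r) +
   (l%:R * (- r^-1%:C ^+ 2 * g r + r^-1%:C * g1 r) + g2 r)).
have d0 (r : R) : 0 < r -> cd (fun r : R^o => f r%:C) r 1 (f1 r).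
  move=> r0; apply: cd_eq (cd_mul (cd_realX l r0) (csum_cd r be)) _.
  by rewrite /f1 /g /g1; ring.
have d1 (r : R) : 0 < r -> cd (f1 : R^o -> R[i]) r 1 (f2 r).
  move=> r0; have r1 : r != 0 by rewrite gt_eqF.
  have i1 : cd (fun r : R^o => (r^-1)%:C) r 1 (- (r^-1)%:C ^+ 2) by exact: inv_cd.
  apply: cd_eq (cd_mul (cd_realX l r0) (cd_add (cd_mul (cd_mull l%:R i1) (csum_cd r be)) (csum_cd r (ecv_cdiffs be)))) _.
  by rewrite /f2 /g /g1 /g2; ring.
move=> r r0 /=.
have c0 (x : R) : 0 < x -> cderive (1 : R^o) (fun r : R^o => f r%:C) x = f1 x.
  by move=> x0; exact: cd_cderive (d0 x x0).
have d1' : cd (cderive (1 : R^o) (fun r : R^o => f r%:C)) r 1 (f2 r).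
  by apply: cd_Rpos r0 _ (d1 r r0) => y y0; rewrite c0.
split.
- exact: cd_cderivable (d0 r r0).
- exact: cd_cderivable d1'.
- rewrite (cd_cderive d1') c0//.
  have := frob_ode gamma l lam r; rewrite -/b -/(g r) -/(g1 r) -/(g2 r).
  have x1 := rC_neq0 r0.
  have -> : f r%:C = r%:C ^+ l * g r by [].
  rewrite /f2 /f1 rC_inv rC_X !rC_mul rC_nat [(l * l.+1)%:R]natrM natrD natrM -[l.+1%:R]natr1.
  move: (g r) (g1 r) (g2 r) => G G1 G2 e.
  have -> : forall P x : R[i], x != 0 -> x ^+ 2 * (P * (l%:R * x^-1 * (l%:R * x^-1 * G + G1) +
      (l%:R * (- x^-1 ^+ 2 * G + x^-1 * G1) + G2))) + 2 * x * (P * (l%:R * x^-1 * G + G1)) -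
    l%:R * (l%:R + 1) * (P * G) + 2 * gamma%:C * x * (P * G) + lam * x ^+ 2 * (P * G)
    = P * x * (x * G2 + (2 * l%:R + 2) * G1 + (2 * gamma%:C + lam * x) * G).
    by move=> P x x0; field.
  by rewrite e mulr0.
  exact: x1.
Qed.

Definition reg_at0 u du : Prop :=
  clim 0^'+ (fun r : R => u r / r%:C ^+ l.+1) 1 /\ clim 0^'+ (fun r : R => du r / r%:C ^+ l) l.+1%:R.

(** [Freg] is selected by its specification, so the behaviour at 0 of the function and of its
    derivative is read off there: the series is divided by its leading power and differentiated
    termwise. *)
Lemma Freg_rsol : exists du : R -> R[i],
  rsol gamma l lam (fun r => r%:C * Freg gamma l lam r%:C) du /\
  reg_at0 (fun r => r%:C * Freg gamma l lam r%:C) du.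
Proof.
have [[a [a0 al hf]] ode] : is_regular_radial gamma l lam (Freg gamma l lam).
  rewrite /Freg; case: xgetP => // h.
  by have [f hf] := regular_radial_exists; case: (h f).
move: (Freg gamma l lam) hf ode => f hf ode.
pose b k := a (l + k)%N.
have ea k : a k = cshift l b k.
  by rewrite /cshift; case: ltnP => [/a0//|lk]; rewrite /b subnKC.
have hs z : cser (cshift l b) z (f z) by apply: cser_eq (hf z).
have rC (r : R) : 0 < r -> r%:C != 0 :> R[i].
  exact: rC_neq0.
(* Dividing the series by [r ^ l] shows convergence for [r > 0]; convergence at a larger positive
   point then gives it at every real [r]. *)
have be : ecv b.
  apply/ecv_pseries => r.
  have hp x : 0 < x -> cvgn (pseries (fun k => complex.Re (b k)) x) /\ cvgn (pseries (fun k => complex.Im (b k)) x).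
    move=> x0; have /cser_pseries[h1 h2] := cser_unshift (rC x x0) (hs x%:C).
    by split; apply/cvg_ex; eexists; eassumption.
  have x0 : 0 < `|r| + 1 by rewrite ltr_wpDl.
  have [h1 h2] := hp _ x0.
  by split; [apply: is_cvg_pseries_inside h1 _|apply: is_cvg_pseries_inside h2 _];
    rewrite [ltRHS]gtr0_norm// ltrDl.
pose g r := csum b r%:C; pose g1 r := csum (cdiffs b) r%:C.
have fg (r : R) : 0 < r -> f r%:C = r%:C ^+ l * g r.
  move=> r0; rewrite /g (csumP (cser_unshift (rC r r0) (hs r%:C))) mulrC divfK//.
  by rewrite expf_neq0// rC.
have gd r : cd (g : R^o -> R[i]) r 1 (g1 r) by exact: csum_cd.
have gc (h : nat -> R[i]) : ecv h -> clim 0^'+ (fun r : R => csum h r%:C) (h 0%N).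
  move=> he; have [c1 c2] := cd_continuous (csum_cd 0 he).
  rewrite -(csum0 h) -(rmorph0 (real_complex R)).
  by apply/clim_ReIm; split; apply: cvg_at_right_filter; [exact: c1|exact: c2].
have c0 := gc _ be; have c1 := gc _ (ecv_cdiffs be).
have b0 : b 0%N = 1 by rewrite /b addn0.
rewrite b0 in c0.
pose f1 (r : R) := cderive (1 : R^o) (fun r : R^o => f r%:C) r.
have fd (r : R) : 0 < r -> cd (fun r : R^o => f r%:C) r 1 (f1 r).
  by move=> r0; have [h _ _] := ode r r0; exact: cderivable_cd.
have f1E (r : R) : 0 < r -> f1 r = r%:C ^+ l * (l%:R * r^-1%:C * g r + g1 r).
  move=> r0; apply: (cd_unique (fd r r0)).
  apply: (@cd_Rpos _ (fun r : R^o => r%:C ^+ l * g r)) => [//|y y0|]; first by rewrite fg.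
  by apply: cd_eq (cd_mul (cd_realX l r0) (gd r)) _; ring.
exists (fun r => f r%:C + r%:C * f1 r); split.
- move=> r r0; split.
    by apply: cd_eq (cd_mul (cd_id (r : R^o)) (fd r r0)) _; ring.
  have [h1 h2 h3] := ode r r0.
  have d2 := cderivable_cd h2.
  apply: cd_eq (cd_add (fd r r0) (cd_mul (cd_id (r : R^o)) d2)) _.
  move: h3; rewrite -/(f1 r).
  set f2 := cderive _ _ _.
  move: (rC r r0) (f r%:C) (f1 r) (f2); rewrite /potential rC_inv rC_X !rC_mul rC_nat.
  move: (r%:C) => x x0 F F1 F2 e.
  apply: (mulfI x0).
  have -> : x * (((l * l.+1)%:R * x^-1 ^+ 2 - 2 * gamma%:C * x^-1 - lam) * (x * F)) =
    (l * l.+1)%:R * F - 2 * gamma%:C * x * F - lam * x ^+ 2 * F.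
    by move: ((l * l.+1)%:R) => c; field.
  apply/eqP; rewrite -subr_eq0; apply/eqP; rewrite -[RHS]e; ring.
- split.
  + apply: clim_near c0; near=> r; have r0 : 0 < r by [].
    rewrite fg// -/(g r) exprS; have := expf_neq0 l (rC r r0); have := rC r r0.
    by move: (r%:C ^+ l) (r%:C) (g r) => P x G x0 P0; field; rewrite x0 P0.
  + have H : clim 0^'+ (fun r : R => (l.+1%:R) * g r + r%:C * g1 r) (l.+1%:R * 1 + 0 * b 1%N).
      apply: clim_add; first exact: clim_mull.
      apply: clim_mul clim_r0 _.
      by have := c1; rewrite /cdiffs mul1r.
    rewrite mulr1 mul0r addr0 in H; apply: clim_near H.
    near=> r; have r0 : 0 < r by [].
    rewrite f1E// fg// rC_inv -[l.+1%:R]natr1; have := expf_neq0 l (rC r r0); have := rC r r0.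
    by move: (r%:C ^+ l) => P x0 P0; field; rewrite x0 P0.
Unshelve. all: end_near. Qed.

End RegularSolution.

(** * Iterated integrals of continuous functions over a rectangle *)

Section RectangleIntegrals.
Context {R : realType}.

Lemma cvg_pairR (T : Type) (F : set_system T) {FF : Filter F} (f g : T -> R) (a b : R) :
  f @ F --> a -> g @ F --> b -> (fun t => (f t, g t)) @ F --> (a, b).
Proof. by move=> hf hg; exact: (cvg_pair hf hg). Qed.

Lemma continuous_section1 (f : R * R -> R) (x : R) : continuous f -> continuous (fun y : R => f (x, y)).
Proof.
move=> fc y; have H : (x, z) @[z --> y] --> (x, y) by apply: cvg_pairR; [exact: cvg_cst|exact: cvg_id].
exact: (@cvg_comp _ _ _ (fun y : R => (x, y)) f _ _ _ H (fc (x, y))).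
Qed.

Lemma continuous_section2 (f : R * R -> R) (y : R) : continuous f -> continuous (fun x : R => f (x, y)).
Proof.
move=> fc x; have H : (z, y) @[z --> x] --> (x, y) by apply: cvg_pairR; [exact: cvg_id|exact: cvg_cst].
exact: (@cvg_comp _ _ _ (fun x : R => (x, y)) f _ _ _ H (fc (x, y))).
Qed.
Notation mu := (@lebesgue_measure R).
Notation TR := (measurableTypeR R).
Notation mu2 := (mu \x mu)%E.
Variables (b1 b2 : R).
Hypothesis b1_ge0 : 0 <= b1.
Hypothesis b2_ge0 : 0 <= b2.
Notation D1 := (`[0, b1]%classic : set TR).
Notation D2 := (`[0, b2]%classic : set TR).

Definition rect : set (TR * TR) := D1 `*` D2.

Lemma measurable_rect : measurable rect.
Proof. by apply: measurableX; exact: measurable_itv. Qed.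

Lemma seg_finite (b : R) : (mu (`[0%R, b]%classic : set TR) < +oo)%E.
Proof.
have E : mu (`[0%R, b]%classic : set TR) = _ := lebesgue_measure_itv _.
by rewrite E; case: ifP => _; rewrite /= -?EFinB ltry.
Qed.

Lemma rect_finite : (mu2 rect < +oo)%E.
Proof.
rewrite product_measure1E; [|exact: measurable_itv|exact: measurable_itv].
apply: lte_mul_pinfty; [exact: measure_ge0| |exact: seg_finite].
by rewrite ge0_fin_numE ?measure_ge0//; exact: seg_finite.
Qed.

(* A continuous function is the limit of its sections at the grid points
   [k / n] of the first variable. *)
Lemma continuous_measurable_rect (f : R * R -> R) : continuous f ->
  measurable_fun rect (f : TR * TR -> R).
Proof.
move=> fc.
pose h (n : nat) (p : R * R) := f ((Num.trunc (n.+1%:R * p.1))%:R / n.+1%:R, p.2).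
apply: (@measurable_fun_cvg _ _ _ _ (h : nat -> TR * TR -> R)); last first.
  move=> [x y] [/= xD _].
  have x0 : 0 <= x by move: xD; rewrite in_itv/= => /andP[].
  have cx : (fun n : nat => (Num.trunc (n.+1%:R * x))%:R / n.+1%:R : R) @ \oo --> x.
    apply/cvgrPdist_le => e e0; near=> n.
    have n0 : 0 < n.+1%:R :> R by [].
    have /andP[t1 t2] := truncn_itv (mulr_ge0 (ltW n0) x0).
    rewrite ger0_norm; last by rewrite subr_ge0 ler_pdivrMr// [x * _]mulrC.
    have : e^-1 <= n%:R by near: n; exact: nbhs_infty_ger.
    move/le_trans; have nn : n%:R <= n.+1%:R :> R by rewrite ler_nat.
    move/(_ _ nn); rewrite -(ler_pM2l e0) divff ?gt_eqF// => en.
    rewrite lerBlDr -(ler_pM2l n0) mulrDr mulrCA divff ?gt_eqF// mulr1.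
    by move: t2; rewrite -[(Num.trunc _).+1%:R]natr1; lra.
  rewrite /h /=; apply: (@cvg_comp _ _ _ (fun n : nat => ((Num.trunc (n.+1%:R * x))%:R / n.+1%:R : R, y)) f _ _ _ _ (fc (x, y))).
  by apply: cvg_pairR => //; exact: cvg_cst.
move=> n _ Y mY.
pose B (k : nat) : set TR := f @^-1` Y \o (fun y => (k%:R / n.+1%:R, y)).
have -> : rect `&` (h n : TR * TR -> R) @^-1` Y =
  \bigcup_k ((D1 `&` [set x | k%:R <= n.+1%:R * x < k.+1%:R]) `*` (D2 `&` (fun y : TR => f (k%:R / n.+1%:R, y)) @^-1` Y)).
  apply/seteqP; split=> [[x y] [[/= xD yD] hY]|[x y] [k _ [[/= xD kx] [yD hY]]]].
    have x0 : 0 <= x by move: xD; rewrite in_itv/= => /andP[].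
    exists (Num.trunc (n.+1%:R * x)) => //; split=> //=; split => //.
    by apply: truncn_itv; rewrite mulr_ge0.
  by split=> //=; rewrite /h /= (truncn_def kx).
apply: bigcupT_measurable => k; apply: measurableX.
- apply: measurableI; first exact: measurable_itv.
  have n0 : 0 < n.+1%:R :> R by [].
  rewrite (_ : [set x | _] = `[k%:R / n.+1%:R, k.+1%:R / n.+1%:R[%classic); first exact: measurable_itv.
  by apply/seteqP; split=> x /=; rewrite in_itv/= ler_pdivrMr// ltr_pdivlMr// [n.+1%:R * x]mulrC.
- have mf : measurable_fun (setT : set TR) (fun y : TR => f (k%:R / n.+1%:R, y)).
    apply: continuous_measurable_fun => y; exact: continuous_section1.
  apply: measurableI; first exact: measurable_itv.
  by rewrite -[X in measurable X]setTI; apply: mf.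
Unshelve. all: end_near. Qed.

Lemma continuous_bounded_rect (f : R * R -> R) : continuous f ->
  exists2 M : R, 0 < M & forall p, rect p -> `|f p| <= M.
Proof.
move=> fc; have cr : compact (rect : set (R * R)).
  by apply: compact_setX; exact: segment_compact.
have [M [_ hM]] : bounded_set (f @` rect).
  by apply: compact_bounded; apply: continuous_compact => //; exact: continuous_subspaceT.
exists (`|M| + 1); first by rewrite ltr_wpDl.
move=> p rp; apply: hM; last by exists p.
by rewrite (le_lt_trans (ler_norm _))// ltrDl.
Qed.

Lemma continuous_integrable_rect (f : R * R -> R) : continuous f ->
  mu2.-integrable rect (EFin \o (f : TR * TR -> R)).
Proof.
move=> fc; apply: measurable_bounded_integrable.
- exact: measurable_rect.
- exact: rect_finite.
- exact: continuous_measurable_rect.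
- have [M M0 hM] := continuous_bounded_rect fc.
  by exists M; split; [exact: num_real|move=> M' MM' p rp; exact: le_trans (hM p rp) (ltW MM')].
Qed.

Lemma rect_integral1 (f : R * R -> R) (g : R -> R) : continuous f ->
  (forall x, D1 x -> \int[mu]_(y in D2) f (x, y) = g x) ->
  \int[mu2]_(p in rect) (f : TR * TR -> R) p = \int[mu]_(x in D1) g x.
Proof.
move=> fc hg.
have i1 := continuous_integrable_rect fc.
have i2 : mu2.-integrable setT ((EFin \o (f : TR * TR -> R)) \_ rect).
  by rewrite -(integrable_mkcond _ measurable_rect).
rewrite /Rintegral integral_mkcond [in RHS]integral_mkcond -(integral12_prod_meas1 i2); congr fine.
apply: eq_integral => x _; rewrite /fubini_F.
rewrite patchE; case: ifPn => xD.
  rewrite -hg; last by rewrite inE in xD.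
  rewrite /Rintegral fineK; last first.
    apply: integrable_fin_num; first exact: measurable_itv.
    have [M M0 hM] := continuous_bounded_rect fc.
    apply: measurable_bounded_integrable.
    - exact: measurable_itv.
    - exact: seg_finite.
    - apply: measurable_funTS; apply: continuous_measurable_fun => y; exact: continuous_section1.
    - exists M; split; [exact: num_real|move=> M' MM' y yD].
      by apply: le_trans (hM (x, y) _) (ltW MM'); split=> //=; rewrite inE in xD.
  rewrite [in RHS]integral_mkcond; apply: eq_integral => y _.
  rewrite !patchE; congr (if _ then _ else _).
  by apply/idP/idP; rewrite !inE; [case|move=> yD; split => //; rewrite inE in xD].
apply: integral0_eq => y _; rewrite patchE; case: ifPn => //.
by rewrite inE => -[/= xD' _]; move: xD; rewrite notin_setE.
Qed.

Lemma rect_integral2 (f : R * R -> R) (g : R -> R) : continuous f ->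
  (forall y, D2 y -> \int[mu]_(x in D1) f (x, y) = g y) ->
  \int[mu2]_(p in rect) (f : TR * TR -> R) p = \int[mu]_(y in D2) g y.
Proof.
move=> fc hg.
have i1 := continuous_integrable_rect fc.
have i2 : mu2.-integrable setT ((EFin \o (f : TR * TR -> R)) \_ rect).
  by rewrite -(integrable_mkcond _ measurable_rect).
rewrite /Rintegral integral_mkcond [in RHS]integral_mkcond -(integral21_prod_meas1 i2); congr fine.
apply: eq_integral => y _; rewrite /fubini_G.
rewrite patchE; case: ifPn => yD.
  rewrite -hg; last by rewrite inE in yD.
  rewrite /Rintegral fineK; last first.
    apply: integrable_fin_num; first exact: measurable_itv.
    have [M M0 hM] := continuous_bounded_rect fc.
    apply: measurable_bounded_integrable.
    - exact: measurable_itv.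
    - exact: seg_finite.
    - apply: measurable_funTS; apply: continuous_measurable_fun => x; exact: continuous_section2.
    - exists M; split; [exact: num_real|move=> M' MM' x xD].
      by apply: le_trans (hM (x, y) _) (ltW MM'); split=> //=; rewrite inE in yD.
  rewrite [in RHS]integral_mkcond; apply: eq_integral => x _.
  rewrite !patchE; congr (if _ then _ else _).
  by apply/idP/idP; rewrite !inE; [case|move=> xD; split => //; rewrite inE in yD].
apply: integral0_eq => x _; rewrite patchE; case: ifPn => //.
by rewrite inE => -[/= _ yD']; move: yD; rewrite notin_setE.
Qed.

Lemma Rintegral_derive (b : R) (F dF : R -> R) : 0 < b ->
  (forall x, is_derive (x : R^o) (1 : R^o) (F : R^o -> R^o) (dF x)) -> continuous dF ->
  \int[mu]_(x in `[0, b]) dF x = F b - F 0.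
Proof.
move=> b0 hF dc; rewrite /Rintegral.
have Fc : continuous F.
  by move=> x; apply: differentiable_continuous; apply/derivable1_diffP; case: (hF x).
have := @continuous_FTC2 R dF F 0 b b0.
move=> H; rewrite H//.
- exact: continuous_subspaceT.
- split.
  + by move=> x _; case: (hF x).
  + by apply: cvg_at_right_filter; exact: Fc.
  + by apply: cvg_at_left_filter; exact: Fc.
- by move=> x _; rewrite derive1E; case: (hF x).
Qed.

End RectangleIntegrals.

(** * Integration over the sphere *)

Section PointwiseContinuity.
Context {R : realType} {T : topologicalType}.
Implicit Types (f g : T -> R[i]) (x : T).

Definition ccat f x : Prop := clim (nbhs x) f (f x).

Lemma ccat_cst (c : R[i]) x : ccat (fun=> c) x.
Proof. exact: clim_cst. Qed.
Lemma ccat_add f g x : ccat f x -> ccat g x -> ccat (fun t => f t + g t) x.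
Proof. by move=> hf hg; apply: clim_add. Qed.
Lemma ccat_mul f g x : ccat f x -> ccat g x -> ccat (fun t => f t * g t) x.
Proof. by move=> hf hg; apply: clim_mul. Qed.
Lemma ccat_opp f x : ccat f x -> ccat (fun t => - f t) x.
Proof. by move=> hf; apply: clim_opp. Qed.
Lemma ccat_exp f n x : ccat f x -> ccat (fun t => f t ^+ n) x.
Proof.
move=> hf; elim: n => [|n IH].
  by under [X in ccat X]eq_fun do rewrite expr0; exact: ccat_cst.
by under [X in ccat X]eq_fun do rewrite exprS; exact: ccat_mul.
Qed.
Lemma ccat_sum (I : Type) (s : seq I) (F : I -> T -> R[i]) x :
  (forall i, ccat (F i) x) -> ccat (fun t => \sum_(i <- s) F i t) x.
Proof. by move=> h; apply: clim_sum. Qed.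
Lemma ccat_real (f : T -> R) x : {for x, continuous f} -> ccat (fun t => (f t)%:C) x.
Proof. by move=> h; apply: clim_real. Qed.
Lemma ccat_ReIm f x : ccat f x <->
  {for x, continuous (fun t => complex.Re (f t))} /\ {for x, continuous (fun t => complex.Im (f t))}.
Proof. exact: clim_ReIm. Qed.
Lemma ccat_near f g x : (\forall t \near x, f t = g t) -> ccat f x -> ccat g x.
Proof.
by move=> fg; rewrite /ccat -(nbhs_singleton fg); exact: clim_near.
Qed.
End PointwiseContinuity.

Lemma ccat_comp {R : realType} {T U : topologicalType} (f : U -> R[i]) (h : T -> U) (x : T) :
  {for x, continuous h} -> ccat f (h x) -> ccat (fun t => f (h t)) x.
Proof. by move=> hc /climP hf; apply/climP => e e0; exact: hc (hf e e0). Qed.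

Section SphereIntegral.
Context {R : realType}.
Notation E := 'cV[R]_3.
Notation mu := (@lebesgue_measure R).
Notation TR := (measurableTypeR R).
Notation mu2 := (mu \x mu)%E.
Notation rct := (rect (pi : R) (2 * pi)).
Implicit Types (f g : E -> R[i]) (x y : E).

Let pi0 : 0 <= pi :> R. Proof. exact: pi_ge0. Qed.

Definition dot (a : 'I_3 -> R[i]) x : R[i] := \sum_(i < 3) a i * (x i 0)%:C.

Lemma dot3 a x : dot a x = a 0 * (x 0 0)%:C + a 1 * (x 1 0)%:C + a 2%R * (x 2%R 0)%:C.
Proof.
rewrite /dot !big_ord_recl big_ord0 addr0 addrA.
by congr (_ + _ + _); congr (a _ * (x _ 0)%:C); apply: val_inj.
Qed.

Lemma sphere_point0 t : sphere_point t 0 0 = sin t.1 * cos t.2 :> R.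
Proof. by rewrite /sphere_point /vec3 mxE. Qed.
Lemma sphere_point1 t : sphere_point t 1 0 = sin t.1 * sin t.2 :> R.
Proof. by rewrite /sphere_point /vec3 mxE. Qed.
Lemma sphere_point2 t : sphere_point t 2%R 0 = cos t.1 :> R.
Proof. by rewrite /sphere_point /vec3 mxE. Qed.

Lemma enorm3 x : enorm x = Num.sqrt (x 0 0 ^+ 2 + x 1 0 ^+ 2 + x 2%R 0 ^+ 2).
Proof.
rewrite /enorm !big_ord_recl big_ord0 addr0 addrA; congr (Num.sqrt (_ + _ + _));
by congr (x _ 0 ^+ 2); apply: val_inj.
Qed.

Lemma sphere_point_norm t : enorm (sphere_point t) = 1 :> R.
Proof.
rewrite enorm3 sphere_point0 sphere_point1 sphere_point2 !exprMn.
have -> : sin t.1 ^+ 2 * cos t.2 ^+ 2 + sin t.1 ^+ 2 * sin t.2 ^+ 2 + cos t.1 ^+ 2 =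
  sin t.1 ^+ 2 * (cos t.2 ^+ 2 + sin t.2 ^+ 2) + cos t.1 ^+ 2 :> R by ring.
by rewrite cos2Dsin2 mulr1 addrC cos2Dsin2 sqrtr1.
Qed.

Lemma enorm0 : enorm (0 : E) = 0.
Proof. by rewrite enorm3 !mxE expr0n /= !addr0 sqrtr0. Qed.
Lemma enorm_ge0 x : 0 <= enorm x. Proof. exact: sqrtr_ge0. Qed.
Lemma enorm_sqr x : enorm x ^+ 2 = x 0 0 ^+ 2 + x 1 0 ^+ 2 + x 2%R 0 ^+ 2.
Proof. by rewrite enorm3 sqr_sqrtr// !addr_ge0 ?sqr_ge0. Qed.

Lemma ord3P (P : 'I_3 -> Prop) : P 0 -> P 1 -> P 2%R -> forall i, P i.
Proof.
move=> p0 p1 p2 [[|[|[|//]]] h].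
- by rewrite (_ : Ordinal h = 0)//; exact: val_inj.
- by rewrite (_ : Ordinal h = 1)//; exact: val_inj.
- by rewrite (_ : Ordinal h = 2%R)//; exact: val_inj.
Qed.

Lemma E_ext x y : x 0 0 = y 0 0 -> x 1 0 = y 1 0 -> x 2%R 0 = y 2%R 0 -> x = y.
Proof. by move=> h0 h1 h2; apply/matrixP => i j; rewrite (ord1 j); move: i; exact: ord3P. Qed.

Lemma enorm_eq0 x : (enorm x == 0) = (x == 0).
Proof.
apply/eqP/eqP => [h|->]; last exact: enorm0.
have := enorm_sqr x; rewrite h expr0n /=.
have p0 := sqr_ge0 (x 0 0); have p1 := sqr_ge0 (x 1 0); have p2 := sqr_ge0 (x 2%R 0).
move=> e; apply: E_ext; rewrite mxE; apply/eqP; rewrite -sqrf_eq0; apply/eqP; lra.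
Qed.

Lemma enorm_gt0 x : x != 0 -> 0 < enorm x.
Proof. by move=> x0; rewrite lt_neqAle eq_sym enorm_eq0 x0 enorm_ge0. Qed.

Lemma sphere_neq0 x : enorm x = 1 -> x != 0.
Proof. by move=> h; rewrite -enorm_eq0 h oner_eq0. Qed.

Lemma vec3_continuous : continuous (@vec3 R).
Proof.
have -> : @vec3 R = fun p => p.1.1 *: (delta_mx 0 0 : E) + p.1.2 *: delta_mx 1 0 + p.2 *: delta_mx 2%R 0.
  by apply/funext => p; apply: E_ext; rewrite /vec3 !mxE /= ?mulr1 ?mulr0 ?addr0 ?add0r.
move=> p; apply: cvgD; [apply: cvgD|]; apply: cvgZr_tmp.
- by apply: (@cvg_comp _ _ _ fst fst _ (nbhs p.1)); exact: cvg_fst.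
- by apply: (@cvg_comp _ _ _ fst snd _ (nbhs p.1)); [exact: cvg_fst|exact: cvg_snd].
- exact: cvg_snd.
Qed.

Lemma sphere_point_continuous : continuous (@sphere_point R : R * R -> E).
Proof.
move=> t.
have c1 : {for t, continuous (fun t : R * R => sin t.1)}.
  by apply: continuous_comp; [exact: cvg_fst|exact: continuous_sin].
have c2 : {for t, continuous (fun t : R * R => cos t.1)}.
  by apply: continuous_comp; [exact: cvg_fst|exact: continuous_cos].
have c3 : {for t, continuous (fun t : R * R => sin t.2)}.
  by apply: continuous_comp; [exact: cvg_snd|exact: continuous_sin].
have c4 : {for t, continuous (fun t : R * R => cos t.2)}.
  by apply: continuous_comp; [exact: cvg_snd|exact: continuous_cos].
apply: (@cvg_comp _ _ _ (fun t : R * R => (sin t.1 * cos t.2, sin t.1 * sin t.2, cos t.1)) (@vec3 R) _ _ _ _ (@vec3_continuous _)).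
have h1 : (fun t : R * R => (sin t.1 * cos t.2, sin t.1 * sin t.2)) @ t --> (sin t.1 * cos t.2, sin t.1 * sin t.2).
  by apply: cvg_pairR; apply: cvgM.
exact: (cvg_pair h1 c2).
Qed.

Lemma coord_ccat (i : 'I_3) (x : E) : ccat (fun x : E => (x i 0)%:C) x.
Proof. by apply: ccat_real; exact: coord_continuous. Qed.

Lemma dot_ccat a (x : E) : ccat (dot a) x.
Proof. by apply: ccat_sum => i; apply: ccat_mul; [exact: ccat_cst|exact: coord_ccat]. Qed.

(** The origin is excluded because eigenfunctions may be singular there. The class is stable under
    [x] to [r *: x] for [r > 0], which moves the integration to a sphere of any radius. *)
Definition scont f : Prop := forall x, x != 0 -> ccat f x.

Definition sint f (t : R * R) : R[i] := f (sphere_point t) * (sin t.1)%:C.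

Lemma sin1_ccat (t : R * R) : ccat (fun t : R * R => (sin t.1)%:C : R[i]) t.
Proof. by apply: ccat_real; apply: continuous_comp; [exact: cvg_fst|exact: continuous_sin]. Qed.
Lemma cos1_ccat (t : R * R) : ccat (fun t : R * R => (cos t.1)%:C : R[i]) t.
Proof. by apply: ccat_real; apply: continuous_comp; [exact: cvg_fst|exact: continuous_cos]. Qed.
Lemma sin2_ccat (t : R * R) : ccat (fun t : R * R => (sin t.2)%:C : R[i]) t.
Proof. by apply: ccat_real; apply: continuous_comp; [exact: cvg_snd|exact: continuous_sin]. Qed.
Lemma cos2_ccat (t : R * R) : ccat (fun t : R * R => (cos t.2)%:C : R[i]) t.
Proof. by apply: ccat_real; apply: continuous_comp; [exact: cvg_snd|exact: continuous_cos]. Qed.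

Lemma ccat_integrable (F : R * R -> R[i]) : (forall t, ccat F t) -> cintegrable mu2 rct F.
Proof.
move=> h; split; apply: continuous_integrable_rect => //.
- by move=> t; have [] := (ccat_ReIm _ _).1 (h t).
- by move=> t; have [] := (ccat_ReIm _ _).1 (h t).
Qed.

Lemma sint_ccat f t : scont f -> ccat (sint f) t.
Proof.
move=> hf; apply: ccat_mul; last exact: sin1_ccat.
apply: ccat_comp; first exact: sphere_point_continuous.
by apply: hf; apply: sphere_neq0; exact: sphere_point_norm.
Qed.

Lemma sint_integrable f : scont f -> cintegrable mu2 rct (sint f).
Proof. by move=> hf; apply: ccat_integrable => t; exact: sint_ccat. Qed.

Let mr2 : measurable rct. Proof. exact: measurable_rect. Qed.

Lemma SI_add f g : scont f -> scont g ->
  sphere_integral (fun x => f x + g x) = sphere_integral f + sphere_integral g.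
Proof.
move=> hf hg; rewrite /sphere_integral -(cintegral_add mr2 (sint_integrable hf) (sint_integrable hg)).
by apply: eq_cintegral => t _; rewrite /sint mulrDl.
Qed.

Lemma SI_mull c f : scont f -> sphere_integral (fun x => c * f x) = c * sphere_integral f.
Proof.
move=> hf; rewrite /sphere_integral -(cintegral_mull mr2 c (sint_integrable hf)).
by apply: eq_cintegral => t _; rewrite /sint mulrA.
Qed.

Lemma SI_eq f g : (forall x, enorm x = 1 -> f x = g x) -> sphere_integral f = sphere_integral g.
Proof. by move=> fg; apply: eq_cintegral => t _; rewrite fg// sphere_point_norm. Qed.

Lemma SI_sum (I : Type) (s : seq I) (F : I -> E -> R[i]) : (forall i, scont (F i)) ->
  sphere_integral (fun x => \sum_(i <- s) F i x) = \sum_(i <- s) sphere_integral (F i).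
Proof.
move=> h; rewrite /sphere_integral -(cintegral_sum mr2 _ (fun i => sint_integrable (h i))).
by apply: eq_cintegral => t _; rewrite /sint mulr_suml.
Qed.

Lemma scont_cst (c : R[i]) : scont (fun=> c). Proof. by move=> x _; exact: ccat_cst. Qed.
Lemma scont_add f g : scont f -> scont g -> scont (fun x => f x + g x).
Proof. by move=> hf hg x x0; apply: ccat_add; [exact: hf|exact: hg]. Qed.
Lemma scont_mul f g : scont f -> scont g -> scont (fun x => f x * g x).
Proof. by move=> hf hg x x0; apply: ccat_mul; [exact: hf|exact: hg]. Qed.
Lemma scont_mull c f : scont f -> scont (fun x => c * f x).
Proof. by move=> hf; apply: scont_mul => //; exact: scont_cst. Qed.
Lemma scont_exp f n : scont f -> scont (fun x => f x ^+ n).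
Proof. by move=> hf x x0; apply: ccat_exp; exact: hf. Qed.
Lemma scont_sum (I : Type) (s : seq I) (F : I -> E -> R[i]) :
  (forall i, scont (F i)) -> scont (fun x => \sum_(i <- s) F i x).
Proof. by move=> h x x0; apply: ccat_sum => i; exact: h. Qed.
Lemma scont_dot a : scont (dot a). Proof. by move=> x _; exact: dot_ccat. Qed.

Lemma scont_bounded f : scont f -> exists2 M : R, 0 < M & forall t, rct t -> normc (f (sphere_point t)) <= M.
Proof.
move=> hf.
have c : continuous (fun t : R * R => normc (f (sphere_point t))).
  move=> t; have h : ccat (fun t : R * R => f (sphere_point t)) t.
    apply: ccat_comp; first exact: sphere_point_continuous.
    by apply: hf; apply: sphere_neq0; exact: sphere_point_norm.
  exact: clim_normc h.
have [M M0 hM] := continuous_bounded_rect pi (2 * pi) c.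
by exists M => // t rt; rewrite (le_trans _ (hM t rt))// ler_norm.
Qed.

Lemma SI_bounded_cvg (F : nat -> E -> R[i]) f (M : R) :
  (forall n, scont (F n)) -> scont f ->
  (forall x, enorm x = 1 -> cvgc (fun n => F n x) (f x)) ->
  (forall n x, enorm x = 1 -> normc (F n x) <= M) ->
  cvgc (fun n => sphere_integral (F n)) (sphere_integral f).
Proof.
move=> hF hf cF bF; have mr : measurable rct by exact: measurable_rect.
apply: (cintegral_cvg mr (g := fun=> M)).
- by move=> n; apply: cintegrable_measurable; exact: (sint_integrable (hF n)).
- by apply: cintegrable_measurable; exact: (sint_integrable hf).
- move=> t _; apply: (clim_mul (F := \oo)); last exact: clim_cst.
  exact: cF (sphere_point_norm t).
- move=> n t _; rewrite normc_mul normc_real.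
  rewrite -[M]mulr1 ler_pM ?normc_ge0// ?bF ?sphere_point_norm//.
  by rewrite -sqrtr_sqr -sqrtr1 ler_wsqrtr// -(cos2Dsin2 t.1) lerDr sqr_ge0.
- by apply: continuous_integrable_rect => // t; exact: cvg_cst.
Qed.

Lemma rect_derive1 (A dA : R * R -> R[i]) :
  (forall t u, cd (fun t : R^o => A (t, u)) t 1 (dA (t, u))) -> (forall t, ccat dA t) ->
  (forall u, A (pi, u) = A (0, u)) -> cintegral mu2 rct dA = 0.
Proof.
move=> hA cA bA; have p0 : 0 < pi :> R by exact: pi_gt0.
have cR : continuous (fun t => complex.Re (dA t)) by move=> t; have [] := (ccat_ReIm _ _).1 (cA t).
have cI : continuous (fun t => complex.Im (dA t)) by move=> t; have [] := (ccat_ReIm _ _).1 (cA t).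
rewrite /cintegral; apply: Cext => /=.
- rewrite (@rect_integral2 R pi (2 * pi) (fun t => complex.Re (dA t)) (fun=> 0))//.
    by rewrite Rintegral_cst ?mul0r//; exact: measurable_itv.
  move=> u _.
  have H (x : R) : is_derive (x : R^o) (1 : R^o) (fun t : R^o => complex.Re (A (t, u)) : R^o) (complex.Re (dA (x, u))).
    by case: (hA x u).
  by rewrite (Rintegral_derive p0 H (continuous_section2 (y := u) cR)) bA subrr.
- rewrite (@rect_integral2 R pi (2 * pi) (fun t => complex.Im (dA t)) (fun=> 0))//.
    by rewrite Rintegral_cst ?mul0r//; exact: measurable_itv.
  move=> u _.
  have H (x : R) : is_derive (x : R^o) (1 : R^o) (fun t : R^o => complex.Im (A (t, u)) : R^o) (complex.Im (dA (x, u))).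
    by case: (hA x u).
  by rewrite (Rintegral_derive p0 H (continuous_section2 (y := u) cI)) bA subrr.
Qed.

Lemma rect_derive2 (A dA : R * R -> R[i]) :
  (forall t u, cd (fun u : R^o => A (t, u)) u 1 (dA (t, u))) -> (forall t, ccat dA t) ->
  (forall t, A (t, 2 * pi) = A (t, 0)) -> cintegral mu2 rct dA = 0.
Proof.
move=> hA cA bA; have p0 : 0 < 2 * pi :> R by rewrite mulr_gt0// pi_gt0.
have cR : continuous (fun t => complex.Re (dA t)) by move=> t; have [] := (ccat_ReIm _ _).1 (cA t).
have cI : continuous (fun t => complex.Im (dA t)) by move=> t; have [] := (ccat_ReIm _ _).1 (cA t).
rewrite /cintegral; apply: Cext => /=.
- rewrite (@rect_integral1 R pi (2 * pi) (fun t => complex.Re (dA t)) (fun=> 0))//.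
    by rewrite Rintegral_cst ?mul0r//; exact: measurable_itv.
  move=> t _.
  have H (x : R) : is_derive (x : R^o) (1 : R^o) (fun u : R^o => complex.Re (A (t, u)) : R^o) (complex.Re (dA (t, x))).
    by case: (hA t x).
  by rewrite (Rintegral_derive p0 H (continuous_section1 (x := t) cR)) bA subrr.
- rewrite (@rect_integral1 R pi (2 * pi) (fun t => complex.Im (dA t)) (fun=> 0))//.
    by rewrite Rintegral_cst ?mul0r//; exact: measurable_itv.
  move=> t _.
  have H (x : R) : is_derive (x : R^o) (1 : R^o) (fun u : R^o => complex.Im (A (t, u)) : R^o) (complex.Im (dA (t, x))).
    by case: (hA t x).
  by rewrite (Rintegral_derive p0 H (continuous_section1 (x := t) cI)) bA subrr.
Qed.

(* The divergence theorem on the sphere for the field [X^e grad X], [X] linear. *)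
Lemma moment_rec a (e : nat) :
  (e + 2)%:R * sphere_integral (fun x => dot a x ^+ e.+1) =
  e%:R * (a 0 ^+ 2 + a 1 ^+ 2 + a 2%R ^+ 2) * sphere_integral (fun x => dot a x ^+ e.-1).
Proof.
pose s1 (t : R * R) : R[i] := (sin t.1)%:C; pose c1 (t : R * R) : R[i] := (cos t.1)%:C.
pose s2 (t : R * R) : R[i] := (sin t.2)%:C; pose c2 (t : R * R) : R[i] := (cos t.2)%:C.
pose C t := a 0 * c2 t + a 1 * s2 t.
pose Y t := - (a 0 * s2 t) + a 1 * c2 t.
pose X t := s1 t * C t + a 2%R * c1 t.
pose X1 t := c1 t * C t + - (a 2%R * s1 t).
(* [A] and [B] are the components of the field X^e grad X along the polar angle and the azimuth,
   weighted so that [dA + dB] is the divergence times [s1]. Boundary terms vanish because [s1]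
   vanishes at the poles and [B] is periodic. *)
pose A t := s1 t * (X t ^+ e * X1 t).
pose dA t := c1 t * (X t ^+ e * X1 t) + s1 t * (e%:R * X t ^+ e.-1 * X1 t * X1 t + X t ^+ e * - X t).
pose B t := X t ^+ e * Y t.
pose dB t := e%:R * X t ^+ e.-1 * (s1 t * Y t) * Y t + X t ^+ e * - C t.
have s1c t : ccat s1 t by exact: sin1_ccat.
have c1c t : ccat c1 t by exact: cos1_ccat.
have s2c t : ccat s2 t by exact: sin2_ccat.
have c2c t : ccat c2 t by exact: cos2_ccat.
have Cc t : ccat C t by apply: ccat_add; apply: ccat_mul => //; exact: ccat_cst.
have Yc t : ccat Y t.
  apply: ccat_add; [apply: ccat_opp|]; by apply: ccat_mul => //; exact: ccat_cst.
have Xc t : ccat X t.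
  by apply: ccat_add; apply: ccat_mul => //; exact: ccat_cst.
have X1c t : ccat X1 t.
  apply: ccat_add; first exact: ccat_mul.
  by apply: ccat_opp; apply: ccat_mul => //; exact: ccat_cst.
have dAc t : ccat dA t.
  apply: ccat_add; apply: ccat_mul => //.
    by apply: ccat_mul => //; exact: ccat_exp.
  apply: ccat_add.
    by do 2 (apply: ccat_mul => //); apply: ccat_mul; [exact: ccat_cst|exact: ccat_exp].
  by apply: ccat_mul; [exact: ccat_exp|exact: ccat_opp].
have dBc t : ccat dB t.
  apply: ccat_add.
    apply: ccat_mul => //; apply: ccat_mul; last exact: ccat_mul.
    by apply: ccat_mul; [exact: ccat_cst|exact: ccat_exp].
  by apply: ccat_mul; [exact: ccat_exp|exact: ccat_opp].
have dsin (x : R) : cd (fun t : R^o => (sin t)%:C : R[i]) x 1 (cos x)%:C by apply: cd_real.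
have dcos (x : R) : cd (fun t : R^o => (cos t)%:C : R[i]) x 1 (- (sin x)%:C).
  by rewrite -rmorphN; apply: cd_real.
have iA : cintegral mu2 rct dA = 0.
  apply: (@rect_derive1 A) => // [t u|u]; last by rewrite /A /s1 /= sinpi sin0 !mul0r.
  have hX : cd (fun t : R^o => X (t, u)) t 1 (X1 (t, u)).
    apply: cd_eq (cd_add (cd_mul (dsin t) (cd_cst (C (t, u)) _ _)) (cd_mull (a 2%R) (dcos t))) _.
    by rewrite /X1 /C /c1 /s1 /=; ring.
  have hX1 : cd (fun t : R^o => X1 (t, u)) t 1 (- X (t, u)).
    apply: cd_eq (cd_add (cd_mul (dcos t) (cd_cst (C (t, u)) _ _)) (cd_opp (cd_mull (a 2%R) (dsin t)))) _.
    by rewrite /X /C /c1 /s1 /=; ring.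
  apply: cd_eq (cd_mul (dsin t) (cd_mul (cd_exp e hX) hX1)) _.
  by rewrite /dA /c1 /s1 /=; ring.
have iB : cintegral mu2 rct dB = 0.
  apply: (@rect_derive2 B) => // [t u|t]; last first.
    by rewrite /B /X /Y /C /s2 /c2 /= mulr_natl sin2pi cos2pi sin0 cos0.
  have hC : cd (fun u : R^o => C (t, u)) u 1 (Y (t, u)).
    apply: cd_eq (cd_add (cd_mull (a 0) (dcos u)) (cd_mull (a 1) (dsin u))) _.
    by rewrite /Y /c2 /s2 /=; ring.
  have hY : cd (fun u : R^o => Y (t, u)) u 1 (- C (t, u)).
    apply: cd_eq (cd_add (cd_opp (cd_mull (a 0) (dsin u))) (cd_mull (a 1) (dcos u))) _.
    by rewrite /C /c2 /s2 /=; ring.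
  have hX : cd (fun u : R^o => X (t, u)) u 1 (s1 (t, u) * Y (t, u)).
    apply: cd_eq (cd_add (cd_mull (s1 (t, u)) hC) (cd_cst (a 2%R * c1 (t, u)) _ _)) _.
    by rewrite addr0.
  by apply: cd_eq (cd_mul (cd_exp e hX) hY) _; rewrite /dB /=.
have XE t : dot a (sphere_point t) = X t.
  rewrite dot3 sphere_point0 sphere_point1 sphere_point2 !rmorphM /X /C /s1 /c1 /s2 /c2 /=.
  by ring.
have key t : e%:R * (a 0 ^+ 2 + a 1 ^+ 2 + a 2%R ^+ 2) * sint (fun x => dot a x ^+ e.-1) t +
    - (e + 2)%:R * sint (fun x => dot a x ^+ e.+1) t = dA t + dB t.
  rewrite /sint XE -/(s1 t).
  have r1 : s1 t ^+ 2 = 1 - c1 t ^+ 2.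
    by rewrite /s1 /c1 -!rmorphXn -(rmorph1 (real_complex R)) -rmorphB -(cos2Dsin2 t.1) addrAC subrr add0r.
  have r2 : s2 t ^+ 2 = 1 - c2 t ^+ 2.
    by rewrite /s2 /c2 -!rmorphXn -(rmorph1 (real_complex R)) -rmorphB -(cos2Dsin2 t.2) addrAC subrr add0r.
  have q1 : X1 t ^+ 2 + Y t ^+ 2 = (a 0 ^+ 2 + a 1 ^+ 2 + a 2%R ^+ 2) - X t ^+ 2.
    rewrite /X1 /Y /X /C; move: (s1 t) (c1 t) (s2 t) (c2 t) r1 r2 => p q u v r1 r2.
    by ring: r1 r2.
  have q2 : c1 t * X1 t - C t = - (s1 t * X t).
    rewrite /X1 /X; move: (s1 t) (c1 t) (C t) r1 => p q u r1.
    by ring: r1.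
  have -> : dA t + dB t = s1 t * (e%:R * X t ^+ e.-1) * (X1 t ^+ 2 + Y t ^+ 2) +
     X t ^+ e * (c1 t * X1 t - C t) - s1 t * (X t ^+ e * X t).
    by rewrite /dA /dB; ring.
  rewrite q1 q2 natrD; case: (e) => [|k] /=.
    by rewrite !mul0r mulr0 mul0r expr1 expr0; ring.
  by rewrite !exprS; ring.
have sc n : scont (fun x => dot a x ^+ n) by apply: scont_exp; exact: scont_dot.
have H : e%:R * (a 0 ^+ 2 + a 1 ^+ 2 + a 2%R ^+ 2) * sphere_integral (fun x => dot a x ^+ e.-1) +
    - (e + 2)%:R * sphere_integral (fun x => dot a x ^+ e.+1) = 0.
  have i1 := sint_integrable (sc e.-1); have i2 := sint_integrable (sc e.+1).
  have mr : measurable rct by exact: measurable_rect.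
  rewrite /sphere_integral -(cintegral_mull mr _ i1) -(cintegral_mull mr _ i2).
  have j1 := cintegrable_mull mr (e%:R * (a 0 ^+ 2 + a 1 ^+ 2 + a 2%R ^+ 2)) i1.
  have j2 := cintegrable_mull mr (- (e + 2)%:R) i2.
  rewrite -(cintegral_add mr j1 j2).
  transitivity (cintegral mu2 rct (fun t => dA t + dB t)); first by apply: eq_cintegral => t _; exact: key.
  by rewrite (cintegral_add mr (ccat_integrable dAc) (ccat_integrable dBc)) iA iB addr0.
by apply/eqP; rewrite -subr_eq0 -oppr_eq0 opprB -mulNr; apply/eqP.
Qed.

Lemma SI_1 : sphere_integral (fun=> 1 : R[i]) = (4 * pi)%:C.
Proof.
rewrite /sphere_integral /cintegral; apply: Cext => /=.
- have c : continuous (fun t : R * R => complex.Re (1 * (sin t.1)%:C : R[i])).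
    by move=> t; have [] := (ccat_ReIm _ _).1 (ccat_mul (ccat_cst 1 t) (sin1_ccat t)).
  rewrite (@rect_integral1 R pi (2 * pi) _ (fun t => 2 * pi * sin t) c)//.
    have H (x : R) : is_derive (x : R^o) (1 : R^o) (fun t : R^o => - (2 * pi * cos t) : R^o) (2 * pi * sin x).
      by apply: is_derive_eq; rewrite /GRing.scale /=; ring.
    rewrite (Rintegral_derive (@pi_gt0 R) H); first by rewrite cospi cos0; lra.
    by move=> x; apply: cvgM; [exact: cvg_cst|exact: continuous_sin].
  move=> x _ /=.
  have H (y : R) : is_derive (y : R^o) (1 : R^o) (fun u : R^o => sin x * u : R^o) (1 * sin x - 0 * 0).
    by apply: is_derive_eq; rewrite /GRing.scale /=; ring.
  have p2 : 0 < 2 * pi :> R by rewrite mulr_gt0// pi_gt0.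
  rewrite (Rintegral_derive p2 H); first by rewrite mulr0 subr0; ring.
  by move=> y; exact: cvg_cst.
- have c : continuous (fun t : R * R => complex.Im (1 * (sin t.1)%:C : R[i])).
    by move=> t; have [] := (ccat_ReIm _ _).1 (ccat_mul (ccat_cst 1 t) (sin1_ccat t)).
  under eq_Rintegral do rewrite mulr0 mul0r addr0.
  by rewrite Rintegral_cst ?mul0r//; exact: measurable_rect.
Qed.

End SphereIntegral.

(** * Spherical harmonics from powers of isotropic forms *)

Section Harmonics.
Context {R : realType}.
Notation E := 'cV[R]_3.
Implicit Types (f g : E -> R[i]) (x y : E).
Notation SI := sphere_integral.

Lemma sumX_ext (n : nat) (c d : nat -> R[i]) :
  (forall t : R[i], \sum_(k < n) c k * t ^+ k = \sum_(k < n) d k * t ^+ k) ->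
  forall k, (k < n)%N -> c k = d k.
Proof.
move=> h k kn; pose p : {poly R[i]} := \poly_(k < n) (c k - d k).
have p0 : p = 0.
  apply/eqP/negP => /negP pn0.
  have rs (m : nat) : root p m%:R.
    rewrite /root horner_poly; under eq_bigr do rewrite mulrBl.
    by rewrite sumrB h subrr.
  have := max_poly_roots pn0 (rs := [seq m%:R | m <- iota 0 (size p)]).
  rewrite size_map size_iota ltnn => H; suff : false by [].
  apply: H; first by apply/allP => z /mapP[m _ ->].
  by rewrite map_inj_uniq ?iota_uniq// => a b /eqP; rewrite eqr_nat => /eqP.
have := congr1 (fun q : {poly R[i]} => q`_k) p0.
by rewrite coef_poly kn coef0 => /eqP; rewrite subr_eq0 => /eqP.
Qed.

Definition ucoord x : R[i] := x 0 0 +i* x 1 0.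
Definition ubar x : R[i] := x 0 0 -i* x 1 0.
Definition zcoord x : R[i] := (x 2%R 0)%:C.

(* the isotropic linear form [dot (av t)] as a polynomial in [t]: its powers are
   generating functions of the harmonic polynomials [H l k] *)
Definition Qp x : {poly R[i]} :=
  (ucoord x)%:P + (2 * zcoord x)%:P * 'X - (ubar x)%:P * 'X^2.
Definition H (l k : nat) x : R[i] := (Qp x ^+ l)`_k.

(* [av t] is isotropic, so that the powers of [dot (av t)] are harmonic *)
Definition av (t : R[i]) (i : 'I_3) : R[i] :=
  if i == 0 then 1 - t ^+ 2 else if i == 1 then (0 +i* 1) * (1 + t ^+ 2) else 2 * t.

Lemma ucoordE x : ucoord x = (x 0 0)%:C + (0 +i* 1) * (x 1 0)%:C.
Proof. by apply: Cext; rewrite /= ; ring. Qed.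
Lemma ubarE x : ubar x = (x 0 0)%:C - (0 +i* 1) * (x 1 0)%:C.
Proof. by apply: Cext; rewrite /= ; ring. Qed.

Lemma Qp_horner x t : (Qp x).[t] = dot (av t) x.
Proof.
rewrite dot3 /av /= /Qp !(hornerD, hornerN, hornerM, hornerC, hornerX, hornerXn) ucoordE ubarE /zcoord.
by move: ((x 0 0)%:C) ((x 1 0)%:C) ((x 2%R 0)%:C) (0 +i* 1) => a b c j; ring.
Qed.

Lemma size_QpX x l : (size (Qp x ^+ l) <= (2 * l).+1)%N.
Proof.
have s3 : (size (Qp x) <= 3)%N.
  rewrite /Qp; apply: (leq_trans (size_polyD _ _)); rewrite size_polyN geq_max; apply/andP; split.
    apply: (leq_trans (size_polyD _ _)); rewrite geq_max (leq_trans (size_polyC_leq1 _))//=.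
    apply: (leq_trans (size_polyMleq _ _)); rewrite size_polyX addn2 /= ltnS.
    exact: leq_trans (size_polyC_leq1 _) _.
  apply: (leq_trans (size_polyMleq _ _)); rewrite size_polyXn addn3 /= ltnS ltnS.
  exact: size_polyC_leq1.
apply: (leq_trans (size_poly_exp_leq _ _)); rewrite ltnS leq_mul2r; apply/orP; right.
by case: (size (Qp x)) s3.
Qed.

Lemma H_gt l k x : (2 * l < k)%N -> H l k x = 0.
Proof. by move=> h; apply: nth_default; exact: leq_trans (size_QpX x l) h. Qed.

Lemma QpX_horner x l t : dot (av t) x ^+ l = \sum_(k < (2 * l).+1) H l k x * t ^+ k.
Proof. by rewrite -Qp_horner -horner_exp (horner_coef_wide _ (size_QpX x l)). Qed.

Lemma Qp_coef_ccat (k : nat) x : ccat (fun x => (Qp x)`_k) x.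
Proof.
have cu : ccat ucoord x.
  have -> : ucoord = (fun x => (x 0 0)%:C + (0 +i* 1) * (x 1 0)%:C) by apply/funext => y; exact: ucoordE.
  by apply: ccat_add; [exact: coord_ccat|apply: ccat_mul; [exact: ccat_cst|exact: coord_ccat]].
have cb : ccat ubar x.
  have -> : ubar = (fun x => (x 0 0)%:C + - ((0 +i* 1) * (x 1 0)%:C)) by apply/funext => y; exact: ubarE.
  by apply: ccat_add; [exact: coord_ccat|apply: ccat_opp; apply: ccat_mul; [exact: ccat_cst|exact: coord_ccat]].
have cz : ccat zcoord x by exact: coord_ccat.
have -> : (fun x => (Qp x)`_k) = (fun x => (ucoord x * (k == 0%N)%:R + 2 * zcoord x * (k == 1%N)%:R) + - (ubar x * (k == 2%N)%:R)).
  apply/funext => y; rewrite /Qp coefB coefD !coefCM coefC coefX coefXn.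
  by case: (k == 0%N); rewrite ?mulr1 ?mulr0.
apply: ccat_add; first apply: ccat_add.
- by apply: ccat_mul => //; exact: ccat_cst.
- by apply: ccat_mul; [apply: ccat_mul => //; exact: ccat_cst|exact: ccat_cst].
- by apply: ccat_opp; apply: ccat_mul => //; exact: ccat_cst.
Qed.

Lemma H_ccat l k x : ccat (H l k) x.
Proof.
elim: l k => [|l IH] k.
  have -> : H 0 k = fun=> (k == 0%N)%:R by apply/funext => y; rewrite /H expr0 coef1.
  exact: ccat_cst.
have -> : H l.+1 k = fun x => \sum_(j < k.+1) (Qp x)`_j * H l (k - j) x.
  by apply/funext => y; rewrite /H exprS coefM.
by apply: ccat_sum => j; apply: ccat_mul; [exact: Qp_coef_ccat|exact: IH].
Qed.

Lemma scont_H l k : scont (H l k). Proof. by move=> x _; exact: H_ccat. Qed.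

Lemma moment_odd a j : SI (fun x => dot a x ^+ (2 * j).+1) = 0.
Proof.
have n0 (n : nat) : (n + 2)%:R != 0 :> R[i] by rewrite addn2 pnatr_eq0.
elim: j => [|j IH].
  have := moment_rec a 0; rewrite !mul0r => /eqP; rewrite mulf_eq0 (negPf (n0 _)) /= => /eqP <-.
  by rewrite muln0.
have := moment_rec a (2 * j).+2; rewrite /= IH mulr0 => /eqP; rewrite mulf_eq0 (negPf (n0 _)) /= => /eqP <-.
by rewrite mulnS.
Qed.

Lemma moment_even a j : SI (fun x => dot a x ^+ (2 * j)) =
  (4 * pi)%:C / (2 * j).+1%:R * (a 0 ^+ 2 + a 1 ^+ 2 + a 2%R ^+ 2) ^+ j.
Proof.
elim: j => [|j IH].
  rewrite muln0 expr0 mulr1 divr1 -SI_1; apply: SI_eq => x _; exact: expr0.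
have := moment_rec a (2 * j).+1; rewrite /= IH.
have -> : (2 * j.+1)%N = (2 * j).+2 by rewrite mulnS.
have n0 : (2 * j).+1%:R != 0 :> R[i] by rewrite pnatr_eq0.
have n1 : (2 * j).+3%:R != 0 :> R[i] by rewrite pnatr_eq0.
rewrite addn2 => e; apply: (mulfI n1); rewrite e.
move: (a 0 ^+ 2 + a 1 ^+ 2 + a 2%R ^+ 2) => A; rewrite [A ^+ j.+1]exprS; move: (A ^+ j) => B.
by move: ((2 * j).+1%:R) ((2 * j).+3%:R) n0 n1 => p q p0 q0; field; rewrite p0 q0.
Qed.

Definition cQ (l : nat) : R[i] := (4 * pi)%:C / (2 * l).+1%:R * (-4) ^+ l / 'C(2 * l, l)%:R.

Lemma cQ_neq0 l : cQ l != 0.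
Proof.
rewrite /cQ !mulf_neq0 ?invr_eq0 ?pnatr_eq0 ?expf_neq0 ?oppr_eq0 ?pnatr_eq0//.
  by rewrite rC_neq0// mulr_gt0// pi_gt0.
by rewrite -lt0n bin_gt0 mul2n -addnn leq_addr.
Qed.

(** Polarization: the moments of [av t + tau * av s] depend only on its sum of squares, which for
    two isotropic vectors is linear in [tau], namely [- 4 * tau * (t - s) ^ 2]. In the expansion in
    powers of [tau] only the middle one survives, which forces [l = l']. *)
Lemma SI_QQ l l' t s : SI (fun x => dot (av t) x ^+ l * dot (av s) x ^+ l') =
  if l == l' then cQ l * (t - s) ^+ (2 * l) else 0.
Proof.
pose d := (l + l')%N.
pose J j := SI (fun x => dot (av t) x ^+ (d - j) * dot (av s) x ^+ j).
pose m : R[i] := (4 * pi)%:C / d.+1%:R * (- 4 * (t - s) ^+ 2) ^+ d./2.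
have key (tau : R[i]) : \sum_(j < d.+1) ('C(d, j)%:R * J j) * tau ^+ j =
    \sum_(j < d.+1) (if ~~ odd d && (j == d./2 :> nat) then m else 0) * tau ^+ j.
  pose a i := av t i + tau * av s i.
  have aE x : dot a x = dot (av t) x + tau * dot (av s) x.
    by rewrite /dot mulr_sumr -big_split; apply: eq_bigr => i _; rewrite /a mulrDl mulrA.
  have aa : a 0 ^+ 2 + a 1 ^+ 2 + a 2%R ^+ 2 = tau * (-4 * (t - s) ^+ 2).
    rewrite /a /av /=.
    have : (0 +i* 1 : R[i]) ^+ 2 = -1 by apply: Cext; rewrite /= ; ring.
    by move: (0 +i* 1 : R[i]) => j j2; ring: j2.
  transitivity (SI (fun x => dot a x ^+ d)).
    transitivity (SI (fun x => \sum_(j < d.+1) ('C(d, j)%:R * tau ^+ j) * (dot (av t) x ^+ (d - j) * dot (av s) x ^+ j))).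
      rewrite SI_sum => [|j]; last first.
        by apply: scont_mull; apply: scont_mul; apply: scont_exp; exact: scont_dot.
      apply: eq_bigr => j _; rewrite SI_mull; last by apply: scont_mul; apply: scont_exp; exact: scont_dot.
      by rewrite /J; ring.
    apply: SI_eq => x _; rewrite aE exprDn; apply: eq_bigr => j _.
    by rewrite exprMn -mulr_natr; ring.
  have [od|ev] := boolP (odd d).
    rewrite big1 => [|j _]; last by rewrite mul0r.
    rewrite -(odd_double_half d) od add1n -mul2n; exact: moment_odd.
  have dE : d = (2 * d./2)%N by rewrite -[LHS]odd_double_half (negPf ev) add0n mul2n.
  rewrite [in LHS]dE moment_even aa -dE.
  have h : (d./2 < d.+1)%N by rewrite ltnS -divn2 leq_div.
  rewrite (bigD1 (Ordinal h)) //= eqxx big1 ?addr0 => [|j jn].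
    by rewrite /m exprMn; ring.
  by rewrite ifF ?mul0r//; apply/eqP => e; move/eqP: jn; apply; exact: val_inj.
have ld : (l' < d.+1)%N by rewrite ltnS leq_addl.
have := sumX_ext (c := fun j => 'C(d, j)%:R * J j) (d := fun j => if ~~ odd d && (j == d./2 :> nat) then m else 0) key ld.
rewrite /J addnK => e.
have C0 : 'C(d, l')%:R != 0 :> R[i] by rewrite pnatr_eq0 -lt0n bin_gt0 leq_addl.
apply: (mulfI C0); rewrite e.
have [ll|ll] := eqVneq l l'.
  rewrite /m /d -ll addnn doubleK eqxx odd_double /= -mul2n /cQ exprMn exprM.
  have C1 : 'C(2 * l, l)%:R != 0 :> R[i] by rewrite pnatr_eq0 -lt0n bin_gt0 mul2n -addnn leq_addr.
  have n1 : (2 * l).+1%:R != 0 :> R[i] by rewrite pnatr_eq0.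
  move: ('C(2 * l, l)%:R) ((2 * l).+1%:R) C1 n1 => p q p0 q0.
  by move: (((t - s) ^+ 2) ^+ l) ((-4) ^+ l) => A B; field; rewrite p0 q0.
rewrite mulr0; case: ifP => // /andP[ev /eqP lE].
by move: ll; rewrite -(eqn_add2r l') -/d addnn lE -[X in X == _]odd_double_half (negPf ev) add0n eqxx.
Qed.

Definition nH (l k : nat) : R[i] := cQ l * ((-1) ^+ (2 * l - k) * 'C(2 * l, k)%:R).

Lemma nH_neq0 l k : (k <= 2 * l)%N -> nH l k != 0.
Proof.
move=> kl; apply: mulf_neq0; first exact: cQ_neq0.
by apply: mulf_neq0; [rewrite expf_neq0// oppr_eq0 oner_eq0|rewrite pnatr_eq0 -lt0n bin_gt0].
Qed.

(** Comparison of the coefficients of [t ^+ k] and [s ^+ k'] in [SI_QQ]. The pairing involves no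
    complex conjugation, so [H l k] pairs with [H l (2 * l - k)]. *)
Lemma SI_HH l k l' k' : (k <= 2 * l)%N -> (k' <= 2 * l')%N ->
  SI (fun x => H l k x * H l' k' x) = if (l == l') && (k + k' == 2 * l)%N then nH l k else 0.
Proof.
rewrite -[(k <= _)%N]ltnS -[(k' <= _)%N]ltnS => kl kl'.
pose S a b := SI (fun x => H l a x * H l' b x).
have sc a b : scont (fun x => H l a x * H l' b x) by apply: scont_mul; exact: scont_H.
have key t s : \sum_(a < (2 * l).+1) (\sum_(b < (2 * l').+1) S a b * s ^+ b) * t ^+ a =
    if l == l' then cQ l * (t - s) ^+ (2 * l) else 0.
  rewrite -SI_QQ.
  transitivity (SI (fun x => \sum_(a < (2 * l).+1) \sum_(b < (2 * l').+1) (t ^+ a * s ^+ b) * (H l a x * H l' b x))).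
    rewrite SI_sum => [|a]; last by apply: scont_sum => b; exact: scont_mull.
    apply: eq_bigr => a _; rewrite SI_sum => [|b]; last exact: scont_mull.
    rewrite mulr_suml; apply: eq_bigr => b _; rewrite SI_mull// /S; ring.
  apply: SI_eq => x _; rewrite !QpX_horner mulr_suml; apply: eq_bigr => a _.
  by rewrite mulr_sumr; apply: eq_bigr => b _; ring.
have [ll|ll] := eqVneq l l'; last first.
  have h1 s : \sum_(b < (2 * l').+1) S k b * s ^+ b = 0.
    have h t : \sum_(a < (2 * l).+1) (\sum_(b < (2 * l').+1) S a b * s ^+ b) * t ^+ a = \sum_(a < (2 * l).+1) 0 * t ^+ a.
      by rewrite key (negPf ll) big1// => i _; rewrite mul0r.
    exact: (sumX_ext (c := fun a => \sum_(b < (2 * l').+1) S a b * s ^+ b) (d := fun=> 0) h kl).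
  have h2 s : \sum_(b < (2 * l').+1) S k b * s ^+ b = \sum_(b < (2 * l').+1) 0 * s ^+ b.
    by rewrite h1 big1// => i _; rewrite mul0r.
  exact: (sumX_ext (c := S k) (d := fun=> 0) h2 kl').
subst l'.
have h1 s : \sum_(b < (2 * l).+1) S k b * s ^+ b = cQ l * ((- s) ^+ (2 * l - k) * 'C(2 * l, k)%:R).
  have h t : \sum_(a < (2 * l).+1) (\sum_(b < (2 * l).+1) S a b * s ^+ b) * t ^+ a =
    \sum_(a < (2 * l).+1) (cQ l * ((- s) ^+ (2 * l - a) * 'C(2 * l, a)%:R)) * t ^+ a.
    rewrite key eqxx addrC exprDn mulr_sumr; apply: eq_bigr => a _.
    by rewrite -mulr_natr; ring.
  exact: (sumX_ext (c := fun a => \sum_(b < (2 * l).+1) S a b * s ^+ b) (d := fun a => cQ l * ((- s) ^+ (2 * l - a) * 'C(2 * l, a)%:R)) h kl).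
have h2 s : \sum_(b < (2 * l).+1) S k b * s ^+ b =
   \sum_(b < (2 * l).+1) (if (k + b == 2 * l)%N then nH l k else 0) * s ^+ b.
  have kk : (2 * l - k < (2 * l).+1)%N by rewrite ltnS leq_subr.
  rewrite h1 (bigD1 (Ordinal kk)) //= subnKC// eqxx big1 ?addr0 => [|b bn].
    by rewrite /nH [(- s) ^+ _]exprNn; ring.
  rewrite ifF ?mul0r//; apply/eqP => e; move/eqP: bn; apply; apply: val_inj => /=.
  by have := congr1 (subn^~ k) e; rewrite /= addKn.
exact: (sumX_ext (c := S k) (d := fun b => if (k + b == 2 * l)%N then nH l k else 0) h2 kl').
Qed.

End Harmonics.

(** * A polynomial approximate identity on the sphere and rotation invariance of the integral *)

Section Kernel.
Context {R : realType}.
Notation E := 'cV[R]_3.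
Notation rct := (rect (pi : R) (2 * pi)).
Implicit Types (f g : E -> R[i]) (x y : E).
Notation SI := sphere_integral.

Definition cv y (i : 'I_3) : R[i] := (y i 0)%:C.
Definition rd x y : R := x 0 0 * y 0 0 + x 1 0 * y 1 0 + x 2%R 0 * y 2%R 0.

Lemma dot_cv y x : dot (cv y) x = (rd y x)%:C.
Proof. by rewrite dot3 /cv /rd !rmorphD !rmorphM. Qed.

Lemma rdC x y : rd x y = rd y x. Proof. by rewrite /rd; ring. Qed.

Lemma rd_enorm x : rd x x = enorm x ^+ 2.
Proof. by rewrite enorm_sqr /rd !expr2. Qed.

Lemma unit_sqr x : enorm x = 1 -> x 0 0 ^+ 2 + x 1 0 ^+ 2 + x 2%R 0 ^+ 2 = 1.
Proof. by move=> h; rewrite -enorm_sqr h expr1n. Qed.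

Lemma rd_bound x y : enorm x = 1 -> enorm y = 1 -> 0 <= 1 + rd x y <= 2.
Proof.
move=> /unit_sqr hx /unit_sqr hy; rewrite /rd.
have := sqr_ge0 (x 0 0 - y 0 0); have := sqr_ge0 (x 1 0 - y 1 0); have := sqr_ge0 (x 2%R 0 - y 2%R 0).
have := sqr_ge0 (x 0 0 + y 0 0); have := sqr_ge0 (x 1 0 + y 1 0); have := sqr_ge0 (x 2%R 0 + y 2%R 0).
move: (x 0 0) (x 1 0) (x 2%R 0) (y 0 0) (y 1 0) (y 2%R 0) hx hy => a b c p q r hx hy.
by move=> *; apply/andP; split; lra.
Qed.

Lemma norm_le_enorm x : `|x| <= enorm x.
Proof.
rewrite [`|x|]mx_normrE; apply: bigmax_le => [|[i j] _]; first exact: enorm_ge0.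
rewrite /= (ord1 j) -sqrtr_sqr enorm3 ler_wsqrtr//.
have h0 := sqr_ge0 (x 0 0); have h1 := sqr_ge0 (x 1 0); have h2 := sqr_ge0 (x 2%R 0).
by move: i; apply: ord3P; lra.
Qed.

Lemma scont_unit_near f y (e : R) : scont f -> enorm y = 1 -> 0 < e ->
  exists2 d : R, 0 < d <= 1 & forall x, enorm x = 1 -> 1 - rd y x < d -> normc (f x - f y) < e.
Proof.
move=> hf y1 e0; have /climP/(_ e e0) := hf y (sphere_neq0 y1).
case/nbhs_normP => r /= r0 hr; exists (Num.min 1 (r ^+ 2 / 2)).
  by rewrite lt_min ltr01 divr_gt0 ?exprn_gt0//= ge_min lexx.
move=> x x1; rewrite lt_min => /andP[_ h]; apply: hr => /=.
apply: (le_lt_trans (norm_le_enorm _)).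
rewrite -(@ltr_pXn2r _ 2) ?nnegrE ?enorm_ge0 ?(ltW r0)//.
move: h; rewrite -rd_enorm ltr_pdivlMr// /rd !mxE => h.
have := unit_sqr x1; have := unit_sqr y1.
by move: h; lra.
Qed.

Definition kernel_mass (n : nat) : R := \sum_(d < n.+1) (if odd d then 0 else 4 * pi / d.+1%:R * 'C(n, d)%:R).

Lemma SI_kernel n y : enorm y = 1 -> SI (fun x => (1 + dot (cv y) x) ^+ n) = (kernel_mass n)%:C.
Proof.
move=> y1.
transitivity (SI (fun x => \sum_(d < n.+1) 'C(n, d)%:R * dot (cv y) x ^+ d)).
  apply: SI_eq => x _; rewrite exprDn; apply: eq_bigr => d _.
  by rewrite expr1n mul1r mulr_natl.
rewrite SI_sum => [|d]; last by apply: scont_mull; apply: scont_exp; exact: scont_dot.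
rewrite /kernel_mass rmorph_sum; apply: eq_bigr => d _.
rewrite SI_mull; last by apply: scont_exp; exact: scont_dot.
have [od|ev] := boolP (odd d).
  have dE : nat_of_ord d = (2 * d./2).+1 by rewrite -[LHS]odd_double_half od mul2n.
  have -> : (fun x => dot (cv y) x ^+ d) = (fun x => dot (cv y) x ^+ (2 * d./2).+1) by rewrite -dE.
  by rewrite moment_odd mulr0.
have dE : nat_of_ord d = (2 * d./2)%N by rewrite -[LHS]odd_double_half (negPf ev) add0n mul2n.
have -> : (fun x => dot (cv y) x ^+ d) = (fun x => dot (cv y) x ^+ (2 * d./2)) by rewrite -dE.
rewrite moment_even -dE.
have -> : cv y 0 ^+ 2 + cv y 1 ^+ 2 + cv y 2%R ^+ 2 = 1.
  by rewrite /cv -!rC_X -!rmorphD (unit_sqr y1).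
transitivity ((4 * pi / d.+1%:R * 'C(n, d)%:R)%:C : R[i]) => //.
by rewrite expr1n mulr1 !rC_mul rC_inv !rC_nat; ring.
Qed.

(** In the sum over even [d] each [d.+1] is replaced by [n.+1]; the even binomial coefficients make
    up at least half of [2 ^+ n] because the alternating sum (1 - 1)^n is nonnegative. The loss
    against the maximum [2 ^+ n] of the kernel is thus only polynomial. *)
Lemma kernel_mass_lower n : 2 * pi * 2 ^+ n / n.+1%:R <= kernel_mass n.
Proof.
have p0 : 0 < pi :> R := pi_gt0 R.
have e1 : (2 : R) ^+ n = \sum_(d < n.+1) 'C(n, d)%:R.
  rewrite -[2]/(1 + 1) exprDn; apply: eq_bigr => d _.
  by rewrite !expr1n mulr1.
have e2 : 0 <= \sum_(d < n.+1) (-1) ^+ d * 'C(n, d)%:R :> R.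
  have : (1 - 1 : R) ^+ n = \sum_(d < n.+1) (-1) ^+ d * 'C(n, d)%:R.
    rewrite exprBn; apply: eq_bigr => d _; by rewrite !expr1n !mulr1 mulr_natr.
  by move=> <-; rewrite subrr exprn_ge0.
apply: (@le_trans _ _ (2 * pi / n.+1%:R * (\sum_(d < n.+1) ('C(n, d)%:R + (-1) ^+ d * 'C(n, d)%:R)))).
  rewrite big_split /= -e1 mulrAC ler_wpM2l//.
    by rewrite !mulr_ge0 ?invr_ge0 ?(ltW p0).
  by rewrite lerDl.
rewrite /kernel_mass mulr_sumr; apply: ler_sum => d _.
have [od|ev] := boolP (odd d).
  by rewrite -signr_odd od expr1 mulN1r subrr mulr0.
rewrite -signr_odd (negPf ev) expr0 mul1r.
have -> : 2 * pi / n.+1%:R * ('C(n, d)%:R + 'C(n, d)%:R) = 4 * pi / n.+1%:R * 'C(n, d)%:R :> R by ring.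
rewrite ler_wpM2r// ler_wpM2l ?mulr_ge0 ?(ltW p0)// lef_pV2 ?posrE ?ltr0n//.
by rewrite ler_nat ltn_ord.
Qed.

Lemma kernel_mass_gt0 n : 0 < kernel_mass n.
Proof. by apply: lt_le_trans (kernel_mass_lower n); rewrite !(mulr_gt0, divr_gt0, exprn_gt0) ?pi_gt0. Qed.

Lemma SI_le f (g : E -> R) : scont f -> scont (fun x => (g x)%:C) ->
  (forall t, rct t -> normc (f (sphere_point t)) <= g (sphere_point t)) ->
  normc (SI f) <= 2 * complex.Re (SI (fun x => (g x)%:C)).
Proof.
move=> hf hg fg.
have [ig _] := sint_integrable hg.
apply: le_trans (normc_cintegral_le (measurable_rect _ _) (sint_integrable hf) ig _) _.
  move=> t rt; rewrite normc_mul normc_real.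
  have s0 : 0 <= sin t.1 :> R.
    have : t.1 \in `[0, pi] by case: rt.
    exact: sin_ge0_pi.
  by rewrite ger0_norm// /sint cReM /= mulr0 subr0 ler_wpM2r// fg.
by [].
Qed.

(** Average of [f] against the kernel (1 + x.y)^n of mass [kernel_mass n], which concentrates at [y]
    as [n] grows. Being polynomial in [y], it realizes the Weierstrass approximation on the sphere
    explicitly. *)
Definition Tk (n : nat) f y : R[i] := ((kernel_mass n)^-1)%:C * SI (fun x => f x * (1 + dot (cv y) x) ^+ n).

Lemma scont_kernel n y : scont (fun x => (1 + dot (cv y) x) ^+ n).
Proof. by apply: scont_exp; apply: scont_add; [exact: scont_cst|exact: scont_dot]. Qed.

Lemma kernelE n y x : (1 + dot (cv y) x) ^+ n = ((1 + rd y x) ^+ n)%:C.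
Proof. by rewrite dot_cv rC_X; congr (_ ^+ _); apply: Cext; rewrite /= ?addr0. Qed.

Lemma kernel_ge0 n y x : enorm y = 1 -> enorm x = 1 -> 0 <= (1 + rd y x) ^+ n.
Proof. by move=> y1 x1; have /andP[h _] := rd_bound y1 x1; rewrite exprn_ge0. Qed.

Lemma SI_real_kernel n y : enorm y = 1 -> complex.Re (SI (fun x => ((1 + rd y x) ^+ n)%:C)) = kernel_mass n.
Proof.
move=> y1; transitivity (complex.Re (kernel_mass n)%:C) => //; congr complex.Re.
by rewrite -(SI_kernel n y1); apply: SI_eq => x _; rewrite kernelE.
Qed.

Lemma Tk_bound n f y M : scont f -> enorm y = 1 ->
  (forall t, rct t -> normc (f (sphere_point t)) <= M) -> normc (Tk n f y) <= 2 * M.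
Proof.
move=> hf y1 hM; have k0 := kernel_mass_gt0 n.
rewrite /Tk normc_mul normc_real ger0_norm ?invr_ge0 ?(ltW k0)// ler_pdivrMl//.
have sk : scont (fun x => ((1 + rd y x) ^+ n)%:C).
  by have := scont_kernel n y; under eq_fun do rewrite kernelE.
have sg : scont (fun x => (M * (1 + rd y x) ^+ n)%:C).
  by under eq_fun do rewrite rC_mul; exact: scont_mull.
apply: le_trans (SI_le (scont_mul hf (scont_kernel n y)) sg _) _.
  move=> t rt; rewrite normc_mul kernelE normc_real.
  by rewrite ger0_norm ?kernel_ge0 ?sphere_point_norm// ler_wpM2r ?kernel_ge0 ?sphere_point_norm// hM.
have -> : (fun x => (M * (1 + rd y x) ^+ n)%:C) = (fun x => M%:C * ((1 + rd y x) ^+ n)%:C).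
  by apply/funext => x; rewrite rC_mul.
rewrite SI_mull// cReM SI_real_kernel// /= mul0r subr0; lra.
Qed.

Lemma Tk_diff n f y : scont f -> enorm y = 1 ->
  Tk n f y - f y = ((kernel_mass n)^-1)%:C * SI (fun x => (f x - f y) * (1 + dot (cv y) x) ^+ n).
Proof.
move=> hf y1; have sk := scont_kernel n y.
have -> : SI (fun x => (f x - f y) * (1 + dot (cv y) x) ^+ n) =
   SI (fun x => f x * (1 + dot (cv y) x) ^+ n) + (- f y) * SI (fun x => (1 + dot (cv y) x) ^+ n).
  rewrite -SI_mull// -SI_add//; [|exact: scont_mul|exact: scont_mull].
  by apply: SI_eq => x _; ring.
rewrite SI_kernel// mulrDr /Tk mulrCA rC_inv mulVf ?mulr1//.
by rewrite rC_neq0// kernel_mass_gt0.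
Qed.

Lemma geometric_nat_cvg0 (q : R) : 0 <= q < 1 -> (fun n : nat => n.+1%:R * q ^+ n) @ \oo --> (0 : R).
Proof.
move=> /andP[q0 q1]; pose h := 1 - q; have h0 : 0 < h by rewrite subr_gt0.
have key (n : nat) : n.+1%:R * q ^+ n <= (2 * expR h / h ^+ 2) * n.+1%:R^-1.
  have n0 : 0 < n.+1%:R :> R by [].
  have hq : q <= expR (- h) by have := expR_ge1Dx (- h); rewrite /h; lra.
  have hqn : q ^+ n <= expR (- h) ^+ n by rewrite lerXn2r ?nnegrE ?expR_ge0.
  have hE : expR (- h) ^+ n = expR h * expR (- (n.+1%:R * h)).
    by rewrite -expRM_natl -expRD; congr expR; rewrite -natr1; ring.
  have hx : expR (- (n.+1%:R * h)) <= 2 / (n.+1%:R * h) ^+ 2.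
    have xp : 0 < n.+1%:R * h by rewrite mulr_gt0.
    rewrite expRN -[2 / _]invf_div lef_pV2 ?posrE ?expR_gt0 ?divr_gt0 ?exprn_gt0//.
    by have := expR_ge1Dxn 1 (ltW xp); rewrite !factS fact0 muln1/=; lra.
  apply: (@le_trans _ _ (n.+1%:R * (expR h * (2 / (n.+1%:R * h) ^+ 2)))).
    by rewrite ler_wpM2l ?(ltW n0)// (le_trans hqn)// hE ler_wpM2l// expR_ge0.
  by rewrite le_eqVlt; apply/orP; left; apply/eqP; field; rewrite !gt_eqF.
apply: (@squeeze_cvgr _ _ _ _ (fun=> 0) (fun n : nat => (2 * expR h / h ^+ 2) * n.+1%:R^-1)).
- by apply: nearW => n; rewrite key andbT mulr_ge0 ?exprn_ge0.
- exact: cvg_cst.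
- rewrite -[X in _ --> X](mulr0 (2 * expR h / h ^+ 2)); apply: cvgM; first exact: cvg_cst.
  exact: cvg_harmonic.
Qed.

Lemma Tk_cvg f y : scont f -> enorm y = 1 -> cvgc (fun n => Tk n f y) (f y).
Proof.
move=> hf y1; apply/(climP (F := \oo)) => e e0.
have e8 : 0 < e / 8 by rewrite divr_gt0.
have [d /andP[d0 d1] hd] := scont_unit_near hf y1 e8.
have [M0 M00 hM0] := scont_bounded hf.
pose M := M0 + normc (f y).
have M_gt0 : 0 < M by rewrite ltr_wpDr ?normc_ge0.
have hM t : rct t -> normc (f (sphere_point t) - f y) <= M.
  by move=> rt; rewrite (le_trans (normc_sub _ _))// lerD2r hM0.
(* Outside the cap where [1 - rd y x < d] the kernel is at most [(2 - d) ^+ n], that is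
   [2 ^+ n * q ^+ n], while the mass is at least a multiple of [2 ^+ n / n.+1]; hence the role of
   [n.+1%:R * q ^+ n]. *)
pose q := 1 - d / 2.
have q01 : 0 <= q < 1 by apply/andP; split; rewrite /q; lra.
have e2 : 0 < e / (8 * M) by rewrite divr_gt0// mulr_gt0.
have /cvgrPdist_lt/(_ _ e2) hq := geometric_nat_cvg0 q01.
near=> n.
have hn : n.+1%:R * q ^+ n < e / (8 * M).
  have : `|0 - n.+1%:R * q ^+ n| < e / (8 * M) by near: n; exact: hq.
  by rewrite sub0r normrN => /(le_lt_trans (ler_norm _)).
have k0 := kernel_mass_gt0 n.
rewrite Tk_diff// normc_mul normc_real ger0_norm ?invr_ge0 ?(ltW k0)//.
pose g x := e / 8 * (1 + rd y x) ^+ n + M * (2 - d) ^+ n.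
have sk : scont (fun x => ((1 + rd y x) ^+ n)%:C).
  by have := scont_kernel n y; under eq_fun do rewrite kernelE.
have gE : (fun x => (g x)%:C) = (fun x => (e / 8)%:C * ((1 + rd y x) ^+ n)%:C + (M * (2 - d) ^+ n)%:C * 1).
  by apply/funext => x; rewrite /g rC_add !rC_mul mulr1.
have sg : scont (fun x => (g x)%:C).
  by rewrite gE; apply: scont_add; [exact: scont_mull|exact: scont_cst].
have sf : scont (fun x => (f x - f y) * (1 + dot (cv y) x) ^+ n).
  by apply: scont_mul; [apply: scont_add => //; exact: scont_cst|exact: scont_kernel].
have p2 : 0 <= (2 - d) ^+ n by rewrite exprn_ge0//; lra.
have H := SI_le sf sg.
rewrite ltr_pdivrMl//; apply: (le_lt_trans (H _)) => [t rt|].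
  rewrite normc_mul kernelE normc_real.
  have K0 := kernel_ge0 n y1 (sphere_point_norm t).
  rewrite (ger0_norm K0) /g.
  have [h|h] := ltP (1 - rd y (sphere_point t)) d.
    rewrite (@le_trans _ _ (e / 8 * (1 + rd y (sphere_point t)) ^+ n))//.
      by rewrite ler_wpM2r// ltW// hd// sphere_point_norm.
    by rewrite lerDl mulr_ge0// ltW.
  rewrite (@le_trans _ _ (M * (2 - d) ^+ n))//.
    rewrite ler_pM ?normc_ge0 ?hM//.
    rewrite lerXn2r ?nnegrE//; last lra.
    - by have /andP[] := rd_bound y1 (sphere_point_norm t).
    - lra.
  by rewrite lerDr mulr_ge0// ltW// divr_gt0.
rewrite gE SI_add ?SI_mull//; last 3 first.
- exact: scont_cst.
- exact: scont_mull.
- exact: scont_cst.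
rewrite SI_1 cReD !cReM SI_real_kernel// /= !mul0r !subr0.
have hk := kernel_mass_lower n.
have n0 : 0 < n.+1%:R :> R by [].
have p0 : 0 < pi :> R := pi_gt0 R.
have h2 : (2 - d) ^+ n = 2 ^+ n * q ^+ n by rewrite -exprMn; congr (_ ^+ _); rewrite /q; field.
have h3 : M * (2 - d) ^+ n * (4 * pi) <= e / 4 * kernel_mass n.
  have t0 : 0 <= 2 * pi * 2 ^+ n / n.+1%:R :> R.
    by rewrite !(mulr_ge0, divr_ge0, exprn_ge0) ?(ltW p0).
  have -> : M * (2 - d) ^+ n * (4 * pi) = (2 * M * (n.+1%:R * q ^+ n)) * (2 * pi * 2 ^+ n / n.+1%:R).
    by rewrite h2; field; rewrite gt_eqF.
  apply: ler_pM => //.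
    by case/andP: q01 => qq _; rewrite !mulr_ge0 ?exprn_ge0 ?(ltW M_gt0).
  by move: hn; rewrite ltr_pdivlMr ?mulr_gt0//; lra.
have ek : 0 < e * kernel_mass n by rewrite mulr_gt0.
lra.
Unshelve. all: end_near. Qed.

(** The index 0 stands for the constant 1, so that [1 + dot (cv y) x] is a sum of four products and
    its powers expand over words of length [n] in four letters. *)
Definition kcoord (j : 'I_4) x : R[i] := if unlift 0 j is Some i then (x i 0)%:C else 1.
Definition mon (n : nat) (m : {ffun 'I_n -> 'I_4}) x : R[i] := \prod_(j < n) kcoord (m j) x.

Lemma kernel_mon n x y : (1 + dot (cv y) x) ^+ n = \sum_(m : {ffun 'I_n -> 'I_4}) mon m x * mon m y.
Proof.
have -> : 1 + dot (cv y) x = \sum_(j < 4) kcoord j x * kcoord j y.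
  rewrite big_ord_recl /kcoord unlift_none mulr1; congr (_ + _).
  by apply: eq_bigr => i _; rewrite liftK mulrC.
have -> : forall a : R[i], a ^+ n = \prod_(i < n) a by move=> a; rewrite prodr_const card_ord.
rewrite bigA_distr_bigA; apply: eq_bigr => m _.
by rewrite big_split.
Qed.

Lemma scont_prod (I : Type) (s : seq I) (F : I -> E -> R[i]) :
  (forall i, scont (F i)) -> scont (fun x => \prod_(i <- s) F i x).
Proof.
move=> h; elim: s => [|i s IH].
  by under eq_fun do rewrite big_nil; exact: scont_cst.
by under eq_fun do rewrite big_cons; exact: scont_mul.
Qed.

Lemma scont_mon n (m : {ffun 'I_n -> 'I_4}) : scont (mon m).
Proof.
apply: scont_prod => j; rewrite /kcoord; case: (unlift _ _) => [i|]; last exact: scont_cst.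
by move=> x _; exact: coord_ccat.
Qed.

Lemma Tk_mon n f y : scont f -> Tk n f y =
  ((kernel_mass n)^-1)%:C * \sum_(m : {ffun 'I_n -> 'I_4}) SI (fun x => f x * mon m x) * mon m y.
Proof.
move=> hf; rewrite /Tk; congr (_ * _).
have sm m : scont (fun x => mon m y * (f x * mon m x)).
  by apply: scont_mull; apply: scont_mul => //; exact: scont_mon.
transitivity (SI (fun x => \sum_(m : {ffun 'I_n -> 'I_4}) mon m y * (f x * mon m x))).
  by apply: SI_eq => x _; rewrite kernel_mon mulr_sumr; apply: eq_bigr => m _; ring.
rewrite SI_sum//; apply: eq_bigr => m _; rewrite SI_mull 1?mulrC//.
by apply: scont_mul => //; exact: scont_mon.
Qed.

Lemma sphere_complete f : scont f ->
  (forall n (m : {ffun 'I_n -> 'I_4}), SI (fun x => f x * mon m x) = 0) ->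
  forall y, enorm y = 1 -> f y = 0.
Proof.
move=> hf h y y1; have H := Tk_cvg hf y1.
have H0 : clim \oo (fun n => Tk n f y) 0.
  have H0 : clim \oo (fun=> 0 : R[i]) 0 by exact: clim_cst.
  apply: clim_near H0; apply: nearW => n; rewrite Tk_mon// big1 ?mulr0// => m _.
  by rewrite h mul0r.
exact: (clim_unique (F := \oo) H H0).
Qed.

Section Rotation.
Variable A : 'M[R]_3.
Hypothesis AO : A *m A^T = 1%:M.

Lemma rd_mulmx x y : rd (A *m x) y = rd x (A^T *m y).
Proof.
have rdE (a b : E) : rd a b = (a^T *m b) 0 0.
  by rewrite !mxE !big_ord_recl big_ord0 /rd !mxE addr0 addrA;
    congr (_ * _ + _ * _ + _ * _); congr (_ _ _); apply: val_inj.
by rewrite !rdE trmx_mul mulmxA.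
Qed.

Lemma rd_mulmxT x y : rd (A^T *m x) y = rd x (A *m y).
Proof. by rewrite [RHS]rdC rd_mulmx rdC. Qed.

Lemma enorm_orth x : enorm (A^T *m x) = enorm x.
Proof.
apply/eqP; rewrite -(@eqrXn2 _ 2) ?enorm_ge0// -!rd_enorm; apply/eqP.
by rewrite -rd_mulmx mulmxA AO mul1mx.
Qed.

Lemma mulmx_continuous (B : 'M[R]_3) : continuous (fun x : E => B *m x).
Proof.
have -> : (fun x : E => B *m x) = fun x => \sum_(i < 3) x i 0 *: (B *m delta_mx i 0).
  apply/funext => x; rewrite [in LHS](_ : x = \sum_(i < 3) x i 0 *: delta_mx i 0); last first.
    by rewrite [LHS]matrix_sum_delta; apply: eq_bigr => i _; rewrite big_ord1.
  by rewrite mulmx_sumr; apply: eq_bigr => i _; rewrite -scalemxAr.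
under eq_fun do rewrite !big_ord_recl big_ord0 addr0.
move=> x.
have h (i : 'I_3) (v : E) : {for x, continuous (fun x : E => x i 0 *: v)}.
  have c : {for x, continuous (fun x : E => x i 0)} by exact: coord_continuous.
  exact: (cvgZr_tmp c).
have hD (f g : E -> E) : {for x, continuous f} -> {for x, continuous g} -> {for x, continuous (fun y => f y + g y)}.
  by move=> hf hg; exact: (@cvgD _ _ _ (nbhs x) _ f g _ _ hf hg).
exact: (hD _ _ (h _ _) (hD _ _ (h _ _) (h _ _))).
Qed.

Lemma unitA : A^T *m A = 1%:M. Proof. exact: mulmx1C. Qed.

Lemma scont_orth f : scont f -> scont (fun x => f (A *m x)).
Proof.
move=> hf x x0; apply: ccat_comp; first exact: mulmx_continuous.
apply: hf; apply: contra x0 => /eqP e.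
by rewrite -[x]mul1mx -unitA -mulmxA e mulmx0.
Qed.

(** Polar coordinates hide the invariance. For [Tk n f] it follows by exchanging the two
    integrations: the kernel at [(x, A *m y)] is the kernel at [(A^T *m x, y)], and its integral
    over [y] does not depend on the centre. The general case is the limit in [n], by bounded
    convergence. *)
Lemma SI_orth f : scont f -> SI (fun x => f (A *m x)) = SI f.
Proof.
move=> hf; have [M M0 hM] := scont_bounded hf.
have en y : enorm y = 1 -> enorm (A *m y) = 1.
  by move=> y1; rewrite -enorm_orth mulmxA unitA mul1mx.
have scT n : scont (fun y => Tk n f (A *m y)).
  have -> : (fun y => Tk n f (A *m y)) = (fun y => \sum_(m : {ffun 'I_n -> 'I_4})
      (((kernel_mass n)^-1)%:C * SI (fun x => f x * mon m x)) * mon m (A *m y)).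
    by apply/funext => y; rewrite Tk_mon// mulr_sumr; apply: eq_bigr => m _; rewrite mulrA.
  by apply: scont_sum => m; apply: scont_mull; apply: scont_orth; exact: scont_mon.
have cT : cvgc (fun n => SI (fun y => Tk n f (A *m y))) (SI (fun y => f (A *m y))).
  apply: (SI_bounded_cvg (M := 2 * M)) => //.
  - exact: scont_orth.
  - by move=> y y1; apply: Tk_cvg => //; exact: en.
  - by move=> n y y1; apply: Tk_bound => //; exact: en.
have eT n : SI (fun y => Tk n f (A *m y)) = SI f.
  have smA m : scont (fun y => @mon n m (A *m y)) by apply: scont_orth; exact: scont_mon.
  have sfm m : scont (fun x => f x * @mon n m x) by apply: scont_mul => //; exact: scont_mon.
  transitivity (((kernel_mass n)^-1)%:C * \sum_(m : {ffun 'I_n -> 'I_4}) SI (fun x => f x * mon m x) * SI (fun y => mon m (A *m y))).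
    transitivity (SI (fun y => \sum_(m : {ffun 'I_n -> 'I_4})
      (((kernel_mass n)^-1)%:C * SI (fun x => f x * mon m x)) * mon m (A *m y))).
      by apply: SI_eq => y _; rewrite Tk_mon// mulr_sumr; apply: eq_bigr => m _; rewrite mulrA.
    rewrite SI_sum => [|m]; last exact: scont_mull.
    rewrite mulr_sumr; apply: eq_bigr => m _; rewrite !SI_mull//.
    by rewrite mulrA.
  have -> : \sum_(m : {ffun 'I_n -> 'I_4}) SI (fun x => f x * mon m x) * SI (fun y => mon m (A *m y)) =
      SI (fun x => (kernel_mass n)%:C * f x).
    transitivity (SI (fun x => \sum_(m : {ffun 'I_n -> 'I_4}) SI (fun y => mon m (A *m y)) * (f x * mon m x))).
      rewrite SI_sum => [|m]; last exact: scont_mull.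
      by apply: eq_bigr => m _; rewrite SI_mull// mulrC.
    apply: SI_eq => x x1.
    have x1' : enorm (A^T *m x) = 1 by rewrite enorm_orth.
    rewrite -(SI_kernel n x1').
    transitivity (SI (fun y => \sum_(m : {ffun 'I_n -> 'I_4}) mon m x * mon m (A *m y)) * f x).
      rewrite SI_sum => [|m]; last exact: scont_mull.
      by rewrite mulr_suml; apply: eq_bigr => m _; rewrite SI_mull//; ring.
    congr (_ * _); apply: SI_eq => y _.
    rewrite dot_cv rd_mulmxT -dot_cv kernel_mon.
    by apply: eq_bigr => m _; rewrite mulrC.
  rewrite SI_mull// mulrA rC_inv mulVf ?mul1r//.
  by rewrite rC_neq0// kernel_mass_gt0.
apply/esym; apply: (clim_unique (F := \oo) _ cT).
have H0 : clim \oo (fun=> SI f) (SI f) by exact: clim_cst.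
by apply: clim_near H0; apply: nearW => n; rewrite eT.
Qed.
End Rotation.
End Kernel.

(** * Completeness of the harmonics: their span is stable under multiplication by coordinates *)

Section Completeness.
Context {R : realType}.
Notation E := 'cV[R]_3.
Implicit Types (f g : E -> R[i]) (x y : E).
Notation SI := sphere_integral.

Definition hspan f : Prop := exists s : seq (R[i] * (nat * nat)),
  forall x, enorm x = 1 -> f x = \sum_(p <- s) p.1 * H p.2.1 p.2.2 x.

Lemma hspan_H l k : hspan (H l k).
Proof. by exists [:: (1, (l, k))] => x _; rewrite big_seq1 mul1r. Qed.

Lemma hspan_eq f g : (forall x, enorm x = 1 -> f x = g x) -> hspan f -> hspan g.
Proof. by move=> fg [s hs]; exists s => x x1; rewrite -fg// hs. Qed.

Lemma hspan_add f g : hspan f -> hspan g -> hspan (fun x => f x + g x).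
Proof. by move=> [s hs] [t ht]; exists (s ++ t) => x x1; rewrite big_cat /= hs// ht. Qed.

Lemma hspan_mull c f : hspan f -> hspan (fun x => c * f x).
Proof.
move=> [s hs]; exists [seq (c * p.1, p.2) | p <- s] => x x1.
by rewrite hs// mulr_sumr big_map; apply: eq_bigr => p _; rewrite mulrA.
Qed.

Lemma hspan0 : hspan (fun=> 0). Proof. by exists [::] => x _; rewrite big_nil. Qed.

Lemma hspan_sum (I : Type) (s : seq I) (F : I -> E -> R[i]) : (forall i, hspan (F i)) ->
  hspan (fun x => \sum_(i <- s) F i x).
Proof.
move=> h; elim: s => [|i s IH]; first by under eq_fun do rewrite big_nil; exact: hspan0.
by under eq_fun do rewrite big_cons; exact: hspan_add.
Qed.

Lemma hspan_closed (q : E -> R[i]) : (forall l k, hspan (fun x => q x * H l k x)) ->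
  forall f, hspan f -> hspan (fun x => q x * f x).
Proof.
move=> h f [s hs].
apply: (@hspan_eq (fun x => \sum_(p <- s) p.1 * (q x * H p.2.1 p.2.2 x))).
  by move=> x x1; rewrite hs// mulr_sumr; apply: eq_bigr => p _; rewrite mulrCA.
by apply: hspan_sum => p; apply: hspan_mull.
Qed.

Lemma natP (n : nat) : n%:R = (n%:R)%:P :> {poly R[i]}.
Proof. by rewrite -polyC_natr. Qed.

Lemma Qp_deriv x : (Qp x)^`() = (2 * zcoord x)%:P - (2 * ubar x)%:P * 'X.
Proof.
rewrite /Qp derivB derivD !derivM !derivC !derivX !polyCM -!natP.
by ring.
Qed.

Lemma unit_uz x : enorm x = 1 -> zcoord x ^+ 2 + ucoord x * ubar x = 1.
Proof.
move=> /unit_sqr h; rewrite /zcoord ucoordE ubarE.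
have j2 : (0 +i* 1 : R[i]) ^+ 2 = -1 by apply: Cext; rewrite /= ; ring.
transitivity ((x 0 0 ^+ 2 + x 1 0 ^+ 2 + x 2%R 0 ^+ 2)%:C : R[i]); last by rewrite h.
rewrite !rC_add !rC_X; move: (0 +i* 1 : R[i]) j2 => j j2.
by move: ((x 0 0)%:C) ((x 1 0)%:C) ((x 2%R 0)%:C) => a b c; ring: j2.
Qed.

Lemma Qp_derivX x n : (Qp x ^+ n.+1)^`() = n.+1%:R * ((2 * zcoord x)%:P - (2 * ubar x)%:P * 'X) * Qp x ^+ n.
Proof. by rewrite deriv_exp /= Qp_deriv -mulr_natl mulrA. Qed.

Lemma coefPM (c : R[i]) (p : {poly R[i]}) k : (c%:P * p)`_k = c * p`_k.
Proof. exact: coefCM. Qed.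

(** Coefficients of the derivative of [Qp x ^+ l.+1], computed in two ways. The remaining term in
    [ubar] is the reason why multiplication by [ubar] is settled first. *)
Lemma zcoord_H l k x : 2 * l.+1%:R * (zcoord x * H l k x) =
  k.+1%:R * H l.+1 k.+1 x + 2 * l.+1%:R * (ubar x * (if k is k'.+1 then H l k' x else 0)).
Proof.
have e := congr1 (fun p : {poly R[i]} => p`_k) (Qp_derivX x l).
rewrite /= coef_deriv -[_ *+ k.+1]mulr_natl in e.
have e2 : l.+1%:R * ((2 * zcoord x)%:P - (2 * ubar x)%:P * 'X) * Qp x ^+ l =
  (2 * l.+1%:R * zcoord x)%:P * Qp x ^+ l - (2 * l.+1%:R * ubar x)%:P * (Qp x ^+ l * 'X).
  by rewrite (natP l.+1) !polyCM; ring.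
rewrite e2 coefB !coefPM coefMX in e.
rewrite /H e; case: k {e} => [|k] /=; ring.
Qed.

(** Coefficients of the second derivative of [Qp x ^+ l.+1]. On the unit sphere the square of the
    derivative of [Qp x] is [4 - 4 * ubar x * Qp x], a discriminant identity that leaves only powers
    of [Qp x] and a single factor [ubar x]. *)
Lemma ubar_H l k x : enorm x = 1 -> 2 * (2 * l + 1)%:R * l.+1%:R * (ubar x * H l k x) =
  4 * l%:R * l.+1%:R * H l.-1 k x - k.+1%:R * k.+2%:R * H l.+1 k.+2 x.
Proof.
move=> x1; have uz := unit_uz x1.
have e := congr1 (fun p : {poly R[i]} => p^`()`_k) (Qp_derivX x l).
rewrite /= !coef_deriv -[_ *+ k.+1]mulr_natl -[_ *+ k.+2]mulr_natl in e.
have e2 : (l.+1%:R * ((2 * zcoord x)%:P - (2 * ubar x)%:P * 'X) * Qp x ^+ l)^`() =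
  (4 * l%:R * l.+1%:R)%:P * Qp x ^+ l.-1 - (2 * (2 * l + 1)%:R * l.+1%:R * ubar x)%:P * Qp x ^+ l.
  have d1 : ((2 * zcoord x)%:P - (2 * ubar x)%:P * 'X)^`() = - (2 * ubar x)%:P.
    by rewrite derivB derivM !derivC derivX; ring.
  rewrite (natP l.+1) -mulrA derivM derivC mul0r add0r derivM d1.
  have sq : ((2 * zcoord x)%:P - (2 * ubar x)%:P * 'X) ^+ 2 = 4%:P - (4 * ubar x)%:P * Qp x.
    have -> : 4%:P = (4 * (zcoord x ^+ 2 + ucoord x * ubar x))%:P by rewrite uz mulr1.
    have -> : (4 * (zcoord x ^+ 2 + ucoord x * ubar x))%:P = 4 * ((zcoord x)%:P ^+ 2 + (ucoord x)%:P * (ubar x)%:P).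
      by rewrite polyCM -natP [(_ + _)%:P]polyCD !expr2 !polyCM.
    by rewrite /Qp !polyCM -!natP; ring.
  case: l {e} => [|l].
    by rewrite /= !expr0 derivC muln0 add0n !polyCM polyC1 polyC0; ring.
  rewrite Qp_derivX /= [Qp x ^+ l.+1]exprS.
  move: ((2 * zcoord x)%:P - (2 * ubar x)%:P * 'X) sq {d1} => w.
  rewrite !polyCM -!natP [(2 * l.+1 + 1)%:R]natrD natrM => sq.
  by move: (Qp x) (Qp x ^+ l) (ubar x)%:P sq => P Pl b sq; ring: sq.
rewrite -coef_deriv e2 coefB !coefPM in e.
by rewrite /H -[k.+1%:R * k.+2%:R * _]mulrA e; ring.
Qed.

Lemma ucoord_H l k x : ucoord x * H l k x = H l.+1 k x
  - 2 * (zcoord x * (if k is k'.+1 then H l k' x else 0))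
  + ubar x * (if k is k'.+2 then H l k' x else 0).
Proof.
have e : Qp x ^+ l.+1 = (ucoord x)%:P * Qp x ^+ l + (2 * zcoord x)%:P * (Qp x ^+ l * 'X)
   - (ubar x)%:P * (Qp x ^+ l * 'X * 'X).
  by rewrite exprS {1}/Qp; ring.
rewrite {2}/H e coefB coefD !coefPM !coefMX /H.
by case: k => [|[|k]] /=; ring.
Qed.

Lemma hspan_ubar f : hspan f -> hspan (fun x => ubar x * f x).
Proof.
apply: hspan_closed => l k.
have n0 : 2 * (2 * l + 1)%:R * l.+1%:R != 0 :> R[i].
  by rewrite addn1 !mulf_neq0 ?pnatr_eq0.
apply: (@hspan_eq (fun x => (2 * (2 * l + 1)%:R * l.+1%:R)^-1 *
    (4 * l%:R * l.+1%:R * H l.-1 k x + (- (k.+1%:R * k.+2%:R)) * H l.+1 k.+2 x))).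
  by move=> x x1; rewrite mulNr -ubar_H// mulKf.
by apply: hspan_mull; apply: hspan_add; apply: hspan_mull; exact: hspan_H.
Qed.

Lemma hspan_zcoord f : hspan f -> hspan (fun x => zcoord x * f x).
Proof.
apply: hspan_closed => l k.
have n0 : 2 * l.+1%:R != 0 :> R[i] by rewrite mulf_neq0 ?pnatr_eq0.
apply: (@hspan_eq (fun x => (2 * l.+1%:R)^-1 * (k.+1%:R * H l.+1 k.+1 x +
    2 * l.+1%:R * (ubar x * (if k is k'.+1 then H l k' x else 0))))).
  by move=> x x1; rewrite -zcoord_H mulKf.
apply: hspan_mull; apply: hspan_add; apply: hspan_mull; first exact: hspan_H.
by apply: hspan_ubar; case: k => [|k]; [exact: hspan0|exact: hspan_H].
Qed.

Lemma hspan_ucoord f : hspan f -> hspan (fun x => ucoord x * f x).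
Proof.
apply: hspan_closed => l k.
apply: (@hspan_eq (fun x => (H l.+1 k x + (-2) * (zcoord x * (if k is k'.+1 then H l k' x else 0)))
  + ubar x * (if k is k'.+2 then H l k' x else 0))).
  by move=> x x1; rewrite ucoord_H mulNr.
apply: hspan_add; first apply: hspan_add.
- exact: hspan_H.
- by apply: hspan_mull; apply: hspan_zcoord; case: k => [|k]; [exact: hspan0|exact: hspan_H].
- by apply: hspan_ubar; case: k => [|[|k]]; [exact: hspan0|exact: hspan0|exact: hspan_H].
Qed.

Lemma hspan_kcoord j f : hspan f -> hspan (fun x => kcoord j x * f x).
Proof.
move=> hf; rewrite /kcoord; case: (unlift _ _) => [i|]; last first.
  by apply: hspan_eq hf => x _; rewrite mul1r.
move: i; apply: ord3P.
- apply: (@hspan_eq (fun x => 2^-1 * (ucoord x * f x + ubar x * f x))).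
    by move=> x _; rewrite ucoordE ubarE; field.
  by apply: hspan_mull; apply: hspan_add; [exact: hspan_ucoord|exact: hspan_ubar].
- apply: (@hspan_eq (fun x => - ((0 +i* 1) / 2) * (ucoord x * f x + (-1) * (ubar x * f x)))).
    move=> x _; rewrite ucoordE ubarE.
    have j2 : (0 +i* 1 : R[i]) ^+ 2 = -1 by apply: Cext; rewrite /= ; ring.
    by move: (0 +i* 1 : R[i]) j2 => i i2; field: i2.
  apply: hspan_mull; apply: hspan_add; first exact: hspan_ucoord.
  by apply: hspan_mull; exact: hspan_ubar.
- exact: hspan_zcoord.
Qed.

Lemma hspan_mon n (m : {ffun 'I_n -> 'I_4}) : hspan (mon m).
Proof.
have h (s : seq 'I_4) : hspan (fun x => \prod_(j <- s) kcoord j x).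
  elim: s => [|j s IH].
    apply: (@hspan_eq (H 0 0)); last exact: hspan_H.
    by move=> x _; rewrite big_nil /H expr0 coef1.
  by under eq_fun do rewrite big_cons; exact: hspan_kcoord.
apply: hspan_eq (h [seq m j | j <- enum 'I_n]) => x _.
by rewrite big_map /mon big_enum.
Qed.

Lemma H_complete f : scont f -> (forall l k, SI (fun x => f x * H l k x) = 0) ->
  forall y, enorm y = 1 -> f y = 0.
Proof.
move=> hf h; apply: sphere_complete => // n m.
have [s hs] := hspan_mon m.
transitivity (SI (fun x => \sum_(p <- s) p.1 * (f x * H p.2.1 p.2.2 x))).
  by apply: SI_eq => x x1; rewrite hs// mulr_sumr; apply: eq_bigr => p _; rewrite mulrCA.
have sc p : scont (fun x => f x * H p.2.1 p.2.2 x) by apply: scont_mul => //; exact: scont_H.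
rewrite SI_sum => [|p]; last exact: scont_mull.
by rewrite big1// => p _; rewrite SI_mull// h mulr0.
Qed.

End Completeness.

(** * K-finiteness bounds the degree of the harmonics that occur *)

Section KFinite.
Context {R : realType}.
Notation E := 'cV[R]_3.
Implicit Types (f g : E -> R[i]) (x y : E).
Notation SI := sphere_integral.

Definition mx3 (a : nat -> nat -> R) : 'M[R]_3 := \matrix_(i < 3, j < 3) a i j.

Lemma mx3_mul (A : 'M[R]_3) x (i : 'I_3) :
  (A *m x) i 0 = A i 0 * x 0 0 + A i 1 * x 1 0 + A i 2%R * x 2%R 0.
Proof.
rewrite !mxE !big_ord_recl big_ord0 addr0 addrA.
by congr (_ + _ + _); congr (A _ _ * x _ _); apply: val_inj.
Qed.

(** A rotation in the plane of the first and third axes, parametrized rationally by the tangent of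
    the half angle. In the rotated coordinates y, the form [dot (av t)] is [1 + t ^ 2] times y_0 + i
    y_1, which rotations about the third axis multiply by a unit number. *)
Definition frame (t : R) : 'M[R]_3 :=
  let c := (1 - t ^+ 2) / (1 + t ^+ 2) in let s := 2 * t / (1 + t ^+ 2) in
  mx3 (fun i j => nth 0 (nth [::] [:: [:: c; 0; s]; [:: 0; 1; 0]; [:: - s; 0; c]] i) j).
Definition zrot (a : R) : 'M[R]_3 :=
  mx3 (fun i j => nth 0 (nth [::] [:: [:: cos a; - sin a; 0]; [:: sin a; cos a; 0]; [:: 0; 0; 1]] i) j).

Lemma frame_orth t : frame t *m (frame t)^T = 1%:M.
Proof.
have t0 : 1 + t ^+ 2 != 0 by rewrite gt_eqF// ltr_pwDl// sqr_ge0.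
apply/matrixP => i j; rewrite !mxE !big_ord_recl big_ord0 !mxE /=.
move: i j; apply: ord3P; apply: ord3P; rewrite /= ; field; rewrite ?t0//.
Qed.

Lemma zrot_orth a : zrot a *m (zrot a)^T = 1%:M.
Proof.
have h := cos2Dsin2 a.
apply/matrixP => i j; rewrite !mxE !big_ord_recl big_ord0 !mxE /=.
by move: i j; apply: ord3P; apply: ord3P; rewrite /= ; first [ring | rewrite -[RHS]h; ring].
Qed.

Definition axisrot t a : 'M[R]_3 := (frame t)^T *m zrot a *m frame t.

Lemma axisrot_orth t a : axisrot t a *m (axisrot t a)^T = 1%:M.
Proof.
rewrite /axisrot !trmx_mul trmxK -!mulmxA (mulmxA (frame t)) frame_orth mul1mx.
by rewrite (mulmxA (zrot a)) zrot_orth mul1mx mulmx1C// frame_orth.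
Qed.

Lemma dot_frame t x : dot (av t%:C) x =
  (1 + t ^+ 2)%:C * (((frame t *m x) 0 0)%:C + (0 +i* 1) * ((frame t *m x) 1 0)%:C).
Proof.
have t0 : 1 + t ^+ 2 != 0 by rewrite gt_eqF// ltr_pwDl// sqr_ge0.
rewrite dot3 /av /= !mx3_mul !mxE /=.
apply: Cext; rewrite /= !expr2 /=; field; rewrite ?t0//.
Qed.

Lemma dot_axisrot t a x : dot (av t%:C) (axisrot t a *m x) = cexp (0 +i* a) * dot (av t%:C) x.
Proof.
rewrite !dot_frame /axisrot -!mulmxA (mulmxA (frame t)) frame_orth mul1mx.
set y := frame t *m x; rewrite !mx3_mul !mxE /= /cexp /= expR0.
by apply: Cext; rewrite /=; ring.
Qed.

Lemma orth_exp (A : 'M[R]_3) n : A *m A^T = 1%:M -> A ^+ n *m (A ^+ n)^T = 1%:M.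
Proof.
move=> h; elim: n => [|n IH]; first by rewrite expr0 trmx1 mulmx1.
by rewrite exprS trmx_mul -!mulmxA (mulmxA (A ^+ n)) IH mul1mx.
Qed.

Lemma det_orth_sqr (A : 'M[R]_3) : A *m A^T = 1%:M -> \det (A ^+ 2) = 1.
Proof.
move=> h; have := congr1 determinant h.
by rewrite det_mulmx det_tr det1 expr2 => e; rewrite [LHS]det_mulmx.
Qed.

Lemma scont_scale f (r : R) : 0 < r -> scont f -> scont (fun x => f (r *: x)).
Proof.
move=> r0 hf x x0; apply: (@ccat_comp R E E f (fun x => r *: x) x).
  exact: (cvgZl_tmp (cvg_id : (id : E -> E) @ x --> x)).
by apply: hf; rewrite scaler_eq0 negb_or gt_eqF.
Qed.

Lemma SI_rotated t a (j l : nat) f (r : R) : 0 < r -> scont f ->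
  let A := axisrot t a ^+ j in
  SI (fun x => f (r *: (A^T *m x)) * dot (av t%:C) x ^+ l) =
  cexp (0 +i* a) ^+ (j * l) * SI (fun x => f (r *: x) * dot (av t%:C) x ^+ l).
Proof.
move=> r0 hf A; have AO : A *m A^T = 1%:M by apply: orth_exp; exact: axisrot_orth.
have AO' : A^T *m A^T^T = 1%:M by rewrite trmxK; exact: mulmx1C.
have sf := scont_scale r0 hf.
have sq : scont (fun x => dot (av t%:C) x ^+ l) by apply: scont_exp; exact: scont_dot.
rewrite -(SI_orth AO); last by apply: scont_mul => //; exact: (scont_orth AO' sf).
rewrite -SI_mull; last exact: scont_mul.
apply: SI_eq => x _; rewrite mulmxA mulmx1C// mul1mx.
have -> : dot (av t%:C) (A *m x) = cexp (0 +i* a) ^+ j * dot (av t%:C) x.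
  rewrite /A; elim: (j) => [|n IH]; first by rewrite !expr0 mul1r mul1mx.
  by rewrite !exprS -[_ * _ *m x]mulmxA dot_axisrot IH mulrA.
by rewrite exprMn -exprM mulrCA mulrA.
Qed.

Lemma SI_0 : SI (fun=> 0 : R[i]) = 0.
Proof.
transitivity (SI (fun x : E => 0 * (1 : R[i]))); first by apply: SI_eq => x _; rewrite mul0r.
by rewrite (SI_mull 0 (@scont_cst R 1)) mul0r.
Qed.

Lemma SI_H_gt g l k : (2 * l < k)%N -> SI (fun x => g x * H l k x) = 0.
Proof. by move=> kl; rewrite -SI_0; apply: SI_eq => x _; rewrite H_gt// mulr0. Qed.

(* Rotations about the axis of [av t] multiply moments of order [l] by the power [l] of a
   unit number; when the orbit of [f] spans a finite-dimensional space, the powers that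
   occur are roots of a single polynomial. *)
Lemma Kfinite_poly f : Kfinite f -> scont f -> exists n : nat, forall (t a : R),
  exists P : {poly R[i]}, [/\ P != 0, (size P <= n.+1)%N & forall (l : nat) (r : R), 0 < r ->
    SI (fun x => f (r *: x) * dot (av t%:C) x ^+ l) != 0 -> root P (cexp (0 +i* a) ^+ l)].
Proof.
move=> [n [g hg]] hf; exists n => t a'; pose a := a' / 2.
(* [Kact] divides by the determinant. A square of an orthogonal matrix has determinant 1, so [Kact]
   is plain multiplication here; [a] is half of the requested angle to compensate. *)
pose A := axisrot t a ^+ 2.
have AO : A *m A^T = 1%:M by apply: orth_exp; exact: axisrot_orth.
have Aj j : (A ^+ j) *m (A ^+ j)^T = 1%:M by exact: orth_exp.
have detA j : \det (A ^+ j) = 1.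
  elim: j => [|j IH]; first by rewrite expr0 det1.
  by rewrite exprS det_mulmx IH mulr1 det_orth_sqr//; exact: axisrot_orth.
have [c hc] : {c : nat -> 'I_n -> R[i] & forall j x, R30 x -> f ((A ^+ j)^T *m x) = \sum_(i < n) c j i * g i x}.
  apply: (@choice _ _ (fun j c => forall x, R30 x -> f ((A ^+ j)^T *m x) = \sum_(i < n) c i * g i x)) => j.
  have [c hc] := hg (A ^+ j) (Aj j); exists c => x x0; rewrite -hc//.
  have -> : invmx (A ^+ j) = (A ^+ j)^T.
    have u : A ^+ j \in unitmx by case: (mulmx1_unit (Aj j)).
    by rewrite -[RHS]mul1mx -(mulVmx u) -mulmxA Aj mulmx1.
  by rewrite /Kact det_tr detA invr1 scale1r.
(* The [n.+1] translates of [f] lie in the span of [n] functions, so the matrix of coefficients has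
   a nonzero vector [d] in its left kernel; the entries of [d] become the coefficients of [P]. *)
pose M := \matrix_(j < n.+1, i < n) c j i.
have : (kermx M != 0).
  rewrite -mxrank_eq0 mxrank_ker -lt0n subn_gt0.
  by rewrite (leq_ltn_trans (rank_leq_col _)).
case/rowV0Pn => d /sub_kermxP dM d0.
have dz x : R30 x -> \sum_(j < n.+1) d 0 j * f ((A ^+ j)^T *m x) = 0.
  move=> x0; under eq_bigr do rewrite hc// mulr_sumr.
  rewrite exchange_big /= big1// => i _.
  have := congr1 (fun v : 'rV[R[i]]_n => v 0 i) dM; rewrite !mxE => e.
  transitivity ((\sum_j d 0 j * M j i) * g i x); last by rewrite e mul0r.
  by rewrite mulr_suml; apply: eq_bigr => j _; rewrite mxE mulrA.
pose P := \poly_(j < n.+1) (d 0 (inord j)).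
exists P; split.
- apply: contra d0 => /eqP P0; apply/eqP/rowP => j; rewrite mxE.
  have := congr1 (fun q : {poly R[i]} => q`_j) P0.
  by rewrite coef0 coef_poly ltn_ord inord_val.
- exact: size_poly.
- move=> l r r0 In; rewrite /root; apply/eqP; apply: (mulIf In).
  rewrite mul0r horner_poly.
  transitivity (SI (fun x => \sum_(j < n.+1) d 0 j * (f (r *: ((A ^+ j)^T *m x)) * dot (av t%:C) x ^+ l))).
    have Aj' j : (A ^+ j)^T *m (A ^+ j)^T^T = 1%:M by rewrite trmxK; exact: mulmx1C.
    have sc j : scont (fun x => f (r *: ((A ^+ j)^T *m x)) * dot (av t%:C) x ^+ l).
      apply: scont_mul; first by exact: (scont_orth (Aj' j) (scont_scale r0 hf)).
      by apply: scont_exp; exact: scont_dot.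
    rewrite SI_sum => [|j]; last exact: scont_mull.
    rewrite mulr_suml; apply: eq_bigr => j _; rewrite SI_mull// inord_val -mulrA; congr (_ * _).
    have := @SI_rotated t a (2 * j) l f r r0 hf; rewrite /= exprM -/A => ->.
    congr (_ * _); rewrite -!exprM -!cexpMn; congr cexp.
    have -> : 0 +i* a' = (0 +i* a) + (0 +i* a) :> R[i].
      by apply: Cext; rewrite /= ?addr0// /a; field.
    by rewrite !natrM; move: (0 +i* a : R[i]) => z; ring.
  transitivity (SI (fun=> 0 : R[i])).
    apply: SI_eq => x x1; have x0 : R30 (r *: x).
      by rewrite /R30 /= scaler_eq0 negb_or gt_eqF//=; exact: sphere_neq0.
    transitivity ((\sum_(j < n.+1) d 0 j * f ((A ^+ j)^T *m (r *: x))) * dot (av t%:C) x ^+ l); last by rewrite dz ?mul0r.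
    by rewrite mulr_suml; apply: eq_bigr => j _; rewrite -scalemxAr mulrA.
  exact: SI_0.
Qed.

Definition active f (l : nat) : Prop := exists k (r : R), 0 < r /\ SI (fun x => f (r *: x) * H l k x) != 0.

Lemma SI_Qpow f l (r : R) (t : R[i]) : 0 < r -> scont f ->
  SI (fun x => f (r *: x) * dot (av t) x ^+ l) =
  \sum_(k < (2 * l).+1) SI (fun x => f (r *: x) * H l k x) * t ^+ k.
Proof.
move=> r0 hf; have sf := scont_scale r0 hf.
transitivity (SI (fun x => \sum_(k < (2 * l).+1) t ^+ k * (f (r *: x) * H l k x))).
  by apply: SI_eq => x _; rewrite QpX_horner mulr_sumr; apply: eq_bigr => k _; ring.
have sc k : scont (fun x => f (r *: x) * H l k x) by apply: scont_mul => //; exact: scont_H.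
rewrite SI_sum => [|k]; last exact: scont_mull.
by apply: eq_bigr => k _; rewrite SI_mull// mulrC.
Qed.

(** Moments against powers of [dot (av t)] are polynomials in [t]; the product of finitely many
    nonzero ones gives a [t] suitable for all these orders at once. *)
Lemma active_poly f (s : seq nat) : scont f -> (forall l, l \in s -> active f l) ->
  exists2 p : {poly R[i]}, p != 0 & forall t : R[i], ~~ root p t -> forall l, l \in s ->
    exists2 r : R, 0 < r & SI (fun x => f (r *: x) * dot (av t) x ^+ l) != 0.
Proof.
move=> hf; elim: s => [|l s IH] h; first by exists 1; rewrite ?oner_eq0.
have [p p0 hp] := IH (fun l' ls => h l' (@mem_behead _ (l :: s) l' ls)).
have [k [r [r0 hk]]] := h l (mem_head _ _).
pose q := \poly_(k < (2 * l).+1) SI (fun x => f (r *: x) * H l k x).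
have kl : (k < (2 * l).+1)%N.
  rewrite ltnS leqNgt; apply: contra hk => kl; apply/eqP.
  exact: SI_H_gt.
exists (p * q).
  rewrite mulf_neq0//; apply: contra hk => /eqP q0; apply/eqP.
  have := congr1 (fun q : {poly R[i]} => q`_k) q0.
  by rewrite coef0 coef_poly kl.
move=> t; rewrite rootM negb_or => /andP[pt qt] l'; rewrite inE => /predU1P[->|ls].
  by exists r => //; move: qt; rewrite SI_Qpow// /root horner_poly.
exact: hp.
Qed.

Lemma nonroot_nat (p : {poly R[i]}) : p != 0 -> exists m : nat, ~~ root p m%:R.
Proof.
move=> p0; apply: contrapT => h.
have := max_poly_roots p0 (rs := [seq m%:R | m <- iota 0 (size p)]).
rewrite size_map size_iota ltnn => H; suff : false by [].
apply: H.
  by apply/allP => z /mapP[m _ ->]; apply: contrapT => /negP hm; apply: h; exists m.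
by rewrite map_inj_uniq ?iota_uniq// => a b /eqP; rewrite eqr_nat => /eqP.
Qed.

(** Given [n.+1] active orders, a suitable integer [t] makes a moment of each order nonzero, and the
    angle [1 / N] is so small that the corresponding powers of cexp(i / N) are distinct: their
    arguments lie in the interval from 0 to 1, where cosine is injective. The polynomial of
    [Kfinite_poly] would have more roots than its degree allows. *)
Lemma Kfinite_bound f : Kfinite f -> scont f -> exists L : nat, forall l, (L <= l)%N -> ~ active f l.
Proof.
move=> Kf hf; have [n hn] := Kfinite_poly Kf hf.
apply: contrapT => h.
have step L : exists2 l, (L <= l)%N & active f l.
  apply: contrapT => h1; apply: h; exists L => l Ll al; apply: h1; by exists l.
have list m : exists s : seq nat, [/\ size s = m, uniq s & forall l, l \in s -> active f l].
  elim: m => [|m [s [s1 s2 s3]]]; first by exists [::].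
  have [l Ll al] := step (\max_(i <- s) i).+1.
  exists (l :: s); split => /=; [by rewrite s1| |].
    rewrite s2 andbT; apply/negP => ls; have := @leq_bigmax_seq _ s xpredT id l ls isT.
    by move=> /= le; have := leq_ltn_trans le Ll; rewrite ltnn.
  by move=> l'; rewrite inE => /predU1P[->|/s3].
have [s [s1 s2 s3]] := list n.+1.
have [p p0 hp] := active_poly hf s3.
have [m hm] := nonroot_nat p0.
pose N := (\max_(i <- s) i).+1; pose a : R := N%:R^-1.
have N0 : 0 < N%:R :> R by rewrite ltr0n.
have [P [P0 Ps hP]] := hn m%:R a.
have := max_poly_roots P0 (rs := [seq cexp (0 +i* a) ^+ l | l <- s]).
rewrite size_map s1 => H; suff : (n.+1 < size P)%N by rewrite ltnNge Ps.
apply: H.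
  apply/allP => z /mapP[l ls ->]; have [r r0 hr] := hp _ hm l ls.
  by apply: (hP l r r0); rewrite rC_nat.
rewrite map_inj_in_uniq// => l l' ls ls' e.
have ub k : k \in s -> k%:R * a \in `[0, pi].
  move=> ks; rewrite in_itv /= mulr_ge0 ?invr_ge0//=.
  have k1 : k%:R * a <= 1.
    by rewrite /a ler_pdivrMr// mul1r ler_nat /N ltnW// ltnS; exact: (@leq_bigmax_seq _ s xpredT id k ks isT).
  by rewrite (le_trans k1)// ltW// (lt_le_trans _ (@pi_ge2 R))// ltr1n.
have cE k : complex.Re (cexp (0 +i* a) ^+ k) = cos (k%:R * a).
  rewrite -cexpMn /cexp -(rmorph_nat (real_complex R)) cReM cImM /=.
  rewrite !mul0r !mulr0 !subr0 ?addr0 expR0 !mul1r; ring.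
have := congr1 (@complex.Re R) e; rewrite !cE => /cos_inj; rewrite !ub// => /(_ isT isT).
move/(mulIf _); rewrite invr_eq0 gt_eqF// => /(_ isT)/eqP.
by rewrite eqr_nat => /eqP.
Qed.

(** The dual index [2 * l - k] appears because the pairing [SI_HH] is bilinear, not sesquilinear. *)
Definition hcoef f (l k : nat) (r : R) : R[i] :=
  SI (fun x => f (r *: x) * H l (2 * l - k) x) / nH l k.

Lemma hcoef_expansion f : Kfinite f -> scont f -> exists L : nat, forall (r : R) x, 0 < r -> enorm x = 1 ->
  f (r *: x) = \sum_(l < L) \sum_(k < (2 * l).+1) hcoef f l k r * H l k x.
Proof.
move=> Kf hf; have [L hL] := Kfinite_bound Kf hf; exists L => r x r0 x1.
have sf := scont_scale r0 hf.
pose g y := \sum_(l < L) \sum_(k < (2 * l).+1) hcoef f l k r * H l k y.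
have sg : scont g by apply: scont_sum => l; apply: scont_sum => k; apply: scont_mull; exact: scont_H.
apply/eqP; rewrite -subr_eq0; apply/eqP.
have sfg : scont (fun y => f (r *: y) + -1 * g y) by apply: scont_add => //; exact: scont_mull.
suff : forall l k, SI (fun y => (f (r *: y) + -1 * g y) * H l k y) = 0.
  by move=> h; have := H_complete sfg h x1; rewrite mulN1r.
move=> l' k'.
have [kl|kl] := leqP k' (2 * l'); last first.
  exact: SI_H_gt.
have sH := scont_H l' k'.
transitivity (SI (fun y => f (r *: y) * H l' k' y) + -1 * SI (fun y => g y * H l' k' y)).
  rewrite -SI_mull; last exact: scont_mul.
  rewrite -SI_add; [|exact: scont_mul|by apply: scont_mull; exact: scont_mul].
  by apply: SI_eq => y _; ring.
have sHH l k : scont (fun y => H l k y * H l' k' y) by apply: scont_mul; exact: scont_H.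
have -> : SI (fun y => g y * H l' k' y) =
    \sum_(l < L) \sum_(k < (2 * l).+1) hcoef f l k r * SI (fun y => H l k y * H l' k' y).
  transitivity (SI (fun y => \sum_(l < L) \sum_(k < (2 * l).+1) hcoef f l k r * (H l k y * H l' k' y))).
    apply: SI_eq => y _; rewrite /g mulr_suml; apply: eq_bigr => l _.
    by rewrite mulr_suml; apply: eq_bigr => k _; rewrite mulrA.
  rewrite SI_sum => [|l]; last by apply: scont_sum => k; exact: scont_mull.
  apply: eq_bigr => l _; rewrite SI_sum => [|k]; last exact: scont_mull.
  by apply: eq_bigr => k _; rewrite SI_mull.
have [lL|Ll] := ltnP l' L; last first.
  have -> : SI (fun y => f (r *: y) * H l' k' y) = 0.
    by apply: contrapT => /eqP h; apply: (hL l' Ll); exists k', r.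
  rewrite big1 ?mulr0 ?addr0// => l _; rewrite big1// => k _.
  rewrite SI_HH//; last by rewrite -ltnS.
  by rewrite ltn_eqF ?mulr0//; exact: leq_trans (ltn_ord l) Ll.
have kk : (2 * l' - k' < (2 * l').+1)%N by rewrite ltnS leq_subr.
have -> : \sum_(l < L) \sum_(k < (2 * l).+1) hcoef f l k r * SI (fun y => H l k y * H l' k' y) =
    hcoef f l' (2 * l' - k') r * nH l' (2 * l' - k').
  rewrite (bigD1 (Ordinal lL)) //= [X in _ + X]big1 => [|l ln]; last first.
    rewrite big1// => k _; rewrite SI_HH//; last by rewrite -ltnS.
    by rewrite (_ : (l == l' :> nat) = false) ?mulr0//; apply/eqP => e; move/eqP: ln; apply; exact: val_inj.
  rewrite addr0 (bigD1 (Ordinal kk)) //= [X in _ + X]big1 => [|k kn]; last first.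
    rewrite SI_HH//; last by rewrite -ltnS.
    rewrite eqxx /= (_ : (k + k' == 2 * l')%N = false) ?mulr0//.
    apply/eqP => e; move/eqP: kn; apply; apply: val_inj => /=.
    by have := congr1 (subn^~ k') e; rewrite /= addnK.
  by rewrite SI_HH ?leq_subr// eqxx subnK// eqxx /= addr0.
rewrite /hcoef subKn// divfK ?nH_neq0 ?leq_subr//.
by rewrite mulN1r subrr.
Qed.

End KFinite.

(** * Separation of variables *)

Section DirectionalDerivative.
Context {R : realType}.
Notation E := 'cV[R]_3.
Implicit Types (f g : E -> R[i]) (x y v : E).

Lemma cd_affine (V : normedModType R) (f : V -> R[i]) (p e : V) (s : R) (d : R[i]) :
  cd f (s *: e + p) e d -> cd (fun s : R^o => f (s *: e + p)) s 1 d.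
Proof.
move=> /cd_line h; apply/cd_line.
rewrite (_ : (fun h : R^o => _) = (fun h : R^o => f (h *: e + (s *: e + p))))//.
by apply/funext => t /=; rewrite addrA -scalerDl [t%:A]mulr1.
Qed.

Lemma real_increment (G dG : R -> R) (a d e : R) :
  (forall s : R, `|s| <= `|a| -> is_derive (s : R^o) (1 : R^o) (G : R^o -> R^o) (dG s)) ->
  (forall s : R, `|s| <= `|a| -> `|dG s - d| <= e) ->
  `|G a - G 0 - a * d| <= e * `|a|.
Proof.
move=> hG hd.
have key (u v : R) : u <= v -> (forall s, u <= s <= v -> `|s| <= `|a|) ->
    `|G v - G u - (v - u) * d| <= e * (v - u).
  move=> uv hs.
  have [||c cI Hc] := @MVT_segment R G dG u v uv.
  - by move=> s /[!in_itv]/= /andP[us sv]; apply: hG; apply: hs; rewrite !ltW.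
  - apply: derivable_within_continuous => s /[!in_itv]/= us.
    by case: (hG s (hs s us)).
  have ca : `|c| <= `|a| by apply: hs; move: cI; rewrite in_itv.
  have -> : G v - G u - (v - u) * d = (dG c - d) * (v - u) by rewrite Hc; ring.
  rewrite normrM [`|v - u|]ger0_norm ?subr_ge0//.
  by rewrite ler_wpM2r ?subr_ge0// hd.
have [a0|a0] := leP 0 a.
  have := key 0 a a0; rewrite !subr0 [`|a|]ger0_norm//; apply => s /andP[s0 sa].
  by rewrite !ger0_norm.
have := key a 0 (ltW a0) _; rewrite !sub0r ltr0_norm// => H.
have -> : G a - G 0 - a * d = - (G 0 - G a - - a * d) by ring.
rewrite normrN; apply: H => s /andP[sa s0].
by rewrite (ler0_norm s0) lerN2.
Qed.

Lemma cd_increment (G dG : R -> R[i]) (a : R) (d : R[i]) (e : R) :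
  (forall s : R, `|s| <= `|a| -> cd (G : R^o -> R[i]) s 1 (dG s)) ->
  (forall s : R, `|s| <= `|a| -> normc (dG s - d) <= e) ->
  normc (G a - G 0 - a%:C * d) <= 2 * e * `|a|.
Proof.
move=> hG hd; apply: (le_trans (normc_le _)).
have h1 : `|complex.Re (G a - G 0 - a%:C * d)| <= e * `|a|.
  rewrite !cReD !cReN cReM /= mul0r subr0.
  apply: (@real_increment (fun s => complex.Re (G s)) (fun s => complex.Re (dG s))) => s sa.
    by case: (hG s sa).
  by rewrite -cReN -cReD (le_trans (Re_le_normc _))// hd.
have h2 : `|complex.Im (G a - G 0 - a%:C * d)| <= e * `|a|.
  rewrite !cImD !cImN cImM /= mul0r addr0.
  apply: (@real_increment (fun s => complex.Im (G s)) (fun s => complex.Im (dG s))) => s sa.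
    by case: (hG s sa).
  by rewrite -cImN -cImD (le_trans (Im_le_normc _))// hd.
lra.
Qed.

Lemma cd_of_estimate (V : normedModType R) (f : V -> R[i]) (x v : V) (d : R[i]) :
  (forall e : R, 0 < e -> \forall h \near (0 : R), normc (f (h *: v + x) - f x - h%:C * d) <= e * `|h|) ->
  cd f x v d.
Proof.
move=> H.
have key (F : V -> R) (c : R) : (forall e : R, 0 < e -> \forall h \near (0 : R),
    `|F (h *: v + x) - F x - h * c| <= e * `|h|) -> is_derive x v F c.
  move=> hF.
  have L : h^-1 *: ((F \o shift x) (h *: v) - F x) @[h --> 0^'] --> c.
    apply/cvgrPdist_le => e e0; have := hF e e0.
    case/nbhs_ballP => r r0 hr; apply/nbhs_ballP; exists r => // h /= hh h0.
    rewrite distrC -(ler_pM2r (_ : 0 < `|h|)) ?normr_gt0// -normrM mulrBl.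
    rewrite [_ *: _ * h]mulrAC mulVf// mul1r [c * h]mulrC; exact: hr.
  by apply: DeriveDef; [apply/cvg_ex; exists c|exact: cvg_lim L].
split; apply: key => e e0; apply: filterS (H e e0) => h; apply: le_trans.
- by rewrite (le_trans _ (Re_le_normc _))// !cReD !cReN cReM /= mul0r subr0.
- by rewrite (le_trans _ (Im_le_normc _))// !cImD !cImN cImM /= mul0r addr0.
Qed.

Notation e_ i := (delta_mx i 0 : E).

Lemma vec_decomp v : v = v 0 0 *: e_ 0 + v 1 0 *: e_ 1 + v 2%R 0 *: e_ 2%R.
Proof. by apply: E_ext; rewrite !mxE /= ?mulr1 ?mulr0 ?addr0 ?add0r. Qed.

Lemma norm_delta (i : 'I_3) : `|e_ i| <= 1.
Proof.
rewrite [`|_|]mx_normrE; apply: bigmax_le => // -[j k] _ /=.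
by rewrite mxE; case: (_ && _); rewrite ?normr1 ?normr0.
Qed.

(** The data concern the coordinate axes only, whereas rays and the Wronskian need the derivative
    along [x] itself. The increment is split into three steps parallel to the axes, each estimated
    by the mean value theorem and the continuity of [D i]. *)
Lemma directional_derivative f (D : 'I_3 -> E -> R[i]) x v :
  (\forall y \near x, forall i, cd f y (e_ i) (D i y)) -> (forall i, ccat (D i) x) ->
  cd f x v (\sum_(i < 3) (v i 0)%:C * D i x).
Proof.
move=> hf hD; pose W := `|v 0 0| + `|v 1 0| + `|v 2%R 0| + 1.
have W0 : 0 < W by rewrite /W ltr_wpDl// !addr_ge0.
apply: cd_of_estimate => e e0.
(* [W] exceeds the sum of the moduli of the coordinates of [v]; the 2 is the one in
   [cd_increment]. *)
pose e' := e / (2 * W); have e'0 : 0 < e' by rewrite divr_gt0// mulr_gt0.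
have hD' i : \forall y \near x, normc (D i y - D i x) <= e'.
  by have /climP/(_ _ e'0) := hD i; apply: filterS => y /ltW.
have H : \forall y \near x, (forall i, cd f y (e_ i) (D i y)) /\ (forall i, normc (D i y - D i x) <= e').
  apply: filterS3 (filterI (hD' 0) (hD' 1)) (hD' 2%R) hf => y [h0 h1] h2 h; split=> //.
  exact: ord3P.
case/nbhs_normP: H => r /= r0 hr.
have rW : 0 < r / W by rewrite divr_gt0.
apply/nbhs_normP; exists (r / W) => // h /=; rewrite sub0r normrN => hh.
have hW : `|h| * W < r by rewrite -ltr_pdivlMr.
have ball y : `|y| <= `|h| * W -> (forall i, cd f (y + x) (e_ i) (D i (y + x))) /\ (forall i, normc (D i (y + x) - D i x) <= e').
  by move=> hy; apply: hr => /=; rewrite opprD addrCA subrr addr0 normrN (le_lt_trans hy).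
pose a0 := h * v 0 0; pose a1 := h * v 1 0; pose a2 := h * v 2%R 0.
have nW (b0 b1 b2 : R) : `|b0| <= `|a0| -> `|b1| <= `|a1| -> `|b2| <= `|a2| ->
    `|b0 *: e_ 0 + b1 *: e_ 1 + b2 *: e_ 2%R| <= `|h| * W.
  move=> q0 q1 q2; rewrite (le_trans (ler_normD _ _))// (le_trans (lerD (ler_normD _ _) (lexx _)))//.
  rewrite !normrZ.
  have t (b : R) i : `|b| * `|e_ i| <= `|b| by rewrite ler_piMr// norm_delta.
  have u0 := t b0 0; have u1 := t b1 1; have u2 := t b2 2%R.
  move: q0 q1 q2; rewrite /a0 /a1 /a2 !normrM /W => q0 q1 q2.
  have := normr_ge0 h; lra.
have step (i : 'I_3) (a : R) (p : E) : (forall s : R, `|s| <= `|a| -> `|s *: e_ i + p| <= `|h| * W) ->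
    normc (f (a *: e_ i + p + x) - f (p + x) - a%:C * D i x) <= 2 * e' * `|a|.
  move=> hp; have := @cd_increment (fun s => f (s *: e_ i + (p + x))) (fun s => D i (s *: e_ i + (p + x))) a (D i x) e'.
  rewrite scale0r add0r addrA; apply => s sa; have [b1 b2] := ball _ (hp s sa).
  - by apply: cd_affine; rewrite addrA.
  - by rewrite addrA.
have s0 := @step 0 a0 0; have s1 := @step 1 a1 (a0 *: e_ 0); have s2 := @step 2%R a2 (a0 *: e_ 0 + a1 *: e_ 1).
have n00 (b : R) : `|0 : R| <= `|b| by rewrite normr0.
have {s0} t0 : normc (f (a0 *: e_ 0 + x) - f x - a0%:C * D 0 x) <= 2 * e' * `|a0|.
  have := s0; rewrite addr0 add0r; apply => s sa.
  have := nW s 0 0 sa (n00 _) (n00 _).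
  by rewrite (scale0r (e_ 1)) (scale0r (e_ 2%R)) !addr0.
have {s1} t1 : normc (f (a1 *: e_ 1 + a0 *: e_ 0 + x) - f (a0 *: e_ 0 + x) - a1%:C * D 1 x) <= 2 * e' * `|a1|.
  by apply: s1 => s sa; have := nW a0 s 0 (lexx _) sa (n00 _); rewrite scale0r addr0 addrC.
have {s2} t2 : normc (f (a2 *: e_ 2%R + (a0 *: e_ 0 + a1 *: e_ 1) + x) - f (a0 *: e_ 0 + a1 *: e_ 1 + x) - a2%:C * D 2%R x) <= 2 * e' * `|a2|.
  by apply: s2 => s sa; have := nW a0 a1 s (lexx _) (lexx _) sa; rewrite [X in `|X|]addrC.
have -> : h *: v = a2 *: e_ 2%R + (a0 *: e_ 0 + a1 *: e_ 1).
  by rewrite {1}(vec_decomp v) !scalerDr !scalerA addrC.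
rewrite [a1 *: _ + _]addrC in t1.
have -> : \sum_(i < 3) (v i 0)%:C * D i x = (v 0 0)%:C * D 0 x + (v 1 0)%:C * D 1 x + (v 2%R 0)%:C * D 2%R x.
  rewrite !big_ord_recl big_ord0 addr0 addrA.
  by congr (_ + _ + _); congr ((v _ _)%:C * D _ _); apply: val_inj.
move: t0 t1 t2; rewrite /a0 /a1 /a2 !rC_mul.
set f1 := f (_ + x); set f2 := f (_ + _ + x); set f3 := f (_ + x); move=> t0 t1 t2.
have -> : f3 - f x - h%:C * ((v 0 0)%:C * D 0 x + (v 1 0)%:C * D 1 x + (v 2%R 0)%:C * D 2%R x) =
  (f1 - f x - h%:C * (v 0 0)%:C * D 0 x) + (f2 - f1 - h%:C * (v 1 0)%:C * D 1 x) + (f3 - f2 - h%:C * (v 2%R 0)%:C * D 2%R x) by ring.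
rewrite (le_trans (normc_add _ _))// (le_trans (lerD (normc_add _ _) (lexx _)))//.
have E : e * `|h| = 2 * e' * (`|h| * W) by rewrite /e'; field; rewrite gt_eqF.
rewrite E; move: t0 t1 t2; rewrite !normrM /W => t0 t1 t2.
have := mulr_ge0 (ltW e'0) (normr_ge0 h); lra.
Qed.

Lemma near_neq0 x : x != 0 -> \forall y \near x, y != 0.
Proof.
move=> x0; apply/nbhs_normP; exists `|x|; rewrite /= ?normr_gt0// => y /= xy.
by apply: contraTneq xy => ->; rewrite subr0 ltxx.
Qed.

Lemma smooth_cd f x v : smooth_on R30 f -> x != 0 ->
  cd f x v (\sum_(i < 3) (v i 0)%:C * pderiv i f x).
Proof.
move=> sf x0; apply: (@directional_derivative f (fun i => pderiv i f)).
  apply: filterS (near_neq0 x0) => y y0 i.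
  by have [_ _ h] := sf [::] y y0; exact: cderivable_cd.
move=> i; have [h1 h2 _] := sf [:: i] x x0; exact/ccat_ReIm.
Qed.

Lemma smooth_scont f : smooth_on R30 f -> scont f.
Proof. by move=> sf x x0; have [h1 h2 _] := sf [::] x x0; exact/ccat_ReIm. Qed.

Lemma smooth_pderiv f i : smooth_on R30 f -> smooth_on R30 (pderiv i f).
Proof.
move=> sf s x x0; have := sf (rcons s i) x x0.
have -> : pderivs (rcons s i) f = pderivs s (pderiv i f) by elim: s => //= j s ->.
by [].
Qed.

Lemma smooth_ray f v r : smooth_on R30 f -> v != 0 -> 0 < r ->
  cd (fun r : R^o => f (r *: v)) r 1 (\sum_(i < 3) (v i 0)%:C * pderiv i f (r *: v)).
Proof.
move=> sf v0 r0; have := @cd_affine E f 0 v r; rewrite addr0 => H.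
have rv : r *: v != 0 by rewrite scaler_eq0 negb_or gt_eqF.
have := H _ (smooth_cd v sf rv).
by rewrite (_ : (fun s : R => f (s *: v + 0)) = (fun s => f (s *: v)))//; apply/funext => s; rewrite addr0.
Qed.

End DirectionalDerivative.

Section RadialRegularity.
Context {R : realType}.
Notation E := 'cV[R]_3.
Notation SI := sphere_integral.
Notation rct := (rect (pi : R) (2 * pi)).
Notation mu2 := ((@lebesgue_measure R) \x (@lebesgue_measure R))%E.
Implicit Types (f g : E -> R[i]) (x y v : E).
Notation e_ i := (delta_mx i 0 : E).

Lemma sum3 (U : nmodType) (F : 'I_3 -> U) : \sum_(i < 3) F i = F 0 + F 1 + F 2%R.
Proof.
by rewrite !big_ord_recl big_ord0 addr0 addrA; congr (F _ + F _ + F _); apply: val_inj.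
Qed.

Lemma annulus_bounded f (a b : R) : scont f -> 0 < a ->
  exists2 M : R, 0 < M & forall (r : R) t, a <= r <= b -> rct t -> normc (f (r *: sphere_point t)) <= M.
Proof.
move=> hf a0; pose A : set (R * (R * R)) := `[a, b]%classic `*` rct.
have cA : compact A by apply: compact_setX; [|apply: compact_setX]; exact: segment_compact.
have cf : {within A, continuous (fun p : R * (R * R) => normc (f (p.1 *: sphere_point p.2)))}.
  apply: continuous_in_subspaceT => p /set_mem[/= + _]; rewrite in_itv/= => /andP[ap _].
  have p0 : 0 < p.1 by exact: lt_le_trans ap.
  have hp : ccat f (p.1 *: sphere_point p.2).
    by apply: hf; rewrite scaler_eq0 negb_or gt_eqF//=; apply: sphere_neq0; exact: sphere_point_norm.
  have c2 : (fun p : R * (R * R) => sphere_point p.2) @ p --> sphere_point p.2.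
    by apply: continuous_comp; [exact: cvg_snd|exact: sphere_point_continuous].
  have c : (fun p : R * (R * R) => p.1 *: sphere_point p.2) @ p --> p.1 *: sphere_point p.2.
    by apply: cvgZ => //; exact: cvg_fst.
  have h := @ccat_comp R (R * (R * R))%type E f (fun p => p.1 *: sphere_point p.2) p c hp.
  exact: clim_normc h.
have [M [_ hM]] := compact_bounded (continuous_compact cf cA).
exists (`|M| + 1); first by rewrite ltr_wpDl.
move=> r t rab rt; rewrite (le_trans (ler_norm _))//; apply: (hM (`|M| + 1)).
  by rewrite (le_lt_trans (ler_norm _))// ltrDl.
by exists (r, t) => //; split.
Qed.

Lemma coord_cd (i : 'I_3) x v : cd (fun x : E => (x i 0)%:C) x v (v i 0)%:C.
Proof.
apply: cd_of_estimate => e e0; apply/nbhs_normP; exists 1; first exact: ltr01.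
move=> h _.
have -> : (h *: v + x) i 0 = h * v i 0 + x i 0 by rewrite !mxE.
rewrite rC_add rC_mul.
by rewrite [X in normc X](_ : _ = 0); [rewrite normc_0 mulr_ge0// ltW|ring].
Qed.

Lemma SI_cd f g (r : R) : smooth_on R30 f -> scont g -> 0 < r ->
  cd (fun r : R^o => SI (fun x => f (r *: x) * g x)) r 1
     (\sum_(i < 3) SI (fun x => pderiv i f (r *: x) * ((x i 0)%:C * g x))).
Proof.
move=> sf hg r0.
have sp i : scont (pderiv i f) by apply: smooth_scont; exact: smooth_pderiv.
pose G i x : R[i] := (x i 0)%:C * g x.
have sG i : scont (G i) by apply: scont_mul => // x _; exact: coord_ccat.
have r2 : 0 < r / 2 by rewrite divr_gt0.
have -> : \sum_(i < 3) SI (fun x => pderiv i f (r *: x) * ((x i 0)%:C * g x)) =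
    SI (fun x => \sum_(i < 3) pderiv i f (r *: x) * G i x).
  by rewrite SI_sum// => i; apply: scont_mul => //; exact: scont_scale.
have bnd i : exists2 M : R, 0 < M & forall s t, r / 2 <= s <= 2 * r -> rct t ->
    normc (pderiv i f (s *: sphere_point t) * G i (sphere_point t) * (sin t.1)%:C) <= M.
  have [M M0 hM] := annulus_bounded (2 * r) (sp i) r2.
  have [N N0 hN] := scont_bounded (sG i).
  exists (M * N) => [|s t hs rt]; first exact: mulr_gt0.
  rewrite (normc_mul _ (sin _)%:C) normc_real -[M * N]mulr1; apply: ler_pM; rewrite ?normc_ge0//; last first.
    by rewrite ler_norml sin_geN1 sin_le1.
  by rewrite normc_mul ler_pM ?normc_ge0 ?hM ?hN.
have [M0 M0p h0] := bnd 0; have [M1 M1p h1] := bnd 1; have [M2 M2p h2] := bnd 2%R.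
have mr : measurable rct by exact: measurable_rect.
have r12 : r / 2 < r < 2 * r by rewrite ltr_pdivrMr// ltr_pMr// ltr1n ltr_pMl// ltr1n.
apply: (@cintegral_cd _ _ _ mu2 rct mr (fun (s : R) => sint (fun x => f (s *: x) * g x))
  (fun s => sint (fun x => \sum_(i < 3) pderiv i f (s *: x) * G i x)) (fun=> M0 + M1 + M2) (r / 2) (2 * r)) => //.
- move=> s /andP[s1 s2]; apply: sint_integrable; apply: scont_mul => //.
  by apply: scont_scale; [exact: lt_trans s1|exact: smooth_scont].
- move=> s t /andP[s1 s2] rt; have s0 : 0 < s by exact: lt_trans s1.
  have t0 : sphere_point t != 0 :> E by apply: sphere_neq0; exact: sphere_point_norm.
  have h := smooth_ray sf t0 s0.
  have := cd_mull ((sin t.1)%:C * g (sphere_point t)) h; rewrite /sint => H.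
  have -> : (fun r1 : R^o => f (r1 *: sphere_point t) * g (sphere_point t) * (sin t.1)%:C) =
    (fun r1 => (sin t.1)%:C * g (sphere_point t) * f (r1 *: sphere_point t)).
    by apply/funext => u; ring.
  apply: cd_eq H _; rewrite mulr_sumr mulr_suml; apply: eq_bigr => i _; rewrite /G; ring.
- by move=> t; rewrite !addr_ge0// ltW.
- apply: continuous_integrable_rect => t; exact: cst_continuous.
- move=> s t /andP[s1 s2] rt; have s12 : r / 2 <= s <= 2 * r by rewrite !ltW.
  rewrite /sint sum3 !mulrDl.
  rewrite (le_trans (normc_add _ _))// lerD//; last exact: h2.
  by rewrite (le_trans (normc_add _ _))// lerD//; [exact: h0|exact: h1].
Qed.

Definition radial_moment f g (r : R) : R[i] := SI (fun x => f (r *: x) * g x).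

Lemma SI_cd2 f g : smooth_on R30 f -> scont g ->
  exists d1 d2 : R -> R[i], forall r, 0 < r ->
    cd (radial_moment f g : R^o -> R[i]) r 1 (d1 r) /\ cd (d1 : R^o -> R[i]) r 1 (d2 r).
Proof.
move=> sf hg.
pose G i x : R[i] := (x i 0)%:C * g x.
have sG i : scont (G i) by apply: scont_mul => // x _; exact: coord_ccat.
exists (fun r => \sum_(i < 3) radial_moment (pderiv i f) (G i) r).
exists (fun r => \sum_(i < 3) \sum_(j < 3)
  SI (fun x => pderiv j (pderiv i f) (r *: x) * ((x j 0)%:C * G i x))) => r r0; split.
  exact: SI_cd.
by apply: cd_sum => i _; exact: (SI_cd (smooth_pderiv i sf) (sG i) r0).
Qed.

Lemma hcoef_cd2 f l k : smooth_on R30 f ->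
  exists d1 d2 : R -> R[i], forall r, 0 < r ->
    cd (hcoef f l k : R^o -> R[i]) r 1 (d1 r) /\ cd (d1 : R^o -> R[i]) r 1 (d2 r).
Proof.
move=> sf; have [d1 [d2 h]] := SI_cd2 sf (@scont_H R l (2 * l - k)).
exists (fun r => (nH l k)^-1 * d1 r), (fun r => (nH l k)^-1 * d2 r) => r r0.
have [h1 h2] := h r r0; split; last exact: cd_mull.
have := cd_mull (nH l k)^-1 h1; rewrite /hcoef /radial_moment => h3.
by rewrite (_ : (fun r => _) = (fun y : R => (nH l k)^-1 * SI (fun x => f (y *: x) * H l (2 * l - k) x)))//;
  apply/funext => y; rewrite mulrC.
Qed.

Lemma enorm_cd x v : x != 0 -> cd (fun x : E => (enorm x)%:C) x v (rd x v / enorm x)%:C.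
Proof.
move=> x0; have nx := enorm_gt0 x0.
pose g (x : E) : R := x 0 0 ^+ 2 + x 1 0 ^+ 2 + x 2%R 0 ^+ 2.
have gd : is_derive x v g (2 * rd x v).
  have h i := cd_exp 2 (coord_cd i x v).
  have [h1 _] := cd_add (cd_add (h 0) (h 1)) (h 2%R).
  apply: is_derive_cong h1 _ _; first by apply/funext => y; rewrite /g !cReD -!rC_X.
  by rewrite !cReD -!rC_X -!rC_nat -!rC_mul/= /rd; ring.
have gx : g x = enorm x ^+ 2 by rewrite enorm_sqr.
have sd : cd (fun r : R^o => (Num.sqrt r)%:C) (g x) 1 ((2 * Num.sqrt (g x))^-1)%:C.
  by apply: cd_real; apply: is_derive1_sqrt; rewrite gx exprn_gt0.
have := cd_real_comp sd gd.
rewrite (_ : (fun y : E => _) = (fun y => (enorm y)%:C)); last by apply/funext => y; rewrite enorm3.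
move=> h; apply: cd_eq h _; rewrite -rC_mul; congr (_%:C).
by rewrite gx sqrtr_sqr ger0_norm ?enorm_ge0//; field; rewrite gt_eqF.
Qed.

Lemma enorm_is_derive x v : x != 0 -> is_derive x v (@enorm R) (rd x v / enorm x).
Proof. by move=> x0; case: (enorm_cd v x0). Qed.

End RadialRegularity.

(** * The Laplacian of harmonics with radial coefficients *)

Section HarmonicDerivatives.
Context {R : realType}.
Notation E := 'cV[R]_3.
Notation SI := sphere_integral.
Implicit Types (f g : E -> R[i]) (x y v : E).
Notation e_ i := (delta_mx i 0 : E).

(** Coefficientwise derivative of a polynomial-valued function: the product rule then applies to the
    generating function, and all [H l k] of a degree are differentiated at once. *)
Definition pcd (P : E -> {poly R[i]}) x v (D : {poly R[i]}) : Prop :=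
  forall k : nat, cd (fun x => (P x)`_k) x v D`_k.

Lemma pcd_mul P Q x v D D' : pcd P x v D -> pcd Q x v D' ->
  pcd (fun x => P x * Q x) x v (D * Q x + P x * D').
Proof.
move=> hP hQ k; have h := cd_sum (P := xpredT) (index_enum 'I_k.+1)
  (fun (j : 'I_k.+1) _ => cd_mul (hP j) (hQ (k - j)%N)).
rewrite (_ : (fun x => (P x * Q x)`_k) = (fun y => \sum_(j < k.+1) (P y)`_j * (Q y)`_(k - j))); last first.
  by apply/funext => y; rewrite coefM.
by apply: cd_eq h _; rewrite coefD !coefM big_split.
Qed.

Lemma Qp_lin x : Qp x = \sum_(i < 3) (x i 0)%:C *: Qp (e_ i).
Proof.
have c (i j : 'I_3) : (e_ i : E) j 0 = (i == j)%:R by rewrite mxE eqxx andbT eq_sym.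
apply/polyP => k; rewrite sum3 /Qp !(coefB, coefD, coefZ, coefCM, coefC, coefX, coefXn).
rewrite !ucoordE !ubarE /zcoord !c /= !rC_nat; set I := (0 +i* 1 : R[i]).
by case: k => [|[|[|k]]] /=; ring.
Qed.

Lemma pcd_Qp x v : pcd (@Qp R) x v (Qp v).
Proof.
move=> k; have h := cd_sum (P := xpredT) (index_enum 'I_3)
  (fun i _ => cd_mull (Qp (e_ i))`_k (coord_cd i x v)).
rewrite (_ : (fun x => (Qp x)`_k) = (fun y : E => \sum_(i < 3) (Qp (e_ i))`_k * (y i 0)%:C)); last first.
  by apply/funext => y; rewrite (Qp_lin y) coef_sum; apply: eq_bigr => i _; rewrite coefZ mulrC.
by apply: cd_eq h _; rewrite (Qp_lin v) coef_sum; apply: eq_bigr => i _; rewrite coefZ mulrC.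
Qed.

Lemma pcd_QpX l x v : pcd (fun x => Qp x ^+ l) x v (l%:R *: (Qp v * Qp x ^+ l.-1)).
Proof.
elim: l => [|l IH].
  have -> : 0%:R *: (Qp v * Qp x ^+ 0.-1) = 0 :> {poly R[i]} by rewrite scale0r.
  have -> : (fun x => Qp x ^+ 0) = (fun=> 1) by apply/funext => y; rewrite expr0.
  by move=> k; apply: cd_eq (cd_cst (1 : {poly R[i]})`_k x v) _; rewrite coef0.
move=> k.
rewrite (_ : (fun x => (Qp x ^+ l.+1)`_k) = (fun x => (Qp x * Qp x ^+ l)`_k)); last by apply/funext => y; rewrite exprS.
apply: cd_eq (pcd_mul (pcd_Qp x v) IH k) _; congr (_ `_ k).
rewrite -scalerAr mulrCA; case: l {IH} => [|l] /=; first by rewrite scale0r addr0 scale1r.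
by rewrite -exprS -[l.+2%:R]natr1 scalerDl scale1r addrC.
Qed.

Definition hd l k v x : R[i] := (l%:R *: (Qp v * Qp x ^+ l.-1))`_k.
Definition hdd l k v w x : R[i] := (l%:R *: (l.-1%:R *: (Qp v * Qp w * Qp x ^+ l.-2)))`_k.

Lemma H_cd l k x v : cd (H l k) x v (hd l k v x).
Proof. exact: pcd_QpX. Qed.

Lemma hd_cd l k v w x : cd (hd l k v) x w (hdd l k v w x).
Proof.
rewrite /hd /hdd (_ : (fun x => _) = (fun x : E => l%:R * (Qp v * Qp x ^+ l.-1)`_k)); last by apply/funext => y; rewrite coefZ.
rewrite coefZ; apply: cd_mull.
have h0 : pcd (fun _ : E => Qp v) x w 0 by move=> j; rewrite coef0; exact: cd_cst.
apply: cd_eq (pcd_mul h0 (pcd_QpX l.-1 x w) k) _; congr (_ `_ k).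
by rewrite mul0r add0r -scalerAr mulrA.
Qed.

Lemma euler_H l k x : \sum_(i < 3) (x i 0)%:C * hd l k (e_ i) x = l%:R * H l k x.
Proof.
have -> : \sum_(i < 3) (x i 0)%:C * hd l k (e_ i) x =
   (\sum_(i < 3) (x i 0)%:C *: (l%:R *: (Qp (e_ i) * Qp x ^+ l.-1)))`_k.
  by rewrite coef_sum; apply: eq_bigr => i _; rewrite [in RHS]coefZ.
have -> : \sum_(i < 3) (x i 0)%:C *: (l%:R *: (Qp (e_ i) * Qp x ^+ l.-1)) =
    l%:R *: (Qp x * Qp x ^+ l.-1).
  rewrite {2}(Qp_lin x) mulr_suml scaler_sumr; apply: eq_bigr => i _.
  by rewrite -scalerAl !scalerA mulrC.
by case: l => [|l]; rewrite coefZ ?mul0r// -exprS.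
Qed.

Lemma isotropic_Qp : \sum_(i < 3) Qp (e_ i) * Qp (e_ i) = 0.
Proof.
have c (i j : 'I_3) : (e_ i : E) j 0 = (i == j)%:R by rewrite mxE eqxx andbT eq_sym.
rewrite sum3 /Qp !ucoordE !ubarE /zcoord !c /= !rC_nat.
rewrite !mulr1 !mulr0 ?addr0 ?subr0 ?add0r ?sub0r.
have i2 : (0 +i* 1 : R[i]) * (0 +i* 1) = -1 by apply: Cext; rewrite /= ?mulr0 ?mul0r ?mulr1 ?sub0r ?addr0// oppr0.
have i2' : (0 +i* 1 : R[i])%:P * (0 +i* 1)%:P = -1 by rewrite -polyCM i2 polyCN.
rewrite !polyCN !polyC1 !polyC0 ?polyCM; move: i2'; set I := (0 +i* 1)%:P => i2'.
have -> : (2%:R%:P : {poly R[i]}) = 2 by rewrite -natP.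
ring: i2'.
Qed.

(** Summing second derivatives of [Qp x ^+ l] over the axes produces the factor [isotropic_Qp],
    which is zero as a polynomial; each coefficient is therefore harmonic. *)
Lemma harmonic_H l k x : \sum_(i < 3) hdd l k (e_ i) (e_ i) x = 0.
Proof.
have -> : \sum_(i < 3) hdd l k (e_ i) (e_ i) x =
   (l%:R *: (l.-1%:R *: ((\sum_(i < 3) Qp (e_ i) * Qp (e_ i)) * Qp x ^+ l.-2)))`_k.
  by rewrite mulr_suml !scaler_sumr coef_sum.
by rewrite isotropic_Qp mul0r !scaler0 coef0.
Qed.

Lemma H_scale l k (r : R) x : H l k (r *: x) = r%:C ^+ l * H l k x.
Proof.
rewrite /H; have -> : Qp (r *: x) = r%:C *: Qp x.
  rewrite (Qp_lin (r *: x)) (Qp_lin x) scaler_sumr.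
  by apply: eq_bigr => i _; rewrite mxE rC_mul scalerA.
by rewrite exprZn coefZ.
Qed.

Lemma rd_e x (i : 'I_3) : rd x (e_ i) = x i 0.
Proof.
have c (j : 'I_3) : (e_ i : E) j 0 = (i == j)%:R by rewrite mxE eqxx andbT eq_sym.
by rewrite /rd !c; elim/ord3P: i {c} => /=; ring.
Qed.

Lemma rho_cd x v : x != 0 ->
  cd (fun x : E => ((enorm x)^-1)%:C) x v (- ((enorm x)^-1)%:C ^+ 3 * (rd x v)%:C).
Proof.
move=> x0; have nx := enorm_gt0 x0.
apply: cd_eq (cd_real_comp (inv_cd nx) (enorm_is_derive v x0)) _.
by rewrite rC_mul; ring.
Qed.

Section RadialTimesHarmonic.
Variables (g g1 g2 : R -> R[i]) (l k : nat).
Hypothesis gd : forall r, 0 < r -> cd (g : R^o -> R[i]) r 1 (g1 r).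
Hypothesis g1d : forall r, 0 < r -> cd (g1 : R^o -> R[i]) r 1 (g2 r).

Definition gHd v x : R[i] := g1 (enorm x) * (rd x v)%:C * ((enorm x)^-1)%:C * H l k x + g (enorm x) * hd l k v x.
Definition gHdd v x : R[i] :=
  g2 (enorm x) * (rd x v)%:C ^+ 2 * ((enorm x)^-1)%:C ^+ 2 * H l k x
  + g1 (enorm x) * (rd v v)%:C * ((enorm x)^-1)%:C * H l k x
  - g1 (enorm x) * (rd x v)%:C ^+ 2 * ((enorm x)^-1)%:C ^+ 3 * H l k x
  + 2 * g1 (enorm x) * (rd x v)%:C * ((enorm x)^-1)%:C * hd l k v x
  + g (enorm x) * hdd l k v v x.

Lemma gH_cd v x : x != 0 -> cd (fun x => g (enorm x) * H l k x) x v (gHd v x).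
Proof.
move=> x0; have nx := enorm_gt0 x0.
apply: cd_eq (cd_mul (cd_real_comp (gd nx) (enorm_is_derive v x0)) (H_cd l k x v)) _.
by rewrite /gHd rC_mul; ring.
Qed.

Lemma gHd_cd v x : x != 0 -> cd (gHd v) x v (gHdd v x).
Proof.
move=> x0; have nx := enorm_gt0 x0.
have c0 := cd_real_comp (gd nx) (enorm_is_derive v x0).
have c1 := cd_real_comp (g1d nx) (enorm_is_derive v x0).
have c2 : cd (fun x : E => (rd x v)%:C) x v (rd v v)%:C.
  have h i := cd_mull (v i 0)%:C (coord_cd i x v).
  have := cd_add (cd_add (h 0) (h 1)) (h 2%R).
  rewrite (_ : (fun y => _) = (fun y : E => (rd y v)%:C)); last first.
    by apply/funext => y; rewrite -!rC_mul -!rC_add /rd; congr (_%:C); ring.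
  by move=> H; apply: cd_eq H _; rewrite -!rC_mul -!rC_add.
apply: cd_eq (cd_add (cd_mul (cd_mul (cd_mul c1 c2) (rho_cd v x0)) (H_cd l k x v)) (cd_mul c0 (hd_cd l k v v x))) _.
by rewrite /gHdd rC_mul; ring.
Qed.

Lemma gH_laplacian x : x != 0 -> \sum_(i < 3) gHdd (e_ i) x =
  (g2 (enorm x) + (2 * l + 2)%:R * ((enorm x)^-1)%:C * g1 (enorm x)) * H l k x.
Proof.
move=> x0; have nx := enorm_gt0 x0; rewrite /gHdd !big_split /=.
rewrite -[X in _ + X]mulr_sumr harmonic_H mulr0 addr0.
have n2 : \sum_(i < 3) (rd x (e_ i))%:C ^+ 2 = ((enorm x)%:C ^+ 2).
  by rewrite -rC_X enorm_sqr sum3 !rd_e -!rC_X -!rC_add.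
have e3 : \sum_(i < 3) (rd (e_ i) (e_ i))%:C = 3 :> R[i].
  rewrite (eq_bigr (fun=> 1)) => [|i _]; last by rewrite rd_e mxE !eqxx.
  by rewrite sum3; ring.
have eu : \sum_(i < 3) (rd x (e_ i))%:C * hd l k (e_ i) x = l%:R * H l k x.
  by rewrite -euler_H; apply: eq_bigr => i _; rewrite rd_e.
set A := g2 _; set B := g1 _; set rho := (_^-1)%:C; set h := H l k x.
have rn : rho * (enorm x)%:C = 1 by rewrite /rho rC_inv mulVf// rC_neq0.
have -> : \sum_(i < 3) A * (rd x (e_ i))%:C ^+ 2 * rho ^+ 2 * h = A * h.
  transitivity (A * rho ^+ 2 * h * \sum_(i < 3) (rd x (e_ i))%:C ^+ 2).
    by rewrite mulr_sumr; apply: eq_bigr => i _; ring.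
  by rewrite n2; ring: rn.
have -> : \sum_(i < 3) B * (rd (e_ i) (e_ i))%:C * rho * h = 3 * B * rho * h.
  by rewrite -e3 !mulr_suml; apply: eq_bigr => i _; ring.
have -> : \sum_(i < 3) - (B * (rd x (e_ i))%:C ^+ 2 * rho ^+ 3 * h) = - (B * rho * h).
  transitivity (- (B * rho ^+ 3 * h * \sum_(i < 3) (rd x (e_ i))%:C ^+ 2)).
    by rewrite mulr_sumr -sumrN; apply: eq_bigr => i _; ring.
  by rewrite n2; ring: rn.
have -> : \sum_(i < 3) 2 * B * (rd x (e_ i))%:C * rho * hd l k (e_ i) x = 2 * B * rho * (l%:R * h).
  by rewrite -eu mulr_sumr; apply: eq_bigr => i _; ring.
by rewrite natrD natrM; ring.
Qed.

End RadialTimesHarmonic.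

Lemma radial_weight_cd (p dp ddp : R -> R[i]) (l : nat) (r : R) : 0 < r ->
  cd (p : R^o -> R[i]) r 1 (dp r) -> cd (dp : R^o -> R[i]) r 1 (ddp r) ->
  cd (fun r : R^o => p r * (r^-1)%:C ^+ l.+1) r 1
     (dp r * (r^-1)%:C ^+ l.+1 - l.+1%:R * (p r * (r^-1)%:C ^+ l.+2)) /\
  cd (fun r : R^o => dp r * (r^-1)%:C ^+ l.+1 - l.+1%:R * (p r * (r^-1)%:C ^+ l.+2)) r 1
     (ddp r * (r^-1)%:C ^+ l.+1 - 2 * l.+1%:R * (dp r * (r^-1)%:C ^+ l.+2)
      + l.+1%:R * l.+2%:R * (p r * (r^-1)%:C ^+ l.+3)).
Proof.
move=> r0 h0 h1; have hr := inv_cd r0; split.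
  apply: cd_eq (cd_mul h0 (cd_exp l.+1 hr)) _; rewrite /= !exprS; ring.
apply: cd_eq (cd_sub (cd_mul h1 (cd_exp l.+1 hr)) (cd_mull l.+1%:R (cd_mul h0 (cd_exp l.+2 hr)))) _.
by rewrite /= !exprS; ring.
Qed.

(** [H l k] is homogeneous of degree [l], so each term is p(r) / r times a function of the
    direction: [p l k] is the radial function multiplied by [r], the one governed by [rsol]. *)
Definition hsum (L : nat) (p : nat -> nat -> R -> R[i]) x : R[i] :=
  \sum_(l < L) \sum_(k < (2 * l).+1) p l k (enorm x) * ((enorm x)^-1)%:C ^+ l.+1 * H l k x.

Lemma laplacian_hsum L (p dp ddp : nat -> nat -> R -> R[i]) f x :
  (forall l k r, 0 < r -> cd (p l k : R^o -> R[i]) r 1 (dp l k r) /\ cd (dp l k : R^o -> R[i]) r 1 (ddp l k r)) ->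
  (forall y, y != 0 -> f y = hsum L p y) -> x != 0 ->
  laplacian f x = hsum L (fun l k r => ddp l k r - (l * l.+1)%:R * (r^-1)%:C ^+ 2 * p l k r) x.
Proof.
move=> hp fE x0.
pose g l k (r : R) : R[i] := p l k r * (r^-1)%:C ^+ l.+1.
pose g1 l k (r : R) : R[i] := dp l k r * (r^-1)%:C ^+ l.+1 - l.+1%:R * (p l k r * (r^-1)%:C ^+ l.+2).
pose g2 l k (r : R) : R[i] := ddp l k r * (r^-1)%:C ^+ l.+1 - 2 * l.+1%:R * (dp l k r * (r^-1)%:C ^+ l.+2)
      + l.+1%:R * l.+2%:R * (p l k r * (r^-1)%:C ^+ l.+3).
have gd l k r : 0 < r -> cd (g l k : R^o -> R[i]) r 1 (g1 l k r).
  by move=> r0; have [a b] := hp l k r r0; have [] := radial_weight_cd l r0 a b.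
have g1d l k r : 0 < r -> cd (g1 l k : R^o -> R[i]) r 1 (g2 l k r).
  by move=> r0; have [a b] := hp l k r r0; have [] := radial_weight_cd l r0 a b.
pose D i y := \sum_(l < L) \sum_(k < (2 * l).+1) gHd (g l k) (g1 l k) l k (e_ i) y.
have pd i y : y != 0 -> pderiv i f y = D i y.
  move=> y0; apply: cd_cderive.
  apply: (@cd_near _ _ (hsum L p)); first by apply: filterS (near_neq0 y0) => z z0; rewrite fE.
  by apply: cd_sum => l _; apply: cd_sum => k _; exact: (gH_cd l k (gd l k) (e_ i) y0).
rewrite /laplacian.
transitivity (\sum_(i < 3) \sum_(l < L) \sum_(k < (2 * l).+1) gHdd (g l k) (g1 l k) (g2 l k) l k (e_ i) x).
  apply: eq_bigr => i _ /=; apply: cd_cderive.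
  apply: (@cd_near _ _ (D i)); first by apply: filterS (near_neq0 x0) => z z0; rewrite pd.
  by apply: cd_sum => l _; apply: cd_sum => k _; exact: (gHd_cd l k (gd l k) (g1d l k) (e_ i) x0).
rewrite exchange_big; apply: eq_bigr => l _; rewrite exchange_big; apply: eq_bigr => k _.
transitivity ((g2 l k (enorm x) + (2 * l + 2)%:R * ((enorm x)^-1)%:C * g1 l k (enorm x)) * H l k x).
  exact: gH_laplacian.
rewrite /g1 /g2; congr (_ * _); rewrite natrM natrD -[l.+2%:R]natr1.
by rewrite -[l.+1%:R]natr1 !exprS natrM; ring.
Qed.

Lemma SI_H_sum L (c : nat -> nat -> R[i]) l k : (k <= 2 * l)%N ->
  SI (fun x => H l k x * (\sum_(l' < L) \sum_(k' < (2 * l').+1) c l' k' * H l' k' x)) =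
  if (l < L)%N then c l (2 * l - k)%N * nH l k else 0.
Proof.
move=> kl.
have -> : SI (fun x => H l k x * (\sum_(l' < L) \sum_(k' < (2 * l').+1) c l' k' * H l' k' x)) =
  \sum_(l' < L) \sum_(k' < (2 * l').+1) c l' k' * SI (fun x => H l k x * H l' k' x).
  transitivity (SI (fun x => \sum_(l' < L) \sum_(k' < (2 * l').+1) c l' k' * (H l k x * H l' k' x))).
    apply: SI_eq => x _; rewrite mulr_sumr; apply: eq_bigr => l' _; rewrite mulr_sumr.
    by apply: eq_bigr => k' _; rewrite mulrCA.
  have sH l' k' : scont (fun x => c l' k' * (H l k x * H l' k' x)).
    by apply: scont_mull; apply: scont_mul; exact: scont_H.
  rewrite SI_sum => [|l']; last by apply: scont_sum => k'; exact: sH.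
  apply: eq_bigr => l' _; rewrite SI_sum => [|k']; last exact: sH.
  by apply: eq_bigr => k' _; rewrite SI_mull//; apply: scont_mul; exact: scont_H.
have off (l' : nat) (k' : 'I_(2 * l').+1) : (l != l') || (k + k' != 2 * l)%N -> c l' k' * SI (fun x => H l k x * H l' k' x) = 0.
  move=> h; have kl' : (k' <= 2 * l')%N by rewrite -ltnS ltn_ord.
  by rewrite (SI_HH kl kl') -negb_and in h *; rewrite (negPf h) mulr0.
case: ltnP => lL; last first.
  rewrite big1 // => l' _; rewrite big1 // => k' _; apply: off; apply/orP; left.
  by rewrite neq_ltn (leq_trans (ltn_ord l') lL) orbT.
have kk : (2 * l - k < (2 * l).+1)%N by rewrite ltnS leq_subr.
rewrite (bigD1 (Ordinal lL))//= (bigD1 (Ordinal kk))//=.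
rewrite (SI_HH kl (leq_subr _ _)) eqxx subnKC// eqxx /= big1 => [|k' k'k]; last first.
  apply: off; rewrite eqxx /=; apply: contra k'k => /eqP h1.
  by apply/eqP/val_inj/eqP; rewrite -(eqn_add2l k) h1 /= subnKC.
rewrite big1 ?addr0 // => l' l'l; rewrite big1 // => k' _; apply: off; apply/orP; left.
by apply: contra l'l => /eqP h1; apply/eqP/val_inj.
Qed.

Lemma H_indep L (c : nat -> nat -> R[i]) :
  (forall x, enorm x = 1 -> \sum_(l < L) \sum_(k < (2 * l).+1) c l k * H l k x = 0) ->
  forall l k, (l < L)%N -> (k <= 2 * l)%N -> c l k = 0.
Proof.
move=> h l k lL kl; have := SI_H_sum L c (leq_subr k (2 * l)).
rewrite lL subKn//.
have -> : SI (fun x => H l (2 * l - k) x * (\sum_(l' < L) \sum_(k' < (2 * l').+1) c l' k' * H l' k' x)) = 0.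
  transitivity (SI (fun _ : E => 0 : R[i])); last exact: SI_0.
  by apply: SI_eq => x x1; rewrite h// mulr0.
by move/esym/eqP; rewrite mulf_eq0 (negPf (nH_neq0 (leq_subr _ _))) orbF => /eqP.
Qed.

End HarmonicDerivatives.

Section RadialReduction.
Context {R : realType}.
Variable gamma : R.
Notation E := 'cV[R]_3.
Implicit Types (f g : E -> R[i]) (x y v : E) (lam : R[i]).

Lemma hsum_Top L lam (p dp : nat -> nat -> R -> R[i]) f x :
  (forall l k, rsol gamma l lam (p l k) (dp l k)) ->
  (forall y, y != 0 -> f y = hsum L p y) -> x != 0 -> Top gamma f x = lam * f x.
Proof.
move=> hp fE x0; rewrite /Top.
rewrite (@laplacian_hsum R L p dp (fun l k r => potential gamma l lam r * p l k r) f x) //.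
rewrite fE// /hsum !mulr_sumr -sumrN -sumrB; apply: eq_bigr => l _.
rewrite !mulr_sumr -sumrN -sumrB; apply: eq_bigr => k _.
by rewrite /potential !rC_mul rC_nat; ring.
Qed.

Lemma unit_scale x : x != 0 -> enorm ((enorm x)^-1 *: x) = 1.
Proof.
move=> x0; have n0 := enorm_gt0 x0; apply: (@pexpIrn _ 2) => //; rewrite ?nnegrE ?enorm_ge0//.
rewrite enorm_sqr !mxE expr1n !exprMn -!mulrDr -enorm_sqr -exprMn mulVf ?expr1n// gt_eqF//.
Qed.

Lemma enorm_scale (r : R) x : 0 <= r -> enorm (r *: x) = r * enorm x.
Proof.
move=> r0; apply: (@pexpIrn _ 2) => //; rewrite ?nnegrE ?mulr_ge0 ?enorm_ge0//.
by rewrite exprMn !enorm_sqr !mxE; ring.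
Qed.

Lemma eigenfunction_radial lam f : Kfinite f -> eigenfunction gamma lam f ->
  exists (L : nat) (p dp : nat -> nat -> R -> R[i]),
    [/\ forall l k, rsol gamma l lam (p l k) (dp l k),
        forall x, x != 0 -> f x = hsum L p x &
        forall l k r, 0 < r -> (l < L)%N -> (k <= 2 * l)%N -> p l k r = r%:C * hcoef f l k r].
Proof.
move=> Kf [sf ef]; have [L hL] := hcoef_expansion Kf (smooth_scont sf).
(* Extension by 0, so that the radial equation holds for all indices and not only for the finitely
   many that occur. *)
pose p l k (r : R) : R[i] := if (l < L)%N && (k <= 2 * l)%N then r%:C * hcoef f l k r else 0.
pose dp l k : R -> R[i] := cderive (1 : R^o) (p l k : R^o -> R[i]).
pose ddp l k : R -> R[i] := cderive (1 : R^o) (dp l k : R^o -> R[i]).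
have hp l k r : 0 < r -> cd (p l k : R^o -> R[i]) r 1 (dp l k r) /\ cd (dp l k : R^o -> R[i]) r 1 (ddp l k r).
  have [d1 [d2 hd]] : exists d1 d2 : R -> R[i], forall r, 0 < r ->
      cd (p l k : R^o -> R[i]) r 1 (d1 r) /\ cd (d1 : R^o -> R[i]) r 1 (d2 r).
    case lk : ((l < L)%N && (k <= 2 * l)%N); last first.
      have -> : p l k = fun=> 0 by apply/funext => s; rewrite /p lk.
      by exists (fun=> 0), (fun=> 0) => s _; split; exact: cd_cst.
    have -> : p l k = fun s => s%:C * hcoef f l k s by apply/funext => s; rewrite /p lk.
    have [d1 [d2 h]] := hcoef_cd2 l k sf.
    exists (fun s => 1 * hcoef f l k s + s%:C * d1 s), (fun s => 1 * d1 s + (1 * d1 s + s%:C * d2 s)) => s s0.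
    have [h1 h2] := h s s0; split; first exact: cd_mul (cd_id s) h1.
    by apply: cd_add; [exact: cd_mull|exact: cd_mul (cd_id s) h2].
  have dE s : 0 < s -> d1 s = dp l k s by move=> s0; have [/cd_cderive <-] := hd s s0.
  move=> r0; have [h1 h2] := hd r r0; rewrite -(dE r r0); split=> //.
  have h3 : cd (dp l k : R^o -> R[i]) r 1 (d2 r) by exact: (cd_Rpos r0 dE h2).
  exact: cd_eq h3 (esym (cd_cderive h3)).
have fE x : x != 0 -> f x = hsum L p x.
  move=> x0; have n0 := enorm_gt0 x0.
  have {1}-> : x = enorm x *: ((enorm x)^-1 *: x) by rewrite scalerA mulfV ?scale1r// gt_eqF.
  rewrite hL// ?unit_scale//; apply: eq_bigr => l _; apply: eq_bigr => k _.
  have kl : (k <= 2 * l)%N by rewrite -ltnS ltn_ord.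
  rewrite H_scale /p ltn_ord kl /= exprS rC_inv.
  have n1 := rC_neq0 n0; move: (enorm x)%:C (hcoef f l k _) n1 => c v n1.
  by rewrite exprVn; field; rewrite ?expf_neq0 ?n1.
exists L, p, dp; split=> // [l k|l k r r0 lL kl]; last by rewrite /p lL kl.
case lk : ((l < L)%N && (k <= 2 * l)%N); last first.
  have pE : p l k = fun=> 0 by apply/funext => r; rewrite /p lk.
  move=> r r0; have [h1 _] := hp l k r r0; split=> //.
  have dE s : 0 < s -> 0 = dp l k s.
    by move=> s0; rewrite /dp pE; apply/esym/cd_cderive; exact: cd_cst.
  apply: (cd_Rpos r0 dE); rewrite pE mulr0; exact: cd_cst.
move=> r r0; have [h1 h2] := hp l k r r0; split=> //; apply: cd_eq h2 _.
case/andP: lk => lL kl; apply/eqP; rewrite -subr_eq0; apply/eqP.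
(* At the fixed radius [r] the eigenvalue equation is a linear relation between the harmonics on the
   unit sphere, with these coefficients; [H_indep] kills each of them. *)
pose c l k := (ddp l k r - potential gamma l lam r * p l k r) * (r^-1)%:C.
suff : c l k = 0.
  by move/eqP; rewrite /c mulf_eq0 rC_inv invr_eq0 (negPf (rC_neq0 r0)) orbF => /eqP.
apply: (@H_indep R L c) => // y y1.
have y0 := sphere_neq0 y1.
have ry0 : r *: y != 0 by rewrite scaler_eq0 negb_or gt_eqF.
have rn : enorm (r *: y) = r by rewrite enorm_scale ?ltW// y1 mulr1.
have := ef _ ry0; rewrite /Top (laplacian_hsum hp fE ry0) (fE _ ry0) => /eqP.
rewrite -subr_eq0 /hsum rn !mulr_sumr -sumrN -!sumrB => /eqP h.
apply: oppr_inj; rewrite oppr0 -[RHS]h -sumrN; apply: eq_bigr => l' _.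
rewrite !mulr_sumr -!sumrN -!big_split /=; apply: eq_bigr => k' _.
rewrite /c /potential H_scale !rC_mul !rC_inv rC_nat.
have n1 := rC_neq0 r0; move: r%:C n1 => t n1; rewrite (exprVn t l'.+1) (exprS t l').
by field; rewrite ?expf_neq0 ?n1.
Qed.

End RadialReduction.

(** * Square-integrable eigenfunctions decay *)

Section SquareIntegrability.
Context {R : realType}.
Notation E := 'cV[R]_3.
Notation mu := (@lebesgue_measure R).
Notation SI := sphere_integral.
Notation TR := (measurableTypeR R).
Notation T3 := (TR * TR * TR)%type.
Implicit Types (f g : E -> R[i]) (x y v : E) (lam : R[i]).

(** Chebyshev's inequality on cubes, whose volume is immediate for the product measure; [B] is the
    squared norm of [u]. *)
Lemma L2_box_bound (u : E -> R[i]) : L2 u -> exists B : R, forall (c : E) (h a : R), 0 < h -> 0 <= a ->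
  (forall x, (forall i, `|x i 0 - c i 0| <= h) -> a <= normc (u x)) -> a ^+ 2 * (2 * h) ^+ 3 <= B.
Proof.
move=> [hRe hIm].
have iR := Lfun2_integrable_sqr hRe; have iI := Lfun2_integrable_sqr hIm.
have iN : (@lebesgue3 R).-integrable setT (EFin \o (fun p => normc (u (vec3 p)) ^+ 2)).
  have := integrableD measurableT iR iI; apply: eq_integrable => // p _ /=.
  by rewrite normc_sqr.
have mN : measurable_fun setT (fun p : T3 => (normc (u (vec3 p)) ^+ 2)%:E).
  by have := measurable_int _ iN.
exists (fine (\int[@lebesgue3 R]_p (normc (u (vec3 p)) ^+ 2)%:E)) => c h a h0 a0 H.
pose I (i : 'I_3) : set TR := `[c i 0 - h, c i 0 + h]%classic.
have mI i : measurable (I i) by exact: measurable_itv.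
have muI i : mu (I i) = (2 * h)%:E.
  rewrite /I lebesgue_measure_itv /= lte_fin ltrD2l -subr_gt0 opprK addr_gt0//.
  by rewrite -EFinD; congr (_%:E); ring.
pose Q : set T3 := (I 0 `*` I 1) `*` I 2%R.
have mQ : measurable Q by apply: measurableX => //; exact: measurableX.
have muQ : lebesgue3 Q = ((2 * h) ^+ 3)%:E.
  pose I0 := I 0; pose I1 := I 1; pose I2 := I 2%R.
  transitivity ((mu \x mu)%E (I0 `*` I1) * mu I2)%E.
    by apply: product_measure1E => //; exact: measurableX.
  have -> : (mu \x mu)%E (I0 `*` I1) = (mu I0 * mu I1)%E.
    by apply: product_measure1E; exact: mI.
  by rewrite !muI -!EFinM; congr (_%:E); ring.
have inQ p : Q p -> a ^+ 2 <= normc (u (vec3 p)) ^+ 2.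
  move=> [[/= h1 h2] h3]; rewrite lerXn2r ?nnegrE ?normc_ge0//; apply: H.
  have hI i : I i (vec3 p i 0) -> `|vec3 p i 0 - c i 0| <= h.
    by rewrite /I /= in_itv /= ler_distl.
  by apply: ord3P; apply: hI; rewrite /vec3 mxE.
rewrite -lee_fin fineK; last first.
  by apply: integrable_fin_num.
rewrite EFinM -muQ.
apply: (@le_trans _ _ (\int[@lebesgue3 R]_(p in Q) (normc (u (vec3 p)) ^+ 2)%:E)%E).
  rewrite -integral_cst//; apply: ge0_le_integral => //.
  - by move=> p _; rewrite lee_fin exprn_ge0.
  - by apply: measurable_funTS; exact: mN.
apply: ge0_subset_integral => //.
by move=> p _; rewrite lee_fin exprn_ge0 ?normc_ge0.
Qed.

Lemma enorm_continuous : continuous (@enorm R).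
Proof.
move=> x.
have -> : @enorm R = (fun y => Num.sqrt (y 0 0 ^+ 2 + y 1 0 ^+ 2 + y 2%R 0 ^+ 2)).
  by apply/funext => y; rewrite enorm3.
apply: (@cvg_comp _ _ _ (fun y : E => y 0 0 ^+ 2 + y 1 0 ^+ 2 + y 2%R 0 ^+ 2) Num.sqrt _ (nbhs (x 0 0 ^+ 2 + x 1 0 ^+ 2 + x 2%R 0 ^+ 2))); last exact: sqrt_continuous.
have c i := ccat_exp 2 (coord_ccat i x).
have [h _] := (ccat_ReIm _ _).1 (ccat_add (ccat_add (c 0) (c 1)) (c 2%R)).
have -> : (fun y : E => y 0 0 ^+ 2 + y 1 0 ^+ 2 + y 2%R 0 ^+ 2) =
   (fun y => complex.Re ((y 0 0)%:C ^+ 2 + (y 1 0)%:C ^+ 2 + (y 2%R 0)%:C ^+ 2)).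
  by apply/funext => y; rewrite !cReD -!rC_X.
have -> : x 0 0 ^+ 2 + x 1 0 ^+ 2 + x 2%R 0 ^+ 2 = complex.Re ((x 0 0)%:C ^+ 2 + (x 1 0)%:C ^+ 2 + (x 2%R 0)%:C ^+ 2).
  by rewrite !cReD -!rC_X.
exact: h.
Qed.

Lemma rho_ccat : scont (fun x : E => ((enorm x)^-1)%:C : R[i]).
Proof.
move=> x x0; apply: ccat_real.
have n0 : enorm x != 0 by rewrite gt_eqF// enorm_gt0.
exact: (@cvgV _ _ (nbhs x) _ (@enorm R) (enorm x) n0 (@enorm_continuous x)).
Qed.

Definition asum (L : nat) (b : nat -> nat -> R[i]) x : R[i] :=
  \sum_(l < L) \sum_(k < (2 * l).+1) b l k * H l k x.

Definition direction x : E := (enorm x)^-1 *: x.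

Lemma asum_direction L b : scont (fun x => asum L b (direction x)).
Proof.
have -> : (fun x => asum L b (direction x)) =
    (fun x => \sum_(l < L) \sum_(k < (2 * l).+1) b l k * (((enorm x)^-1)%:C ^+ l * H l k x)).
  apply/funext => x; apply: eq_bigr => l _; apply: eq_bigr => k _; by rewrite /direction H_scale.
apply: scont_sum => l; apply: scont_sum => k; apply: scont_mull; apply: scont_mul; last exact: scont_H.
by apply: scont_exp; exact: rho_ccat.
Qed.

Lemma hsum_direction L p x : x != 0 ->
  hsum L p x = ((enorm x)^-1)%:C * asum L (fun l k => p l k (enorm x)) (direction x).
Proof.
move=> x0; rewrite /hsum /asum mulr_sumr; apply: eq_bigr => l _; rewrite mulr_sumr; apply: eq_bigr => k _.
by rewrite /direction H_scale exprS; ring.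
Qed.

Lemma hsum_ray L p (r : R) x : 0 < r -> enorm x = 1 ->
  hsum L p (r *: x) = (r^-1)%:C * asum L (fun l k => p l k r) x.
Proof.
move=> r0 x1; have nr : enorm (r *: x) = r by rewrite enorm_scale ?(ltW r0)// x1 mulr1.
have rx : r *: x != 0 by rewrite scaler_eq0 negb_or gt_eqF//=; exact: sphere_neq0.
have dx : direction (r *: x) = x by rewrite /direction nr scalerA mulVf ?scale1r// gt_eqF.
by rewrite (hsum_direction L p rx) nr dx.
Qed.

Lemma cbounded_sum (X : Type) (S : set X) (I : Type) (s : seq I) (G : I -> X -> R[i]) :
  (forall i, cbounded S (G i)) -> cbounded S (fun t => \sum_(i <- s) G i t).
Proof.
move=> h; elim: s => [|i s IH].
  by exists 0 => x _; rewrite big_nil normc_0.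
have [B hB] := cbounded_add (h i) IH.
by exists B => x Sx; rewrite big_cons hB.
Qed.

Lemma uclim_sum (T X : Type) (F : set_system T) {FF : Filter F} (S : set X) (I : Type) (s : seq I)
    (G : I -> T -> X -> R[i]) (M : I -> X -> R[i]) : (forall i, uclim F S (G i) (M i)) ->
  uclim F S (fun t z => \sum_(i <- s) G i t z) (fun z => \sum_(i <- s) M i z).
Proof.
move=> h; elim: s => [|i s IH] e e0.
  by apply: filterE => t x _; rewrite !big_nil subrr normc_0.
have H : \forall t \near F, forall x : X, S x -> normc (G i t x + \sum_(i <- s) G i t x - (M i x + \sum_(i <- s) M i x)) < e.
  exact: (uclim_add (h i) IH e0).
apply: filterS H => t ht x Sx.
by rewrite !big_cons ht.
Qed.

Lemma coord_le_enorm x (i : 'I_3) : `|x i 0| <= enorm x.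
Proof.
rewrite -(@ler_pXn2r _ 2) ?nnegrE ?enorm_ge0// real_normK ?num_real// enorm_sqr.
have h j := sqr_ge0 (x j 0); have := h 0; have := h 1; have := h 2%R.
by elim/ord3P: i; lra.
Qed.

Lemma H_cbounded (S : set E) (B : R) l k : (forall x, S x -> enorm x <= B) -> cbounded S (H l k).
Proof.
move=> hS; elim: l k => [|l IH] k.
  by exists (normc (1 : {poly R[i]})`_k) => x _; rewrite /H expr0.
have Qb j : cbounded S (fun x => (Qp x)`_j).
  have [C hC] : cbounded S (fun x => \sum_(i < 3) (x i 0)%:C * (Qp (delta_mx i 0 : E))`_j).
    apply: cbounded_sum => i; apply: cbounded_mul; last exact: cbounded_cst.
    by exists B => x Sx; rewrite normc_real (le_trans _ (hS x Sx))// coord_le_enorm.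
  exists C => x Sx; have := hC x Sx; rewrite [in X in _ -> X](Qp_lin x) coef_sum.
  by under [in X in _ -> X]eq_bigr do rewrite coefZ.
have [C hC] : cbounded S (fun x => \sum_(j < k.+1) (Qp x)`_j * H l (k - j) x).
  by apply: cbounded_sum => j; apply: cbounded_mul; [exact: Qb|exact: IH].
by exists C => x Sx; rewrite /H exprS coefM; exact: hC.
Qed.

Lemma asum_uclim (T : Type) (F : set_system T) {FF : Filter F} L (c : T -> nat -> nat -> R[i]) b :
  (forall l k, (l < L)%N -> (k <= 2 * l)%N -> clim F (fun t => c t l k) (b l k)) ->
  uclim F [set x | enorm x = 1] (fun t x => asum L (c t) x) (asum L b).
Proof.
move=> h; apply: uclim_sum => l; apply: uclim_sum => k.
apply: uclim_mul; [exact: cbounded_cst| |apply: uclim_scalar; apply: h => //|exact: uclim_const].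
- by apply: (@H_cbounded _ 1) => x /= ->.
- by rewrite -ltnS.
Qed.

Section Growth.
Variables (L : nat) (p : nat -> nat -> R -> R[i]) (psi : R -> R[i]) (b : nat -> nat -> R[i]).
Variables (f sigma : E -> R[i]) (K : set E) (r1 : R).
Hypothesis p_cvg : forall l k, (l < L)%N -> (k <= 2 * l)%N -> clim +oo (fun r => p l k r / psi r) (b l k).
Hypothesis psi_lower : forall r, r1 <= r -> r <= normc (psi r).
Hypothesis fE : forall x, x != 0 -> f x = hsum L p x.
Hypothesis K_compact : compact K.
Hypothesis sigma1 : forall x, ~ K x -> sigma x = 1.
Hypothesis fL2 : L2 (fun x => sigma x * f x).

(* Otherwise [f] is bounded away from 0 in a cone near infinity, which contains
   arbitrarily large boxes. *)
Lemma square_integrable_not_growing l k : (l < L)%N -> (k <= 2 * l)%N -> b l k = 0.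
Proof.
apply: H_indep => y y1; apply/eqP/negP => /negP A0.
pose a := normc (asum L b y) / 4.
have a0 : 0 < a by rewrite divr_gt0// normc_gt0.
have y0 := sphere_neq0 y1.
have dy : direction y = y by rewrite /direction y1 invr1 scale1r.
have ny : 0 < `|y| by rewrite normr_gt0.
have /climP/(_ a a0)/nbhs_normP[s0 /= s00 hs] := asum_direction L b y0.
(* Half of each tolerance: points of the box around [y] stay within [s0] of [y], and their norm is
   at least half that of [y]. *)
pose s := Num.min (s0 / 2) (`|y| / 2).
have s_gt0 : 0 < s by rewrite lt_min !divr_gt0.
have [M [Mr hM]] := asum_uclim p_cvg a0.
have [M1 [M1r hM1]] := compact_bounded K_compact.
pose r2 := Num.max (Num.max (`|M| + 1) (`|r1| + 1)) (`|M1| + 2).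
have far x : r2 <= `|x| -> normc (asum L b (direction x)) >= 2 * a -> a <= normc (sigma x * f x).
  rewrite !ge_max => /andP[/andP[xM xr] xM1] ax.
  have x0 : x != 0 by rewrite -normr_gt0 (lt_le_trans _ xr)// ltr_wpDl.
  have n0 := enorm_gt0 x0; have xn := norm_le_enorm x.
  have nr : r1 <= enorm x.
    by rewrite (le_trans _ xn)// (le_trans _ xr)// (le_trans (ler_norm _))// lerDl.
  have Mn : M < enorm x.
    by rewrite (lt_le_trans _ xn)// (lt_le_trans _ xM)// (le_lt_trans (ler_norm _))// ltrDl.
  rewrite sigma1 ?mul1r => [|Kx]; last first.
    have M11 : M1 < `|M1| + 1 by rewrite (le_lt_trans (ler_norm _))// ltrDl.
    by have := le_trans xM1 (hM1 _ M11 x Kx); rewrite lerD2l leNgt ltr1n.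
  rewrite fE// hsum_direction//; set w := direction x.
  have w1 : enorm w = 1 by exact: unit_scale.
  have := hM _ Mn w w1; set t := asum L _ w => ht.
  have pn := psi_lower nr.
  have psi0 : psi (enorm x) != 0 by rewrite -normc_gt0 (lt_le_trans n0).
  have -> : asum L (fun l k => p l k (enorm x)) w = psi (enorm x) * t.
    rewrite /t /asum mulr_sumr; apply: eq_bigr => l' _; rewrite mulr_sumr; apply: eq_bigr => k' _.
    by field.
  rewrite !normc_mul normc_real ger0_norm ?invr_ge0 ?(ltW n0)//.
  have at_ : a <= normc t.
    have := normc_sub (asum L b w) (asum L b w - t); rewrite subKr -/w => h.
    have h2 : normc (asum L b w - t) < a by rewrite -normc_opp opprB.
    have h3 : normc (asum L b w) <= normc t + normc (asum L b w - t).
      by rewrite (le_trans _ (normc_add _ _))// addrC subrK.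
    by move: ax h3 h2; rewrite -/w; lra.
  by rewrite (le_trans at_)// ler_pdivlMl// ler_wpM2r// normc_ge0.
have [B hB] := L2_box_bound fL2.
(* Dilation factor: at least 1, so that [T <= T ^+ 3]; large enough to push the box beyond [r2]; and
   large enough for its volume to contradict the bound [B]. *)
pose T := Num.max (Num.max 1 (2 * r2 / `|y|)) (`|B| / (a ^+ 2 * (2 * s) ^+ 3) + 1).
have T1 : 1 <= T by rewrite !le_max lexx.
have T0 : 0 < T by exact: lt_le_trans T1.
have hx : forall x, (forall i, `|x i 0 - (T *: y) i 0| <= T * s) -> a <= normc (sigma x * f x).
  move=> x hx; pose z := T^-1 *: x.
  have xz : x = T *: z by rewrite /z scalerA mulfV ?scale1r// gt_eqF.
  have zy : `|y - z| <= s.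
    rewrite [`|_|]mx_normrE; apply: bigmax_le => [|[i j] _ /=]; first exact: ltW.
    rewrite (ord1 j) !mxE; have := hx i; rewrite {1}xz !mxE -mulrBr normrM gtr0_norm//.
    by rewrite ler_pM2l// distrC.
  have zn : `|y| / 2 <= `|z|.
    have h1 : `|y| <= `|y - z| + `|z| by rewrite (le_trans _ (ler_normD _ _))// subrK.
    have h2 : s <= `|y| / 2 by rewrite ge_min lexx orbT.
    by move: h1 zy h2; lra.
  apply: far.
    rewrite xz normrZ gtr0_norm// (le_trans _ (ler_wpM2l (ltW T0) zn))//.
    have : 2 * r2 / `|y| <= T by rewrite /T !le_max lexx orbT.
    by rewrite ler_pdivrMr// => h; lra.
  have zs : `|y - z| < s0.
    by rewrite (le_lt_trans zy)// gt_min; apply/orP; left; rewrite ltr_pdivrMr// ltr_pMr// (ltr1n _ 2).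
  have := hs z zs; rewrite dy => h.
  have -> : direction x = direction z.
    rewrite /direction xz enorm_scale ?ltW// scalerA invfM mulrAC mulVf ?mul1r// gt_eqF//.
  have h3 : normc (asum L b y) <= normc (asum L b (direction z)) + normc (asum L b (direction z) - asum L b y).
    rewrite -[normc (_ - _)]normc_opp opprB (le_trans _ (normc_add _ _))// addrC subrK//.
  have aE : normc (asum L b y) = 4 * a by rewrite /a mulrC divfK.
  by move: h h3; rewrite aE; lra.
have := hB (T *: y) (T * s) a (mulr_gt0 T0 s_gt0) (ltW a0) hx.
apply/negP; rewrite -ltNge.
have as0 : 0 < a ^+ 2 * (2 * s) ^+ 3 by apply: mulr_gt0; apply: exprn_gt0 => //; apply: mulr_gt0.
have -> : a ^+ 2 * (2 * (T * s)) ^+ 3 = (a ^+ 2 * (2 * s) ^+ 3) * T ^+ 3 by ring.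
have BT : `|B| / (a ^+ 2 * (2 * s) ^+ 3) < T.
  by rewrite /T lt_max; apply/orP; right; rewrite ltrDl.
rewrite (le_lt_trans (ler_norm B))//; move: BT; rewrite ltr_pdivrMr// => BT.
rewrite (lt_le_trans BT)// mulrC ler_pM2l// -[leLHS]expr1 ler_weXn2l//.
Qed.

End Growth.
End SquareIntegrability.

(** * Elimination of the growing radial solutions *)

Section DecayingSolutions.
Context {R : realType}.
Variable gamma : R.
Hypothesis gamma_gt0 : 0 < gamma.
Notation E := 'cV[R]_3.
Implicit Types (f g : E -> R[i]) (x y v : E) (lam kappa : R[i]).

Definition dsol l lam kappa : R -> R[i] := (ladder gamma l lam (phi0 gamma kappa) (dphi0 gamma kappa)).1.
Definition ddsol l lam kappa : R -> R[i] := (ladder gamma l lam (phi0 gamma kappa) (dphi0 gamma kappa)).2.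

Lemma dsol_rsol l lam kappa : good gamma kappa -> kappa ^+ 2 = - lam ->
  rsol gamma l lam (dsol l lam kappa) (ddsol l lam kappa).
Proof.
move=> gk kl; apply: ladder_rsol; have := phi0_rsol gk.
by rewrite kl opprK.
Qed.

Lemma dsol_sing l lam kappa : good gamma kappa -> sing_at0 l (dsol l lam kappa) (ddsol l lam kappa).
Proof. by move=> gk; apply: ladder_sing; exact: phi0_sing. Qed.

Lemma ladder_factor_neq0 l lam : complex.Im lam != 0 -> ladder_factor gamma l lam != 0.
Proof.
move=> l0; apply/prodf_neq0 => j _; rewrite mulf_neq0 ?invr_eq0 ?expf_neq0 ?natC_neq0//.
apply: contra_neq l0 => h; have -> : lam = - (gamma%:C ^+ 2 / j.+1%:R ^+ 2) by apply/eqP; rewrite -addr_eq0 h.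
by rewrite -[j.+1%:R]rC_nat -!rC_X -rC_inv -rC_mul cImN /= oppr0.
Qed.

(** All orders are compared with the single function [psi], the growing solution for [l = 0]: the
    decaying solutions become negligible, and the growing ones keep nonzero limits because
    [kappa + gamma / n.+1] has positive real part. The limits of the coefficients of [f] are thus
    nonzero multiples of the numbers [B l k], to which [square_integrable_not_growing] applies. *)
Lemma Sol_infty_decaying lam kappa f : complex.Im lam != 0 ->
  good gamma kappa -> 0 < complex.Re kappa -> kappa ^+ 2 = - lam ->
  wr (phi0 gamma kappa) (dphi0 gamma kappa) (phi0 gamma (- kappa)) (dphi0 gamma (- kappa)) 1 != 0 ->
  Sol_infty gamma lam f ->
  exists (L : nat) (a : nat -> nat -> R[i]), forall x, x != 0 ->
    f x = hsum L (fun l k r => a l k * dsol l lam kappa r) x.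
Proof.
move=> l0 gk kR kl wk [[Kf ef] [sigma [[ssig s0 [K [cK sK]]] [fL2 _]]]].
have [L [p [dp [hp fE _]]]] := eigenfunction_radial Kf ef.
have gkN := good_opp gk.
have klN : (- kappa) ^+ 2 = - lam by rewrite sqrrN.
have rD l := dsol_rsol l gk kl; have rG l := dsol_rsol l gkN klN.
have wDG l : wr (dsol l lam kappa) (ddsol l lam kappa) (dsol l lam (- kappa)) (ddsol l lam (- kappa)) 1 != 0.
  rewrite /dsol /ddsol wr_ladder//; apply: mulf_neq0 => //; exact: ladder_factor_neq0.
pose A l k := wr (p l k) (dp l k) (dsol l lam (- kappa)) (ddsol l lam (- kappa)) 1
   / wr (dsol l lam kappa) (ddsol l lam kappa) (dsol l lam (- kappa)) (ddsol l lam (- kappa)) 1.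
pose B l k := wr (p l k) (dp l k) (dsol l lam kappa) (ddsol l lam kappa) 1
   / wr (dsol l lam kappa) (ddsol l lam kappa) (dsol l lam (- kappa)) (ddsol l lam (- kappa)) 1.
have pE l k r : 0 < r -> p l k r = A l k * dsol l lam kappa r - B l k * dsol l lam (- kappa) r.
  by move=> r0; apply: (rsol_basis (hp l k) (rD l) (rG l) (wDG l)).
pose psi := phi0 gamma (- kappa).
have [r1 r10 hr1] := phi0_growing gamma_gt0 gk kR wk 1.
have psi0 : \forall r \near +oo, psi r != 0.
  exists (Num.max 0 r1); split; first exact: num_real.
  move=> r /=; rewrite gt_max => /andP[r0 rr1]; rewrite -normc_gt0.
  by rewrite (lt_le_trans _ (hr1 r (ltW rr1)))// mul1r.
have k0 n : kappa + gamma%:C / n.+1%:R != 0.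
  apply/eqP => /(congr1 (@complex.Re R)); rewrite cReD -[n.+1%:R]rC_nat -rC_inv -rC_mul /=.
  by apply/eqP; rewrite gt_eqF// addr_gt0// divr_gt0.
have psi1 : clim +oo (fun r => phi0 gamma (- kappa) r / psi r) 1.
  by apply: (clim_near _ (clim_cst 1)); apply: filterS psi0 => r h; rewrite divff.
have hD l : clim +oo (fun r => dsol l lam kappa r / psi r) 0.
  have [c' [d' [h1 _ h2 _]]] := ladder_growth gamma lam (phi0_decay_ratio gamma_gt0 gk kR wk)
    (dphi0_decay_ratio gamma_gt0 gk kR wk) l.
  by have [c0 _] := h2 erefl erefl; rewrite -c0.
have hG l : exists c : R[i], c != 0 /\ clim +oo (fun r => dsol l lam (- kappa) r / psi r) c.
  have [c' [d' [h1 _ _ h2]]] := ladder_growth gamma lam psi1 (dphi0_growing_ratio gamma_gt0 gk kR wk) l.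
  by exists c'; split=> //; have [] := h2 kappa kl k0 (oner_neq0 _) (esym (mulr1 _)).
have [c hc] := choice hG.
have alg (a d b e s : R[i]) : a * (d / s) - b * (e / s) = (a * d - b * e) / s by ring.
have alg0 (a b : R[i]) : a * 0 - b = - b by ring.
have B0 l k : (l < L)%N -> (k <= 2 * l)%N -> B l k = 0.
  move=> lL kl2.
  suff : - (B l k * c l) = 0.
    have [c0 _] := hc l.
    by move/eqP; rewrite oppr_eq0 mulf_eq0 (negPf c0) orbF => /eqP.
  apply: (@square_integrable_not_growing R L p psi (fun l k => - (B l k * c l)) f sigma K r1) => //; last first.
    by move=> r rr; have := hr1 r rr; rewrite mul1r.
  move=> l' k' _ _; have [_ hc'] := hc l'.
  have h1 : clim +oo (fun r => A l' k' * (dsol l' lam kappa r / psi r) - B l' k' * (dsol l' lam (- kappa) r / psi r)) (A l' k' * 0 - B l' k' * c l').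
    by apply: clim_sub; apply: clim_mull.
  have e0 : A l' k' * 0 - B l' k' * c l' = - (B l' k' * c l') by exact: alg0.
  rewrite e0 in h1; apply: clim_near h1; exists 0; split; first exact: num_real.
  move=> r r0; rewrite (pE l' k' r r0); exact: alg.
exists L, A => x x0; rewrite fE//; apply: eq_bigr => l _; apply: eq_bigr => k _.
have kl2 : (k <= 2 * l)%N by rewrite -ltnS.
by congr (_ * _ * _); rewrite (pE l k _ (enorm_gt0 x0)) (B0 l k (ltn_ord l) kl2) mul0r subr0.
Qed.

End DecayingSolutions.

(** * Wronskians and the expansion of Kodaira families *)

Section HarmonicPolynomials.
Context {R : realType}.
Notation E := 'cV[R]_3.
Notation M := (mpoly.mpoly 3 R[i]).
Notation homog := (fun d => @mpoly.ishomog1 3 R[i] d mpoly.mdeg).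

Definition mvar (i : 'I_3) : M := @mpoly.mpolyX 3 R[i] (mpoly.mnm1 i).
Definition mcQ (i : 'I_3) : {poly M} := map_poly (@mpoly.mpolyC 3 R[i]) (Qp (delta_mx i 0 : E)).
(** [Qp] with indeterminate coordinates: the coefficients of its powers are the polynomials required
    by [spherical_harmonic]. *)
Definition mQ : {poly M} := \sum_(i < 3) mvar i *: mcQ i.

Definition pmd (i : 'I_3) (P D : {poly M}) : Prop := forall k : nat, mpoly.mderiv i P`_k = D`_k.

Lemma pmd_mul i P Q D D' : pmd i P D -> pmd i Q D' -> pmd i (P * Q) (D * Q + P * D').
Proof.
move=> hP hQ k; rewrite coefD !coefM raddf_sum -big_split; apply: eq_bigr => j _.
by rewrite /= mpoly.mderivM hP hQ.
Qed.

Lemma pmd_cst i j : pmd i (mcQ j) 0.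
Proof. by move=> k; rewrite coef0 /mcQ coef_map mpoly.mderivC. Qed.

Lemma mderiv_var i j : mpoly.mderiv i (mvar j) = (i == j)%:R.
Proof.
rewrite /mvar mpoly.mderivX mpoly.mnm1E; case: eqVneq => [->|ij].
  have -> : mpoly.mnm_sub (mpoly.mnm1 i) (mpoly.mnm1 i) = mpoly.mnm0.
    by apply/mpoly.mnmP => k; rewrite mpoly.mnmBE mpoly.mnm0E subnn.
  by rewrite scale1r mpoly.mpolyX0.
by rewrite scale0r.
Qed.

Lemma pmd_mQ i : pmd i mQ (mcQ i).
Proof.
move=> k; rewrite /mQ coef_sum raddf_sum /=.
rewrite (bigD1 i)//= coefZ mpoly.mderivM mderiv_var eqxx mul1r pmd_cst coef0 mulr0 addr0.
by rewrite big1 ?addr0// => j ji; rewrite coefZ mpoly.mderivM mderiv_var eq_sym (negPf ji) mul0r pmd_cst coef0 mulr0 addr0.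
Qed.

Lemma pmd_mQX i l : pmd i (mQ ^+ l) (l%:R *: (mcQ i * mQ ^+ l.-1)).
Proof.
elim: l => [|l IH] k.
  by rewrite expr0 coef1 scale0r coef0; case: k => [|k] /=; rewrite ?(mpoly.mderivC _ (1 : R[i])) ?raddf0.
rewrite exprS (pmd_mul (pmd_mQ i) IH); congr (_ `_ k).
rewrite -scalerAr mulrCA; case: l {IH} => [|l] /=; first by rewrite scale0r addr0 scale1r.
by rewrite -exprS -[l.+2%:R]natr1 scalerDl scale1r addrC.
Qed.

Lemma pmd_scale i (n : nat) P D : pmd i P D -> pmd i (n%:R *: P) (n%:R *: D).
Proof. by move=> h k; rewrite !coefZ !mulr_natl raddfMn /= h. Qed.

Lemma mQ_homog l k : (mQ ^+ l)`_k \is homog l.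
Proof.
have h1 j : mQ`_j \is homog 1%N.
  rewrite /mQ coef_sum; apply: rpred_sum => i _; rewrite coefZ /mcQ coef_map mulrC mpoly.mul_mpolyC.
  apply: rpredZ; have : mvar i \is homog 1%N by rewrite /mvar mpoly.dhomogX; apply/eqP; exact: mpoly.mdeg1.
  by [].
elim: l k => [|l IH] k.
  rewrite expr0 coef1; case: k => [|k]; [exact: mpoly.dhomog1|exact: mpoly.dhomog0].
by rewrite exprS coefM; apply: rpred_sum => j _; exact: (mpoly.dhomogM (h1 j) (IH (k - j)%N)).
Qed.

Lemma H_spherical_harmonic l k : spherical_harmonic l (@H R l k).
Proof.
exists (mQ ^+ l)`_k; split; first exact: mQ_homog.
- have h i : mpoly.mderiv i (mpoly.mderiv i (mQ ^+ l)`_k) = (l%:R *: (l.-1%:R *: (mcQ i * mcQ i * mQ ^+ l.-2)))`_k.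
    rewrite pmd_mQX (pmd_scale l (pmd_mul (pmd_cst i i) (pmd_mQX i l.-1))).
    by rewrite mul0r add0r -scalerAr mulrA.
  under eq_bigr do rewrite h.
  have -> : \sum_(i < 3) (l%:R *: (l.-1%:R *: (mcQ i * mcQ i * mQ ^+ l.-2)))`_k =
    (l%:R *: (l.-1%:R *: ((\sum_(i < 3) mcQ i * mcQ i) * mQ ^+ l.-2)))`_k.
    by rewrite mulr_suml !scaler_sumr coef_sum.
  have -> : \sum_(i < 3) mcQ i * mcQ i = 0.
    transitivity (map_poly (@mpoly.mpolyC 3 R[i]) (\sum_(i < 3) Qp (delta_mx i 0 : E) * Qp (delta_mx i 0 : E))).
      by rewrite rmorph_sum; apply: eq_bigr => i _; rewrite rmorphM.
    by rewrite isotropic_Qp rmorph0.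
  by rewrite mul0r !scaler0 coef0.
- move=> x _; set v := fun i => (x i 0)%:C.
  have Q k' : mpoly.meval v mQ`_k' = (Qp x)`_k'.
    rewrite (Qp_lin x) /mQ !coef_sum raddf_sum; apply: eq_bigr => i _.
    by rewrite !coefZ /= mpoly.mevalM mpoly.mevalXU /mcQ coef_map mpoly.mevalC.
  elim: l k => [|l IH] k.
    rewrite /H !expr0 !coef1; case: (k == 0%N); [by rewrite mpoly.meval1|by rewrite mpoly.meval0].
  rewrite /H exprS coefM exprS coefM raddf_sum; apply: eq_bigr => j _.
  by rewrite /= mpoly.mevalM Q -IH.
Qed.

End HarmonicPolynomials.

Section Wronskians.
Context {R : realType}.
Variable gamma : R.
Notation E := 'cV[R]_3.
Notation SI := sphere_integral.
Implicit Types (f g : E -> R[i]) (x y v : E) (lam kappa : R[i]).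

(** The Wronskian is constant, and the leading terms at 0 give it the limit (l + 1)/(2 l + 1) + l/(2
    l + 1). *)
Lemma wr_reg_sing l lam u du D dD : rsol gamma l lam u du -> rsol gamma l lam D dD ->
  reg_at0 l u du -> sing_at0 l D dD -> wr u du D dD 1 = 1.
Proof.
move=> ru rD [u1 u2] [D1 D2].
have c : clim 0^'+ (fun r : R => wr u du D dD r) 1.
  have h : clim 0^'+ (fun r : R => (du r / r%:C ^+ l) * (r%:C ^+ l * D r) - (u r / r%:C ^+ l.+1) * (r%:C ^+ l.+1 * dD r))
      (l.+1%:R * (2 * l + 1)%:R^-1 - 1 * (- (l%:R / (2 * l + 1)%:R))).
    by apply: clim_sub; apply: clim_mul.
  have e : l.+1%:R * (2 * l + 1)%:R^-1 - 1 * (- (l%:R / (2 * l + 1)%:R)) = 1 :> R[i].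
    rewrite mul1r opprK -mulrDl -natrD.
    have -> : (l.+1 + l = 2 * l + 1)%N by rewrite addn1 mul2n -addnn addSn.
    by rewrite divff// addn1 natC_neq0.
  rewrite e in h; apply: clim_near h.
  near=> r; have r0 : 0 < r by near: r; exact: nbhs_right_gt.
  have rl j : r%:C ^+ j != 0 by rewrite expf_neq0// rC_neq0.
  by rewrite /wr mulrA divfK// mulrA divfK.
have c1 : clim 0^'+ (fun r : R => wr u du D dD r) (wr u du D dD 1).
  apply: clim_near (clim_cst _); near=> r; have r0 : 0 < r by near: r; exact: nbhs_right_gt.
  exact: (wr_const ru rD ltr01 r0).
exact: clim_unique c1 c.
Unshelve. all: by end_near. Qed.

Lemma radial_cd f x d : cd (fun r : R^o => f (r *: x)) 1 1 d -> cd f x x d.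
Proof.
move=> /cd_line h; apply/cd_line.
rewrite (_ : (fun t : R^o => f (t *: x + x)) = (fun t : R^o => f ((t *: (1 : R^o) + 1) *: x)))//.
by apply/funext => t; rewrite scalerDl scale1r [t%:A]mulr1.
Qed.

Lemma wronskian_radial (phi psi P dP Q dQ : E -> R[i]) :
  (forall x, enorm x = 1 -> phi x = P x /\ cd phi x x (dP x)) ->
  (forall x, enorm x = 1 -> psi x = Q x /\ cd psi x x (dQ x)) ->
  wronskian phi psi = ((4 * pi)^-1)%:C * SI (fun x => dP x * Q x - P x * dQ x).
Proof.
move=> h1 h2; congr (_ * _); apply: SI_eq => x x1; rewrite !scale1r expr1n mul1r.
have [-> /cd_cderive ->] := h1 x x1; by have [-> /cd_cderive ->] := h2 x x1.
Qed.

Lemma hsum_radial L (p dp : nat -> nat -> R -> R[i]) f :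
  (forall l k, cd (p l k : R^o -> R[i]) 1 1 (dp l k 1)) -> (forall x, x != 0 -> f x = hsum L p x) ->
  forall x, enorm x = 1 -> f x = asum L (fun l k => p l k 1) x /\
    cd f x x (asum L (fun l k => dp l k 1 - p l k 1) x).
Proof.
move=> hp fE x x1; have x0 := sphere_neq0 x1.
have fr (r : R) : 0 < r -> f (r *: x) = asum L (fun l k => (r^-1)%:C * p l k r) x.
  move=> r0; have rx : r *: x != 0 by rewrite scaler_eq0 negb_or gt_eqF.
  rewrite fE// (hsum_ray L p r0 x1) /asum mulr_sumr; apply: eq_bigr => l _.
  by rewrite mulr_sumr; apply: eq_bigr => k _; rewrite mulrA.
split.
  have := fr 1 ltr01; rewrite scale1r => ->; apply: eq_bigr => l _; apply: eq_bigr => k _.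
  by rewrite invr1 mul1r.
apply: radial_cd; apply: (cd_Rpos ltr01 (fun r r0 => esym (fr r r0))).
apply: cd_sum => l _; apply: cd_sum => k _.
have h := cd_mull (H l k x) (cd_mul (inv_cd (ltr01 : 0 < (1 : R))) (hp l k)).
rewrite (_ : (fun y : R^o => _) = (fun y : R^o => H l k x * ((y^-1)%:C * p l k y))); last by apply/funext => y; rewrite mulrC.
by apply: cd_eq h _; rewrite invr1 expr1n mul1r mulN1r mulrC addrC.
Qed.

Lemma Fsol_radial l k lam (u du : R -> R[i]) : (forall r : R, 0 < r -> u r = r%:C * Freg gamma l lam r%:C) ->
  cd (u : R^o -> R[i]) 1 1 (du 1) ->
  forall x, enorm x = 1 -> Fsol gamma l lam (H l k) x = u 1 * H l k x /\
    cd (Fsol gamma l lam (H l k)) x x ((du 1 - u 1) * H l k x).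
Proof.
move=> uE ud x x1; have x0 := sphere_neq0 x1.
have fr (r : R) : 0 < r -> Fsol gamma l lam (H l k) (r *: x) = (r^-1)%:C * u r * H l k x.
  move=> r0; rewrite /Fsol enorm_scale ?(ltW r0)// x1 mulr1 scalerA mulVf ?gt_eqF// scale1r.
  by rewrite uE// mulrA -rC_mul mulVf ?gt_eqF// mul1r.
split; first by have := fr 1 ltr01; rewrite scale1r invr1 mul1r.
apply: radial_cd; apply: (cd_Rpos ltr01 (fun r r0 => esym (fr r r0))).
have h := cd_mull (H l k x) (cd_mul (inv_cd (ltr01 : 0 < (1 : R))) ud).
rewrite (_ : (fun y : R^o => _) = (fun y : R^o => H l k x * ((y^-1)%:C * u y))); last by apply/funext => y; rewrite mulrC.
by apply: cd_eq h _; rewrite invr1 expr1n mul1r mulN1r mulrC addrC.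
Qed.

Lemma SI_H_asum L b l k : (k <= 2 * l)%N -> SI (fun x => H l k x * asum L b x) =
  if (l < L)%N then b l (2 * l - k)%N * nH l k else 0.
Proof. exact: SI_H_sum. Qed.

Section AgainstRegular.
Variables (l k : nat) (lam : R[i]) (u du : R -> R[i]) (L : nat) (q dq : nat -> nat -> R -> R[i]) (f : E -> R[i]).
Hypothesis kl : (k <= 2 * l)%N.
Hypothesis uE : forall r : R, 0 < r -> u r = r%:C * Freg gamma l lam r%:C.
Hypothesis ud : cd (u : R^o -> R[i]) 1 1 (du 1).
Hypothesis qd : forall l k, cd (q l k : R^o -> R[i]) 1 1 (dq l k 1).
Hypothesis fE : forall x, x != 0 -> f x = hsum L q x.

Lemma wronskian_Fsol_hsum : wronskian (Fsol gamma l lam (H l k)) f =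
  ((4 * pi)^-1)%:C * (if (l < L)%N then wr u du (q l (2 * l - k)%N) (dq l (2 * l - k)%N) 1 * nH l k else 0).
Proof.
rewrite (wronskian_radial (Fsol_radial k uE ud) (hsum_radial qd fE)); congr (_ * _).
rewrite -(@SI_H_asum L (fun l' k' => wr u du (q l' k') (dq l' k') 1))//; apply: SI_eq => x _.
rewrite /asum !mulr_sumr -sumrB; apply: eq_bigr => l' _.
by rewrite !mulr_sumr -sumrB; apply: eq_bigr => k' _; rewrite /wr; ring.
Qed.

Lemma wronskian_hsum_Fsol : wronskian f (Fsol gamma l lam (H l k)) =
  ((4 * pi)^-1)%:C * (if (l < L)%N then - wr u du (q l (2 * l - k)%N) (dq l (2 * l - k)%N) 1 * nH l k else 0).
Proof.
rewrite (wronskian_radial (hsum_radial qd fE) (Fsol_radial k uE ud)); congr (_ * _).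
rewrite -(@SI_H_asum L (fun l' k' => - wr u du (q l' k') (dq l' k') 1))//; apply: SI_eq => x _.
rewrite /asum !mulr_sumr !mulr_suml -sumrB; apply: eq_bigr => l' _.
by rewrite !mulr_sumr !mulr_suml -sumrB; apply: eq_bigr => k' _; rewrite /wr; ring.
Qed.

End AgainstRegular.

Lemma wr_mulr (c : R[i]) u du D dD (r : R) :
  wr u du (fun s => c * D s) (fun s => c * dD s) r = c * wr u du D dD r.
Proof. by rewrite /wr; ring. Qed.

Section AgainstDecaying.
Variables (lam kappa : R[i]) (L : nat) (a : nat -> nat -> R[i]) (f : E -> R[i]).
Hypothesis gk : good gamma kappa.
Hypothesis kl : kappa ^+ 2 = - lam.
Hypothesis fE : forall x, x != 0 -> f x = hsum L (fun l k r => a l k * dsol gamma l lam kappa r) x.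

Let qd l k : cd (fun r : R^o => a l k * dsol gamma l lam kappa r) 1 1 (a l k * ddsol gamma l lam kappa 1).
Proof. by apply: cd_mull; have [] := dsol_rsol l gk kl ltr01. Qed.

Lemma wronskian_Fsol_decaying l k : (k <= 2 * l)%N ->
  wronskian (Fsol gamma l lam (H l k)) f =
  ((4 * pi)^-1)%:C * (if (l < L)%N then a l (2 * l - k)%N * nH l k else 0).
Proof.
move=> k2; have [du [ru u0]] := @Freg_rsol R gamma l lam.
have [ud _] := ru 1 ltr01.
rewrite (wronskian_Fsol_hsum k2 (fun _ _ => erefl) ud (dq := fun l k r => a l k * ddsol gamma l lam kappa r) qd fE).
by rewrite wr_mulr (wr_reg_sing ru (dsol_rsol l gk kl) u0 (dsol_sing l lam gk)) mulr1.
Qed.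

Lemma wronskian_decaying_Fsol l k : (k <= 2 * l)%N ->
  wronskian f (Fsol gamma l lam (H l k)) =
  ((4 * pi)^-1)%:C * (if (l < L)%N then - a l (2 * l - k)%N * nH l k else 0).
Proof.
move=> k2; have [du [ru u0]] := @Freg_rsol R gamma l lam.
have [ud _] := ru 1 ltr01.
rewrite (wronskian_hsum_Fsol k2 (fun _ _ => erefl) ud (dq := fun l k r => a l k * ddsol gamma l lam kappa r) qd fE).
by rewrite wr_mulr (wr_reg_sing ru (dsol_rsol l gk kl) u0 (dsol_sing l lam gk)) mulr1.
Qed.

End AgainstDecaying.
End Wronskians.

(** * Kodaira families have finitely many polynomial coefficients *)

Section KodairaExpansion.
Context {R : realType}.
Variable gamma : R.
Hypothesis gamma_gt0 : 0 < gamma.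
Notation E := 'cV[R]_3.
Notation SI := sphere_integral.
Implicit Types (x : E) (lam kappa : R[i]).

(** The conditions under which an element of [Sol_infty] is known to consist of the solutions
    [dsol]. They are verified close to the positive half-line, which is the region that boundary
    values see. *)
Definition admissible lam kappa : Prop :=
  [/\ complex.Im lam != 0, good gamma kappa, 0 < complex.Re kappa, kappa ^+ 2 = - lam &
   wr (phi0 gamma kappa) (dphi0 gamma kappa) (phi0 gamma (- kappa)) (dphi0 gamma (- kappa)) 1 != 0].

Lemma kpath_admissible (q s : R) : 0 < q -> s ^+ 2 = 1 ->
  \forall e \near 0^'+, admissible (q +i* (s * e)) (kpath q s e).
Proof.
move=> q0 s1; have s0 : s != 0 by apply: contra_eq_neq s1 => ->; rewrite expr0n eq_sym oner_eq0.
have k0 := kpath0_Im q0 s1; have kR (e : R) (h : 0 < e) : 0 < complex.Re (kpath q s e) by exact: kpath_Re.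
have g := good_near gamma (kpath_cvg s q0) erefl k0 kR.
have w := wr_phi0_neq0_near gamma_gt0 (kpath_cvg s q0) erefl k0 kR.
near=> e; have e0 : 0 < e by near: e; exact: nbhs_right_gt.
split.
- by rewrite /= mulf_neq0// gt_eqF.
- by near: e; exact: g.
- exact: kR.
- exact: kpath_sqr.
- by near: e; exact: w.
Unshelve. all: by end_near. Qed.

Lemma notin_SpecT lam : complex.Im lam != 0 -> ~ SpecT gamma lam.
Proof. by move=> l0 [[n [_ h]]|[t [_ h]]]; move: l0; rewrite h /= eqxx. Qed.

Lemma root_countable (P : {poly R[i]}) (lam : R -> R[i]) : P != 0 -> injective lam ->
  countable [set e | root P (lam e)].
Proof.
move=> P0 li; have [r hr] := closed_field_poly_normal P.
apply/countable_injP; exists (fun e => index (lam e) r) => e e' /set_mem/= re /set_mem/= re' eq_i; apply: li.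
have mem z : root P z -> z \in r.
  by rewrite hr rootZ ?lead_coef_eq0// root_prod_XsubC.
by rewrite -(nth_index 0 (mem _ re)) eq_i nth_index// mem.
Qed.

(* Countably many polynomials: their zeros cannot cover an interval. *)
Lemma generic_point (P : nat -> nat -> {poly R[i]}) (lam : R -> R[i]) (e0 : R) : injective lam -> 0 < e0 ->
  exists e : R, 0 < e < e0 /\ forall l k, root (P l k) (lam e) -> P l k = 0.
Proof.
move=> li e00; apply/not_existsP => h.
have : countable `]0, e0[%classic.
  pose D := [set p : nat * nat | P p.1 p.2 != 0].
  apply: (@sub_countable _ _ _ (\bigcup_(p in D) [set e | root (P p.1 p.2) (lam e)])).
    apply: subset_card_le => e /=; rewrite in_itv /= => he.
    have := h e => /not_andP[//|/existsNP[l /existsNP[k /not_implyP[re Pn]]]].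
    by exists (l, k) => //=; apply/eqP.
  apply: bigcup_countable => // p Dp; exact: root_countable.
move=> /countable_lebesgue_measure0; rewrite lebesgue_measure_itv /= lte_fin e00 oppr0 adde0.
by move=> h0; move: e00; rewrite -lte_fin h0 ltxx.
Qed.

Lemma regular_family l k : RegFam gamma (fun q => Fsol gamma l q.1 (H l k) q.2).
Proof.
exists 1%N, (fun=> 1), (fun=> fun q => (1%:P : {poly R[i]}).[q.1] * Fsol gamma l q.1 (H l k) q.2).
split=> [_|q _]; last by rewrite big_ord_recl big_ord0 addr0 hornerC !mul1r.
by exists l, (H l k), 1%:P; split=> //; exact: H_spherical_harmonic.
Qed.

Lemma pi4_neq0 : (4 * pi)%:C != 0 :> R[i].
Proof. by apply: rC_neq0; rewrite mulr_gt0// pi_gt0. Qed.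

Lemma generator_expansion (V : R[i] * E -> R[i]) :
  (forall lam, ~ SpecT gamma lam -> Sol_infty gamma lam (fiber V lam)) ->
  (forall F, RegFam gamma F -> exists p : {poly R[i]}, forall lam, ~ SpecT gamma lam ->
     wronskian (fiber F lam) (fiber V lam) = p.[lam]) ->
  exists (L : nat) (P : nat -> nat -> {poly R[i]}), forall lam kappa, admissible lam kappa ->
    forall x, x != 0 -> V (lam, x) = hsum L (fun l k r => (P l k).[lam] * dsol gamma l lam kappa r) x.
Proof.
move=> Vs Vw.
have /choice[P hP] : forall p : nat * nat, exists Q : {poly R[i]}, (p.2 <= 2 * p.1)%N ->
    forall lam, ~ SpecT gamma lam ->
    wronskian (Fsol gamma p.1 lam (H p.1 (2 * p.1 - p.2))) (fiber V lam) = Q.[lam].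
  move=> [l k]; case: (leqP k (2 * l)) => kl; last by exists 0.
  have [Q hQ] := Vw _ (regular_family l (2 * l - k)).
  by exists Q => _ lam hlam; rewrite -hQ.
pose Q l k := ((4 * pi)%:C / nH l (2 * l - k)) *: P (l, k).
have key lam kappa : admissible lam kappa -> exists (M : nat) (a : nat -> nat -> R[i]),
    (forall l k, (k <= 2 * l)%N -> (Q l k).[lam] = if (l < M)%N then a l k else 0) /\
    forall x, x != 0 -> V (lam, x) = hsum M (fun l k r => a l k * dsol gamma l lam kappa r) x.
  move=> [l0 gk kR kl wk]; have ls := notin_SpecT l0.
  have [M [a fE]] := Sol_infty_decaying gamma_gt0 l0 gk kR kl wk (Vs lam ls).
  exists M, a; split=> // l k k2.
  rewrite hornerZ -(hP (l, k) k2 lam ls) /=.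
  have k2' := leq_subr k (2 * l).
  rewrite (@wronskian_Fsol_decaying R gamma lam kappa M a (fiber V lam) gk kl fE l _ k2') subKn//.
  rewrite rC_inv; have n0 := @nH_neq0 R _ _ k2'; have := pi4_neq0; move: (4 * pi)%:C => c p0.
  by case: ifP => _; [field; rewrite n0 p0|rewrite !mulr0].
have e1 : (1 : R) ^+ 2 = 1 by rewrite expr1n.
(* A vertical segment above lambda = 1 provides uncountably many admissible points, among which a
   generic one is chosen. *)
have := @kpath_admissible 1 1 ltr01 e1; rewrite near_withinE => /nbhs_normP[e0 /= e00 he0].
have li : injective (fun e : R => 1 +i* (1 * e) : R[i]) by move=> e e' /(congr1 (@complex.Im R)) /=; rewrite !mul1r.
have [e [/andP[ep ee0] he]] := generic_point (fun l k => Q l (minn k (2 * l))) li e00.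
have adm : admissible (1 +i* (1 * e)) (kpath 1 1 e).
  by apply: he0 => //=; rewrite sub0r normrN gtr0_norm.
have [L [a [hL _]]] := key _ _ adm.
have Q0 l k : (L <= l)%N -> (k <= 2 * l)%N -> Q l k = 0.
  move=> Ll kl; have := he l k; rewrite (minn_idPl kl); apply.
  by rewrite /root hL// ltnNge Ll.
exists L, Q => lam kappa hadm x x0; have [M [b [hM ->]]] := key lam kappa hadm => //.
pose G (N : nat) := hsum N (fun l k r => (Q l k).[lam] * dsol gamma l lam kappa r) x.
have GM : hsum M (fun l k r => b l k * dsol gamma l lam kappa r) x = G M.
  apply: eq_bigr => l _; apply: eq_bigr => k _; congr (_ * _ * _ * _).
  by rewrite hM ?ltn_ord// -ltnS.
(* The number [M] of degrees present at [lam] may lie on either side of [L]. Summands are dropped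
   between them for different reasons: the polynomials vanish identically for [l >= L], and their
   values at [lam] vanish for [l >= M]. *)
have widen (N N' : nat) : (N <= N')%N -> (forall l k, (N <= l)%N -> (k <= 2 * l)%N -> (Q l k).[lam] = 0) -> G N' = G N.
  move=> NN hN; rewrite /G /hsum (big_ord_widen N' (fun l => \sum_(k < (2 * l).+1) (Q l k).[lam] * dsol gamma l lam kappa (enorm x) * ((enorm x)^-1)%:C ^+ l.+1 * H l k x) NN).
  rewrite [LHS](bigID (fun l : 'I_N' => (l < N)%N)) /= [X in _ + X]big1 ?addr0// => l.
  rewrite -leqNgt => Nl; rewrite big1// => k _; rewrite hN ?mul0r// -ltnS//.
rewrite GM; case: (leqP M L) => ML.
  apply/esym/widen => // l k Ml kl; by rewrite hM// ltnNge Ml.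
by apply: widen => [|l k Ll kl]; [exact: ltnW|rewrite Q0// horner0].
Qed.

Lemma Kodaira_expansion (V : R[i] * E -> R[i]) : Kodaira gamma V ->
  exists (L : nat) (P : nat -> nat -> {poly R[i]}), forall lam kappa, admissible lam kappa ->
    forall x, x != 0 -> V (lam, x) = hsum L (fun l k r => (P l k).[lam] * dsol gamma l lam kappa r) x.
Proof.
move=> [n [c [g [hg hV]]]].
have h i : exists LP : nat * (nat -> nat -> {poly R[i]}), forall lam kappa, admissible lam kappa ->
    forall x, x != 0 -> g i (lam, x) = hsum LP.1 (fun l k r => (LP.2 l k).[lam] * dsol gamma l lam kappa r) x.
  by have [L [P hP]] := generator_expansion (hg i).1 (hg i).2; exists (L, P).
have [LP hLP] := choice h.
pose L := (\max_(i < n) (LP i).1)%N.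
exists L, (fun l k => \sum_(i < n) (if (l < (LP i).1)%N then c i *: (LP i).2 l k else 0)) => lam kappa adm x x0.
have ls : ~ SpecT gamma lam by case: adm => l0 *; exact: notin_SpecT.
rewrite hV; last by split.
transitivity (\sum_(i < n) \sum_(l < L) \sum_(k < (2 * l).+1) (if (l < (LP i).1)%N then c i * ((LP i).2 l k).[lam] else 0) * dsol gamma l lam kappa (enorm x) * ((enorm x)^-1)%:C ^+ l.+1 * H l k x).
  apply: eq_bigr => i _; rewrite (hLP i lam kappa adm x x0) /hsum mulr_sumr.
  have iL : ((LP i).1 <= L)%N by exact: (leq_bigmax i).
  rewrite (big_ord_widen L (fun l => c i * \sum_(k < (2 * l).+1) ((LP i).2 l k).[lam] * dsol gamma l lam kappa (enorm x) * ((enorm x)^-1)%:C ^+ l.+1 * H l k x) iL) big_mkcond.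
  apply: eq_bigr => l _; case: ifP => lL; last by rewrite big1 // => k _; rewrite !mul0r.
  by rewrite mulr_sumr; apply: eq_bigr => k _; rewrite !mulrA.
rewrite exchange_big; apply: eq_bigr => l _; rewrite exchange_big; apply: eq_bigr => k _.
rewrite -!mulr_suml horner_sum; congr (_ * _ * _ * _); apply: eq_bigr => i _.
by case: ifP; rewrite ?horner0 ?hornerZ.
Qed.

End KodairaExpansion.

(** * Boundary values *)

Section ElementaryFamilies.
Context {R : realType}.
Variable gamma : R.
Hypothesis gamma_gt0 : 0 < gamma.
Notation E := 'cV[R]_3.
Notation family := (R[i] -> R[i] -> E -> R[i]).
Notation e_ i := (delta_mx i 0 : E).
Implicit Types (x y : E) (lam kappa : R[i]) (F G D : family).

(* Stable under partial derivatives when [kappa ^ 2 = - lam], because then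
   [phi0'' = (- lam - 2 gamma / r) phi0]; limits of all derivatives thus reduce to
   those of [phi0] and [dphi0]. *)
Inductive elementary : family -> Prop :=
| elementary_cst c : elementary (fun _ _ _ => c)
| elementary_lam : elementary (fun lam _ _ => lam)
| elementary_coord (i : 'I_3) : elementary (fun _ _ x => (x i 0)%:C)
| elementary_rho : elementary (fun _ _ x => ((enorm x)^-1)%:C)
| elementary_phi : elementary (fun _ kappa x => phi0 gamma kappa (enorm x))
| elementary_dphi : elementary (fun _ kappa x => dphi0 gamma kappa (enorm x))
| elementary_add F G : elementary F -> elementary G -> elementary (fun lam kappa x => F lam kappa x + G lam kappa x)
| elementary_mul F G : elementary F -> elementary G -> elementary (fun lam kappa x => F lam kappa x * G lam kappa x).

Lemma elementary_eq F G : elementary F -> (forall lam kappa x, F lam kappa x = G lam kappa x) -> elementary G.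
Proof. by move=> eF FG; have <- : F = G by apply/funext => a; apply/funext => b; apply/funext => x. Qed.

Lemma elementary_mull c F : elementary F -> elementary (fun lam kappa x => c * F lam kappa x).
Proof. by move=> eF; apply: elementary_mul => //; exact: elementary_cst. Qed.

Lemma elementary_opp F : elementary F -> elementary (fun lam kappa x => - F lam kappa x).
Proof. by move=> eF; apply: elementary_eq (elementary_mull (-1) eF) _ => lam kappa x; rewrite mulN1r. Qed.

Lemma elementary_sub F G : elementary F -> elementary G -> elementary (fun lam kappa x => F lam kappa x - G lam kappa x).
Proof. by move=> eF eG; apply: elementary_add => //; exact: elementary_opp. Qed.

Lemma elementary_exp F n : elementary F -> elementary (fun lam kappa x => F lam kappa x ^+ n).
Proof.
move=> eF; elim: n => [|n IH]; first by apply: elementary_eq (elementary_cst 1) _ => *; rewrite expr0.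
by apply: elementary_eq (elementary_mul eF IH) _ => *; rewrite exprS.
Qed.

Lemma elementary_sum (I : Type) (s : seq I) (F : I -> family) : (forall i, elementary (F i)) ->
  elementary (fun lam kappa x => \sum_(i <- s) F i lam kappa x).
Proof.
move=> h; elim: s => [|i s IH]; first by apply: elementary_eq (elementary_cst 0) _ => *; rewrite big_nil.
by apply: elementary_eq (elementary_add (h i) IH) _ => *; rewrite big_cons.
Qed.

Lemma elementary_horner (p : {poly R[i]}) : elementary (fun lam _ _ => p.[lam]).
Proof.
apply: (@elementary_eq (fun lam _ _ => \sum_(i < size p) p`_i * lam ^+ i)) => [|*]; last by rewrite horner_coef.
by apply: elementary_sum => i; apply: elementary_mull; apply: elementary_exp; exact: elementary_lam.
Qed.

Lemma elementary_H l k : elementary (fun _ _ x => H l k x).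
Proof.
elim: l k => [|l IH] k.
  by apply: elementary_eq (elementary_cst (1 : {poly R[i]})`_k) _ => *; rewrite /H expr0.
have eQ j : elementary (fun _ _ x => (Qp x)`_j).
  apply: (@elementary_eq (fun _ _ x => \sum_(i < 3) (Qp (e_ i))`_j * (x i 0)%:C)).
    by apply: elementary_sum => i; apply: elementary_mull; exact: elementary_coord.
  by move=> _ _ x; rewrite [in RHS](Qp_lin x) coef_sum; apply: eq_bigr => i _; rewrite coefZ mulrC.
apply: (@elementary_eq (fun _ _ x => \sum_(j < k.+1) (Qp x)`_j * H l (k - j) x)).
  by apply: elementary_sum => j; apply: elementary_mul; [exact: eQ|exact: IH].
by move=> _ _ x; rewrite /H exprS coefM.
Qed.

Lemma elementary_dsol l : elementary (fun lam kappa x => dsol gamma l lam kappa (enorm x)) /\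
  elementary (fun lam kappa x => ddsol gamma l lam kappa (enorm x)).
Proof.
elim: l => [|l [IH1 IH2]]; first by split; [exact: elementary_phi|exact: elementary_dphi].
have ew : elementary (fun _ _ x => up_weight gamma l (enorm x)).
  by apply: elementary_sub; [apply: elementary_mull; exact: elementary_rho|exact: elementary_cst].
have ep : elementary (fun lam _ x => l.+1%:R * ((enorm x)^-1)%:C ^+ 2 + potential gamma l lam (enorm x)).
  have er := elementary_rho; have er2 := elementary_exp 2 er.
  apply: elementary_add; first exact: elementary_mull.
  by apply: elementary_sub; [apply: elementary_sub; exact: elementary_mull|exact: elementary_lam].
split; apply: elementary_mull; apply: elementary_sub => //; exact: elementary_mul.
Qed.

Lemma elementary_hsum L (P : nat -> nat -> {poly R[i]}) :
  elementary (fun lam kappa x => hsum L (fun l k r => (P l k).[lam] * dsol gamma l lam kappa r) x).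
Proof.
apply: elementary_sum => l; apply: elementary_sum => k; apply: elementary_mul; last exact: elementary_H.
apply: elementary_mul; last by apply: elementary_exp; exact: elementary_rho.
by apply: elementary_mul; [exact: elementary_horner|have [] := elementary_dsol l].
Qed.

(** Unlike [admissible], this also holds at the imaginary boundary values of [kappa], so the same
    formulas give the derivatives before and at the limit. *)
Definition on_shell lam kappa : Prop := good gamma kappa /\ kappa ^+ 2 = - lam.

Lemma elementary_cd F (i : 'I_3) : elementary F -> exists2 D, elementary D &
  forall lam kappa x, on_shell lam kappa -> x != 0 -> cd (F lam kappa) x (e_ i) (D lam kappa x).
Proof.
have er1 : elementary (fun _ _ x => (x i 0)%:C * ((enorm x)^-1)%:C) by apply: elementary_mul; [exact: elementary_coord|exact: elementary_rho].
elim=> {F}.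
- by move=> c; exists (fun _ _ _ => 0) => [|*]; [exact: elementary_cst|exact: cd_cst].
- by exists (fun _ _ _ => 0) => [|*]; [exact: elementary_cst|exact: cd_cst].
- move=> j; exists (fun _ _ _ => ((e_ i) j 0)%:C) => [|lam kappa x _ _]; [exact: elementary_cst|exact: coord_cd].
- exists (fun _ _ x => - ((enorm x)^-1)%:C ^+ 3 * (x i 0)%:C) => [|lam kappa x _ x0].
    by apply: elementary_mul; [apply: elementary_opp; apply: elementary_exp; exact: elementary_rho|exact: elementary_coord].
  by apply: cd_eq (rho_cd _ x0) _; rewrite rd_e.
- exists (fun _ kappa x => dphi0 gamma kappa (enorm x) * ((x i 0)%:C * ((enorm x)^-1)%:C)) => [|lam kappa x [gk kl] x0].
    by apply: elementary_mul => //; exact: elementary_dphi.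
  have [h _] := phi0_rsol gk (enorm_gt0 x0).
  by apply: cd_eq (cd_real_comp h (enorm_is_derive (e_ i) x0)) _; rewrite rd_e rC_mul.
- exists (fun lam kappa x => (- (2 * gamma%:C * ((enorm x)^-1)%:C) - lam) * phi0 gamma kappa (enorm x) * ((x i 0)%:C * ((enorm x)^-1)%:C)) => [|lam kappa x [gk kl] x0].
    apply: elementary_mul => //; apply: elementary_mul; last exact: elementary_phi.
    by apply: elementary_sub; [apply: elementary_opp; apply: elementary_mull; exact: elementary_rho|exact: elementary_lam].
  have [_ h] := phi0_rsol gk (enorm_gt0 x0).
  apply: cd_eq (cd_real_comp h (enorm_is_derive (e_ i) x0)) _; rewrite rd_e rC_mul kl opprK /potential.
  by rewrite mul0r sub0r.
- move=> F G _ [D1 e1 h1] _ [D2 e2 h2]; exists (fun lam kappa x => D1 lam kappa x + D2 lam kappa x); first exact: elementary_add.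
  by move=> lam kappa x sh x0; apply: cd_add; [exact: h1|exact: h2].
- move=> F G eF [D1 e1 h1] eG [D2 e2 h2].
  exists (fun lam kappa x => D1 lam kappa x * G lam kappa x + F lam kappa x * D2 lam kappa x).
    by apply: elementary_add; exact: elementary_mul.
  by move=> lam kappa x sh x0; apply: cd_mul; [exact: h1|exact: h2].
Qed.

Lemma elementary_pderivs F (s : seq 'I_3) : elementary F -> exists2 D, elementary D &
  forall lam kappa f, on_shell lam kappa -> (forall x, x != 0 -> f x = F lam kappa x) ->
  forall x, x != 0 -> pderivs s f x = D lam kappa x.
Proof.
move=> eF; elim: s => [|i s [D eD hD]]; first by exists F.
have [D' eD' hD'] := elementary_cd i eD; exists D' => // lam kappa f sh fF x x0 /=.
apply: cd_cderive; apply: cd_near (hD' lam kappa x sh x0).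
by apply: filterS (near_neq0 x0) => y y0; rewrite (hD lam kappa f).
Qed.

Lemma radial_scont (u du : R -> R[i]) : (forall r, 0 < r -> cd (u : R^o -> R[i]) r 1 (du r)) ->
  scont (fun x => u (enorm x)).
Proof.
move=> h x x0; have [c1 c2] := cd_continuous (h _ (enorm_gt0 x0)).
by apply: ccat_comp; [exact: enorm_continuous|exact/ccat_ReIm].
Qed.

Lemma elementary_scont F lam kappa : elementary F -> on_shell lam kappa -> scont (F lam kappa).
Proof.
move=> eF [gk kl]; elim: eF.
- by move=> c; exact: scont_cst.
- exact: scont_cst.
- by move=> i x _; exact: coord_ccat.
- exact: rho_ccat.
- by apply: radial_scont => r r0; have [h _] := phi0_rsol gk r0; exact: h.
- by apply: radial_scont => r r0; have [_ h] := phi0_rsol gk r0; exact: h.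
- by move=> *; exact: scont_add.
- by move=> *; exact: scont_mul.
Qed.

Lemma elementary_smooth F lam kappa f : elementary F -> on_shell lam kappa ->
  (forall x, x != 0 -> f x = F lam kappa x) -> smooth_on R30 f.
Proof.
move=> eF sh fF s x x0; have [D eD hD] := elementary_pderivs s eF.
have near_eq : \forall y \near x, D lam kappa y = pderivs s f y.
  by apply: filterS (near_neq0 x0) => y y0; rewrite (hD lam kappa f).
have /ccat_ReIm[c1 c2] := ccat_near near_eq (elementary_scont eD sh x0).
split=> // i; have [D' eD' hD'] := elementary_cd i eD.
exact: cd_cderivable (cd_near near_eq (hD' lam kappa x sh x0)).
Qed.

Lemma compact_scont_cbounded (K : set E) (f : E -> R[i]) : compact K -> K `<=` R30 -> scont f -> cbounded K f.
Proof.
move=> cK K0 hf.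
have cf : {within K, continuous (fun x => normc (f x))}.
  by apply: continuous_in_subspaceT => x /set_mem Kx; exact: clim_normc (hf x (K0 x Kx)).
have [M [_ hM]] := compact_bounded (continuous_compact cf cK).
exists (`|M| + 1) => x Kx; rewrite (le_trans (ler_norm _))//; apply: (hM (`|M| + 1)); last by exists x.
by rewrite (le_lt_trans (ler_norm _))// ltrDl.
Qed.

Lemma compact_annulus (K : set E) : compact K -> K `<=` R30 ->
  exists a b : R, 0 < a /\ forall x, K x -> a <= enorm x <= b.
Proof.
move=> cK K0.
have [b hb] := compact_scont_cbounded cK K0 (fun x _ => ccat_real (@enorm_continuous R x)).
have [c hc] := compact_scont_cbounded cK K0 (@rho_ccat R).
exists ((`|c| + 1)^-1), b; split; first by rewrite invr_gt0 ltr_wpDl.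
move=> x Kx; have n0 := enorm_gt0 (K0 x Kx).
have := hb x Kx; have := hc x Kx; rewrite !normc_real normfV [`|enorm x|]ger0_norm ?(ltW n0)// => h1 ->.
rewrite andbT -[leRHS]invrK lef_pV2 ?posrE ?invr_gt0 ?ltr_wpDl//.
by rewrite (le_trans h1)// (le_trans (ler_norm _))// lerDl.
Qed.

Section Limit.
Variables (lam kap : R -> R[i]) (lam0 kap0 : R[i]).
Hypothesis lam_cvg : clim 0^'+ lam lam0.
Hypothesis kap_cvg : clim 0^'+ kap kap0.
Hypothesis kap0_Re : complex.Re kap0 = 0.
Hypothesis kap0_Im : complex.Im kap0 != 0.
Hypothesis kap_Re : forall e, 0 < e -> 0 < complex.Re (kap e).
Hypothesis shell0 : on_shell lam0 kap0.
Hypothesis shell : \forall e \near 0^'+, on_shell (lam e) (kap e).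

Lemma elementary_uclim F (K : set E) : elementary F -> compact K -> K `<=` R30 ->
  uclim 0^'+ K (fun e => F (lam e) (kap e)) (F lam0 kap0).
Proof.
move=> eF cK K0; have [a [b [a0 hab]]] := compact_annulus cK K0.
have [u1 u2] := phi0_limit gamma_gt0 kap_cvg kap0_Re kap0_Im kap_Re b a0.
have bnd G : elementary G -> cbounded K (G lam0 kap0).
  by move=> eG; apply: compact_scont_cbounded => //; exact: elementary_scont.
have rad (u : R -> R -> R[i]) u0 : uclim 0^'+ [set r | a <= r <= b] u u0 ->
    uclim 0^'+ K (fun e x => u e (enorm x)) (fun x => u0 (enorm x)).
  by move=> h e e0; apply: filterS (h e e0) => t ht x Kx; apply: ht; exact: hab.
elim: eF.
- by move=> c; exact: uclim_const.
- exact: uclim_scalar.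
- by move=> i; exact: uclim_const.
- exact: uclim_const.
- exact: rad u1.
- exact: rad u2.
- by move=> *; exact: uclim_add.
- by move=> *; apply: uclim_mul => //; exact: bnd.
Qed.

(** One elementary family [D] computes a given derivative both of the approximants and of the limit,
    so convergence of derivatives is again [elementary_uclim]. *)
Lemma elementary_cvg_smooth F (f : R -> E -> R[i]) : elementary F ->
  (\forall e \near 0^'+, forall x, x != 0 -> f e x = F (lam e) (kap e) x) ->
  cvg_smooth f (F lam0 kap0).
Proof.
move=> eF hf; split; first exact: (elementary_smooth eF shell0).
move=> s K cK K0 e e0; have [D eD hD] := elementary_pderivs s eF.
apply: filterS3 hf shell (elementary_uclim eD cK K0 e0) => t h1 h2 h3 x Kx.
by rewrite (hD (lam t) (kap t) (f t) h2 h1 x (K0 x Kx)) (hD lam0 kap0 _ shell0 (fun _ _ => erefl) x (K0 x Kx)) h3.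
Qed.

End Limit.
End ElementaryFamilies.

Lemma cvg_smooth_unique {R : realType} (f : R -> 'cV[R]_3 -> R[i]) g h :
  cvg_smooth f g -> cvg_smooth f h -> forall x, x != 0 -> g x = h x.
Proof.
move=> [_ hg] [_ hh] x x0.
have K0 : [set x] `<=` (R30 : set 'cV[R]_3) by move=> y /= ->.
have c k : (forall (s : seq 'I_3) (K : set 'cV[R]_3), compact K -> K `<=` R30 -> forall e : R, 0 < e ->
    \forall eps \near 0^'+, forall x, K x -> normc (pderivs s (f eps) x - pderivs s k x) < e) ->
    clim 0^'+ (fun e => f e x) (k x).
  move=> H; apply/climP => e e0; apply: filterS (H [::] _ (@compact_set1 _ x) K0 e e0) => t; exact.
exact: clim_unique (c g hg) (c h hh).
Qed.

Section BoundaryValues.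
Context {R : realType}.
Variable gamma : R.
Hypothesis gamma_gt0 : 0 < gamma.
Notation E := 'cV[R]_3.
Implicit Types (x : E) (lam kappa : R[i]).

Lemma sqrN1 : (-1 : R) ^+ 2 = 1. Proof. by rewrite sqrrN expr1n. Qed.

Definition boundary_kappa (q s : R) : R[i] := 0 +i* (- s * Num.sqrt q).

Lemma boundary_kappa_on_shell (q s : R) : 0 < q -> s ^+ 2 = 1 -> on_shell gamma q%:C (boundary_kappa q s).
Proof.
move=> q0 s1; have i0 := kpath0_Im q0 s1; split; last first.
  apply: Cext; rewrite expr2 ?cReM ?cImM /= ?mulr0 ?mul0r ?addr0 ?sub0r ?oppr0//.
  by rewrite mulrACA mulrNN -!expr2 s1 mul1r sqr_sqrtr// ltW.
split=> //; set b := boundary_kappa q s.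
have -> : gamma%:C / b = 0 +i* (- gamma / complex.Im b).
  have b0 : b != 0 by apply/eqP => h; move: i0; rewrite -/(boundary_kappa q s) -/b h eqxx.
  apply: (@mulIf _ b) => //; rewrite divfK//.
  rewrite /b /boundary_kappa; move: (- s * Num.sqrt q) i0 => t /= i0.
  by apply: Cext; rewrite ?cReM ?cImM /= ?mulr0 ?mul0r ?addr0// sub0r !mulNr opprK divfK.
by rewrite /= normr0 invr_ge0.
Qed.

Lemma lam_path_cvg (q s : R) : clim 0^'+ (fun e : R => q +i* (s * e)) q%:C.
Proof.
apply/clim_ReIm; split; first exact: cvg_cst.
have h : (fun e : R => s * e) @ 0^'+ --> s * 0.
  by apply: cvg_at_right_filter; exact: mulrl_continuous.
by rewrite mulr0 in h.
Qed.

Definition boundary_wr (q : R) : R[i] :=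
  wr (phi0 gamma (boundary_kappa q 1)) (dphi0 gamma (boundary_kappa q 1)) (phi0 gamma (boundary_kappa q (-1))) (dphi0 gamma (boundary_kappa q (-1))) 1.

Lemma boundary_wr_neq0 q : 0 < q -> boundary_wr q != 0.
Proof.
move=> q0; have e1 : (1 : R) ^+ 2 = 1 by rewrite expr1n.
have i0 := kpath0_Im q0 e1.
have -> : boundary_wr q = wr (phi0 gamma (boundary_kappa q 1)) (dphi0 gamma (boundary_kappa q 1)) (phi0 gamma (- boundary_kappa q 1)) (dphi0 gamma (- boundary_kappa q 1)) 1.
  by rewrite /boundary_wr; have -> : boundary_kappa q (-1) = - boundary_kappa q 1 by apply: Cext; rewrite /= ?oppr0// opprK mul1r mulN1r opprK.
exact: wr_phi0_imaginary_neq0.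
Qed.

(** Multiplied by the Wronskian of the two boundary solutions, the regular solution is their
    difference, since each of them has Wronskian 1 with it. *)
Lemma dsol_jump l (q r : R) : 0 < q -> 0 < r ->
  dsol gamma l q%:C (boundary_kappa q 1) r - dsol gamma l q%:C (boundary_kappa q (-1)) r =
  ladder_factor gamma l q%:C * boundary_wr q * (r%:C * Freg gamma l q%:C r%:C).
Proof.
move=> q0 r0; have [gp kp] := boundary_kappa_on_shell q0 (expr1n _ 2).
have [gm km] := boundary_kappa_on_shell q0 sqrN1.
have [du [ru u0]] := @Freg_rsol R gamma l q%:C.
have rp := dsol_rsol l gp kp; have rm := dsol_rsol l gm km.
set u := fun r : R => _ in ru u0.
have alg (a b c g h t w : R[i]) : t * w = a * g - b * h -> a = 1 -> b = 1 -> w = c -> g - h = c * t.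
  by move=> e ha hb <-; rewrite mulrC e ha hb !mul1r.
apply: (alg _ _ _ _ _ _ _ (wr_expand u du (dsol gamma l q%:C (boundary_kappa q 1)) (ddsol gamma l q%:C (boundary_kappa q 1))
  (dsol gamma l q%:C (boundary_kappa q (-1))) (ddsol gamma l q%:C (boundary_kappa q (-1))) r)).
- exact: etrans (wr_const ru rm r0 ltr01) (wr_reg_sing ru rm u0 (dsol_sing l _ gm)).
- exact: etrans (wr_const ru rp r0 ltr01) (wr_reg_sing ru rp u0 (dsol_sing l _ gp)).
- exact: etrans (wr_const rp rm r0 ltr01) (wr_ladder _ _ _ _ _ _ _ ltr01).
Qed.

Section Family.
Variables (V : R[i] * E -> R[i]) (L : nat) (P : nat -> nat -> {poly R[i]}).
Hypothesis VE : forall lam kappa, admissible gamma lam kappa -> forall x, x != 0 ->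
  V (lam, x) = hsum L (fun l k r => (P l k).[lam] * dsol gamma l lam kappa r) x.

Definition bval (q s : R) x : R[i] := hsum L (fun l k r => (P l k).[q%:C] * dsol gamma l q%:C (boundary_kappa q s) r) x.

Lemma boundary_cvg (q s : R) : 0 < q -> s ^+ 2 = 1 ->
  cvg_smooth (fun e => fiber V (q +i* (s * e))) (bval q s).
Proof.
move=> q0 s1; have adm := kpath_admissible gamma_gt0 q0 s1.
apply: (elementary_cvg_smooth gamma_gt0 (lam_path_cvg q s) (kpath_cvg s q0) erefl (kpath0_Im q0 s1)
  (fun e => @kpath_Re R q s q0 e) (boundary_kappa_on_shell q0 s1) _ (elementary_hsum gamma L P)).
  by apply: filterS adm => e [_ g _ k2 _]; split.
by apply: filterS adm => e ad x x0; rewrite /fiber (VE ad).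
Qed.

(** [upper_limit] is a choice among limits that need agree only off the origin, whence the
    restriction to [x != 0]. *)
Lemma upper_limitP (q : R) : 0 < q ->
  cvg_smooth (fun eps : R => fiber V (q +i* eps)) (upper_limit V q) /\
  forall x, x != 0 -> upper_limit V q x = bval q 1 x.
Proof.
move=> q0; have h := boundary_cvg q0 (expr1n _ 2).
have h1 : cvg_smooth (fun eps : R => fiber V (q +i* eps)) (bval q 1).
  by rewrite (_ : (fun eps => _) = (fun e => fiber V (q +i* (1 * e))))//; apply/funext => e; rewrite mul1r.
have h2 : cvg_smooth (fun eps : R => fiber V (q +i* eps)) (upper_limit V q).
  exact: (xgetPex (fun=> 0) (ex_intro (cvg_smooth _) _ h1)).
split=> //; exact: cvg_smooth_unique h2 h1.
Qed.

Lemma lower_limitP (q : R) : 0 < q ->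
  cvg_smooth (fun eps : R => fiber V (q -i* eps)) (lower_limit V q) /\
  forall x, x != 0 -> lower_limit V q x = bval q (-1) x.
Proof.
move=> q0; have h := boundary_cvg q0 sqrN1.
have h1 : cvg_smooth (fun eps : R => fiber V (q -i* eps)) (bval q (-1)).
  by rewrite (_ : (fun eps => _) = (fun e => fiber V (q +i* (-1 * e))))//; apply/funext => e; rewrite mulN1r.
have h2 : cvg_smooth (fun eps : R => fiber V (q -i* eps)) (lower_limit V q).
  exact: (xgetPex (fun=> 0) (ex_intro (cvg_smooth _) _ h1)).
split=> //; exact: cvg_smooth_unique h2 h1.
Qed.

Lemma bval_eigenfunction (q s : R) (f : R -> E -> R[i]) g : 0 < q -> s ^+ 2 = 1 -> cvg_smooth f g ->
  (forall x, x != 0 -> g x = bval q s x) -> eigenfunction gamma q%:C g.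
Proof.
move=> q0 s1 [sg _] gE; split=> // x x0; have [gk kk] := boundary_kappa_on_shell q0 s1.
apply: (@hsum_Top R gamma L q%:C _ (fun l k r => (P l k).[q%:C] * ddsol gamma l q%:C (boundary_kappa q s) r) g x _ gE x0).
by move=> l k; apply: rsol_mull; exact: dsol_rsol.
Qed.

Lemma bval_jump (q : R) x : 0 < q -> x != 0 -> bval q 1 x - bval q (-1) x =
  boundary_wr q * \sum_(l < L) \sum_(k < (2 * l).+1) (P l k).[q%:C] * ladder_factor gamma l q%:C * Fsol gamma l q%:C (H l k) x.
Proof.
move=> q0 x0; have n0 := enorm_gt0 x0.
have alg (a b c d e : R[i]) : a * b * d * e - a * c * d * e = a * (b - c) * d * e by ring.
rewrite /bval /hsum -sumrB mulr_sumr; apply: eq_bigr => l _; rewrite -sumrB mulr_sumr; apply: eq_bigr => k _.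
rewrite /Fsol H_scale.
transitivity ((P l k).[q%:C] * (dsol gamma l q%:C (boundary_kappa q 1) (enorm x) - dsol gamma l q%:C (boundary_kappa q (-1)) (enorm x)) *
   ((enorm x)^-1)%:C ^+ l.+1 * H l k x); first exact: alg.
rewrite dsol_jump// exprS rC_inv.
move: (enorm x)%:C (rC_neq0 n0) => c c0.
by field; rewrite ?expf_neq0.
Qed.

End Family.
End BoundaryValues.

(** * The K-invariant family and the function w *)

Section SphericalFamily.
Context {R : realType}.
Variable gamma : R.
Hypothesis gamma_gt0 : 0 < gamma.
Notation E := 'cV[R]_3.
Notation SI := sphere_integral.
Implicit Types (x : E) (lam kappa : R[i]).

Lemma H00 : H 0 0 = (fun=> 1) :> (E -> R[i]).
Proof. by apply/funext => x; rewrite /H expr0 coef1. Qed.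

Lemma nH00 : nH 0 0 = (4 * pi)%:C :> R[i].
Proof. by rewrite /nH /cQ !muln0 subnn !expr0 !bin0 !mulr1n !divr1 !mulr1. Qed.

(** A rotation by twice the angle [a] about the axis of [av t] multiplies the moment by cexp(i pi) =
    -1, while invariance leaves it unchanged. It therefore vanishes for every real [t], and so do
    its coefficients as a polynomial in [t]. *)
Lemma invariant_moment (f : E -> R[i]) (l k : nat) (r : R) : Kinvariant f -> scont f -> 0 < r -> (0 < l)%N ->
  (k <= 2 * l)%N -> SI (fun x => f (r *: x) * H l k x) = 0.
Proof.
move=> Kf sf r0 l0 kl.
have key (t : R) : SI (fun x => f (r *: x) * dot (av t%:C) x ^+ l) = 0.
  pose a : R := pi / (2 * l)%:R.
  pose A := axisrot t a ^+ 2.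
  have hA : SI (fun x => f (r *: (A^T *m x)) * dot (av t%:C) x ^+ l) =
    cexp (0 +i* a) ^+ (2 * l) * SI (fun x => f (r *: x) * dot (av t%:C) x ^+ l).
    exact: (SI_rotated t a 2 l r0 sf).
  have AO : A *m A^T = 1%:M by apply: orth_exp; exact: axisrot_orth.
  have dA : \det A = 1 by apply: det_orth_sqr; exact: axisrot_orth.
  have inv x : x != 0 -> f (A^T *m x) = f x.
    move=> x0; have BO : O3 A^T by rewrite /O3 /= trmxK; exact: mulmx1C.
    by rewrite -(Kf _ _ BO x0) /Kact det_tr dA invr1 scale1r.
  have c1 : cexp (0 +i* a) ^+ (2 * l) = -1 :> R[i].
    rewrite -cexpMn; have -> : (2 * l)%:R * (0 +i* a) = 0 +i* pi :> R[i].
      rewrite -[(2 * l)%:R]rC_nat; apply: Cext; rewrite ?cReM ?cImM /= ?mulr0 ?mul0r ?subr0 ?addr0//.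
      by rewrite /a mulrC divfK// pnatr_eq0 muln_eq0 /= -lt0n.
    by rewrite /cexp /= expR0 cospi sinpi mul1r; apply: Cext; rewrite /= ?oppr0.
  move: hA; rewrite c1 mulN1r.
  have -> : SI (fun x => f (r *: (A^T *m x)) * dot (av t%:C) x ^+ l) = SI (fun x => f (r *: x) * dot (av t%:C) x ^+ l).
    apply: SI_eq => x x1; rewrite scalemxAr inv// scaler_eq0 negb_or gt_eqF//=; exact: sphere_neq0.
  move/eqP; rewrite -addr_eq0 -mulr2n mulrn_eq0 /= => /eqP; exact.
pose c k := SI (fun x => f (r *: x) * H l k x).
pose p : {poly R[i]} := \poly_(k < (2 * l).+1) c k.
have p0 : p = 0.
  apply/eqP/negPn/negP => /nonroot_nat[m]; rewrite /root horner_poly.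
  have := key m%:R; rewrite SI_Qpow// rC_nat => ->; by rewrite eqxx.
by have := congr1 (fun q : {poly R[i]} => q`_k) p0; rewrite coef_poly coef0 ltnS kl.
Qed.

Lemma dsol_somewhere_neq0 l lam kappa : good gamma kappa -> exists2 r : R, 0 < r & dsol gamma l lam kappa r != 0.
Proof.
move=> gk; apply: contrapT => h.
have z (r : R) : 0 < r -> dsol gamma l lam kappa r = 0.
  by move=> r0; apply/eqP/negPn/negP => d0; apply: h; exists r.
have [c _] := dsol_sing l lam gk.
have c0 : clim 0^'+ (fun r : R => r%:C ^+ l * dsol gamma l lam kappa r) 0.
  apply: clim_near (clim_cst 0); near=> r; rewrite z ?mulr0//; near: r; exact: nbhs_right_gt.
have e : (2 * l + 1)%:R^-1 = 0 :> R[i] by exact: clim_unique c c0.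
by move/eqP: e; rewrite invr_eq0 addn1; apply/negP; exact: natC_neq0.
Unshelve. all: by end_near. Qed.

(** The sign arises because [is_V0] has the singular solution in the first slot of the Wronskian,
    while [wr_reg_sing] has the regular one there. Invariance removes the degrees [l > 0] through
    [invariant_moment], as [dsol l] is not identically zero. *)
Lemma V0_expansion (V : R[i] * E -> R[i]) : is_V0 gamma V -> forall lam kappa, admissible gamma lam kappa ->
  forall x, x != 0 -> V (lam, x) = hsum 1 (fun l k r => ((-1)%:P : {poly R[i]}).[lam] * dsol gamma l lam kappa r) x.
Proof.
move=> [VK Vinv Vw] lam kappa adm; have [L [P VE]] := Kodaira_expansion gamma_gt0 VK.
have fE := VE lam kappa adm; have [l0 gk _ kk _] := adm; have ls := @notin_SpecT R gamma lam l0.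
pose a l k := (P l k).[lam].
have sf : scont (fiber V lam).
  have [L' [P' VE']] : exists L P, forall x, x != 0 -> fiber V lam x = hsum L (fun l k r => (P l k).[lam] * dsol gamma l lam kappa r) x by exists L, P.
  exact: smooth_scont (elementary_smooth (elementary_hsum gamma L' P') (conj gk kk) VE').
have fr (r : R) x : 0 < r -> enorm x = 1 -> fiber V lam (r *: x) = (r^-1)%:C * asum L (fun l k => a l k * dsol gamma l lam kappa r) x.
  move=> r0 x1; have rx : r *: x != 0 by rewrite scaler_eq0 negb_or gt_eqF//=; exact: sphere_neq0.
  by rewrite -(hsum_ray L (fun l k s => a l k * dsol gamma l lam kappa s) r0 x1) -(fE _ rx).
have a0 l k : (0 < l)%N -> (l < L)%N -> (k <= 2 * l)%N -> a l k = 0.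
  move=> lp lL kl; have [r r0 d0] := dsol_somewhere_neq0 l lam gk.
  have kl' := leq_subr k (2 * l).
  have := invariant_moment (Vinv lam ls) sf r0 lp kl'.
  have -> : SI (fun x => fiber V lam (r *: x) * H l (2 * l - k) x) =
    (r^-1)%:C * SI (fun x => H l (2 * l - k) x * asum L (fun l k => a l k * dsol gamma l lam kappa r) x).
    rewrite -SI_mull.
      by apply: SI_eq => x x1; rewrite fr//; ring.
    apply: scont_mul; first exact: scont_H.
    by apply: scont_sum => l'; apply: scont_sum => k'; apply: scont_mull; exact: scont_H.
  rewrite SI_H_asum// lL subKn//.
  have cancel (u b c d : R[i]) : b != 0 -> c != 0 -> d != 0 -> d * (u * b * c) = 0 -> u = 0.
    by move=> b0 c0 d0' /eqP; rewrite !mulf_eq0 (negPf b0) (negPf c0) (negPf d0') /= !orbF => /eqP.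
  apply: cancel => //; first exact: nH_neq0.
  by rewrite rC_inv invr_eq0 rC_neq0.
have := Vw lam ls; rewrite -H00 (wronskian_decaying_Fsol gk kk fE (k := 0) (l := 0))// subn0 muln0 nH00.
have pi0 := @pi4_neq0 R.
case: (L) fE a0 => [|M] fE a0 /=; first by rewrite mulr0 => /esym/eqP; rewrite oner_eq0.
rewrite rC_inv mulrCA mulVf// mulr1 => h x x0.
rewrite fE// /hsum !big_ord_recl big_ord0 addr0 [X in _ + X]big1 ?addr0 => [|l _]; last first.
  rewrite big1// => k _; have := a0 (lift ord0 l) k; rewrite /a => -> //; rewrite ?mul0r//.
  by rewrite -ltnS.
congr (_ + _); last by apply: eq_bigr => j _; have := ltn_ord j; rewrite [X in (_ < X)%N]muln0.
by congr (_ * _ * _ * _); rewrite hornerC -h opprK.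
Qed.

(** The two minus signs of [V0_expansion] cancel, and the derivatives of the factors [1 / r] drop
    out of the antisymmetric combination. *)
Lemma wfunE (V : R[i] * E -> R[i]) (q : R) : is_V0 gamma V -> 0 < q -> wfun V q = boundary_wr gamma q.
Proof.
move=> V0 q0; have VE := V0_expansion V0.
have [_ up] := upper_limitP gamma_gt0 (P := fun _ _ => (-1)%:P) VE q0.
have [_ lo] := lower_limitP gamma_gt0 (P := fun _ _ => (-1)%:P) VE q0.
have [gp kp] := boundary_kappa_on_shell gamma q0 (expr1n _ 2); have [gm km] := boundary_kappa_on_shell gamma q0 (@sqrN1 R).
have cdq (kappa : R[i]) l (k : nat) : good gamma kappa -> kappa ^+ 2 = - q%:C ->
   cd (fun r : R^o => ((-1)%:P : {poly R[i]}).[q%:C] * dsol gamma l q%:C kappa r) 1 1 (- ddsol gamma l q%:C kappa 1).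
  move=> g kk; have [h _] := dsol_rsol l g kk ltr01.
  by apply: cd_eq (cd_mull _ h) _; rewrite hornerC mulN1r.
rewrite /wfun (wronskian_radial
   (hsum_radial (dp := fun l k r => - ddsol gamma l q%:C (boundary_kappa q 1) r) (fun l k => cdq (boundary_kappa q 1) l k gp kp) up)
   (hsum_radial (dp := fun l k r => - ddsol gamma l q%:C (boundary_kappa q (-1)) r) (fun l k => cdq (boundary_kappa q (-1)) l k gm km) lo)).
have a1 (c : nat -> nat -> R[i]) x : asum 1 c x = c 0%N 0%N.
  by rewrite /asum big_ord_recl big_ord0 addr0 muln0 big_ord_recl big_ord0 addr0 H00 mulr1.
have alg (d d' e e' : R[i]) : (- d' - -1 * d) * (-1 * e) - (-1 * d) * (- e' - -1 * e) = (d' * e - d * e') * 1 by ring.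
transitivity (((4 * pi)^-1)%:C * SI (fun _ : E => boundary_wr gamma q * 1)).
  have wE : boundary_wr gamma q = ddsol gamma 0 q%:C (boundary_kappa q 1) 1 * dsol gamma 0 q%:C (boundary_kappa q (-1)) 1
      - dsol gamma 0 q%:C (boundary_kappa q 1) 1 * ddsol gamma 0 q%:C (boundary_kappa q (-1)) 1 by [].
  rewrite wE; congr (_ * _); apply: SI_eq => x _.
  apply: (etrans (congr2 (fun u v : R[i] => u - v) (congr2 *%R (a1 _ x) (a1 _ x)) (congr2 *%R (a1 _ x) (a1 _ x)))).
  rewrite !hornerC.
  exact: alg.
rewrite SI_mull; last exact: scont_cst.
by rewrite SI_1 rC_inv mulrCA mulVf ?mulr1// pi4_neq0.
Qed.

End SphericalFamily.

Section Spans.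
Context {R : realType} {X : Type}.
Variables (D : set X) (G : set (X -> R[i])).

Lemma span_on_gen g : G g -> span_on D G g.
Proof. by move=> Gg; exists 1%N, (fun=> 1), (fun=> g); split=> // x _; rewrite big_ord1 mul1r. Qed.

Lemma span_on_add f g : span_on D G f -> span_on D G g -> span_on D G (fun x => f x + g x).
Proof.
move=> [n [c [u [hu fE]]]] [m [d [v [hv gE]]]].
exists (n + m)%N, (fun i => match fintype.split i with inl j => c j | inr j => d j end),
  (fun i => match fintype.split i with inl j => u j | inr j => v j end).
split=> [i|x Dx]; first by case: (fintype.split i).
rewrite fE// gE// big_split_ord; congr (_ + _); apply: eq_bigr => i _ /=.
- by case: splitP => j /= h; [have -> : i = j by apply: val_inj|move: (ltn_ord i); rewrite h ltnNge leq_addr].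
- case: splitP => j /= h; first by move: (ltn_ord j); rewrite -h ltnNge leq_addr.
  by have -> : i = j by apply/val_inj/eqP; rewrite -(eqn_add2l n) h.
Qed.

Lemma span_on_mull a f : span_on D G f -> span_on D G (fun x => a * f x).
Proof.
move=> [n [c [u [hu fE]]]]; exists n, (fun i => a * c i), u; split=> // x Dx.
by rewrite fE// mulr_sumr; apply: eq_bigr => i _; rewrite mulrA.
Qed.

Lemma span_on_sum (I : Type) (s : seq I) (F : I -> X -> R[i]) : (forall i, span_on D G (F i)) ->
  span_on D G (fun x => \sum_(i <- s) F i x).
Proof.
move=> h; elim: s => [|i s IH].
  by exists 0%N, (fun=> 0), (fun _ _ => 0); split=> [[]//|x _]; rewrite big_nil big_ord0.
have [n [c [u [hu fE]]]] := span_on_add (h i) IH.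
by exists n, c, u; split=> // x Dx; rewrite big_cons fE.
Qed.

Lemma span_on_eq f g : span_on D G f -> (forall x, D x -> f x = g x) -> span_on D G g.
Proof. by move=> [n [c [u [hu fE]]]] fg; exists n, c, u; split=> // x Dx; rewrite -fg// fE. Qed.

End Spans.

(** * A regular family is determined by its values at positive lambda *)

Section RegularFamilies.
Context {R : realType}.
Variable gamma : R.
Notation E := 'cV[R]_3.
Implicit Types (x : E) (lam : R[i]).

Lemma Freg_at0 l lam : clim 0^'+ (fun r : R => Freg gamma l lam r%:C / r%:C ^+ l) 1.
Proof.
have [du [_ [h _]]] := @Freg_rsol R gamma l lam; apply: clim_near h.
near=> r; have r0 : r%:C != 0 :> R[i] by apply: rC_neq0; near: r; exact: nbhs_right_gt.
by move: (Freg _ _ _ _) => f; rewrite exprS; field; rewrite r0 expf_neq0.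
Unshelve. all: by end_near. Qed.

(** The summands have different orders at 0: dividing by the lowest remaining power [r ^ l] and
    letting [r] tend to 0 isolates [c l]. *)
Lemma Freg_indep L lam (c : nat -> R[i]) :
  (forall r : R, 0 < r -> \sum_(l < L) Freg gamma l lam r%:C * c l = 0) ->
  forall l, (l < L)%N -> c l = 0.
Proof.
move=> h l; elim/ltn_ind: l => l IH lL.
pose g (j : 'I_L) (r : R) : R[i] := if (l <= j)%N then (Freg gamma j lam r%:C / r%:C ^+ j * r%:C ^+ (j - l)) * c j else 0.
have hg : clim 0^'+ (fun r => \sum_(j < L) g j r) (\sum_(j < L) (if l == j then c l else 0)).
  apply: clim_sum => j; rewrite /g; case: ltngtP => lj; last 1 first.
  - rewrite -lj subnn -[X in clim _ _ X]mul1r; apply: clim_mul; last exact: clim_cst.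
    rewrite (_ : (fun r : R => _) = (fun r : R => Freg gamma l lam r%:C / r%:C ^+ l)); first exact: Freg_at0.
    by apply/funext => r; rewrite expr0 mulr1.
  - rewrite -[X in clim _ _ X](mul0r (c j)); apply: clim_mul; last exact: clim_cst.
    rewrite -(mulr0 1); apply: clim_mul; first exact: Freg_at0.
    have -> : (j - l = (j - l).-1.+1)%N by rewrite prednK// subn_gt0.
    elim: (j - l).-1 => [|n IHn]; first by under eq_fun do rewrite expr1; exact: clim_r0.
    by under eq_fun do rewrite exprS; rewrite -(mulr0 0); apply: clim_mul => //; exact: clim_r0.
  - exact: clim_cst.
have hg0 : clim 0^'+ (fun r => \sum_(j < L) g j r) 0.
  apply: clim_near (clim_cst 0); near=> r; have r0 : 0 < r by near: r; exact: nbhs_right_gt.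
  have rn := rC_neq0 r0.
  transitivity ((r%:C ^+ l)^-1 * \sum_(j < L) Freg gamma j lam r%:C * c j); first by rewrite h// mulr0.
  rewrite mulr_sumr; apply: eq_bigr => j _; rewrite /g; case: leqP => lj; last by rewrite IH// ?mulr0.
  have -> : r%:C ^+ j = r%:C ^+ (j - l) * r%:C ^+ l by rewrite -exprD subnK.
  by move: (Freg _ _ _ _) => f; field; rewrite !expf_neq0.
have : \sum_(j < L) (if l == j then c l else 0) = 0 by exact: clim_unique hg hg0.
rewrite (bigD1 (Ordinal lL))//= eqxx big1 ?addr0// => j jl.
by rewrite ifF//; apply/negbTE; apply: contra jl => /eqP e; apply/eqP/val_inj.
Unshelve. all: by end_near. Qed.

Lemma poly_eq0_pos (p : {poly R[i]}) : (forall q : R, 0 < q -> p.[q%:C] = 0) -> p = 0.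
Proof.
move=> h; apply/eqP/negPn/negP => p0.
(* The factor ['X] excludes 0 from the integers that [nonroot_nat] may return, leaving a positive
   one. *)
have : p * 'X != 0 by rewrite mulf_neq0// polyX_eq0.
move=> /nonroot_nat[m]; rewrite /root hornerMX mulf_eq0 negb_or => /andP[/eqP pm m0]; apply: pm.
by rewrite -rC_nat h// ltr0n lt0n; apply: contra m0 => /eqP ->.
Qed.

(** The harmonics occurring in a member of [RegFam] are arbitrary and possibly dependent. Fixing the
    direction of [x] and grouping by degree leaves polynomials in lambda as coefficients of the
    [Freg]; they vanish by [Freg_indep] and [poly_eq0_pos]. *)
Lemma RegFam_eq0 (D : R[i] * E -> R[i]) : RegFam gamma D ->
  (forall (q : R) x, 0 < q -> x != 0 -> D (q%:C, x) = 0) -> forall lam x, x != 0 -> D (lam, x) = 0.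
Proof.
move=> [n [c [g [hg DE]]]] h.
have /choice[d hd] : forall i, exists d : nat * (E -> R[i]) * {poly R[i]}, g i = fun q => d.2.[q.1] * Fsol gamma d.1.1 q.1 d.1.2 q.2.
  by move=> i; have [l [Y [p [_ ->]]]] := hg i; exists (l, Y, p).
pose L := (\max_(i < n) (d i).1.1).+1.
pose S (l : nat) x : {poly R[i]} := \sum_(i < n | (d i).1.1 == l) (c i * (d i).1.2 (direction x)) *: (d i).2.
have key lam x : x != 0 -> D (lam, x) = \sum_(l < L) Freg gamma l lam (enorm x)%:C * (S l x).[lam].
  move=> x0; rewrite DE; last by split.
  have iL i : ((d i).1.1 < L)%N by rewrite ltnS; exact: (leq_bigmax i).
  rewrite (partition_big (fun i => Ordinal (iL i)) xpredT)//=; apply: eq_bigr => l _.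
  rewrite /S horner_sum mulr_sumr; apply: eq_big => [i|i /eqP <-]; first by rewrite -val_eqE.
  by rewrite hd hornerZ /Fsol /direction /=; ring.
have S0 l x : (l < L)%N -> x != 0 -> S l x = 0.
  move=> lL x0; apply: poly_eq0_pos => q q0.
  apply: (@Freg_indep L q%:C (fun l => (S l x).[q%:C])) => // r r0.
  have n0 := enorm_gt0 x0; pose y := (r / enorm x) *: x.
  have c0 : 0 < r / enorm x by rewrite divr_gt0.
  have y0 : y != 0 by rewrite scaler_eq0 negb_or gt_eqF.
  have ny : enorm y = r by rewrite enorm_scale ?(ltW c0)// divfK// gt_eqF.
  have dy : direction y = direction x.
    by rewrite /direction ny /y scalerA mulrA mulVf ?mul1r// gt_eqF.
  have := h q y q0 y0; rewrite key// ny => e; rewrite -[RHS]e; apply: eq_bigr => l' _.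
  by rewrite /S dy.
by move=> lam x x0; rewrite key// big1// => l _; rewrite S0// horner0 mulr0.
Qed.

Definition ladder_poly (l : nat) : {poly R[i]} :=
  \prod_(j < l) (((2 * j + 3)%:R ^+ 2)^-1 *: ('X + (gamma%:C ^+ 2 / j.+1%:R ^+ 2)%:P)).

Lemma ladder_polyE l lam : (ladder_poly l).[lam] = ladder_factor gamma l lam.
Proof.
rewrite /ladder_poly horner_prod; apply: eq_bigr => j _.
by rewrite hornerZ hornerD hornerX hornerC mulrC.
Qed.

End RegularFamilies.

Theorem theorem8p3p10 (R : realType) (gamma : R) (gamma_gt0 : 0 < gamma)
    (V : R[i] * 'cV[R]_3 -> R[i]) (VP : Kodaira gamma V) :
  (forall lam : R, 0 < lam ->
     [/\ cvg_smooth (fun eps : R => fiber V (lam +i* eps)) (upper_limit V lam),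
         cvg_smooth (fun eps : R => fiber V (lam -i* eps)) (lower_limit V lam),
         eigenfunction gamma lam%:C (upper_limit V lam),
         eigenfunction gamma lam%:C (lower_limit V lam) &
         RegSol gamma lam%:C (fun x => upper_limit V lam x - lower_limit V lam x)]) /\
  (forall V0 : R[i] * 'cV[R]_3 -> R[i], is_V0 gamma V0 ->
   exists F : R[i] * 'cV[R]_3 -> R[i],
     [/\ RegFam gamma F,
         (forall (lam : R) (x : 'cV[R]_3), 0 < lam -> R30 x ->
            upper_limit V lam x - lower_limit V lam x = wfun V0 lam * F (lam%:C, x)) &
         (forall G : R[i] * 'cV[R]_3 -> R[i], RegFam gamma G ->
            (forall (lam : R) (x : 'cV[R]_3), 0 < lam -> R30 x ->
               upper_limit V lam x - lower_limit V lam x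
               = wfun V0 lam * G (lam%:C, x)) ->
            forall (lam : R[i]) (x : 'cV[R]_3), R30 x -> G (lam, x) = F (lam, x))]).
Proof.
have [L [P VE]] := Kodaira_expansion gamma_gt0 VP.
have up lam (l0 : 0 < lam) := upper_limitP gamma_gt0 VE l0.
have lo lam (l0 : 0 < lam) := lower_limitP gamma_gt0 VE l0.
have jump lam x (l0 : 0 < lam) (x0 : x != 0) : upper_limit V lam x - lower_limit V lam x =
    boundary_wr gamma lam * \sum_(l < L) \sum_(k < (2 * l).+1) (P l k).[lam%:C] * ladder_factor gamma l lam%:C * Fsol gamma l lam%:C (H l k) x.
  by rewrite (up lam l0).2// (lo lam l0).2//; exact: bval_jump.
split=> [lam l0|V0 hV0].
  have [u1 u2] := up lam l0; have [d1 d2] := lo lam l0; split=> //.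
  - exact: (bval_eigenfunction l0 (expr1n _ 2) u1 u2).
  - exact: (bval_eigenfunction l0 (@sqrN1 R) d1 d2).
  - apply: (@span_on_eq _ _ _ _ (fun x => boundary_wr gamma lam * \sum_(l < L) \sum_(k < (2 * l).+1) (P l k).[lam%:C] * ladder_factor gamma l lam%:C * Fsol gamma l lam%:C (H l k) x)) => [|x x0]; last by rewrite jump.
    apply: span_on_mull; apply: span_on_sum => l; apply: span_on_sum => k; apply: span_on_mull.
    by apply: span_on_gen; exists l, (H l k); split=> //; exact: H_spherical_harmonic.
(* The jump of [dsol l] carries [boundary_wr], common to all degrees, and [ladder_factor], a
   polynomial in lambda; absorbing the latter into the coefficients places the quotient in
   [RegFam]. *)
pose F (z : R[i] * 'cV[R]_3) : R[i] := \sum_(l < L) \sum_(k < (2 * l).+1) (P l k * ladder_poly gamma l).[z.1] * Fsol gamma l z.1 (H l k) z.2.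
have FR : RegFam gamma F.
  apply: span_on_sum => l; apply: span_on_sum => k; apply: span_on_gen.
  by exists l, (H l k), (P l k * ladder_poly gamma l); split=> //; exact: H_spherical_harmonic.
have FE lam x : 0 < lam -> x != 0 -> upper_limit V lam x - lower_limit V lam x = boundary_wr gamma lam * F (lam%:C, x).
  move=> l0 x0; rewrite jump//; congr (_ * _); apply: eq_bigr => l _; apply: eq_bigr => k _.
  by rewrite hornerM ladder_polyE.
exists F; split=> // [lam x l0 x0|G GR GE lam x x0]; first by rewrite (wfunE gamma_gt0 hV0 l0) FE.
apply/eqP; rewrite -subr_eq0; apply/eqP.
(* Since [boundary_wr] has no zero on the positive half-line, the difference vanishes there, and
   [RegFam_eq0] extends this to all complex lambda. *)
have DR : RegFam gamma (fun z => G z + -1 * F z) by apply: span_on_add => //; exact: span_on_mull.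
have := RegFam_eq0 DR _ lam x0; rewrite mulN1r; apply => q y q0 y0.
apply: (mulfI (boundary_wr_neq0 gamma_gt0 q0)); rewrite mulr0 mulN1r mulrBr.
by have := GE q y q0 y0; rewrite (wfunE gamma_gt0 hV0 q0) FE// => ->; rewrite subrr.
Qed.
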